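(* Let $M\in[1,\infty[$, $\eta\in\mathbb R$, $B\in\mathbb R$ and $\Delta\in[1,M]$. Put $F=|B|M^{1/2}$ and assume $M^2\ll\Delta F$. Let $g$ be a $C^1$-function on $[M,M+\Delta]$ with $g(x)\ll G$ and $g'(x)\ll G'$ on $[M,M+\Delta]$ for some $G,G'>0$. Then \[\sum_{M\leqslant m\leqslant M+\Delta}t(m)\,g(m)\,e\!\left(\eta m+Bm^{1/2}\right)\ll\Delta^{5/6}\left(G+\Delta G'\right)M^{\vartheta-1/3}F^{1/3+\varepsilon}.\]
   Context: Let $\psi$ be a fixed Maass cusp form for the full modular group $\mathrm{SL}_2(\mathbb Z)$, with eigenvalue $1/4+\kappa^2$ of the hyperbolic Laplacian and Fourier expansion $\psi(x+yi)=y^{1/2}\sum_{n\neq0}t(n)K_{i\kappa}(2\pi|n|y)e(nx)$; $\psi$ is assumed even or odd. $e(x)=e^{2\pi ix}$. $\vartheta\in[0,\infty[$ is a fixed exponent with $t(n)\ll n^{\vartheta+\varepsilon}$ for all $\varepsilon>0$. $\varepsilon$ is an arbitrarily small fixed positive number; implicit constants may depend on $\psi$, $\vartheta$, $\varepsilon$ and the implicit constant in $M^2\ll\Delta F$. *)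

(* Defs.v *)
From Stdlib Require Import Reals ZArith.
From Coquelicot Require Import Coquelicot.
Open Scope R_scope.

(* A point x + iy of the upper half-plane is the
   pair (x, y) : C.  C-valued functions of a real variable are differentiated
   and integrated in the real normed space [C_R_NormedModule]. *)

Definition e (x : R) : C := (cos (2 * PI * x), sin (2 * PI * x)).

(* K_{i kappa}(y) = int_0^oo exp (- y cosh u) cos (kappa u) du, for y > 0. *)
Definition BesselKi (kappa y : R) : R :=
  RInt_gen (fun u => exp (- y * cosh u) * cos (kappa * u))
    (at_point 0) (Rbar_locally p_infty).

(* [D j k] is the partial derivative d^{j+k} f / dx^j dy^k.  Requiring all of
   them to exist and to be jointly continuous says that f is C^infinity on the
   upper half-plane; the values outside it are irrelevant. *)
Definition upper_partials (f : C -> C) (D : nat -> nat -> C -> C) : Prop :=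
  (forall z : C, 0 < Im z -> D 0%nat 0%nat z = f z) /\
  (forall (j k : nat) (x y : R), 0 < y ->
     is_derive (V := C_R_NormedModule) (fun u : R => D j k (u, y)) x (D (S j) k (x, y)) /\
     is_derive (V := C_R_NormedModule) (fun v : R => D j k (x, v)) y (D j (S k) (x, y)) /\
     continuous (T := C_UniformSpace) (U := C_UniformSpace) (D j k) (x, y)).

Definition SL2Z_invariant (psi : C -> C) : Prop :=
  forall (a b c d : Z) (z : C),
    (a * d - b * c = 1)%Z -> 0 < Im z ->
    psi ((RtoC (IZR a) * z + RtoC (IZR b)) / (RtoC (IZR c) * z + RtoC (IZR d)))%C = psi z.

Definition laplace_eigenfunction (psi : C -> C) (lambda : R) : Prop :=
  (exists z : C, 0 < Im z /\ psi z <> RtoC 0) /\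
  exists D : nat -> nat -> C -> C,
    upper_partials psi D /\
    forall z : C, 0 < Im z ->
      (RtoC (- (Im z) ^ 2) * (D 2%nat 0%nat z + D 0%nat 2%nat z))%C
      = (RtoC lambda * psi z)%C.

Definition moderate_growth (psi : C -> C) : Prop :=
  exists (A : R) (N : nat), forall x y : R, 1 <= y -> Cmod (psi (x, y)) <= A * y ^ N.

Definition cuspidal (psi : C -> C) : Prop :=
  forall y : R, 0 < y ->
    is_RInt (V := C_R_NormedModule) (fun x : R => psi (x, y)) 0 1 (RtoC 0).

Definition maass_cusp_form (psi : C -> C) (kappa : R) : Prop :=
  SL2Z_invariant psi /\
  laplace_eigenfunction psi (1 / 4 + kappa ^ 2) /\
  moderate_growth psi /\
  cuspidal psi.

Definition even_form (psi : C -> C) : Prop :=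
  forall x y : R, 0 < y -> psi (- x, y) = psi (x, y).

Definition odd_form (psi : C -> C) : Prop :=
  forall x y : R, 0 < y -> psi (- x, y) = (- psi (x, y))%C.

Definition fourier_term (kappa : R) (t : Z -> C) (x y : R) (n : Z) : C :=
  (t n * RtoC (BesselKi kappa (2 * PI * Rabs (IZR n) * y)) * e (IZR n * x))%C.

(* The sum over n <> 0 is the sum of two convergent series, over n >= 1 and
   over n <= -1. *)
Definition fourier_expansion (psi : C -> C) (kappa : R) (t : Z -> C) : Prop :=
  forall x y : R, 0 < y ->
    exists Sp Sm : C,
      is_series (V := C_R_NormedModule)
        (fun n : nat => fourier_term kappa t x y (Z.of_nat (S n))) Sp /\
      is_series (V := C_R_NormedModule)
        (fun n : nat => fourier_term kappa t x y (- Z.of_nat (S n))%Z) Sm /\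
      psi (x, y) = (RtoC (sqrt y) * (Sp + Sm))%C.

Definition coefficient_exponent (t : Z -> C) (vartheta : R) : Prop :=
  forall eps : R, 0 < eps ->
    exists A : R, forall n : Z, (1 <= n)%Z ->
      Cmod (t n) <= A * Rpower (IZR n) (vartheta + eps).

(* g is C^1 on [a, b] with derivative dg; at a and b the derivative is the
   one-sided one, so nothing is assumed about g outside [a, b]. *)
Definition C1_on (a b : R) (g dg : R -> C) : Prop :=
  (forall x : R, a <= x <= b ->
     filterdiff (K := R_AbsRing) (U := R_NormedModule) (V := C_R_NormedModule) g
       (within (fun u : R => a <= u <= b) (locally x))
       (fun h : R => scal (V := C_R_NormedModule) h (dg x))) /\
  continuous_on (T := R_UniformSpace) (U := C_UniformSpace)
    (fun u : R => a <= u <= b) dg.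

(* Sum of f over the integers m with a <= m <= b, for a >= 0. *)
Definition sum_between (a b : R) (f : Z -> C) : C :=
  sum_n_m (fun m : nat => f (Z.of_nat m)) (Z.to_nat (Zceil a)) (Z.to_nat (Zfloor b)).

(* Main.v *)
(* The sum is extracted from integrals of e(Br/2) psi(eta + B/(2r) + iy) over r near sqrt m, with y
   of order 1/M: the m-th Fourier mode contributes e(B sqrt m) times a Fresnel integral whose
   imaginary part, after averaging over the end points, is bounded below, and a discrete Fourier
   average isolates a given range of m at the cost of a logarithm.  In the variable x = eta + B/(2r)
   these are integrals of psi along a short piece of a horocycle against an oscillating kernel.  By
   Dirichlet's theorem each x lies on the arc of a fraction h/k with |k| <= Q, and invariance under
   SL2(Z) replaces psi there by its value at a point whose real part runs over unit intervals while
   its imaginary part hardly changes.  Cauchy-Schwarz then removes psi and leaves a sum over pairs of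
   arcs of oscillatory integrals.  The first and second derivative tests bound these, and for
   pairs close to each other the derivative of the phase difference is bounded below because the trace
   of the quotient of the two matrices is an integer different from 2.  The choice Q^3 = M^(5/2) / (F Delta) gives the bound.  Abel
   summation removes the Bessel weights and inserts g; when F exceeds a multiple of Delta^(1/2) M
   the trivial bound suffices. *)

Require Import Defs.
From Stdlib Require Import Reals ZArith Znumtheory Lra Lia Psatz List Classical ClassicalEpsilon.
From Coquelicot Require Import Coquelicot.
Import ListNotations.
Open Scope R_scope.

(** The diagonal of the pair sum sets the size of the bound. It contributes about [R0 / (Q^2 b1^4)],
    where [R0] is the length of the x-interval and [b1] its distance from [eta], and [Q] is pushed
    as far as the other pairs stay below this size; expressed by M, F and Delta this is the stated
    choice of [Q]. Three obstacles shape the rest. The height of the transformed point is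
    [y / (k x - h)^2], which varies by a factor 4 along a dyadic arc, while Cauchy-Schwarz needs one
    fixed function of the new variable. The change of height is therefore telescoped over nested
    arcs, and the differences are so small that together they cost a constant only. Next, an
    integral over a horocycle contains all Fourier modes, also those outside the range of m. Its
    bound is uniform in [eta], so translations of [eta] by [j / L] are free and a finite Fourier
    transform removes the other modes. Finally the cutoff factor of a mode has to vary slowly with m
    to be divided out by partial summation. A sharp end point does not give this, an average over
    end points does. *)

Definition indic (P : Prop) : R := if excluded_middle_informative P then 1 else 0.

Lemma indic_true (P : Prop) : P -> indic P = 1.
Proof. intros; unfold indic; destruct excluded_middle_informative; tauto. Qed.

Lemma indic_false (P : Prop) : ~ P -> indic P = 0.
Proof. intros; unfold indic; destruct excluded_middle_informative; tauto. Qed.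

Lemma indic_bounds (P : Prop) : 0 <= indic P <= 1.
Proof. unfold indic; destruct excluded_middle_informative; lra. Qed.

Lemma indic_le (P Q : Prop) : (P -> Q) -> indic P <= indic Q.
Proof. unfold indic; do 2 destruct excluded_middle_informative; try lra; tauto. Qed.

Ltac pos := solve [repeat first [assumption | lra | apply Rmult_lt_0_compat | apply Rdiv_lt_0_compat
  | apply Rinv_0_lt_compat | apply pow_lt | apply sqrt_lt_R0 | apply exp_pos | apply PI_RGT_0
  | apply Rabs_pos | apply sqrt_pos | apply pow2_ge_0 | apply indic_bounds | apply Rmult_le_pos
  | apply Rdiv_le_0_compat | match goal with |- 0 <= / _ => left; apply Rinv_0_lt_compat end | apply pow_le | apply Rplus_le_le_0_compat]].

Tactic Notation "via" uconstr(t) := eapply Rle_trans; [apply t|].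
Tactic Notation "below" uconstr(t) := eapply Rle_trans; [|apply t].
Ltac mull := apply Rmult_le_compat_l; [first [lra | assumption | left; pos | solve [auto using Rabs_pos]]|].
Ltac mulr := apply Rmult_le_compat_r; [first [lra | assumption | left; pos | solve [auto using Rabs_pos]]|].
Ltac minmax := rewrite Rmin_left, Rmax_right by (auto || lra).
Ltac by_derivative := match goal with |- continuous ?f ?x => refine (ex_derive_continuous (V := R_NormedModule) f x _) end.

Ltac rring := match goal with |- @eq _ ?a ?b => change (@eq R a b); ring end.

Lemma RInt_eq (f : R -> R) a b I : is_RInt f a b I -> RInt f a b = I.
Proof. apply (is_RInt_unique (V := R_CompleteNormedModule)). Qed.

(** * Finite sums over lists of integers *)

Definition lsum {A : Type} (l : list A) (f : A -> R) : R :=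
  fold_right (fun a s => f a + s) 0 l.

Lemma lsum_le {A} (l : list A) f g :
  (forall a, In a l -> f a <= g a) -> lsum l f <= lsum l g.
Proof.
  induction l as [|a l IH]; simpl; intros H; [lra|].
  apply Rplus_le_compat; [apply H|apply IH]; auto.
Qed.

Lemma lsum_ext {A} (l : list A) f g :
  (forall a, In a l -> f a = g a) -> lsum l f = lsum l g.
Proof.
  induction l as [|a l IH]; simpl; intros H; [lra|].
  f_equal; [apply H|apply IH]; auto.
Qed.

Lemma lsum_plus {A} (l : list A) f g :
  lsum l (fun a => f a + g a) = lsum l f + lsum l g.
Proof. induction l; simpl; lra. Qed.

Lemma lsum_scal {A} (l : list A) c f : lsum l (fun a => c * f a) = c * lsum l f.
Proof. induction l as [|a l IH]; simpl; [lra|rewrite IH; lra]. Qed.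

Lemma lsum_const {A} (l : list A) c : lsum l (fun _ => c) = INR (length l) * c.
Proof.
  induction l as [|a l IH]; [simpl; lra|].
  change (lsum (a :: l) (fun _ => c)) with (c + lsum l (fun _ => c)).
  rewrite IH. change (length (a :: l)) with (S (length l)). rewrite S_INR. lra.
Qed.

Lemma lsum_nonneg {A} (l : list A) f : (forall a, In a l -> 0 <= f a) -> 0 <= lsum l f.
Proof.
  intros H. apply Rle_trans with (lsum l (fun _ => 0)).
  - rewrite lsum_const; lra.
  - apply lsum_le; auto.
Qed.

Lemma Rabs_lsum {A} (l : list A) f : Rabs (lsum l f) <= lsum l (fun a => Rabs (f a)).
Proof.
  induction l as [|a l IH]; simpl; [rewrite Rabs_R0; lra|].
  via Rabs_triang. lra.
Qed.

Lemma lsum_app {A} (l1 l2 : list A) f : lsum (l1 ++ l2) f = lsum l1 f + lsum l2 f.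
Proof. induction l1 as [|a l IH]; simpl; [lra|rewrite IH; lra]. Qed.

Lemma lsum_map {A B} (g : A -> B) l f : lsum (map g l) f = lsum l (fun a => f (g a)).
Proof. induction l as [|a l IH]; simpl; [lra|rewrite IH; lra]. Qed.

Lemma lsum_swap {A B} (l : list A) (m : list B) f :
  lsum l (fun a => lsum m (fun b => f a b)) = lsum m (fun b => lsum l (fun a => f a b)).
Proof.
  induction l as [|a l IH]; simpl.
  - rewrite lsum_const; lra.
  - rewrite IH, <- lsum_plus. lra.
Qed.

Lemma lsum_list_prod {A B} (l : list A) (m : list B) f :
  lsum (list_prod l m) f = lsum l (fun a => lsum m (fun b => f (a, b))).
Proof.
  induction l as [|a l IH]; simpl; [reflexivity|].
  rewrite lsum_app, IH, lsum_map. lra.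
Qed.

Lemma lsum_filter {A} (p : A -> bool) l f :
  lsum (filter p l) f = lsum l (fun a => if p a then f a else 0).
Proof.
  induction l as [|a l IH]; simpl; [reflexivity|].
  destruct (p a); simpl; rewrite IH; lra.
Qed.

Lemma lsum_sub {A} (l m : list A) f :
  NoDup l -> incl l m -> (forall a, In a m -> 0 <= f a) -> lsum l f <= lsum m f.
Proof.
  intros Hn. revert m. induction Hn as [|a l Ha Hn IH]; intros m Hi Hf.
  - simpl. apply lsum_nonneg; auto.
  - destruct (in_split a m) as [m1 [m2 ->]]; [apply Hi; simpl; auto|].
    rewrite lsum_app. simpl.
    assert (lsum l f <= lsum (m1 ++ m2) f).
    { apply IH.
      - intros z Hz. assert (Hz' : In z (m1 ++ a :: m2)) by (apply Hi; simpl; auto).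
        apply in_app_or in Hz'. apply in_or_app. destruct Hz' as [Hz'|[<-|Hz']]; auto.
        tauto.
      - intros z Hz. apply Hf. apply in_app_or in Hz. apply in_or_app. simpl; tauto. }
    rewrite lsum_app in H. lra.
Qed.

Definition zr (a b : Z) : list Z :=
  map (fun i => (a + Z.of_nat i)%Z) (seq 0 (Z.to_nat (b - a + 1))).

Lemma In_zr a b z : In z (zr a b) <-> (a <= z <= b)%Z.
Proof.
  unfold zr. rewrite in_map_iff. split.
  - intros [i [<- Hi]]. apply in_seq in Hi. lia.
  - intros H. exists (Z.to_nat (z - a)). split; [lia|]. apply in_seq. lia.
Qed.

Lemma NoDup_zr a b : NoDup (zr a b).
Proof.
  unfold zr. apply NoDup_map_NoDup_ForallPairs; [intros i j _ _; lia|apply seq_NoDup].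
Qed.

(** The integers of the window on one side of [x] are numbered from the one nearest to [x]. The i-th
    of them has distance at least i from [x], and [g] is nonincreasing. The point [x] may lie
    outside the window; [sg] selects the side. *)
Lemma lsum_ind_one_side (g : R -> R) a b x x0 n (sg : bool) :
  (forall s t, 0 <= s <= t -> g t <= g s) -> (forall t, 0 <= g t) -> 0 <= n ->
  lsum (zr a b) (fun z => indic ((x0 <= IZR z <= x0 + n) /\
      (if sg then x <= IZR z else IZR z < x)) * g (Rabs (IZR z - x)))
  <= lsum (seq 0 (Z.to_nat (Zfloor n) + 1)) (fun i => g (INR i)).
Proof.
  intros Hg Hp Hn.
  set (P := fun z => (x0 <= IZR z <= x0 + n) /\ (if sg then x <= IZR z else IZR z < x)).
  set (l := filter (fun z => if excluded_middle_informative (P z) then true else false) (zr a b)).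
  assert (El : lsum (zr a b) (fun z => indic (P z) * g (Rabs (IZR z - x)))
               = lsum l (fun z => g (Rabs (IZR z - x)))).
  { unfold l. rewrite lsum_filter. apply lsum_ext. intros z _. unfold indic.
    destruct excluded_middle_informative; lra. }
  change (lsum (zr a b) (fun z => indic (P z) * g (Rabs (IZR z - x)))
    <= lsum (seq 0 (Z.to_nat (Zfloor n) + 1)) (fun i => g (INR i))).
  rewrite El. clear El.
  assert (Nl : NoDup l) by (apply NoDup_filter, NoDup_zr).
  assert (Pl : forall z, In z l -> P z).
  { intros z Hz. apply filter_In in Hz. destruct Hz as [_ Hz].
    destruct excluded_middle_informative; [auto|discriminate]. }
  clearbody l.
  destruct (Zfloor_bound n) as [Hn1 Hn2].
  assert (Hn3 : (0 <= Zfloor n)%Z) by (apply Zfloor_lub; auto).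
  assert (Key : exists z0 : Z, exists e : Z, (e = 1 \/ e = -1)%Z /\ forall z, In z l ->
     exists i, (i < Z.to_nat (Zfloor n) + 1)%nat /\ z = (z0 + e * Z.of_nat i)%Z /\
      INR i <= Rabs (IZR z - x)).
  { destruct sg.
    - set (z0 := Zceil (Rmax x x0)).
      assert (Hz0 : IZR z0 - 1 < Rmax x x0 <= IZR z0).
      { unfold z0. pose proof (Zceil_bound (Rmax x x0)). lra. }
      exists z0, 1%Z. split; [auto|]. intros z Hz. destruct (Pl z Hz) as [[H1 H2] H3].
      assert (z0 <= z)%Z.
      { assert (IZR z0 < IZR z + 1).
        { assert (Rmax x x0 <= IZR z) by (apply Rmax_lub; auto). lra. }
        rewrite <- plus_IZR in H. apply lt_IZR in H. lia. }
      assert (Hi : IZR (z - z0) = INR (Z.to_nat (z - z0))).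
      { rewrite INR_IZR_INZ. f_equal. lia. }
      exists (Z.to_nat (z - z0)). split; [|split; [lia|]].
      + assert (IZR (z - z0) < IZR (Zfloor n) + 1).
        { rewrite minus_IZR. pose proof (Rmax_r x x0). lra. }
        rewrite <- plus_IZR in H0. apply lt_IZR in H0. lia.
      + rewrite <- Hi, minus_IZR. pose proof (Rmax_l x x0). rewrite Rabs_pos_eq; lra.
    - set (z0 := Zfloor (Rmin x (x0 + n))).
      assert (Hz0 : IZR z0 <= Rmin x (x0 + n) < IZR z0 + 1) by apply Zfloor_bound.
      exists z0, (-1)%Z. split; [auto|]. intros z Hz. destruct (Pl z Hz) as [[H1 H2] H3].
      assert (z <= z0)%Z.
      { apply Zfloor_lub. apply Rmin_glb; lra. }
      assert (Hi : IZR (z0 - z) = INR (Z.to_nat (z0 - z))).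
      { rewrite INR_IZR_INZ. f_equal. lia. }
      exists (Z.to_nat (z0 - z)). split; [|split; [lia|]].
      + assert (IZR (z0 - z) < IZR (Zfloor n) + 1).
        { rewrite minus_IZR. pose proof (Rmin_r x (x0 + n)). lra. }
        rewrite <- plus_IZR in H0. apply lt_IZR in H0. lia.
      + rewrite <- Hi, minus_IZR. pose proof (Rmin_l x (x0 + n)). rewrite Rabs_left1; lra. }
  destruct Key as [z0 [e [He Key]]].
  set (t := fun z : Z => Z.to_nat (e * (z - z0))%Z).
  apply Rle_trans with (lsum l (fun z => g (INR (t z)))).
  - apply lsum_le. intros z Hz. destruct (Key z Hz) as [i [Hi [Hz' Hi']]]. apply Hg.
    replace (t z) with i; [|unfold t; destruct He; subst e; lia].
    split; [apply pos_INR|auto].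
  - rewrite <- (lsum_map t l (fun i => g (INR i))). apply lsum_sub; [| |intros; apply Hp].
    + clear -Nl Key He. revert Key. induction Nl as [|z l Hz Nl IH]; intros Key; simpl; constructor.
      * intros Hin. apply in_map_iff in Hin. destruct Hin as [z' [E Hz']].
        destruct (Key z) as [i [_ [Ei _]]]; [simpl; auto|].
        destruct (Key z') as [i' [_ [Ei' _]]]; [simpl; auto|].
        apply Hz. replace z with z'; auto. unfold t in E. lia.
      * apply IH. intros; apply Key; simpl; auto.
    + intros i Hi. apply in_map_iff in Hi. destruct Hi as [z [<- Hz]].
      destruct (Key z Hz) as [i [Hi [Ez _]]]. apply in_seq.
      unfold t. lia.
Qed.

(* On each side of [x] the i-th nearest integer is at distance at least i. *)
Lemma lsum_spaced (g : R -> R) a b x x0 n :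
  (forall s t, 0 <= s <= t -> g t <= g s) -> (forall t, 0 <= g t) -> 0 <= n ->
  lsum (zr a b) (fun z => indic (x0 <= IZR z <= x0 + n) * g (Rabs (IZR z - x)))
  <= 2 * lsum (seq 0 (Z.to_nat (Zfloor n) + 1)) (fun i => g (INR i)).
Proof.
  intros Hg Hp Hn.
  pose proof (lsum_ind_one_side g a b x x0 n true Hg Hp Hn) as H1.
  pose proof (lsum_ind_one_side g a b x x0 n false Hg Hp Hn) as H2.
  rewrite double. eapply Rle_trans; [|apply Rplus_le_compat; [apply H1|apply H2]].
  rewrite <- lsum_plus. apply lsum_le. intros z _. rewrite <- Rmult_plus_distr_r.
  mulr. unfold indic.
  repeat destruct excluded_middle_informative; lra.
Qed.

Lemma sum_inv_le_ln (N : nat) :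
  lsum (seq 0 (N + 1)) (fun i => / (1 + INR i)) <= 1 + ln (1 + INR N).
Proof.
  induction N as [|N IH].
  - simpl. replace (1 + 0) with 1 by ring. rewrite Rinv_1, ln_1. lra.
  - replace (S N + 1)%nat with (S (N + 1)) by lia. rewrite seq_S, lsum_app. simpl lsum at 2.
    pose proof (pos_INR N).
    assert (/ (1 + INR (S N)) <= ln (1 + INR (S N)) - ln (1 + INR N)).
    { rewrite S_INR. rewrite <- ln_div by lra.
      set (u := / (1 + (INR N + 1))).
      assert (Hu : 0 < u) by pos.
      assert (Hu1 : u <= 1/2).
      { unfold u. replace (1/2) with (/2) by lra. apply Rinv_le_contravar; lra. }
      replace ((1 + (INR N + 1)) / (1 + INR N)) with (/ (1 - u)) by (unfold u; field; lra).
      rewrite ln_Rinv by lra.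
      pose proof (exp_ineq1_le (- u)). assert (ln (1 - u) <= - u); [|lra].
      rewrite <- (ln_exp (- u)). apply ln_le; lra. }
    assert (E : INR (N + 1) = INR (S N)) by (f_equal; lia). rewrite Rplus_0_r, E. lra.
Qed.

Lemma sum_inv_sqrt_le (N : nat) :
  lsum (seq 0 N) (fun i => / sqrt (1 + INR i)) <= 2 * sqrt (INR N).
Proof.
  induction N as [|N IH].
  - pos.
  - rewrite seq_S, lsum_app. simpl lsum at 2. rewrite Rplus_0_r.
    rewrite S_INR. pose proof (pos_INR N). rewrite (Rplus_comm 1 (INR N)).
    set (u := INR N) in *.
    assert (0 < sqrt (u + 1)) by pos.
    assert (0 <= sqrt u) by apply sqrt_pos.
    assert (Hs1 : sqrt (u + 1) * sqrt (u + 1) = u + 1) by (apply sqrt_sqrt; lra).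
    assert (Hs2 : sqrt u * sqrt u = u) by (apply sqrt_sqrt; lra).
    enough (/ sqrt (u + 1) <= 2 * (sqrt (u + 1) - sqrt u)) by lra.
    apply Rmult_le_reg_l with (sqrt (u + 1)); auto. rewrite Rinv_r by lra. nra.
Qed.

Lemma lsum_count a b x0 n : 0 <= n ->
  lsum (zr a b) (fun z => indic (x0 <= IZR z <= x0 + n)) <= n + 1.
Proof.
  intros Hn.
  pose proof (lsum_ind_one_side (fun _ => 1) a b x0 x0 n true) as H.
  cbv beta in H. rewrite lsum_const, length_seq, plus_INR in H. simpl INR in H.
  destruct (Zfloor_bound n) as [Hn1 Hn2].
  assert (Hn3 : (0 <= Zfloor n)%Z) by (apply Zfloor_lub; auto).
  rewrite INR_IZR_INZ, Z2Nat.id in H by auto.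
  eapply Rle_trans; [|eapply Rle_trans; [apply H; intros; lra|lra]].
  apply lsum_le. intros z _. rewrite Rmult_1_r. apply indic_le. lra.
Qed.

Lemma lsum_inv_spaced a b x x0 n : 0 <= n ->
  lsum (zr a b) (fun z => indic (x0 <= IZR z <= x0 + n) * / (1 + Rabs (IZR z - x)))
  <= 2 * (1 + ln (1 + n)).
Proof.
  intros Hn.
  destruct (Zfloor_bound n) as [Hn1 Hn2].
  assert (Hn3 : (0 <= Zfloor n)%Z) by (apply Zfloor_lub; auto).
  rewrite (lsum_ext _ _ (fun z => indic (x0 <= IZR z <= x0 + n) * / (1 + Rabs (Rabs (IZR z - x)))))
    by (intros; rewrite Rabs_Rabsolu; reflexivity).
  eapply Rle_trans.
  - apply (lsum_spaced (fun t => / (1 + Rabs t)) a b x x0 n); auto.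
    + intros s t H. rewrite !Rabs_pos_eq by lra. apply Rinv_le_contravar; lra.
    + intros t. left. apply Rinv_0_lt_compat. pose proof (Rabs_pos t). lra.
  - mull.
    erewrite lsum_ext; [|intros i _; rewrite Rabs_pos_eq by apply pos_INR; reflexivity].
    via sum_inv_le_ln.
    rewrite INR_IZR_INZ, Z2Nat.id by auto. apply IZR_le in Hn3.
    apply Rplus_le_compat_l, ln_le; lra.
Qed.

Lemma lsum_inv_sqrt_spaced a b x x0 n : 0 <= n ->
  lsum (zr a b) (fun z => indic (x0 <= IZR z <= x0 + n) * / sqrt (1 + Rabs (IZR z - x)))
  <= 4 * sqrt (n + 1).
Proof.
  intros Hn.
  destruct (Zfloor_bound n) as [Hn1 Hn2].
  assert (Hn3 : (0 <= Zfloor n)%Z) by (apply Zfloor_lub; auto).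
  rewrite (lsum_ext _ _ (fun z => indic (x0 <= IZR z <= x0 + n) * / sqrt (1 + Rabs (Rabs (IZR z - x)))))
    by (intros; rewrite Rabs_Rabsolu; reflexivity).
  eapply Rle_trans.
  - apply (lsum_spaced (fun t => / sqrt (1 + Rabs t)) a b x x0 n); auto.
    + intros s t H. rewrite !Rabs_pos_eq by lra.
      apply Rinv_le_contravar; [apply sqrt_lt_R0; lra|apply sqrt_le_1; lra].
    + intros t. left. apply Rinv_0_lt_compat, sqrt_lt_R0. pose proof (Rabs_pos t). lra.
  - erewrite lsum_ext; [|intros i _; rewrite Rabs_pos_eq by apply pos_INR; reflexivity].
    pose proof (sum_inv_sqrt_le (Z.to_nat (Zfloor n) + 1)) as H.
    rewrite plus_INR, INR_IZR_INZ, Z2Nat.id in H by auto. simpl INR in H.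
    assert (sqrt (IZR (Zfloor n) + 1) <= sqrt (n + 1)); [|lra].
    apply IZR_le in Hn3. apply sqrt_le_1; lra.
Qed.

Lemma lsum_unique {A} (l : list A) (a : A) : NoDup l -> In a l -> lsum l (fun x => indic (x = a)) = 1.
Proof.
  intros Hn. induction Hn as [|b l Hb Hn IH]; intros Hi; [destruct Hi|]. simpl.
  destruct (classic (b = a)) as [->|N].
  - rewrite indic_true by auto. rewrite (lsum_ext _ _ (fun _ => 0)); [rewrite lsum_const; ring|].
    intros x Hx. apply indic_false. intros ->. auto.
  - rewrite indic_false by auto. rewrite IH; [ring|]. destruct Hi; [contradiction|auto].
Qed.

Lemma list_upper_bound {A} (l : list A) (g : A -> R) : exists m, forall a, In a l -> g a <= m.
Proof.
  induction l as [|b l [m IH]]; [exists 0; simpl; tauto|].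
  exists (Rmax (g b) m). intros a [->|Ha]; [apply Rmax_l|].
  apply Rle_trans with m; [auto|apply Rmax_r].
Qed.

(** * Oscillatory integrals *)

(** A change of sign would put the zero [- c / s] of the linear function into the interval, where
    its absolute value is at least [l]. *)
Lemma linear_abs_sign (s c x1 x2 l : R) :
  0 < l -> (forall x, x1 <= x <= x2 -> l <= Rabs (s * x + c)) ->
  (forall x, x1 <= x <= x2 -> l <= s * x + c) \/
  (forall x, x1 <= x <= x2 -> l <= - (s * x + c)).
Proof.
  intros Hl H.
  destruct (Rle_dec x1 x2) as [H12|H12]; [|left; intros; lra].
  assert (K : forall x x', x1 <= x <= x2 -> x1 <= x' <= x2 ->
     l <= s * x + c -> l <= - (s * x' + c) -> False).
  { intros x x' Hx Hx' P1 P2.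
    assert (Hs : s <> 0) by nra.
    set (z := - c / s).
    assert (Hz : s * z + c = 0) by (unfold z; field; auto).
    assert (x1 <= z <= x2).
    { nra. }
    pose proof (H z H0) as Hq. rewrite Hz, Rabs_R0 in Hq. lra. }
  destruct (Rle_dec l (s * x1 + c)) as [P|P].
  - left. intros x Hx. pose proof (H x Hx) as Hq.
    destruct (Rcase_abs (s * x + c)) as [N|N].
    + rewrite Rabs_left in Hq by auto. exfalso. apply (K x1 x); auto; lra.
    + rewrite Rabs_right in Hq by auto. auto.
  - right. intros x Hx. pose proof (H x Hx) as Hq. pose proof (H x1 ltac:(lra)) as Hq1.
    destruct (Rcase_abs (s * x + c)) as [N|N].
    + rewrite Rabs_left in Hq by auto. auto.
    + rewrite Rabs_right in Hq by auto. exfalso. apply (K x x1); auto; [lra|].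
      destruct (Rcase_abs (s * x1 + c)); [rewrite Rabs_left in Hq1|rewrite Rabs_right in Hq1]; lra.
Qed.

Lemma Rabs_sin_le x : Rabs (sin x) <= 1.
Proof. pose proof (SIN_bound x). apply Rabs_le; lra. Qed.

Lemma Rabs_cos_le x : Rabs (cos x) <= 1.
Proof. pose proof (COS_bound x). apply Rabs_le; lra. Qed.

Section Pair.
Variables (B v c v' c' th0 P1 x1 x2 : R).
Hypothesis HB : 0 < B.
Hypothesis HP1 : 0 < P1.
Hypothesis Hv : v <> 0.
Hypothesis Hv' : v' <> 0.

(** In the new variable the kernel of a piece has amplitude [1 / p^2] and phase [B^2 / (4 v p)] up
    to a constant, with [p = v x + c] linear. This is the real part of one such kernel times the
    conjugate of another; [th0] collects the constants. *)
Definition pair_integrand (x : R) : R :=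
  cos (2 * PI * (B ^ 2 / 4 * (/ (v * (v * x + c)) - / (v' * (v' * x + c'))) + th0))
   / ((v * x + c) ^ 2 * (v' * x + c') ^ 2).

Lemma pair_continuous x : P1 <= v * x + c -> P1 <= v' * x + c' -> continuous pair_integrand x.
Proof.
  intros H1 H2. by_derivative. unfold pair_integrand.
  auto_derive. repeat split; auto; try nra; try (apply Rmult_integral_contrapositive; split; lra).
  apply Rmult_integral_contrapositive; split; apply Rgt_not_eq; nra.
Qed.

Lemma pair_ex_RInt a b : a <= b -> (forall x, a <= x <= b -> P1 <= v * x + c) ->
  (forall x, a <= x <= b -> P1 <= v' * x + c') -> ex_RInt pair_integrand a b.
Proof.
  intros Hab H1 H2. apply (ex_RInt_continuous pair_integrand). intros z.
  minmax. intros Hz. apply pair_continuous; auto.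
Qed.

Lemma pair_abs_le x : P1 <= v * x + c -> P1 <= v' * x + c' -> Rabs (pair_integrand x) <= / P1 ^ 4.
Proof.
  intros H1 H2. unfold pair_integrand, Rdiv. rewrite Rabs_mult.
  assert (0 < P1 ^ 4) by pos.
  assert (H3 : P1 ^ 4 <= (v * x + c) ^ 2 * (v' * x + c') ^ 2).
  { replace (P1 ^ 4) with (P1 ^ 2 * P1 ^ 2) by ring.
    apply Rmult_le_compat; try (apply pow2_ge_0); apply pow_incr; lra. }
  rewrite (Rabs_pos_eq (/ _)) by pos.
  rewrite <- (Rmult_1_l (/ P1 ^ 4)). apply Rmult_le_compat; try apply Rabs_pos.
  - pos.
  - apply Rabs_cos_le.
  - apply Rinv_le_contravar; auto.
Qed.

Lemma pair_trivial a b : a <= b -> (forall x, a <= x <= b -> P1 <= v * x + c) ->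
  (forall x, a <= x <= b -> P1 <= v' * x + c') ->
  Rabs (RInt pair_integrand a b) <= (b - a) * / P1 ^ 4.
Proof.
  intros Hab H1 H2. apply abs_RInt_le_const; auto using pair_ex_RInt.
  intros; apply pair_abs_le; auto.
Qed.

(* The phase difference has derivative (B^2/4) (p^2 - q^2) / (p^2 q^2) for p = vx+c, q = v'x+c',
   so the integrand is a derivative divided by p^2 - q^2 = (p - q) (p + q),
   a product of two linear functions. *)
Lemma pair_first_derivative_pos l :
  x1 <= x2 -> (forall x, x1 <= x <= x2 -> P1 <= v * x + c) ->
  (forall x, x1 <= x <= x2 -> P1 <= v' * x + c') ->
  0 < l -> (forall x, x1 <= x <= x2 -> l <= (v - v') * x + (c - c')) ->
  Rabs (RInt pair_integrand x1 x2) <= 2 / (B ^ 2 * l * P1).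
Proof.
  intros H12 Hp Hp' Hl HL.
  set (s := v - v'). set (s2 := v + v').
  set (L := fun x => s * x + (c - c')). set (N := fun x => s2 * x + (c + c')).
  assert (HN : forall x, x1 <= x <= x2 -> 2 * P1 <= N x).
  { intros x Hx. unfold N, s2. pose proof (Hp x Hx). pose proof (Hp' x Hx). lra. }
  assert (HL' : forall x, x1 <= x <= x2 -> l <= L x) by auto.
  assert (PIp := PI_RGT_0).
  set (Th := fun x => 2 * PI * (B ^ 2 / 4 * (/ (v * (v * x + c)) - / (v' * (v' * x + c'))) + th0)).
  (* For constant [L] and [N] the derivative of [H] would be the integrand itself; [E] is the
     correction from differentiating [1 / (L N)]. *)
  set (H := fun x => 2 / (PI * B ^ 2) * (sin (Th x) / (L x * N x))).
  set (E := fun x => 2 / (PI * B ^ 2) * (sin (Th x) * (s / (L x ^ 2 * N x) + s2 / (L x * N x ^ 2)))).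
  assert (DH : forall x, x1 <= x <= x2 -> is_derive H x (pair_integrand x - E x)).
  { intros x Hx. pose proof (Hp x Hx). pose proof (Hp' x Hx). pose proof (HN x Hx). pose proof (HL' x Hx).
    unfold H, Th, L, N. auto_derive.
    - fold (L x) (N x). repeat split; auto; try lra;
      apply Rmult_integral_contrapositive; split; lra.
    - unfold E, pair_integrand. fold (Th x) (L x) (N x).
      replace (L x) with (v * x + c - (v' * x + c')) in * by (unfold L, s; ring).
      replace (N x) with (v * x + c + (v' * x + c')) in * by (unfold N, s2; ring).
      set (p := v * x + c) in *. set (q := v' * x + c') in *.
      unfold s, s2.
      replace (2 * PI * (B * (B * 1) / 4 * (/ (v * p) + - / (v' * q)) + th0)) with (Th x)
        by auto.
      generalize (cos (Th x)) (sin (Th x)). intros co si.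
      field. lra. }
  assert (CE : forall x, x1 <= x <= x2 -> continuous E x).
  { intros x Hx. pose proof (Hp x Hx). pose proof (Hp' x Hx). pose proof (HN x Hx). pose proof (HL' x Hx).
    by_derivative. unfold E, Th. unfold L, N in *. auto_derive.
    fold (L x) (N x). unfold L, N in *.
    repeat split; auto; try lra; repeat apply Rmult_integral_contrapositive_currified; lra. }
  assert (XE : ex_RInt E x1 x2).
  { apply (ex_RInt_continuous E). intros z. minmax. auto. }
  assert (XP : ex_RInt pair_integrand x1 x2) by (apply pair_ex_RInt; auto).
  assert (EQ : RInt pair_integrand x1 x2 = (H x2 - H x1) + RInt E x1 x2).
  { assert (is_RInt (fun x => pair_integrand x - E x) x1 x2 (H x2 - H x1)).
    { apply (is_RInt_derive H (fun x => pair_integrand x - E x)).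
      - intros x. minmax. auto.
      - intros x. minmax. intros Hx.
        apply (continuous_minus pair_integrand E); auto. apply pair_continuous; auto. }
    apply RInt_eq in H0. rewrite <- H0.
    rewrite <- (RInt_plus (fun x => pair_integrand x - E x) E).
    - apply RInt_ext. intros x _. unfold plus; simpl. ring.
    - apply (ex_RInt_minus pair_integrand E); auto.
    - auto. }
  (* [D] majorises the absolute value of [E] and has the explicit antiderivative [A]. [Rabs s / s]
     is the sign of [s]; it evaluates to 0 at [s = 0], so a constant [L] or [N] is no separate
     case. *)
  set (D := fun x => 2 / (PI * B ^ 2) * (Rabs s / L x ^ 2 * / (2 * P1) + Rabs s2 / N x ^ 2 * / l)).
  set (A := fun x => 2 / (PI * B ^ 2) * (- (Rabs s / s / L x * / (2 * P1)) + - (Rabs s2 / s2 / N x * / l))).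
  assert (Hss : forall z, Rabs z / z * z = Rabs z).
  { intros z. destruct (Req_dec z 0) as [->|]; [rewrite Rabs_R0; lra|field; auto]. }
  assert (Hss1 : forall z, Rabs (Rabs z / z) <= 1).
  { intros z. destruct (Req_dec z 0) as [->|]; [rewrite Rabs_R0; unfold Rdiv; rewrite Rmult_0_l, Rabs_R0; lra|].
    unfold Rdiv. rewrite Rabs_mult, Rabs_Rabsolu, Rabs_inv, Rinv_r; [lra|]. apply Rabs_no_R0; auto. }
  assert (DA : forall x, x1 <= x <= x2 -> is_derive A x (D x)).
  { intros x Hx. pose proof (HN x Hx). pose proof (HL' x Hx).
    unfold A, L, N. auto_derive.
    - fold (L x) (N x). lra.
    - fold (L x) (N x). unfold D. rewrite <- (Hss s) at 2. rewrite <- (Hss s2) at 2.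
      set (u := Rabs s / s). set (u2 := Rabs s2 / s2). field. lra. }
  assert (CD : forall x, x1 <= x <= x2 -> continuous D x).
  { intros x Hx. pose proof (HN x Hx). pose proof (HL' x Hx).
    by_derivative. unfold D, L, N in *. auto_derive.
    nra. }
  assert (ID : is_RInt D x1 x2 (A x2 - A x1)).
  { apply (is_RInt_derive A D); intros x; minmax; auto. }
  assert (Hc : 0 < 2 / (PI * B ^ 2)) by pos.
  assert (BE : Rabs (RInt E x1 x2) <= A x2 - A x1).
  { apply (norm_RInt_le E D x1 x2 (RInt E x1 x2) (A x2 - A x1)); auto.
    - intros x Hx. pose proof (HN x Hx). pose proof (HL' x Hx).
      change (norm (E x)) with (Rabs (E x)). unfold E, D. rewrite Rabs_mult, (Rabs_pos_eq (2 / _)) by lra.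
      mull. rewrite Rabs_mult.
      eapply Rle_trans; [apply Rmult_le_compat_r; [apply Rabs_pos|apply Rabs_sin_le]|].
      rewrite Rmult_1_l.
      via Rabs_triang. apply Rplus_le_compat.
      + unfold Rdiv. rewrite Rabs_mult, Rabs_inv, Rinv_mult.
        rewrite Rmult_assoc. mull.
        rewrite Rabs_mult, (Rabs_pos_eq (L x ^ 2)), (Rabs_pos_eq (N x)) by pos.
        rewrite Rinv_mult. mull.
        rewrite <- Rinv_mult. apply Rinv_le_contravar; lra.
      + unfold Rdiv. rewrite Rabs_mult, Rabs_inv.
        rewrite Rmult_assoc. mull.
        rewrite Rabs_mult, (Rabs_pos_eq (N x ^ 2)), (Rabs_pos_eq (L x)) by pos.
        rewrite Rinv_mult, Rmult_comm. mull.
        apply Rinv_le_contravar; lra.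
    - apply (RInt_correct E); auto. }
  assert (HBnd : forall x, x1 <= x <= x2 -> Rabs (H x) <= 2 / (PI * B ^ 2) * (/ l * / (2 * P1))).
  { intros x Hx. pose proof (HN x Hx). pose proof (HL' x Hx).
    unfold H. rewrite Rabs_mult, (Rabs_pos_eq (2 / _)) by lra.
    mull. unfold Rdiv. rewrite Rabs_mult.
    eapply Rle_trans; [apply Rmult_le_compat_r; [apply Rabs_pos|apply Rabs_sin_le]|].
    rewrite Rmult_1_l.
    rewrite Rabs_pos_eq by pos.
    rewrite Rinv_mult. apply Rmult_le_compat; try (left; apply Rinv_0_lt_compat; lra); apply Rinv_le_contravar; lra. }
  assert (BA : A x2 - A x1 <= 2 / (PI * B ^ 2) * (/ l * / P1)).
  { unfold A. rewrite <- Rmult_minus_distr_l. mull.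
    assert (Q : forall z u1 u2 m, 0 < m -> m <= u1 -> m <= u2 ->
       Rabs z / z / u1 - Rabs z / z / u2 <= / m).
    { intros z u1 u2 m Hm Hu1 Hu2. unfold Rdiv at 1 3. rewrite <- Rmult_minus_distr_l.
      assert (0 < / u1 <= / m) by (split; [apply Rinv_0_lt_compat; lra|apply Rinv_le_contravar; lra]).
      assert (0 < / u2 <= / m) by (split; [apply Rinv_0_lt_compat; lra|apply Rinv_le_contravar; lra]).
      pose proof (Hss1 z) as Hz. apply Rabs_le_between in Hz. nra. }
    pose proof (Q s (L x1) (L x2) l Hl (HL' x1 ltac:(lra)) (HL' x2 ltac:(lra))) as Q1.
    pose proof (Q s2 (N x1) (N x2) (2 * P1) ltac:(lra) (HN x1 ltac:(lra)) (HN x2 ltac:(lra))) as Q2.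
    assert (0 < / (2 * P1)) by pos.
    assert (0 < / l) by pos.
    replace (/ l * / P1) with (/ l * / (2 * P1) + / (2 * P1) * / l) by (field; lra). nra. }
  pose proof (HBnd x1 ltac:(lra)) as B1. pose proof (HBnd x2 ltac:(lra)) as B2.
  rewrite EQ. via Rabs_triang.
  eapply Rle_trans; [apply Rplus_le_compat; [apply Rabs_triang|exact BE]|].
  rewrite Rabs_Ropp.
  replace (2 / (B ^ 2 * l * P1)) with (PI * (2 / (PI * B ^ 2) * (/ l * / P1))) by (field; lra).
  replace (/ l * / (2 * P1)) with ((/ l * / P1) / 2) in B1, B2 by (field; lra).
  assert (0 < / l * / P1) by pos.
  assert (2 <= PI) by (pose proof PI2_1; lra).
  set (K := 2 / (PI * B ^ 2)) in *. set (J := / l * / P1) in *.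
  assert (0 < K * J) by pos.
  nra.
Qed.
End Pair.

(** Exchanging the two pieces allows the difference of the linear functions to be taken positive. *)
Lemma pair_integrand_sym B v c v' c' th0 x :
  pair_integrand B v' c' v c (- th0) x = pair_integrand B v c v' c' th0 x.
Proof.
  unfold pair_integrand. rewrite <- cos_neg. f_equal; [f_equal; ring|ring].
Qed.

Lemma pair_first_derivative B v c v' c' th0 P1 x1 x2 l :
  0 < B -> 0 < P1 -> v <> 0 -> v' <> 0 -> x1 <= x2 ->
  (forall x, x1 <= x <= x2 -> P1 <= v * x + c) ->
  (forall x, x1 <= x <= x2 -> P1 <= v' * x + c') ->
  0 < l -> (forall x, x1 <= x <= x2 -> l <= Rabs (v * x + c - (v' * x + c'))) ->
  Rabs (RInt (pair_integrand B v c v' c' th0) x1 x2) <= 2 / (B ^ 2 * l * P1).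
Proof.
  intros HB HP Hv Hv' H12 Hp Hp' Hl HL.
  destruct (linear_abs_sign (v - v') (c - c') x1 x2 l Hl) as [H|H].
  - intros x Hx. replace ((v - v') * x + (c - c')) with (v * x + c - (v' * x + c')) by ring. auto.
  - apply pair_first_derivative_pos; auto.
  - rewrite (RInt_ext _ (pair_integrand B v' c' v c (- th0))).
    + apply pair_first_derivative_pos; auto. intros x Hx. pose proof (H x Hx). lra.
    + intros x _. symmetry. apply pair_integrand_sym.
Qed.

(** The difference of the two linear functions has slope [v - v'] and vanishes at a single point
    [z]. Within distance [d] of [z] the trivial bound is used, outside it the first derivative
    test. *)
Lemma pair_second_derivative B v c v' c' th0 P1 x1 x2 :
  0 < B -> 0 < P1 -> v <> 0 -> v' <> 0 -> v - v' <> 0 -> x1 <= x2 ->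
  (forall x, x1 <= x <= x2 -> P1 <= v * x + c) ->
  (forall x, x1 <= x <= x2 -> P1 <= v' * x + c') ->
  Rabs (RInt (pair_integrand B v c v' c' th0) x1 x2)
  <= 6 / (B * sqrt (Rabs (v - v')) * (P1 ^ 2 * sqrt P1)).
Proof.
  intros HB HP Hv Hv' Hs H12 Hp Hp'.
  set (s := v - v') in *.
  assert (Hs0 : 0 < Rabs s) by (apply Rabs_pos_lt; auto).
  set (q := sqrt (Rabs s)). set (r := sqrt P1).
  assert (Hq : 0 < q) by pos.
  assert (Hr : 0 < r) by pos.
  assert (Eq : Rabs s = q * q) by (symmetry; apply sqrt_sqrt; lra).
  assert (Er : P1 = r * r) by (symmetry; apply sqrt_sqrt; lra).
  (* With this value the trivial bound [2 d / P1^4] of the middle part equals the first derivative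
     bound [2 / (B^2 lam P1)] of the outer parts, whence the factor 6. *)
  set (lam := q * (P1 * r) / B).
  assert (Hlam : 0 < lam) by pos.
  set (z := - (c - c') / s). set (d := lam / Rabs s).
  assert (Hd : 0 < d) by pos.
  assert (HLz : forall x, v * x + c - (v' * x + c') = s * (x - z)).
  { intros x. unfold z. unfold s. field. auto. }
  set (f := pair_integrand B v c v' c' th0).
  (* Clamping yields the three subintervals wherever [z] lies; some of them may be single points. *)
  set (u1 := Rmin x2 (Rmax x1 (z - d))). set (u2 := Rmin x2 (Rmax x1 (z + d))).
  assert (Hu : x1 <= u1 /\ u1 <= u2 /\ u2 <= x2 /\ u2 - u1 <= 2 * d /\
    (x1 < u1 -> u1 <= z - d) /\ (u2 < x2 -> z + d <= u2)).
  { unfold u1, u2, Rmin, Rmax. repeat destruct Rle_dec; lra. }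
  destruct Hu as [Hu1 [Hu2 [Hu3 [Hu4 [Hu5 Hu6]]]]].
  assert (X : forall a b, x1 <= a -> a <= b -> b <= x2 -> ex_RInt f a b).
  { intros. apply (pair_ex_RInt B v c v' c' th0 P1); auto; intros; [apply Hp|apply Hp']; lra. }
  assert (EQ : RInt f x1 x2 = RInt f x1 u1 + RInt f u1 u2 + RInt f u2 x2).
  { rewrite <- (RInt_Chasles f x1 u2 x2) by (apply X; lra).
    rewrite <- (RInt_Chasles f x1 u1 u2) by (apply X; lra). auto. }
  assert (Hpos : 0 < 2 / (B ^ 2 * lam * P1)).
  { pos. }
  assert (I1 : Rabs (RInt f x1 u1) <= 2 / (B ^ 2 * lam * P1)).
  { destruct (Req_dec x1 u1) as [<-|N].
    - rewrite RInt_point. change (Rabs 0 <= 2 / (B ^ 2 * lam * P1)). rewrite Rabs_R0. lra.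
    - apply pair_first_derivative; auto; intros; [apply Hp|apply Hp'|]; try lra.
      rewrite HLz, Rabs_mult, (Rabs_left1 (x - z)) by lra.
      replace lam with (Rabs s * d) by (unfold d; field; lra). apply Rmult_le_compat_l; lra. }
  assert (I3 : Rabs (RInt f u2 x2) <= 2 / (B ^ 2 * lam * P1)).
  { destruct (Req_dec u2 x2) as [->|N].
    - rewrite RInt_point. change (Rabs 0 <= 2 / (B ^ 2 * lam * P1)). rewrite Rabs_R0. lra.
    - apply pair_first_derivative; auto; intros; [apply Hp|apply Hp'|]; try lra.
      rewrite HLz, Rabs_mult, (Rabs_pos_eq (x - z)) by lra.
      replace lam with (Rabs s * d) by (unfold d; field; lra). apply Rmult_le_compat_l; lra. }
  assert (I2 : Rabs (RInt f u1 u2) <= 2 * d * / P1 ^ 4).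
  { eapply Rle_trans; [apply (pair_trivial B v c v' c' th0 P1); auto; intros; [apply Hp|apply Hp']; lra|].
    apply Rmult_le_compat_r; [left; apply Rinv_0_lt_compat, pow_lt; auto|auto]. }
  rewrite EQ. via Rabs_triang.
  eapply Rle_trans; [apply Rplus_le_compat; [apply Rabs_triang|apply I3]|].
  replace (6 / (B * q * (P1 ^ 2 * r)))
    with (2 / (B ^ 2 * lam * P1) + 2 * d * / P1 ^ 4 + 2 / (B ^ 2 * lam * P1)).
  - lra.
  - unfold d, lam. rewrite Eq, Er. field. lra.
Qed.

(** * Pairs of arcs *)

(* Here v = k eta - h and p = v X - (a eta + b) for the matrix (a b; k -h), and the primed data
   belong to a second matrix; C is the lower left entry of the quotient g g'^{-1} and tau is
   its trace minus 2. *)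
Lemma moebius_difference (eta X a b k h a' b' k' h' : R) :
  - a * h - b * k = 1 -> - a' * h' - b' * k' = 1 -> k <> 0 -> k' <> 0 ->
  let v := k * eta - h in let v' := k' * eta - h' in
  let p := v * X - (a * eta + b) in let p' := v' * X - (a' * eta + b') in
  let C := h * k' - k * h' in let tau := (- a * h' - b * k') + (- k * b' - h * a') - 2 in
  v * C * (p - p') = (v - v') * p * C + (v - v') ^ 2 - v * v' * tau.
Proof.
  intros H H' Hk Hk'.
  replace b with ((-1 - a * h) / k) by (field_simplify_eq; lra).
  replace b' with ((-1 - a' * h') / k') by (field_simplify_eq; lra).
  cbv zeta. field. auto.
Qed.

(** The quotient of the two matrices has determinant 1 and here trace 2, so [(A - 1)^2 = - bb C].
    Since [k' - k = (A - 1) k - C a], the square of [k' - k] is divisible by [C]. For trace 2 the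
    entry [C] is therefore at most [(k' - k)^2] in size when [k] and [k'] differ, which is too small
    for two close arcs. *)
Lemma parabolic_divides (a b k h a' b' k' h' : Z) :
  (- a * h - b * k = 1)%Z -> (- a' * h' - b' * k' = 1)%Z ->
  ((- a * h' - b * k') + (- k * b' - h * a') - 2 = 0)%Z ->
  (h * k' - k * h' | (k' - k) * (k' - k))%Z.
Proof.
  intros H H' Ht.
  set (A := (- a * h' - b * k')%Z) in *. set (d := (- k * b' - h * a')%Z) in *.
  set (C := (h * k' - k * h')%Z).
  set (bb := (- a * b' + b * a')%Z).
  assert (Det : (A * d - bb * C = 1)%Z).
  { unfold A, d, bb, C.
    replace 1%Z with ((- a * h - b * k) * (- a' * h' - b' * k'))%Z by (rewrite H, H'; ring). ring. }
  assert (K : (k' - k = (A - 1) * k - C * a)%Z).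
  { unfold A, C. replace k' with ((- a * h - b * k) * k')%Z at 1 by (rewrite H; ring). ring. }
  assert (Hd : d = (2 - A)%Z) by lia. rewrite Hd in Det.
  exists (- bb * k * k - 2 * (A - 1) * k * a + C * a * a)%Z.
  rewrite K. replace ((A - 1) * k - C * a)%Z with ((A - 1) * k - C * a)%Z by ring.
  assert ((A - 1) * (A - 1) = - bb * C)%Z by lia.
  transitivity ((A - 1) * (A - 1) * k * k - 2 * (A - 1) * k * a * C + C * a * a * C)%Z; [ring|].
  rewrite H0. ring.
Qed.

(** * Counting the arcs of one dyadic class and summing over their pairs *)

Section Count.
Variables (eta b1 R0 B w w' rho : R) (Q H L : Z) (av bv : Z -> Z -> Z).
Hypothesis Hrho : 0 < rho <= 1.
Hypothesis HR0 : rho <= R0 <= b1.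
Hypothesis HR1 : 4 * R0 <= b1 ^ 2.
Hypothesis HQ : 32 <= IZR Q * rho.
Hypothesis Hw : 0 < w.
Hypothesis Hww : w <= w' <= 2 * w.
Hypothesis HwQ : w' * IZR Q <= 1.
Hypothesis HB : 0 < B.

Definition vv (k h : Z) : R := IZR k * eta - IZR h.
Definition al (k h : Z) : R := IZR (av k h) * eta + IZR (bv k h).
Definition pp (k h l : Z) (X : R) : R := vv k h * (X + IZR l) - al k h.

(* The matrix g = (a b; k -h) lies in SL2(Z), and g moves some xi in the interval, with k xi - h in
   the dyadic window [w, w'], into [l, l + 1]. *)
Definition good (k h l : Z) : Prop :=
  (1 <= Z.abs k <= Q)%Z /\ (- av k h * h - bv k h * k = 1)%Z /\
  exists xi, eta + b1 <= xi <= eta + b1 + R0 /\ w <= IZR k * xi - IZR h <= w' /\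
    IZR l <= (IZR (av k h) * xi + IZR (bv k h)) / (IZR k * xi - IZR h) <= IZR l + 1.

(** On a piece [p] equals [(x - eta) / (k x - h)] and hence lies between [P1] and [P2]. The
    threshold [s0] separates the pairs with nearly equal [v] from the others, and [C1] absorbs the
    [+ 1] of lattice point counts by means of [rho <= R0]. *)
Let P1 := b1 / w'.
Let P2 := (b1 + R0) / w.
Let s0 := rho / 8.
Let C1 := 3 / rho.

Lemma b1_pos : 0 < b1. Proof using Hrho HR0. lra. Qed.
Lemma w'_pos : 0 < w'. Proof using Hw Hww. lra. Qed.
Lemma P1_pos : 0 < P1.
Proof using Hrho HR0 Hw Hww. pos. Qed.

Lemma P2_le : P2 <= 4 * P1.
Proof using Hrho HR0 Hw Hww.
  unfold P2, P1. pose proof b1_pos. pose proof w'_pos.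
  apply Rle_trans with (2 * b1 / w); [unfold Rdiv; apply Rmult_le_compat_r; [left; apply Rinv_0_lt_compat; auto|lra]|].
  apply (Rmult_le_reg_r (w * w')); [apply Rmult_lt_0_compat; auto|].
  replace (2 * b1 / w * (w * w')) with (2 * b1 * w') by (field; lra).
  replace (4 * (b1 / w') * (w * w')) with (4 * b1 * w) by (field; lra). nra.
Qed.

Lemma Q_pos : 32 <= IZR Q.
Proof using HQ Hrho. nra. Qed.

Lemma w'_small : w' <= rho / 32.
Proof using HQ Hrho HwQ Hw Hww. nra. Qed.

Lemma k_bounds k h l : good k h l -> 1 <= Rabs (IZR k) <= IZR Q.
Proof.
  intros [[H1 H2] _]. rewrite <- abs_IZR. split; apply IZR_le; lia.
Qed.

(** [v] is [(k xi - h) - k (xi - eta)]. The first term is at most [w' <= rho / 32], small against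
    the second, whose size lies between [|k| b1] and [2 |k| b1] because [R0 <= b1]. *)
Lemma v_bounds k h l : good k h l ->
  3 / 4 * (Rabs (IZR k) * b1) <= Rabs (vv k h) <= 9 / 4 * (Rabs (IZR k) * b1).
Proof using All.
  intros Hg. pose proof (k_bounds _ _ _ Hg) as Hk. destruct Hg as [_ [_ [xi [Hxi [Hx _]]]]].
  pose proof w'_small. pose proof b1_pos.
  set (x := IZR k * xi - IZR h) in *. set (b := xi - eta).
  assert (Hb : b1 <= b <= b1 + R0) by (unfold b; lra).
  replace (vv k h) with (x - IZR k * b) by (unfold vv, x, b; ring).
  assert (Ekb : Rabs (IZR k * b) = Rabs (IZR k) * b) by (rewrite Rabs_mult, (Rabs_pos_eq b) by lra; reflexivity).
  assert (Rabs x <= rho / 32) by (rewrite Rabs_pos_eq; lra).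
  pose proof (Rabs_triang_inv (IZR k * b) x) as T1. rewrite Rabs_minus_sym in T1.
  pose proof (Rabs_triang x (- (IZR k * b))) as T2. rewrite Rabs_Ropp in T2.
  change (x + - (IZR k * b)) with (x - IZR k * b) in T2.
  rewrite Ekb in *. nra.
Qed.

Lemma v_neq0 k h l : good k h l -> vv k h <> 0.
Proof using All.
  intros Hg E. pose proof (v_bounds _ _ _ Hg). pose proof (k_bounds _ _ _ Hg). pose proof b1_pos.
  rewrite E, Rabs_R0 in H0. nra.
Qed.

(** [h = k eta + k b - (k xi - h)] with [b = xi - eta] between [b1] and [b1 + R0]; the minimum
    covers both signs of [k]. *)
Lemma h_interval k h l : good k h l ->
  IZR k * eta + Rmin (IZR k * b1) (IZR k * (b1 + R0)) - w' <= IZR h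
  <= (IZR k * eta + Rmin (IZR k * b1) (IZR k * (b1 + R0)) - w') + (Rabs (IZR k) * R0 + w').
Proof using All.
  intros Hg. pose proof (k_bounds _ _ _ Hg) as Hk. destruct Hg as [_ [_ [xi [Hxi [Hx _]]]]].
  pose proof b1_pos.
  set (b := xi - eta). replace (IZR h) with (IZR k * eta + IZR k * b - (IZR k * xi - IZR h)) by (unfold b; ring).
  set (x := IZR k * xi - IZR h) in *.
  assert (Hb : b1 <= b <= b1 + R0) by (unfold b; lra).
  unfold Rmin, Rabs. destruct Rle_dec; destruct Rcase_abs; nra.
Qed.

Lemma h_count k (f : Z -> Prop) : (1 <= Z.abs k <= Q)%Z ->
  (forall h, f h -> exists l, good k h l) ->
  lsum (zr (- H) H) (fun h => indic (f h)) <= C1 * (Rabs (IZR k) * R0).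
Proof using All.
  intros Hk Hf. assert (Hk1 : 1 <= Rabs (IZR k)) by (rewrite <- abs_IZR; apply IZR_le; lia).
  pose proof w'_small. pose proof w'_pos.
  eapply Rle_trans; [|eapply Rle_trans].
  - apply lsum_le. intros h _. apply indic_le. intros Hh. destruct (Hf h Hh) as [l Hl].
    exact (h_interval k h l Hl).
  - apply lsum_count. nra.
  - unfold C1. assert (rho <= Rabs (IZR k) * R0) by nra.
    apply (Rmult_le_reg_l rho); [lra|].
    replace (rho * (3 / rho * (Rabs (IZR k) * R0))) with (3 * (Rabs (IZR k) * R0)) by (field; lra). nra.
Qed.

(** By the determinant the image of [xi] is [a / k - 1 / (k x)] with [x = k xi - h] in [[w, w']], so
    it moves in an interval of length at most [1 / (|k| w)]. *)
Lemma l_interval k h l : good k h l ->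
  (IZR (av k h) / IZR k + Rmin (- / (IZR k * w)) (- / (IZR k * w')) - 1) <= IZR l
  <= (IZR (av k h) / IZR k + Rmin (- / (IZR k * w)) (- / (IZR k * w')) - 1) + (/ (Rabs (IZR k) * w) + 1).
Proof using All.
  intros Hg. pose proof (k_bounds _ _ _ Hg) as Hk. pose proof w'_pos.
  destruct Hg as [_ [Hdet [xi [Hxi [Hx Hl]]]]].
  assert (Hk0 : IZR k <> 0) by (intros E; rewrite E, Rabs_R0 in Hk; lra).
  set (x := IZR k * xi - IZR h) in *.
  assert (EX : (IZR (av k h) * xi + IZR (bv k h)) / x = IZR (av k h) / IZR k - / (IZR k * x)).
  { apply (f_equal IZR) in Hdet. rewrite minus_IZR, !mult_IZR, opp_IZR in Hdet.
    replace (IZR (bv k h)) with ((-1 - IZR (av k h) * IZR h) / IZR k) by (field_simplify_eq; lra).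
    replace xi with ((x + IZR h) / IZR k) by (unfold x; field; auto).
    field. lra. }
  rewrite EX in Hl.
  assert (I1 : / x <= / w) by (apply Rinv_le_contravar; lra).
  assert (I2 : / w' <= / x) by (apply Rinv_le_contravar; lra).
  assert (I0 : 0 < / w') by pos.
  rewrite !Rinv_mult in *.
  destruct (Rcase_abs (IZR k)) as [N|N].
  - rewrite Rabs_left by auto. rewrite Rinv_opp.
    assert (/ IZR k < 0) by (apply Rinv_lt_0_compat; auto).
    unfold Rmin; destruct Rle_dec; nra.
  - rewrite Rabs_right by auto.
    assert (0 < / IZR k) by pos.
    unfold Rmin; destruct Rle_dec; nra.
Qed.

Lemma kw_le k : (1 <= Z.abs k <= Q)%Z -> 0 < Rabs (IZR k) * w <= 1.
Proof using All.
  intros Hk. assert (1 <= Rabs (IZR k) <= IZR Q) by (rewrite <- abs_IZR; split; apply IZR_le; lia).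
  nra.
Qed.

Lemma l_count k h : (1 <= Z.abs k <= Q)%Z ->
  lsum (zr (- L) L) (fun l => indic (good k h l)) <= 3 / (Rabs (IZR k) * w).
Proof using All.
  intros Hk. pose proof (kw_le k Hk).
  assert (1 <= / (Rabs (IZR k) * w)) by (rewrite <- Rinv_1; apply Rinv_le_contravar; lra).
  eapply Rle_trans; [|eapply Rle_trans].
  - apply lsum_le. intros l _. apply indic_le. exact (l_interval k h l).
  - apply lsum_count. lra.
  - lra.
Qed.

Definition SG (F : Z -> Z -> Z -> R) : R :=
  lsum (zr (- Q) Q) (fun k => lsum (zr (- H) H) (fun h => lsum (zr (- L) L)
    (fun l => indic (good k h l) * F k h l))).

Lemma SG_le F G : (forall k h l, good k h l -> F k h l <= G k h l) -> SG F <= SG G.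
Proof.
  intros HF. apply lsum_le; intros k _. apply lsum_le; intros h _. apply lsum_le; intros l _.
  unfold indic. destruct excluded_middle_informative; [|lra]. rewrite !Rmult_1_l. auto.
Qed.

Lemma SG_plus F G : SG (fun k h l => F k h l + G k h l) = SG F + SG G.
Proof.
  unfold SG. rewrite <- lsum_plus. apply lsum_ext; intros k _.
  rewrite <- lsum_plus. apply lsum_ext; intros h _.
  rewrite <- lsum_plus. apply lsum_ext; intros l _. ring.
Qed.

Lemma SG_swap (F : Z -> Z -> Z -> Z -> Z -> Z -> R) :
  SG (fun k h l => SG (fun k' h' l' => F k h l k' h' l'))
  = SG (fun k' h' l' => SG (fun k h l => F k h l k' h' l')).
Proof.
  set (box := list_prod (zr (- Q) Q) (list_prod (zr (- H) H) (zr (- L) L))).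
  assert (E : forall G, SG G = lsum box (fun t => indic (good (fst t) (fst (snd t)) (snd (snd t)))
      * G (fst t) (fst (snd t)) (snd (snd t)))).
  { intros G. unfold box, SG. rewrite lsum_list_prod. apply lsum_ext; intros k _.
    rewrite lsum_list_prod. auto. }
  rewrite !E.
  rewrite (lsum_ext _ _ (fun t => lsum box (fun t' => indic (good (fst t) (fst (snd t)) (snd (snd t))) *
     (indic (good (fst t') (fst (snd t')) (snd (snd t'))) *
      F (fst t) (fst (snd t)) (snd (snd t)) (fst t') (fst (snd t')) (snd (snd t')))))).
  2:{ intros t _. rewrite E, <- lsum_scal. lra. }
  rewrite lsum_swap. apply lsum_ext; intros t' _. rewrite E, <- lsum_scal.
  apply lsum_ext; intros t _. ring.
Qed.

(** A given [k] admits at most [C1 |k| R0] values of [h], and a given pair at most [3 / (|k| w)]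
    values of [l]; the factors [|k|] cancel. *)
Lemma SG_const_le c : 0 <= c -> SG (fun _ _ _ => c) <= 9 * C1 * (IZR Q * R0 / w) * c.
Proof using All.
  intros Hc. pose proof Q_pos.
  assert (HQ0 : (0 <= Q)%Z) by (apply le_IZR; lra).
  assert (0 < C1) by pos.
  apply Rle_trans with (lsum (zr (- Q) Q) (fun k => indic (- IZR Q <= IZR k <= - IZR Q + 2 * IZR Q) * (3 * C1 * (R0 / w) * c))).
  - apply lsum_le. intros k Hk. apply In_zr in Hk. rewrite indic_true, Rmult_1_l.
    2:{ rewrite <- opp_IZR. replace (IZR (- Q) + 2 * IZR Q) with (IZR Q) by (rewrite opp_IZR; ring).
        split; apply IZR_le; lia. }
    destruct (Z.eq_dec k 0) as [->|Nk].
    + apply Rle_trans with 0.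
      * rewrite <- (Rmult_0_r (INR (length (zr (- H) H)))), <- lsum_const. apply lsum_le; intros h _.
        rewrite <- (Rmult_0_r (INR (length (zr (- L) L)))), <- lsum_const. apply lsum_le; intros l _.
        rewrite indic_false; [lra|]. intros [[G _] _]. simpl in G. lia.
      * pos.
    + assert (Hk1 : (1 <= Z.abs k <= Q)%Z) by lia. pose proof (kw_le k Hk1) as Hkw.
      set (f := fun h => exists l, good k h l).
      apply Rle_trans with (lsum (zr (- H) H) (fun h => 3 / (Rabs (IZR k) * w) * c * indic (f h))).
      * apply lsum_le; intros h _.
        destruct (classic (f h)) as [Hf|Hf].
        -- rewrite (indic_true (f h)), Rmult_1_r by auto.
           rewrite (lsum_ext _ _ (fun l => c * indic (good k h l))) by (intros; ring).
           rewrite lsum_scal, Rmult_comm. apply Rmult_le_compat_r; auto. apply l_count; auto.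
        -- rewrite (indic_false (f h)) by auto. rewrite Rmult_0_r.
           rewrite <- (Rmult_0_r (INR (length (zr (- L) L)))), <- lsum_const. apply lsum_le; intros l _.
           rewrite indic_false; [lra|]. intros G. apply Hf. exists l; auto.
      * rewrite lsum_scal. pose proof (h_count k f Hk1 ltac:(auto)) as Hh.
        apply Rle_trans with (3 / (Rabs (IZR k) * w) * c * (C1 * (Rabs (IZR k) * R0))).
        -- apply Rmult_le_compat_l; auto. pos.
        -- right. field. nra.
  - rewrite (lsum_ext _ _ (fun k => (3 * C1 * (R0 / w) * c) * indic (- IZR Q <= IZR k <= - IZR Q + 2 * IZR Q))) by (intros; ring).
    rewrite lsum_scal.
    assert (0 <= 3 * C1 * (R0 / w) * c).
    { pos. }
    apply Rle_trans with (3 * C1 * (R0 / w) * c * (3 * IZR Q)).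
    + apply Rmult_le_compat_l; auto. eapply Rle_trans; [apply lsum_count; lra|lra].
    + lra.
Qed.

(** What remains of [SG] once the sum over [l] has been estimated: a pair [(k, h)] enters once as
    soon as some [l] is good. *)
Definition SH (D : Z -> Z -> R) : R :=
  lsum (zr (- Q) Q) (fun k => lsum (zr (- H) H) (fun h => indic (exists l, good k h l) * D k h)).

Lemma SG_le_SH F D :
  (forall k h l, good k h l -> lsum (zr (- L) L) (fun l => indic (good k h l) * F k h l) <= D k h) ->
  SG F <= SH D.
Proof.
  intros HF. apply lsum_le; intros k _. apply lsum_le; intros h _.
  unfold indic at 2. destruct excluded_middle_informative as [[l Hl]|N].
  - rewrite Rmult_1_l. apply (HF k h l Hl).
  - rewrite Rmult_0_l. rewrite <- (Rmult_0_r (INR (length (zr (- L) L)))), <- lsum_const.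
    apply lsum_le; intros l _. rewrite indic_false; [lra|]. intros G; apply N; eauto.
Qed.

Lemma sum_k_le (f : Z -> R) c : 0 <= c -> (forall k, (Z.abs k <= Q)%Z -> f k <= c) ->
  lsum (zr (- Q) Q) f <= 3 * IZR Q * c.
Proof using All.
  intros Hc Hf. pose proof Q_pos.
  apply Rle_trans with (lsum (zr (- Q) Q) (fun k => c * indic (- IZR Q <= IZR k <= - IZR Q + 2 * IZR Q))).
  - apply lsum_le. intros k Hk. apply In_zr in Hk. rewrite indic_true, Rmult_1_r.
    2:{ rewrite <- opp_IZR. replace (IZR (- Q) + 2 * IZR Q) with (IZR Q) by (rewrite opp_IZR; ring).
        split; apply IZR_le; lia. }
    apply Hf. lia.
  - rewrite lsum_scal.
    assert (lsum (zr (- Q) Q) (fun k => indic (- IZR Q <= IZR k <= - IZR Q + 2 * IZR Q)) <= 2 * IZR Q + 1)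
      by (apply lsum_count; lra). nra.
Qed.

Lemma sum_h_zero f : lsum (zr (- H) H) (fun h => indic (exists l, good 0 h l) * f h) = 0.
Proof.
  rewrite (lsum_ext _ _ (fun _ => 0)); [rewrite lsum_const; ring|].
  intros h _. rewrite indic_false; [ring|]. intros [l [[G _] _]]. auto.
Qed.

Lemma sum_h_le k f c : (1 <= Z.abs k <= Q)%Z -> 0 <= c ->
  (forall h l, good k h l -> f h <= c) ->
  lsum (zr (- H) H) (fun h => indic (exists l, good k h l) * f h) <= C1 * (Rabs (IZR k) * R0) * c.
Proof using All.
  intros Hk Hc Hf.
  apply Rle_trans with (lsum (zr (- H) H) (fun h => c * indic (exists l, good k h l))).
  - apply lsum_le; intros h _. unfold indic. destruct excluded_middle_informative as [[l Hl]|]; [|lra].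
    pose proof (Hf h l Hl). lra.
  - rewrite lsum_scal, Rmult_comm. apply Rmult_le_compat_r; auto. apply h_count; auto.
Qed.

Lemma C1_pos : 0 < C1.
Proof using Hrho. pos. Qed.

Lemma SH_inv_k c : 0 <= c -> SH (fun k h => c / Rabs (IZR k)) <= 3 * IZR Q * (C1 * R0 * c).
Proof using All.
  intros Hc. pose proof C1_pos.
  assert (0 <= C1 * R0 * c) by pos.
  apply sum_k_le; auto. intros k Hk.
  destruct (Z.eq_dec k 0) as [->|Nk]; [rewrite (sum_h_zero (fun _ => c / Rabs 0)); auto|].
  assert (0 < Rabs (IZR k)) by (apply Rabs_pos_lt, IZR_neq; auto).
  eapply Rle_trans; [apply (sum_h_le k _ (c / Rabs (IZR k))); [lia| |intros; lra]|].
  - pos.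
  - right. field. lra.
Qed.

(** As a function of X the difference of the two linear functions is [ss X - v' (l' - ls)]: [ss] is
    its slope, and [ls] is the real value of [l'] for which it vanishes at [X = 0]. *)
Definition ls (k h l k' h' : Z) : R := (vv k h * IZR l - al k h + al k' h') / vv k' h'.
Definition ss (k h k' h' : Z) : R := vv k h - vv k' h'.
Let K5 := P1 ^ 2 * sqrt P1.
Let kap (k k' : Z) := Rabs (IZR k' - IZR k).

(** Expressed by the points of the two arcs, [ss] is [(k' - k) b' - k (b - b') + (x - x')].
    Different denominators thus force different [v], up to the length of the interval. *)
Lemma ss_spread k h l k' h' l' : good k h l -> good k' h' l' ->
  kap k k' * b1 <= Rabs (ss k h k' h') + Rabs (IZR k) * R0 + w'.
Proof using All.
  intros [_ [_ [xi [Hxi [Hx _]]]]] [_ [_ [xi' [Hxi' [Hx' _]]]]]. pose proof b1_pos.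
  set (x := IZR k * xi - IZR h) in *. set (x' := IZR k' * xi' - IZR h') in *.
  set (b := xi - eta). set (b' := xi' - eta).
  replace (ss k h k' h') with ((IZR k' - IZR k) * b' - IZR k * (b - b') + (x - x'))
    by (unfold ss, vv, x, x', b, b'; ring).
  set (u := (IZR k' - IZR k) * b').
  assert (Hu : kap k k' * b1 <= Rabs u).
  { unfold u. rewrite Rabs_mult. mull.
    rewrite Rabs_pos_eq; unfold b'; lra. }
  assert (Rabs (IZR k * (b - b')) <= Rabs (IZR k) * R0).
  { rewrite Rabs_mult. mull. apply Rabs_le. unfold b, b'; lra. }
  assert (Rabs (x - x') <= w') by (apply Rabs_le; lra).
  replace u with ((u - IZR k * (b - b') + (x - x')) + (IZR k * (b - b') - (x - x'))) in Hu by ring.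
  pose proof (Rabs_triang (u - IZR k * (b - b') + (x - x')) (IZR k * (b - b') - (x - x'))).
  pose proof (Rabs_triang (IZR k * (b - b')) (- (x - x'))). rewrite Rabs_Ropp in *.
  change (IZR k * (b - b') + - (x - x')) with (IZR k * (b - b') - (x - x')) in *. lra.
Qed.

Lemma kap_int k k' : k <> k' -> 1 <= kap k k'.
Proof.
  intros N. unfold kap. rewrite <- minus_IZR, <- abs_IZR. apply IZR_le. lia.
Qed.

(** For equal [k] the number [ss] is an integer, so [|ss| < s0 < 1] forces equal [h]. For different
    [k] the bound of [ss_spread] applies, where [s0 + w'] is absorbed by [|k| R0]. *)
Lemma near_kap k h l k' h' l' : good k h l -> good k' h' l' ->
  Rabs (ss k h k' h') < s0 -> (k, h) <> (k', h') ->
  1 <= kap k k' <= 2 * (Rabs (IZR k) * R0) / b1.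
Proof using All.
  intros Hg Hg' Hs N.
  assert (Nk : k <> k').
  { intros ->. apply N. f_equal.
    replace (ss k' h k' h') with (IZR (h' - h)) in Hs by (unfold ss, vv; rewrite minus_IZR; ring).
    rewrite <- abs_IZR in Hs. assert (IZR (Z.abs (h' - h)) < 1) by (unfold s0 in Hs; lra).
    apply lt_IZR in H0. lia. }
  pose proof (kap_int k k' Nk). split; auto.
  pose proof (ss_spread _ _ _ _ _ _ Hg Hg'). pose proof w'_small. pose proof b1_pos.
  apply (Rmult_le_reg_r b1); auto.
  replace (2 * (Rabs (IZR k) * R0) / b1 * b1) with (2 * (Rabs (IZR k) * R0)) by (field; lra).
  unfold s0 in *. nra.
Qed.

(** Divided by [v C], the identity [moebius_difference] writes [v' tau / C] in terms of [p - p'] and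
    two small terms. As [tau] is a nonzero integer, [|v'| >= |v|] and [|C|] is about [|v| kap], that
    quotient is at least [6 / (7 kap)]. *)
Lemma near_distance k h l k' h' l' X : good k h l -> good k' h' l' ->
  Rabs (ss k h k' h') < s0 -> (k, h) <> (k', h') -> Rabs (vv k h) <= Rabs (vv k' h') ->
  P1 <= pp k h l X <= P2 -> Rabs (ss k h k' h') * P2 / Rabs (vv k h) <= / (4 * kap k k') ->
  3 / 10 * / kap k k' <= Rabs (pp k h l X - pp k' h' l' X).
Proof using All.
  intros Hg Hg' Hs N Hvv HX Hsm.
  pose proof (near_kap _ _ _ _ _ _ Hg Hg' Hs N) as [Hk1 Hk2].
  pose proof (k_bounds _ _ _ Hg) as Hk. pose proof (k_bounds _ _ _ Hg') as Hk'.
  pose proof (v_bounds _ _ _ Hg) as Hv. pose proof (v_neq0 _ _ _ Hg) as Hv0.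
  pose proof (v_neq0 _ _ _ Hg') as Hv0'. pose proof P1_pos as HP1. pose proof b1_pos as Hb1.
  assert (Hk0 : IZR k <> 0) by (intros E; rewrite E, Rabs_R0 in Hk; lra).
  assert (Hk0' : IZR k' <> 0) by (intros E; rewrite E, Rabs_R0 in Hk'; lra).
  destruct Hg as [HkQ [Hdet _]]. destruct Hg' as [HkQ' [Hdet' _]].
  set (v := vv k h) in *. set (v' := vv k' h') in *. set (s := ss k h k' h') in *.
  set (a := (av k h - l * k)%Z). set (b := (bv k h + l * h)%Z).
  set (a' := (av k' h' - l' * k')%Z). set (b' := (bv k' h' + l' * h')%Z).
  assert (Da : (- a * h - b * k = 1)%Z) by lia.
  assert (Da' : (- a' * h' - b' * k' = 1)%Z) by lia.
  set (tau := ((- a * h' - b * k') + (- k * b' - h * a') - 2)%Z).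
  set (C := (h * k' - k * h')%Z).
  assert (EC : IZR C = - (v * (IZR k' - IZR k) + s * IZR k)).
  { unfold C, s, ss. fold v v'. unfold v, v', vv. rewrite minus_IZR, !mult_IZR. ring. }
  assert (Hsk : Rabs (s * IZR k) <= / 6 * (Rabs v * kap k k')).
  { rewrite Rabs_mult. unfold s0 in Hs.
    assert (Rabs s * Rabs (IZR k) <= b1 / 8 * Rabs (IZR k)) by (apply Rmult_le_compat_r; lra).
    assert (Rabs v * 1 <= Rabs v * kap k k') by (apply Rmult_le_compat_l; lra). lra. }
  assert (HC : 5 / 6 * (Rabs v * kap k k') <= Rabs (IZR C) <= 7 / 6 * (Rabs v * kap k k')).
  { rewrite EC, Rabs_Ropp.
    assert (E1 : Rabs (v * (IZR k' - IZR k)) = Rabs v * kap k k') by (rewrite Rabs_mult; reflexivity).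
    pose proof (Rabs_triang (v * (IZR k' - IZR k)) (s * IZR k)).
    pose proof (Rabs_triang_inv (v * (IZR k' - IZR k)) (- (s * IZR k))) as T.
    rewrite Rabs_Ropp in T.
    replace (v * (IZR k' - IZR k) - - (s * IZR k)) with (v * (IZR k' - IZR k) + s * IZR k) in T by ring.
    lra. }
  assert (Hvp : 0 < Rabs v) by (apply Rabs_pos_lt; auto).
  assert (HCp : 0 < Rabs (IZR C)) by (assert (0 < Rabs v * kap k k') by (apply Rmult_lt_0_compat; lra); lra).
  assert (HC0 : IZR C <> 0) by (intros E; rewrite E, Rabs_R0 in HCp; lra).
  (* If [tau = 0], then [C] divides [(k' - k)^2], so [5/6 |v| kap <= kap^2]. With
     [|v| >= 3/4 |k| b1] and [kap b1 <= 2 |k| R0] this gives [5/8 b1^2 <= 2 R0], against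
     [4 R0 <= b1^2]. *)
  assert (Ht : tau <> 0%Z).
  { intros E. pose proof (parabolic_divides a b k h a' b' k' h' Da Da' E) as Dv. fold C in Dv.
    assert (HkK : kap k k' = IZR (Z.abs (k' - k))) by (unfold kap; rewrite abs_IZR, minus_IZR; reflexivity).
    assert ((Z.abs C <= Z.abs (k' - k) * Z.abs (k' - k))%Z).
    { rewrite <- Z.abs_mul. apply Z.divide_pos_le.
      - assert (1 <= Z.abs (k' - k))%Z by (apply le_IZR; rewrite <- HkK; auto). lia.
      - apply Z.divide_abs_r, Z.divide_abs_l. auto. }
    apply IZR_le in H0. rewrite mult_IZR, <- HkK, abs_IZR in H0.
    assert (5 / 6 * Rabs v <= kap k k').
    { apply (Rmult_le_reg_r (kap k k')); [lra|]. lra. }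
    assert (5 / 8 * (Rabs (IZR k) * b1) * b1 <= 2 * (Rabs (IZR k) * R0)).
    { apply Rle_trans with (kap k k' * b1); [apply Rmult_le_compat_r; lra|].
      apply (Rmult_le_compat_r b1) in Hk2; [|lra].
      replace (2 * (Rabs (IZR k) * R0) / b1 * b1) with (2 * (Rabs (IZR k) * R0)) in Hk2 by (field; lra). auto. }
    assert (0 < Rabs (IZR k) * (5 / 8 * b1 ^ 2 - 2 * R0)) by (apply Rmult_lt_0_compat; lra). lra. }
  assert (Htau : 1 <= Rabs (IZR tau)) by (rewrite <- abs_IZR; apply IZR_le; lia).
  assert (Id : v * IZR C * (pp k h l X - pp k' h' l' X)
     = s * pp k h l X * IZR C + s ^ 2 - v * v' * IZR tau).
  { assert (Eq : forall k h l, pp k h l X = vv k h * X - (IZR (av k h - l * k) * eta + IZR (bv k h + l * h))).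
    { intros. unfold pp, al, vv. rewrite minus_IZR, plus_IZR, !mult_IZR. ring. }
    rewrite !Eq. fold a b a' b' v v'.
    apply (f_equal IZR) in Da. apply (f_equal IZR) in Da'.
    rewrite minus_IZR, !mult_IZR, opp_IZR in Da, Da'.
    pose proof (moebius_difference eta X (IZR a) (IZR b) (IZR k) (IZR h) (IZR a') (IZR b') (IZR k') (IZR h')
      Da Da' Hk0 Hk0') as M. cbv zeta in M.
    unfold tau, C, s, ss. rewrite ?minus_IZR, ?plus_IZR, ?minus_IZR, ?mult_IZR, ?opp_IZR. auto. }
  assert (Id2 : - (v' * IZR tau / IZR C) =
     (pp k h l X - pp k' h' l' X) - s * pp k h l X / v - s ^ 2 / (v * IZR C)).
  { apply (Rmult_eq_reg_l (v * IZR C)); [|apply Rmult_integral_contrapositive; auto].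
    rewrite 2!Rmult_minus_distr_l, Id. field. auto. }
  set (Y := pp k h l X - pp k' h' l' X) in *.
  assert (T : Rabs v' * / Rabs (IZR C) <= Rabs Y + Rabs s * P2 / Rabs v + s ^ 2 / (Rabs v * Rabs (IZR C))).
  { apply Rle_trans with (Rabs (- (v' * IZR tau / IZR C))).
    - rewrite Rabs_Ropp. unfold Rdiv. rewrite !Rabs_mult, Rabs_inv.
      rewrite <- (Rmult_1_r (Rabs v')) at 1. mulr. mull. auto.
    - rewrite Id2. pose proof (Rabs_triang (Y - s * pp k h l X / v) (- (s ^ 2 / (v * IZR C)))) as T1.
      pose proof (Rabs_triang Y (- (s * pp k h l X / v))) as T2.
      rewrite Rabs_Ropp in T1, T2.
      assert (Rabs (s * pp k h l X / v) <= Rabs s * P2 / Rabs v).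
      { unfold Rdiv. rewrite !Rabs_mult, Rabs_inv. mulr.
        mull. rewrite Rabs_pos_eq; lra. }
      assert (Rabs (s ^ 2 / (v * IZR C)) = s ^ 2 / (Rabs v * Rabs (IZR C))).
      { unfold Rdiv. rewrite Rabs_mult, Rabs_inv, Rabs_mult, (Rabs_pos_eq (s ^ 2)) by apply pow2_ge_0. lra. }
      unfold Rminus in *. lra. }
  set (K := kap k k') in *.
  assert (A1 : 6 / 7 * / K <= Rabs v' * / Rabs (IZR C)).
  { apply (Rmult_le_reg_r (K * Rabs (IZR C))); [apply Rmult_lt_0_compat; lra|].
    replace (6 / 7 * / K * (K * Rabs (IZR C))) with (6 / 7 * Rabs (IZR C)) by (field; lra).
    replace (Rabs v' * / Rabs (IZR C) * (K * Rabs (IZR C))) with (Rabs v' * K) by (field; lra).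
    assert (Rabs v * K <= Rabs v' * K) by (apply Rmult_le_compat_r; lra). lra. }
  assert (A2 : s ^ 2 / (Rabs v * Rabs (IZR C)) <= / 20 * / K).
  { apply (Rmult_le_reg_r (K * (Rabs v * Rabs (IZR C)))); [apply Rmult_lt_0_compat; [lra|apply Rmult_lt_0_compat; lra]|].
    replace (s ^ 2 / (Rabs v * Rabs (IZR C)) * (K * (Rabs v * Rabs (IZR C)))) with (s ^ 2 * K) by (field; lra).
    replace (/ 20 * / K * (K * (Rabs v * Rabs (IZR C)))) with (/ 20 * (Rabs v * Rabs (IZR C))) by (field; lra).
    assert (s ^ 2 <= (rho / 8) ^ 2).
    { rewrite <- (Rabs_pos_eq (s ^ 2)), <- RPow_abs by apply pow2_ge_0. apply pow_incr.
      unfold s0 in Hs. split; [apply Rabs_pos|lra]. }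
    assert (1 * rho <= Rabs (IZR k) * b1) by (apply Rmult_le_compat; lra).
    assert (3 / 4 * rho <= Rabs v) by lra.
    assert (Rabs v * (5 / 6 * (Rabs v * K)) <= Rabs v * Rabs (IZR C)) by (apply Rmult_le_compat_l; lra).
    assert ((3 / 4 * rho) * (3 / 4 * rho) <= Rabs v * Rabs v) by (apply Rmult_le_compat; lra).
    assert (0 <= rho * rho) by pos.
    assert (s ^ 2 <= / 20 * (5 / 6) * (Rabs v * Rabs v)) by lra.
    assert (s ^ 2 * K <= / 20 * (5 / 6) * (Rabs v * Rabs v) * K) by (apply Rmult_le_compat_r; lra). lra. }
  (* [6/7 - 1/4 - 1/20] exceeds [3/10]. *)
  rewrite Rinv_mult in Hsm. assert (0 < / K) by pos. lra.
Qed.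

(** [J] stands for the absolute value of an overlap integral. Of the analysis it retains symmetry,
    the trivial bound on the diagonal and the two derivative tests. *)
Variable J : Z -> Z -> Z -> Z -> Z -> Z -> R.
Hypothesis HJsym : forall k h l k' h' l', J k h l k' h' l' = J k' h' l' k h l.
Hypothesis HJ0 : forall k h l k' h' l', 0 <= J k h l k' h' l'.
Hypothesis HJa : forall k h l, good k h l -> J k h l k h l <= / P1 ^ 4.
Hypothesis HJb : forall k h l k' h' l' d, good k h l -> good k' h' l' -> 0 < d ->
  (forall X, 0 <= X <= 1 -> P1 <= pp k h l X <= P2 -> d <= Rabs (pp k h l X - pp k' h' l' X)) ->
  J k h l k' h' l' <= 2 / (B ^ 2 * d * P1).
Hypothesis HJc : forall k h l k' h' l', good k h l -> good k' h' l' -> ss k h k' h' <> 0 ->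
  J k h l k' h' l' <= 6 / (B * sqrt (Rabs (ss k h k' h')) * K5).

Lemma K5_pos : 0 < K5.
Proof using Hrho HR0 Hw Hww.
  pos.
Qed.

(** [Tfar] is the first derivative test where [v' (l' - ls)] dominates the difference of the linear
    functions, [Tmid] the second derivative test for [|ss| >= s0]. [Tnear] adds both tests for
    [|ss| < s0]; the distance used by the first is that of [near_distance]. *)
Definition Tfar (k h l k' h' l' : Z) : R :=
  5 / (B ^ 2 * P1 * Rabs (vv k' h')) * / (1 + Rabs (IZR l' - ls k h l k' h')).
Definition Tmid (k h k' h' : Z) : R :=
  indic (s0 <= Rabs (ss k h k' h')) * (6 / (B * sqrt (Rabs (ss k h k' h')) * K5)).
Definition Tnear (k h k' h' : Z) : R :=
  indic (Rabs (ss k h k' h') < s0 /\ 1 <= kap k k' <= 2 * (Rabs (IZR k) * R0) / b1) *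
    (7 * kap k k' / (B ^ 2 * P1) + 6 * sqrt (4 * kap k k' * P2 / Rabs (vv k h)) / (B * K5)).

Lemma pp_diff k h l k' h' l' X : vv k' h' <> 0 ->
  pp k h l X - pp k' h' l' X = ss k h k' h' * X - vv k' h' * (IZR l' - ls k h l k' h').
Proof. intros N. unfold pp, ss, ls. field. auto. Qed.

Lemma Tfar_pos k h l k' h' l' : good k' h' l' -> 0 <= Tfar k h l k' h' l'.
Proof using All.
  intros Hg'. pose proof P1_pos. pose proof (v_neq0 _ _ _ Hg').
  assert (0 < Rabs (vv k' h')) by (apply Rabs_pos_lt; auto).
  pose proof (Rabs_pos (IZR l' - ls k h l k' h')).
  pos.
Qed.

Lemma Tmid_pos k h k' h' : 0 <= Tmid k h k' h'.
Proof using Hrho HR0 Hw Hww HB.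
  unfold Tmid, indic. destruct excluded_middle_informative as [H0|]; [|lra].
  rewrite Rmult_1_l. pose proof K5_pos. left. apply Rdiv_lt_0_compat; [lra|].
  assert (0 < Rabs (ss k h k' h')) by (unfold s0 in H0; lra). pos.
Qed.

Lemma Tnear_pos k h k' h' : 0 <= Tnear k h k' h'.
Proof using Hrho HR0 Hw Hww HB.
  pos.
Qed.

(** The ordering [|v| <= |v'|] gives [|ss| <= 2 |v'|]. The factor [2/5] satisfies
    [d - 2 >= 2/5 (1 + d)] for [d >= 4], where the slope cannot compensate the constant term, and
    [d >= 2/5 (1 + d)] for [d >= 1], the case of two different pieces of one arc, where the slope is
    0. *)
Lemma J_le k h l k' h' l' : good k h l -> good k' h' l' -> (k, h, l) <> (k', h', l') ->
  Rabs (vv k h) <= Rabs (vv k' h') ->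
  J k h l k' h' l' <= Tfar k h l k' h' l' +
     indic (Rabs (IZR l' - ls k h l k' h') <= 4) * (Tmid k h k' h' + Tnear k h k' h').
Proof using All.
  intros Hg Hg' N Hvv.
  pose proof (v_neq0 _ _ _ Hg) as Hv0. pose proof (v_neq0 _ _ _ Hg') as Hv0'.
  pose proof (Tmid_pos k h k' h') as Tm. pose proof (Tnear_pos k h k' h') as Tn.
  pose proof (Tfar_pos k h l k' h' l' Hg') as Tf.
  pose proof P1_pos as HP1. pose proof K5_pos as HK5.
  assert (Hv'p : 0 < Rabs (vv k' h')) by (apply Rabs_pos_lt; auto).
  assert (Hvp : 0 < Rabs (vv k h)) by (apply Rabs_pos_lt; auto).
  set (d := Rabs (IZR l' - ls k h l k' h')) in *.
  assert (Hs2 : Rabs (ss k h k' h') <= 2 * Rabs (vv k' h')).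
  { unfold ss. pose proof (Rabs_triang (vv k h) (- vv k' h')) as T. rewrite Rabs_Ropp in T.
    unfold Rminus. lra. }
  assert (Far :
     (forall X, 0 <= X <= 1 -> Rabs (vv k' h') * (2 / 5 * (1 + d)) <= Rabs (pp k h l X - pp k' h' l' X)) ->
     J k h l k' h' l' <= Tfar k h l k' h' l').
  { intros HX.
    assert (Hd : 0 <= d) by apply Rabs_pos.
    assert (Hl : 0 < Rabs (vv k' h') * (2 / 5 * (1 + d))) by pos.
    eapply Rle_trans; [apply (HJb k h l k' h' l' (Rabs (vv k' h') * (2 / 5 * (1 + d)))); auto|].
    right. unfold Tfar. fold d. field. lra. }
  destruct (Rle_dec 4 d) as [D4|D4].
  - apply Rle_trans with (Tfar k h l k' h' l').
    + apply Far. intros X HX. rewrite pp_diff by auto.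
      set (y := vv k' h' * (IZR l' - ls k h l k' h')).
      assert (Ey : Rabs y = Rabs (vv k' h') * d) by (unfold y; rewrite Rabs_mult; reflexivity).
      pose proof (Rabs_triang_inv y (ss k h k' h' * X)) as T. rewrite Rabs_minus_sym in T.
      assert (Rabs (ss k h k' h' * X) <= 2 * Rabs (vv k' h')).
      { rewrite Rabs_mult, (Rabs_pos_eq X) by lra. pose proof (Rabs_pos (ss k h k' h')). nra. }
      rewrite Ey in T.
      assert (Rabs (vv k' h') * (2 / 5 * (1 + d)) <= Rabs (vv k' h') * (d - 2)) by (apply Rmult_le_compat_l; lra).
      lra.
    + assert (0 <= indic (d <= 4) * (Tmid k h k' h' + Tnear k h k' h')); [|lra].
      pos.
  - rewrite indic_true, Rmult_1_l by lra.
    destruct (classic ((k, h) = (k', h'))) as [E|E].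
    + inversion E; subst k' h'.
      assert (Nl : (l' - l <> 0)%Z) by (intros E0; apply N; repeat f_equal; lia).
      assert (Els : ls k h l k h = IZR l) by (unfold ls; field; auto).
      assert (Ed : 1 <= d).
      { unfold d. rewrite Els, <- minus_IZR, <- abs_IZR. apply IZR_le. lia. }
      apply Rle_trans with (Tfar k h l k h l'); [|lra].
      apply Far. intros X HX. rewrite pp_diff by auto.
      replace (ss k h k h) with 0 by (unfold ss; ring).
      rewrite Rmult_0_l, Rminus_0_l, Rabs_Ropp, Rabs_mult. fold d.
      nra.
    + destruct (Rlt_dec (Rabs (ss k h k' h')) s0) as [S|S].
      * pose proof (near_kap _ _ _ _ _ _ Hg Hg' S E) as Hk.
        apply Rle_trans with (Tnear k h k' h'); [|lra].
        unfold Tnear. rewrite indic_true, Rmult_1_l by auto.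
        assert (Q1 : 0 <= 7 * kap k k' / (B ^ 2 * P1)).
        { pos. }
        assert (Q2 : 0 <= 6 * sqrt (4 * kap k k' * P2 / Rabs (vv k h)) / (B * K5)).
        { pos. }
        (* Either the smallness condition of [near_distance] holds, or its failure bounds [1 / |ss|]
           by [4 kap P2 / |v|], which goes into the second derivative test. *)
        destruct (Rle_dec (Rabs (ss k h k' h') * P2 / Rabs (vv k h)) (/ (4 * kap k k'))) as [Sm|Sm].
        -- apply Rle_trans with (7 * kap k k' / (B ^ 2 * P1)); [|lra].
           assert (0 < / kap k k') by pos.
           eapply Rle_trans; [apply (HJb k h l k' h' l' (3 / 10 * / kap k k')); auto; [lra|]|].
           ++ intros X _ HX. apply near_distance; auto.
           ++ apply Rle_trans with (20 / 3 * (kap k k' / (B ^ 2 * P1))); [right; field; repeat split; lra|].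
              lra.
        -- apply Rle_trans with (6 * sqrt (4 * kap k k' * P2 / Rabs (vv k h)) / (B * K5)); [|lra].
           apply Rnot_le_lt in Sm.
           assert (HP2 : 0 < P2).
           { pos. }
           assert (Hs : 0 < Rabs (ss k h k' h')).
           { destruct (Rle_lt_or_eq_dec 0 _ (Rabs_pos (ss k h k' h'))) as [|E0]; auto.
             rewrite <- E0 in Sm. unfold Rdiv in Sm. rewrite !Rmult_0_l in Sm.
             assert (0 < / (4 * kap k k')) by pos. lra. }
           eapply Rle_trans; [apply HJc; auto|].
           { intros E0; rewrite E0, Rabs_R0 in Hs; lra. }
           set (sg := Rabs (ss k h k' h')) in *.
           replace (6 / (B * sqrt sg * K5)) with (6 * / sqrt sg / (B * K5))
             by (assert (0 < sqrt sg) by pos; field; repeat split; lra).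
           mulr.
           mull. rewrite <- sqrt_inv. apply sqrt_le_1_alt.
           apply (Rmult_le_reg_r (sg * Rabs (vv k h) * / (4 * kap k k') * / P2)).
           { pos. }
           replace (/ sg * (sg * Rabs (vv k h) * / (4 * kap k k') * / P2))
             with (Rabs (vv k h) / P2 * / (4 * kap k k')) by (field; lra).
           replace (4 * kap k k' * P2 / Rabs (vv k h) * (sg * Rabs (vv k h) * / (4 * kap k k') * / P2))
             with (Rabs (vv k h) / P2 * (sg * P2 / Rabs (vv k h))) by (field; lra).
           apply Rmult_le_compat_l; [left; apply Rdiv_lt_0_compat; auto|lra].
      * apply Rle_trans with (Tmid k h k' h'); [|lra].
        unfold Tmid. rewrite indic_true, Rmult_1_l by lra. apply HJc; auto.
        intros E0; rewrite E0, Rabs_R0 in S; unfold s0 in S; lra.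
Qed.

Let Lam := 1 + ln (2 + / w).

Lemma Lam_ge1 : 1 <= Lam.
Proof using Hw.
  unfold Lam. assert (0 < / w) by pos.
  pose proof (ln_le 1 (2 + / w)). rewrite ln_1 in H1. lra.
Qed.

(** Over [l'] the terms [1 / (1 + |l' - ls|)] add up to the logarithm of the number of admissible
    [l'], at most about [1 / w]. This is the origin of [Lam]. *)
Lemma sum_far k h l :
  SG (fun k' h' l' => Tfar k h l k' h' l') <= 3 * IZR Q * (C1 * R0 * (40 / 3 * Lam / (B ^ 2 * P1 * b1))).
Proof using All.
  pose proof P1_pos. pose proof b1_pos. pose proof Lam_ge1.
  below SH_inv_k.
  2:{ pos. }
  apply SG_le_SH. intros k' h' l0 Hg.
  pose proof (v_bounds _ _ _ Hg) as Hv. pose proof (v_neq0 _ _ _ Hg) as Hv0.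
  pose proof (k_bounds _ _ _ Hg) as Hk.
  assert (Hvp : 0 < Rabs (vv k' h')) by nra.
  destruct Hg as [HkQ _]. pose proof (kw_le k' HkQ) as Hkw.
  set (A := 5 / (B ^ 2 * P1 * Rabs (vv k' h'))).
  assert (HA : 0 < A) by pos.
  set (x0 := IZR (av k' h') / IZR k' + Rmin (- / (IZR k' * w)) (- / (IZR k' * w')) - 1).
  set (n := / (Rabs (IZR k') * w) + 1).
  assert (Hn : 0 <= n) by pos.
  assert (Hn2 : 1 + n <= 2 + / w).
  { unfold n. assert (/ (Rabs (IZR k') * w) <= / w); [|lra].
    apply Rinv_le_contravar; auto. nra. }
  apply Rle_trans with (A * lsum (zr (- L) L) (fun l' => indic (x0 <= IZR l' <= x0 + n) * / (1 + Rabs (IZR l' - ls k h l k' h')))).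
  - rewrite <- lsum_scal. apply lsum_le. intros l' _. unfold Tfar. fold A.
    rewrite <- !Rmult_assoc, (Rmult_comm A). rewrite !Rmult_assoc.
    apply Rmult_le_compat_r.
    + apply Rmult_le_pos; [lra|]. left; apply Rinv_0_lt_compat.
      pose proof (Rabs_pos (IZR l' - ls k h l k' h')). lra.
    + apply indic_le. intros G. exact (l_interval _ _ _ G).
  - eapply Rle_trans; [mull; [apply lsum_inv_spaced; auto]|].
    assert (ln (1 + n) <= ln (2 + / w)) by (apply ln_le; lra).
    apply Rle_trans with (A * (2 * Lam)); [apply Rmult_le_compat_l; unfold Lam; lra|].
    apply Rle_trans with (5 / (B ^ 2 * P1 * (3 / 4 * (Rabs (IZR k') * b1))) * (2 * Lam)).
    + mulr. unfold A. mull.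
      apply Rinv_le_contravar.
      * pos.
      * apply Rmult_le_compat_l; [|lra]. pos.
    + right. field. lra.
Qed.

(** At most nine integers [l'] lie within 4 of [ls]. *)
Lemma sum_close k h l (T : Z -> Z -> R) : (forall k' h', 0 <= T k' h') ->
  SG (fun k' h' l' => indic (Rabs (IZR l' - ls k h l k' h') <= 4) * T k' h')
  <= 9 * SH T.
Proof using All.
  intros HT.
  assert (E : 9 * SH T = SH (fun k' h' => 9 * T k' h')).
  { unfold SH. rewrite <- lsum_scal. apply lsum_ext; intros k' _.
    rewrite <- lsum_scal. apply lsum_ext; intros h' _. ring. }
  rewrite E. apply SG_le_SH. intros k' h' l0 _.
  apply Rle_trans with (lsum (zr (- L) L) (fun l' => T k' h' * indic (ls k h l k' h' - 4 <= IZR l' <= ls k h l k' h' - 4 + 8))).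
  - apply lsum_le. intros l' _. rewrite <- Rmult_assoc, (Rmult_comm (T k' h')). apply Rmult_le_compat_r; auto.
    pose proof (indic_bounds (good k' h' l')).
    apply Rle_trans with (1 * indic (Rabs (IZR l' - ls k h l k' h') <= 4)).
    + apply Rmult_le_compat_r; [apply indic_bounds|lra].
    + rewrite Rmult_1_l. apply indic_le. intros G. apply Rabs_le_between in G. lra.
  - rewrite lsum_scal, Rmult_comm. apply Rmult_le_compat_r; auto.
    eapply Rle_trans; [apply lsum_count; lra|lra].
Qed.

Let C2 := sqrt (1 + / s0).
Let QR := IZR Q * R0.

Lemma QR_ge : 32 <= QR.
Proof using All. unfold QR. nra. Qed.

(** If [kap] exceeds [4 |k| R0 / b1], then [ss_spread] gives [|ss| >= kap b1 / 2] for every [h'],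
    and a sum of [kap^(-1/2)] over [k'] remains. For the few smaller [kap] the values of [ss] are
    spaced by 1 as [h'] varies, so [|ss|^(-1/2)] is summed over [h'] instead. *)
Lemma sum_mid k h l : good k h l ->
  SH (Tmid k h) <= 6 / (B * K5) *
    (14 * (C1 * QR / sqrt b1 * sqrt (IZR Q)) + (1 + 8 * QR / b1) * (4 * C2 * sqrt (C1 * QR))).
Proof using All.
  intros Hg. pose proof (k_bounds _ _ _ Hg) as Hk. pose proof b1_pos as Hb1. pose proof K5_pos as HK5.
  pose proof C1_pos as HC1. pose proof QR_ge as HQR. pose proof Q_pos as HQ32. pose proof w'_small as Hw'.
  set (c := 6 / (B * K5)). assert (Hc : 0 < c) by pos.
  set (k1 := 4 * (Rabs (IZR k) * R0) / b1).
  assert (Hk1 : 0 <= k1).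
  { pos. }
  assert (Hk1' : k1 <= 4 * QR / b1).
  { unfold k1, QR, Rdiv. mulr.
    nra. }
  assert (Hsb : 0 < sqrt b1) by pos.
  assert (HC2 : 0 <= C2) by apply sqrt_pos.
  set (E1 := 2 * (C1 * QR / sqrt b1)). set (E2 := 4 * C2 * sqrt (C1 * QR)).
  assert (HE1 : 0 <= E1).
  { pos. }
  assert (HE2 : 0 <= E2).
  { pos. }
  apply Rle_trans with (lsum (zr (- Q) Q) (fun k' =>
     c * E1 * (indic (- IZR Q <= IZR k' <= - IZR Q + 2 * IZR Q) * / sqrt (1 + Rabs (IZR k' - IZR k)))
     + c * E2 * indic (IZR k - k1 <= IZR k' <= IZR k - k1 + 2 * k1))).
  - apply lsum_le. intros k' Hk'. apply In_zr in Hk'. rewrite (indic_true (- IZR Q <= _ <= _)), Rmult_1_l.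
    2:{ rewrite <- opp_IZR. replace (IZR (- Q) + 2 * IZR Q) with (IZR Q) by (rewrite opp_IZR; ring).
        split; apply IZR_le; lia. }
    assert (Hsq : 0 < / sqrt (1 + Rabs (IZR k' - IZR k))).
    { pose proof (Rabs_pos (IZR k' - IZR k)). pos. }
    assert (X1 : 0 <= c * E1 * / sqrt (1 + Rabs (IZR k' - IZR k))).
    { pos. }
    assert (X2 : 0 <= c * E2 * indic (IZR k - k1 <= IZR k' <= IZR k - k1 + 2 * k1)).
    { pos. }
    destruct (Z.eq_dec k' 0) as [->|Nk].
    { rewrite sum_h_zero. lra. }
    assert (HkQ : (1 <= Z.abs k' <= Q)%Z) by lia.
    assert (HkQ' : Rabs (IZR k') <= IZR Q) by (rewrite <- abs_IZR; apply IZR_le; lia).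
    destruct (Rle_dec (kap k k') k1) as [D|D].
    + rewrite indic_true, Rmult_1_r.
      2:{ unfold kap in D. apply Rabs_le_between in D. lra. }
      set (x0 := IZR k' * eta + Rmin (IZR k' * b1) (IZR k' * (b1 + R0)) - w').
      set (n := Rabs (IZR k') * R0 + w').
      assert (Hn : 0 <= n).
      { pos. }
      apply Rle_trans with (c * C2 * lsum (zr (- H) H) (fun h' => indic (x0 <= IZR h' <= x0 + n) *
          / sqrt (1 + Rabs (IZR h' - (IZR k' * eta - vv k h))))).
      * rewrite <- lsum_scal. apply lsum_le. intros h' _.
        set (y := IZR h' - (IZR k' * eta - vv k h)).
        assert (Es : ss k h k' h' = y) by (unfold y, ss, vv; ring).
        assert (0 < / sqrt (1 + Rabs y)) by (pose proof (Rabs_pos y); pos).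
        rewrite <- Rmult_assoc, (Rmult_comm (c * C2)), Rmult_assoc.
        apply Rle_trans with (indic (x0 <= IZR h' <= x0 + n) * Tmid k h k' h').
        { apply Rmult_le_compat_r; [apply Tmid_pos|]. apply indic_le. intros [l' Hl']. exact (h_interval _ _ _ Hl'). }
        apply Rmult_le_compat_l; [apply indic_bounds|].
        unfold Tmid. rewrite Es. unfold indic. destruct excluded_middle_informative as [G|G].
        -- rewrite Rmult_1_l. unfold s0 in G.
           assert (Hy : 0 < Rabs y) by lra.
           replace (6 / (B * sqrt (Rabs y) * K5)) with (c * / sqrt (Rabs y)).
           2:{ unfold c. assert (0 < sqrt (Rabs y)) by pos. field. lra. }
           (* [|y| >= s0] gives [1 / |y| <= (1 + 1 / s0) / (1 + |y|)], which leads to the shifted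
              square roots of [lsum_inv_sqrt_spaced]. *)
           rewrite (Rmult_assoc c C2). mull. unfold C2. rewrite <- !sqrt_inv, <- sqrt_mult_alt.
           2:{ pos. }
           apply sqrt_le_1_alt. unfold s0.
           apply (Rmult_le_reg_r (Rabs y * (1 + Rabs y) * rho)); [pos|].
           replace (/ Rabs y * (Rabs y * (1 + Rabs y) * rho)) with ((1 + Rabs y) * rho) by (field; lra).
           replace ((1 + / (rho / 8)) * / (1 + Rabs y) * (Rabs y * (1 + Rabs y) * rho)) with ((rho + 8) * Rabs y) by (field; lra).
           nra.
        -- rewrite Rmult_0_l. pos.
      * eapply Rle_trans; [apply Rmult_le_compat_l; [apply Rmult_le_pos; lra|apply lsum_inv_sqrt_spaced; auto]|].
        assert (sqrt (n + 1) <= sqrt (C1 * QR)).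
        { apply sqrt_le_1_alt. unfold n.
          assert (Rabs (IZR k') * R0 <= QR) by (unfold QR; apply Rmult_le_compat_r; lra).
          assert (3 * QR <= C1 * QR).
          { mulr. unfold C1. apply (Rmult_le_reg_r rho); [lra|].
            replace (3 / rho * rho) with 3 by (field; lra). lra. }
          lra. }
        assert (c * C2 * (4 * sqrt (n + 1)) <= c * C2 * (4 * sqrt (C1 * QR))).
        { apply Rmult_le_compat_l; [apply Rmult_le_pos; lra|lra]. }
        unfold E2. lra.
    + apply Rnot_le_lt in D.
      assert (Nkk : k <> k').
      { intros ->. unfold kap in D. rewrite Rminus_diag_eq, Rabs_R0 in D by auto. lra. }
      pose proof (kap_int k k' Nkk) as Hk2.
      apply Rle_trans with (C1 * (Rabs (IZR k') * R0) * (c * (2 / (sqrt b1 * sqrt (1 + kap k k'))))).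
      * apply sum_h_le; auto.
        { pos. }
        intros h' l' Hg'. unfold Tmid.
        pose proof (ss_spread _ _ _ _ _ _ Hg Hg') as Sp.
        assert (K : 4 * (Rabs (IZR k) * R0) < kap k k' * b1).
        { apply (Rmult_lt_compat_r b1) in D; auto. unfold k1 in D.
          replace (4 * (Rabs (IZR k) * R0) / b1 * b1) with (4 * (Rabs (IZR k) * R0)) in D by (field; lra). auto. }
        assert (b1 <= kap k k' * b1) by nra.
        assert (Ks : kap k k' * b1 / 2 <= Rabs (ss k h k' h')) by lra.
        assert (Hs : 0 < Rabs (ss k h k' h')) by lra.
        apply Rle_trans with (1 * (6 / (B * sqrt (Rabs (ss k h k' h')) * K5))).
        { mulr; [apply indic_bounds]. }
        rewrite Rmult_1_l.
        replace (6 / (B * sqrt (Rabs (ss k h k' h')) * K5)) with (c * / sqrt (Rabs (ss k h k' h'))).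
        2:{ unfold c. assert (0 < sqrt (Rabs (ss k h k' h'))) by pos. field. lra. }
        mull.
        rewrite <- sqrt_mult by lra.
        assert (Hp : 0 < sqrt (b1 * (1 + kap k k'))) by pos.
        replace (2 / sqrt (b1 * (1 + kap k k'))) with (/ (sqrt (b1 * (1 + kap k k')) / 2)) by (field; lra).
        apply Rinv_le_contravar; [lra|].
        replace (sqrt (b1 * (1 + kap k k')) / 2) with (sqrt (b1 * (1 + kap k k') / 4)).
        -- apply sqrt_le_1_alt. lra.
        -- rewrite sqrt_div_alt by lra. f_equal. replace 4 with (2 * 2) by ring. apply sqrt_square. lra.
      * apply Rle_trans with (c * E1 * / sqrt (1 + Rabs (IZR k' - IZR k))); [|lra].
        fold (kap k k'). assert (Hp : 0 < sqrt (1 + kap k k')) by pos.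
        apply Rle_trans with (C1 * QR * (c * (2 / (sqrt b1 * sqrt (1 + kap k k'))))).
        -- apply Rmult_le_compat_r; [apply Rmult_le_pos; [lra|left; pos]|].
           mull. unfold QR. nra.
        -- right. unfold E1. field. lra.
  - rewrite lsum_plus, !lsum_scal.
    assert (A1 : lsum (zr (- Q) Q) (fun k' => indic (- IZR Q <= IZR k' <= - IZR Q + 2 * IZR Q) *
       / sqrt (1 + Rabs (IZR k' - IZR k))) <= 7 * sqrt (IZR Q)).
    { eapply Rle_trans; [apply lsum_inv_sqrt_spaced; lra|].
      apply Rsqr_incr_0_var; [|pose proof (sqrt_pos (IZR Q)); lra].
      unfold Rsqr. assert (sqrt (2 * IZR Q + 1) * sqrt (2 * IZR Q + 1) = 2 * IZR Q + 1) by (apply sqrt_sqrt; lra).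
      assert (sqrt (IZR Q) * sqrt (IZR Q) = IZR Q) by (apply sqrt_sqrt; lra). lra. }
    assert (A2 : lsum (zr (- Q) Q) (fun k' => indic (IZR k - k1 <= IZR k' <= IZR k - k1 + 2 * k1)) <= 1 + 8 * QR / b1).
    { eapply Rle_trans; [apply lsum_count; lra|]. lra. }
    apply (Rmult_le_compat_l (c * E1)) in A1; [|apply Rmult_le_pos; lra].
    apply (Rmult_le_compat_l (c * E2)) in A2; [|apply Rmult_le_pos; lra].
    eapply Rle_trans; [apply Rplus_le_compat; [apply A1|apply A2]|].
    right. unfold E1, E2. ring.
Qed.

Let kb := 2 * QR / b1.
Let Vn := 7 * kb / (B ^ 2 * P1) + 6 * sqrt (43 * (R0 * P1 / b1 ^ 2)) / (B * K5).

(** Each [k'] has at most two [h'] with [|ss| < s0], and at most [3 kb] values of [k'] have [kap] in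
    range. In [4 kap P2 / |v|] the bounds [kap <= 2 |k| R0 / b1], [P2 <= 4 P1] and
    [|v| >= 3/4 |k| b1] produce the factor [128/3], rounded up to 43. *)
Lemma sum_near k h l : good k h l -> SH (Tnear k h) <= 6 * kb * Vn.
Proof using All.
  intros Hg. pose proof (k_bounds _ _ _ Hg) as Hk. pose proof b1_pos as Hb1.
    pose proof (v_bounds _ _ _ Hg) as Hv.
  set (k2 := 2 * (Rabs (IZR k) * R0) / b1).
  assert (Hk2' : k2 <= kb).
  { unfold k2, kb, QR, Rdiv. mulr.
    nra. }
  assert (Hkb : 0 < kb) by pos.
  assert (HVn : 0 <= Vn).
  { pos. }
  apply Rle_trans with (lsum (zr (- Q) Q) (fun k' => 2 * Vn * indic (1 <= kap k k' <= k2))).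
  - apply lsum_le. intros k' _.
    apply Rle_trans with (lsum (zr (- H) H) (fun h' => Vn * indic (1 <= kap k k' <= k2) *
       indic (IZR k' * eta - vv k h - s0 <= IZR h' <= IZR k' * eta - vv k h - s0 + 2 * s0))).
    + apply lsum_le. intros h' _.
      apply Rle_trans with (1 * Tnear k h k' h'); [apply Rmult_le_compat_r; [apply Tnear_pos|apply indic_bounds]|].
      rewrite Rmult_1_l. unfold Tnear. unfold indic at 1. destruct excluded_middle_informative as [[G1 G2]|G].
      * rewrite !indic_true, !Rmult_1_l, !Rmult_1_r by (auto;
          replace (ss k h k' h') with (IZR h' - (IZR k' * eta - vv k h)) in G1 by (unfold ss, vv; ring);
          apply Rabs_lt_between in G1; lra).
         apply Rplus_le_compat; unfold Rdiv; apply Rmult_le_compat_r; try (left; pos).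
        -- fold k2 in G2. lra.
        -- mull. apply sqrt_le_1_alt.
           assert (Hvp : 0 < Rabs (vv k h)) by nra.
           pose proof P2_le.
           apply (Rmult_le_reg_r (Rabs (vv k h))); auto.
           replace (4 * kap k k' * P2 * / Rabs (vv k h) * Rabs (vv k h)) with (4 * kap k k' * P2) by (field; lra).
           apply Rle_trans with (4 * (2 * (Rabs (IZR k) * R0) / b1) * (4 * P1)).
           ++ assert (0 < P2) by pos. nra.
           ++ apply Rle_trans with (43 * (R0 * P1 * / b1 ^ 2) * (3 / 4 * (Rabs (IZR k) * b1))).
              ** replace (43 * (R0 * P1 * / b1 ^ 2) * (3 / 4 * (Rabs (IZR k) * b1))) with (129 / 4 * (Rabs (IZR k) * R0 * P1 * / b1)) by (field; lra).
                 assert (0 < Rabs (IZR k) * R0 * P1 * / b1) by pos. lra.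
              ** mull; lra.
      * rewrite Rmult_0_l. pos.
    + rewrite lsum_scal.
      assert (Hs0 : 0 <= 2 * s0) by pos.
      assert (A : lsum (zr (- H) H) (fun h' => indic (IZR k' * eta - vv k h - s0 <= IZR h' <= IZR k' * eta - vv k h - s0 + 2 * s0)) <= 2).
      { eapply Rle_trans; [apply lsum_count; auto|unfold s0; lra]. }
      assert (0 <= Vn * indic (1 <= kap k k' <= k2)) by pos.
      nra.
  - rewrite lsum_scal.
    assert (A : lsum (zr (- Q) Q) (fun k' => indic (1 <= kap k k' <= k2)) <= 3 * kb).
    { destruct (Rle_dec 1 k2) as [D|D].
      - apply Rle_trans with (lsum (zr (- Q) Q) (fun k' => indic (IZR k - k2 <= IZR k' <= IZR k - k2 + 2 * k2))).
        + apply lsum_le. intros k' _. apply indic_le. intros [_ G].  apply Rabs_le_between in G. lra.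
        + eapply Rle_trans; [apply lsum_count; lra|lra].
      - rewrite (lsum_ext _ _ (fun _ => 0)); [rewrite lsum_const; lra|].
        intros k' _. apply indic_false. lra. }
    nra.
Qed.

Let Sfar := 3 * IZR Q * (C1 * R0 * (40 / 3 * Lam / (B ^ 2 * P1 * b1))).
Let Smid := 6 / (B * K5) *
    (14 * (C1 * QR / sqrt b1 * sqrt (IZR Q)) + (1 + 8 * QR / b1) * (4 * C2 * sqrt (C1 * QR))).

Lemma sum_one k h l : good k h l ->
  SG (fun k' h' l' => indic ((k, h, l) <> (k', h', l') /\ Rabs (vv k h) <= Rabs (vv k' h')) * J k h l k' h' l')
  <= Sfar + 9 * (Smid + 6 * kb * Vn).
Proof using All.
  intros Hg.
  apply Rle_trans with (SG (fun k' h' l' => Tfar k h l k' h' l' +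
     indic (Rabs (IZR l' - ls k h l k' h') <= 4) * (Tmid k h k' h' + Tnear k h k' h'))).
  - apply SG_le. intros k' h' l' Hg'. unfold indic at 1. destruct excluded_middle_informative as [[G1 G2]|G].
    + rewrite Rmult_1_l. apply J_le; auto.
    + rewrite Rmult_0_l. apply Rplus_le_le_0_compat; [apply Tfar_pos; auto|].
      apply Rmult_le_pos; [apply indic_bounds|]. apply Rplus_le_le_0_compat; [apply Tmid_pos|apply Tnear_pos].
  - rewrite SG_plus. apply Rplus_le_compat; [apply sum_far|].
    via (sum_close k h l (fun k' h' => Tmid k h k' h' + Tnear k h k' h')).
    { intros. apply Rplus_le_le_0_compat; [apply Tmid_pos|apply Tnear_pos]. }
    mull.
    assert (E : SH (fun k' h' => Tmid k h k' h' + Tnear k h k' h') = SH (Tmid k h) + SH (Tnear k h)).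
    { unfold SH. rewrite <- lsum_plus. apply lsum_ext; intros k' _.
      rewrite <- lsum_plus. apply lsum_ext; intros h' _. ring. }
    rewrite E. apply Rplus_le_compat; [apply (sum_mid k h l Hg)|apply (sum_near k h l Hg)].
Qed.

Lemma Rmult_le_self a x : 0 <= a -> x <= 1 -> a * x <= a.
Proof. nra. Qed.

Lemma SG_diag k h l c : 0 <= c -> SG (fun k' h' l' => indic ((k, h, l) = (k', h', l')) * c) <= c.
Proof.
  intros Hc.
  assert (One : forall N z0, lsum (zr (- N) N) (fun z => indic (IZR z0 <= IZR z <= IZR z0 + 0)) <= 1).
  { intros. eapply Rle_trans; [apply lsum_count; lra|lra]. }
  assert (Iz : forall z z0, z = z0 -> indic (IZR z0 <= IZR z <= IZR z0 + 0) = 1).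
  { intros z z0 ->. apply indic_true. lra. }
  set (i := fun z0 z => indic (IZR z0 <= IZR z <= IZR z0 + 0)).
  assert (Hi : forall z0 z, 0 <= i z0 z) by (intros; apply indic_bounds).
  apply Rle_trans with (SG (fun k' h' l' => i k k' * (i h h' * (i l l' * c)))).
  - apply SG_le. intros k' h' l' _. unfold indic. destruct excluded_middle_informative as [E|E].
    + inversion E; subst. unfold i. rewrite !Iz by auto. lra.
    + rewrite Rmult_0_l. pos.
  - apply Rle_trans with (lsum (zr (- Q) Q) (fun k' => c * i k k')).
    + apply lsum_le. intros k' _.
      apply Rle_trans with (lsum (zr (- H) H) (fun h' => (c * i k k') * i h h')).
      * apply lsum_le. intros h' _.
        apply Rle_trans with (lsum (zr (- L) L) (fun l' => (c * i k k' * i h h') * i l l')).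
        -- apply lsum_le. intros l' _. pose proof (indic_bounds (good k' h' l')).
           replace (c * i k k' * i h h' * i l l') with (1 * (i k k' * (i h h' * (i l l' * c)))) by ring.
           apply Rmult_le_compat_r; [repeat apply Rmult_le_pos; auto|lra].
        -- rewrite lsum_scal. pose proof (One L l).
           assert (0 <= c * i k k' * i h h') by pos.
           apply Rmult_le_self; auto.
      * rewrite lsum_scal. pose proof (One H h).
        assert (0 <= c * i k k') by pos.
        apply Rmult_le_self; auto.
    + rewrite lsum_scal. pose proof (One Q k).
      apply Rmult_le_self; auto.
Qed.

(** [sum_one] covers the pairs with [|v| <= |v'|]; the symmetry of [J] turns the remaining ones into
    the same sum with the two pieces exchanged. Each piece adds [1 / P1^4] on the diagonal. *)
Lemma pair_sum_le :
  SG (fun k h l => SG (fun k' h' l' => J k h l k' h' l'))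
  <= 9 * C1 * (IZR Q * R0 / w) * (/ P1 ^ 4 + 2 * (Sfar + 9 * (Smid + 6 * kb * Vn))).
Proof using All.
  set (S1 := Sfar + 9 * (Smid + 6 * kb * Vn)).
  set (n := 9 * C1 * (IZR Q * R0 / w)).
  set (ii := fun k h (l : Z) k' h' (l' : Z) => indic ((k, h, l) <> (k', h', l') /\ Rabs (vv k h) <= Rabs (vv k' h'))).
   pose proof Q_pos as HQ0. pose proof Lam_ge1 as HL1.
  assert (HP4 : 0 < / P1 ^ 4) by pos.
  assert (HS1 : 0 <= S1).
  { pos. }
  assert (Hone : SG (fun k h l => SG (fun k' h' l' => ii k h l k' h' l' * J k h l k' h' l')) <= n * S1).
  { eapply Rle_trans; [apply (SG_le _ (fun _ _ _ => S1))|apply SG_const_le; auto].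
    intros k h l Hg. apply sum_one; auto. }
  assert (Htwo : SG (fun k h l => SG (fun k' h' l' => ii k' h' l' k h l * J k h l k' h' l')) <= n * S1).
  { rewrite SG_swap. below Hone. apply SG_le. intros k h l _. apply SG_le. intros k' h' l' _.
    rewrite (HJsym k' h' l' k h l). lra. }
  assert (Hd : SG (fun k h l => SG (fun k' h' l' => indic ((k, h, l) = (k', h', l')) * / P1 ^ 4)) <= n * / P1 ^ 4).
  { eapply Rle_trans; [apply (SG_le _ (fun _ _ _ => / P1 ^ 4))|apply SG_const_le; lra].
    intros k h l Hg. apply SG_diag. lra. }
  apply Rle_trans with (SG (fun k h l => SG (fun k' h' l' => indic ((k, h, l) = (k', h', l')) * / P1 ^ 4) +
     (SG (fun k' h' l' => ii k h l k' h' l' * J k h l k' h' l') +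
      SG (fun k' h' l' => ii k' h' l' k h l * J k h l k' h' l')))).
  - apply SG_le. intros k h l Hg. rewrite <- !SG_plus. apply SG_le. intros k' h' l' Hg'.
    pose proof (HJ0 k h l k' h' l') as HJp.
    destruct (classic ((k, h, l) = (k', h', l'))) as [E|E].
    + rewrite (indic_true _ E). inversion E; subst.
      pose proof (HJa _ _ _ Hg'). unfold ii.
      pose proof (indic_bounds ((k', h', l') <> (k', h', l') /\ Rabs (vv k' h') <= Rabs (vv k' h'))). nra.
    + rewrite (indic_false _ E).
      destruct (Rle_dec (Rabs (vv k h)) (Rabs (vv k' h'))) as [D|D].
      * assert (Ei : ii k h l k' h' l' = 1) by (apply indic_true; auto).
        assert (0 <= ii k' h' l' k h l) by apply indic_bounds. nra.
      * assert (Ei : ii k' h' l' k h l = 1).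
        { apply indic_true. split; [intros E'; apply E; rewrite E'; auto|lra]. } rewrite Ei.
        assert (0 <= ii k h l k' h' l') by apply indic_bounds. nra.
  - rewrite !SG_plus. lra.
Qed.

End Count.

(** * The size of the pair sum *)

Lemma Rmult_le_1 a b : 0 <= a <= 1 -> 0 <= b <= 1 -> 0 <= a * b <= 1.
Proof. nra. Qed.

Definition pair_const (rho : R) : R :=
  let c1 := 3 / rho in let c2 := sqrt (1 + / (rho / 8)) in
  18 * c1 * (1 + 80 * c1 / rho + 18 * (84 * c1 + 24 * c2 * sqrt c1 * 9)
    + 108 * (28 + 12 * sqrt 43)).

Lemma pair_const_pos rho : 0 < rho -> 0 < pair_const rho.
Proof.
  intros H. unfold pair_const. cbv zeta.
  assert (0 < 3 / rho) by pos. assert (0 <= sqrt (1 + / (rho / 8))) by apply sqrt_pos.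
  assert (0 <= sqrt 43) by apply sqrt_pos. assert (0 <= sqrt (3 / rho)) by apply sqrt_pos.
  assert (0 < 80 * (3 / rho) / rho) by pos.
  apply Rmult_lt_0_compat; [lra|].
  nra.
Qed.

(** With the square roots of [R0], [b1], [q] and [w'] as variables, every term is the diagonal size
    [R0 / (q^2 b1^4)] times a constant, possibly [Lam], and a monomial in bounded quantities. The
    two hypotheses that bound powers of [q] by [B] and [B^2] say [u2 <= 1] and [u3 <= 1]; [o <= 1]
    comes from [w' q <= 1]. *)
Lemma pair_sum_bound (b1 R0 B w w' rho q Lam : R) :
  0 < rho <= 1 -> rho <= R0 <= b1 -> 4 * R0 <= b1 ^ 2 -> 32 <= q * rho ->
  0 < w -> w <= w' <= 2 * w -> w' * q <= 1 -> 0 < B -> 1 <= Lam ->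
  q ^ 3 * R0 * b1 <= B -> q ^ 4 * R0 * b1 ^ 3 <= B ^ 2 ->
  9 * (3 / rho) * (q * R0 / w) * (/ (b1 / w') ^ 4 + 2 * (3 * q * ((3 / rho) * R0 * (40 / 3 * Lam / (B ^ 2 * (b1 / w') * b1))) + 9 * (6 / (B * ((b1 / w') ^ 2 * sqrt (b1 / w'))) *
    (14 * ((3 / rho) * (q * R0) / sqrt b1 * sqrt q) + (1 + 8 * (q * R0) / b1) * (4 * sqrt (1 + / (rho / 8)) * sqrt ((3 / rho) * (q * R0)))) + 6 * (2 * (q * R0) / b1) *
     (7 * (2 * (q * R0) / b1) / (B ^ 2 * (b1 / w')) + 6 * sqrt (43 * (R0 * (b1 / w') / b1 ^ 2)) / (B * ((b1 / w') ^ 2 * sqrt (b1 / w'))) ))))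
  <= pair_const rho * (Lam * (R0 / (q ^ 2 * b1 ^ 4))).
Proof.
  intros Hrho HR0 HR1 HQ Hw Hww HwQ HB HL H2 H3.
  assert (Hq : 32 <= q) by nra.
  assert (Hb1 : 0 < b1) by lra. assert (Hw' : 0 < w') by lra. assert (HRp : 0 < R0) by lra.
  unfold pair_const. cbv zeta.
  set (c1 := 3 / rho). set (c2 := sqrt (1 + / (rho / 8))).
  assert (Hc1 : 0 < c1) by pos. assert (Hc2 : 0 <= c2) by apply sqrt_pos.
  set (e := sqrt 43). assert (He : 0 <= e) by apply sqrt_pos.
  set (d := sqrt c1). assert (Hd : 0 < d) by pos.
  assert (E0 : sqrt (b1 / w') = sqrt b1 / sqrt w') by (apply sqrt_div_alt; auto).
  assert (E1 : sqrt (c1 * (q * R0)) = d * (sqrt q * sqrt R0)) by (unfold d; rewrite <- !sqrt_mult; try lra; nra).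
  assert (E2 : sqrt (43 * (R0 * (b1 / w') / b1 ^ 2)) = e * (sqrt R0 * (sqrt b1 / sqrt w') / b1)).
  { assert (0 < b1 / w') by pos.
    unfold e. rewrite sqrt_mult_alt by lra. f_equal. rewrite sqrt_div_alt by pos.
    rewrite sqrt_mult_alt, E0 by lra. f_equal. apply sqrt_pow2. lra. }
  rewrite E0, E1, E2.
  set (r := sqrt R0). set (sb := sqrt b1). set (sq := sqrt q). set (om := sqrt w').
  assert (Hr : 0 < r) by pos. assert (Hsb : 0 < sb) by pos.
  assert (Hsq : 0 < sq) by pos. assert (Hom : 0 < om) by pos.
  assert (Er : R0 = r * r) by (symmetry; apply sqrt_sqrt; lra).
  assert (Eb : b1 = sb * sb) by (symmetry; apply sqrt_sqrt; lra).
  assert (Eq : q = sq * sq) by (symmetry; apply sqrt_sqrt; lra).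
  assert (Ew : w' = om * om) by (symmetry; apply sqrt_sqrt; lra).
  assert (HO : sq * om <= 1).
  { nra. }
  assert (Hrb : r <= sb) by nra.
  assert (Hrb2 : r <= sb * sb) by nra.
  assert (Hqb : 1 <= sq * sq * (sb * sb)) by nra.
  assert (Hrb1 : rho <= sb * sb) by lra.
  assert (h2 : sq ^ 6 * r ^ 2 * sb ^ 2 / B <= 1).
  { apply (Rmult_le_reg_r B); auto. unfold Rdiv. rewrite Rmult_assoc, Rinv_l, Rmult_1_r, Rmult_1_l by lra.
    below H2. right. rewrite Eq, Er, Eb. ring. }
  assert (h3 : sq ^ 4 * r * sb ^ 3 / B <= 1).
  { apply (Rmult_le_reg_r B); auto. unfold Rdiv. rewrite Rmult_assoc, Rinv_l, Rmult_1_r, Rmult_1_l by lra.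
    apply Rsqr_incr_0_var; [|lra]. unfold Rsqr. rewrite Eq, Er, Eb in H3.
    lra. }
  set (u2 := sq ^ 6 * r ^ 2 * sb ^ 2 / B) in *. set (u3 := sq ^ 4 * r * sb ^ 3 / B) in *.
  assert (0 < u2) by pos. assert (0 < u3) by pos.
  set (o := sq * om) in *. assert (Ho : 0 < o) by pos.
  set (z := r / sb). assert (Hz : 0 < z <= 1).
  { split; [unfold z; pos|]. apply (Rmult_le_reg_r sb); auto. unfold z. field_simplify; lra. }
  set (z2 := r / (sb * sb)). assert (Hz2 : 0 < z2 <= 1).
  { assert (0 < sb * sb) by pos. split; [unfold z2; pos|]. apply (Rmult_le_reg_r (sb * sb)); auto.
    unfold z2. field_simplify; lra. }
  set (z3 := / (sq * sq * (sb * sb))). assert (Hz3 : 0 < z3 <= 1).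
  { split; [unfold z3; apply Rinv_0_lt_compat; lra|]. unfold z3. rewrite <- Rinv_1. apply Rinv_le_contravar; lra. }
  set (z4 := / (sb * sb)). assert (Hz4 : 0 < z4 <= / rho).
  { split; [unfold z4; pos|]. unfold z4. apply Rinv_le_contravar; lra. }
  set (X := R0 / (q ^ 2 * b1 ^ 4)). assert (HX : 0 < X) by pos.
  set (N := 18 * c1 * (q * R0 / w')).
  set (S := / (b1 / w') ^ 4 + 2 * (3 * q * (c1 * R0 * (40 / 3 * Lam / (B ^ 2 * (b1 / w') * b1))) + 9 * (6 / (B * ((b1 / w') ^ 2 * (sb / om))) *
    (14 * (c1 * (q * R0) / sb * sq) + (1 + 8 * (q * R0) / b1) * (4 * c2 * (d * (sq * r)))) + 6 * (2 * (q * R0) / b1) *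
     (7 * (2 * (q * R0) / b1) / (B ^ 2 * (b1 / w')) + 6 * (e * (r * (sb / om) / b1)) / (B * ((b1 / w') ^ 2 * (sb / om))))))).
  (* In this order: the diagonal, the far pairs, the middle pairs and the near pairs. *)
  assert (ES : N * S = 18 * c1 * X * (o ^ 6 + 80 * c1 * Lam * (u3 ^ 2 * z4)
     + 18 * (84 * c1 * (o ^ 3 * u2) + 24 * c2 * d * (o ^ 3 * u3) + 24 * c2 * d * 8 * (o ^ 3 * u2 * z))
     + 108 * (28 * (u2 ^ 2 * z3) + 12 * e * (o ^ 2 * u2 * z2)))).
  { unfold N, S, X, u2, u3, z, z2, z3, z4, o. rewrite Eq, Er, Eb, Ew. field. lra. }
  assert (HS : 0 <= S).
  { pos. }
  apply Rle_trans with (N * S).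
  { apply Rmult_le_compat_r; auto. unfold N.
    replace (18 * c1 * (q * R0 / w')) with (9 * c1 * (q * R0 * (2 / w'))) by lra.
    assert (K : / w <= 2 / w').
    { apply (Rmult_le_reg_r (w * w')); [pos|]. replace (/ w * (w * w')) with w' by (field; lra).
      replace (2 / w' * (w * w')) with (2 * w) by (field; lra). lra. }
    mull. unfold Rdiv at 1.
    mull; [exact K]. }
  rewrite ES.
  assert (O : forall n, 0 <= o ^ n <= 1).
  { intros n. split; [apply pow_le; lra|]. rewrite <- (pow1 n). apply pow_incr; lra. }
  assert (U2 : 0 <= u2 <= 1) by lra. assert (U3 : 0 <= u3 <= 1) by lra.
  assert (Q1 : 0 <= o ^ 3 * u2 <= 1) by (apply Rmult_le_1; auto).
  assert (Q2 : 0 <= o ^ 3 * u3 <= 1) by (apply Rmult_le_1; auto).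
  assert (Q3 : 0 <= o ^ 3 * u2 * z <= 1) by (apply Rmult_le_1; auto; lra).
  assert (Q4 : 0 <= u2 ^ 2 * z3 <= 1).
  { apply Rmult_le_1; [|lra]. simpl. rewrite Rmult_1_r. apply Rmult_le_1; auto. }
  assert (Q5 : 0 <= o ^ 2 * u2 * z2 <= 1) by (apply Rmult_le_1; [apply Rmult_le_1; auto|lra]).
  assert (Q6 : u3 ^ 2 * z4 <= / rho).
  { assert (0 <= u3 ^ 2 <= 1) by (simpl; rewrite Rmult_1_r; apply Rmult_le_1; auto).
    apply Rle_trans with (1 * z4); [apply Rmult_le_compat_r; lra|lra]. }
  fold c1 c2 d.
  replace (18 * c1 * (1 + 80 * c1 / rho + 18 * (84 * c1 + 24 * c2 * d * 9) + 108 * (28 + 12 * e)) * (Lam * X))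
    with (18 * c1 * X * (Lam * (1 + 80 * c1 * / rho + 18 * (84 * c1 + 24 * c2 * d * 9) + 108 * (28 + 12 * e))))
    by lra.
  mull.
  assert (P1 : 80 * c1 * Lam * (u3 ^ 2 * z4) <= 80 * c1 * Lam * / rho) by (mull; auto).
  assert (P2 : 84 * c1 * (o ^ 3 * u2) <= 84 * c1) by (apply Rmult_le_self; lra).
  assert (Z : 0 <= 24 * c2 * d) by pos.
  assert (P3 : 24 * c2 * d * (o ^ 3 * u3) <= 24 * c2 * d) by (apply Rmult_le_self; lra).
  assert (P4 : 24 * c2 * d * 8 * (o ^ 3 * u2 * z) <= 24 * c2 * d * 8) by (apply Rmult_le_self; lra).
  assert (P5 : 12 * e * (o ^ 2 * u2 * z2) <= 12 * e) by (apply Rmult_le_self; lra).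
  assert (P6 : 0 <= c1 * / rho) by pos.
  pose proof (O 6%nat).
  set (Y := 1 + 18 * (84 * c1 + 24 * c2 * d * 9) + 108 * (28 + 12 * e)).
  assert (HY : 0 <= Y) by pos.
  assert (Y <= Lam * Y) by (rewrite <- (Rmult_1_l Y) at 1; mulr; auto).
  apply Rle_trans with (Y + 80 * c1 * Lam * / rho); [unfold Y; lra|].
  replace (Lam * (1 + 80 * c1 * / rho + 18 * (84 * c1 + 24 * c2 * d * 9) + 108 * (28 + 12 * e)))
    with (Lam * Y + 80 * c1 * Lam * / rho) by (unfold Y; ring). lra.
Qed.

(** * Sums of integrals over intervals *)

Definition convex (E : R -> Prop) : Prop := forall x y z, E x -> E z -> x <= y <= z -> E y.

(** The ends are the supremum of [E] and, by reflection, its infimum; for empty [E] both are [a].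
    They may or may not belong to [E], hence an open and a closed inclusion. *)
Lemma convex_endpoints E a b : a <= b -> convex E -> (forall x, E x -> a <= x <= b) ->
  exists p : R * R, a <= fst p /\ fst p <= snd p /\ snd p <= b /\
    (forall x, fst p < x < snd p -> E x) /\ (forall x, E x -> fst p <= x <= snd p).
Proof.
  intros Hab HE Hb.
  destruct (classic (exists x, E x)) as [[x0 Hx0]|N].
  - destruct (completeness E) as [u [Hu1 Hu2]].
    { exists b. intros x Hx. apply Hb; auto. }
    { exists x0; auto. }
    destruct (completeness (fun x => E (- x))) as [l [Hl1 Hl2]].
    { exists (- a). intros x Hx. pose proof (Hb _ Hx). lra. }
    { exists (- x0). rewrite Ropp_involutive; auto. }
    assert (L : forall x, E x -> - l <= x).
    { intros x Hx. assert (- x <= l) by (apply Hl1; rewrite Ropp_involutive; auto). lra. }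
    exists (- l, u). simpl. repeat split.
    + assert (l <= - a); [|lra]. apply Hl2. intros x Hx. pose proof (Hb _ Hx). lra.
    + pose proof (L _ Hx0). pose proof (Hu1 _ Hx0). lra.
    + apply Hu2. intros x Hx. apply Hb; auto.
    + intros x [H1 H2].
      assert (exists x1, E x1 /\ x1 <= x) as [x1 [Hx1 Hx1']].
      { apply NNPP. intros N. apply (Rlt_not_le _ _ H1). assert (l <= - x); [|lra]. apply Hl2. intros z Hz.
        destruct (Rle_dec z (- x)); auto. exfalso. apply N. exists (- z). split; auto. lra. }
      assert (exists x2, E x2 /\ x <= x2) as [x2 [Hx2 Hx2']].
      { apply NNPP. intros N. apply (Rlt_not_le _ _ H2). apply Hu2. intros z Hz.
        destruct (Rle_dec z x); auto. exfalso. apply N. exists z. split; auto. lra. }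
      apply (HE x1 x x2); auto.
    + auto.
    + auto.
  - exists (a, a). simpl. repeat split; try lra; intros; exfalso; [lra|eauto..].
Qed.

Lemma is_RInt_const_R a b (c : R) : is_RInt (fun _ => c) a b ((b - a) * c).
Proof. exact (is_RInt_const a b c). Qed.

Lemma is_RInt_zero a b : is_RInt (fun _ => 0) a b 0.
Proof. pose proof (is_RInt_const_R a b 0) as K. rewrite Rmult_0_r in K. auto. Qed.

Lemma is_RInt_scal_R (f : R -> R) a b c I : is_RInt f a b I -> is_RInt (fun x => c * f x) a b (c * I).
Proof. exact (is_RInt_scal f a b c I). Qed.

Lemma is_RInt_indic (E : R -> Prop) (g : R -> R) a b p q I :
  a <= p -> p <= q -> q <= b -> (forall x, p < x < q -> E x) -> (forall x, E x -> p <= x <= q) ->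
  is_RInt g p q I -> is_RInt (fun x => indic (E x) * g x) a b I.
Proof.
  intros H1 H2 H3 HE1 HE2 Hg.
  replace I with (plus (plus zero I) zero) by (rewrite plus_zero_l, plus_zero_r; auto).
  assert (Z : forall u v, u <= v -> (forall x, u < x < v -> ~ E x) ->
     is_RInt (fun x => indic (E x) * g x) u v zero).
  { intros u v Huv N. apply (is_RInt_ext (fun _ => 0)).
    - minmax. intros x Hx. rewrite indic_false; [rring|auto].
    - apply is_RInt_zero. }
  apply is_RInt_Chasles with q; [apply is_RInt_Chasles with p|].
  - apply Z; auto. intros x Hx Ex. pose proof (HE2 _ Ex). lra.
  - apply (is_RInt_ext g); auto. minmax.
    intros x Hx. rewrite indic_true; [rring|auto].
  - apply Z; auto. intros x Hx Ex. pose proof (HE2 _ Ex). lra.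
Qed.

Lemma is_RInt_lsum {A} (T : list A) (f : A -> R -> R) (l : A -> R) a b :
  (forall t, In t T -> is_RInt (f t) a b (l t)) ->
  is_RInt (fun x => lsum T (fun t => f t x)) a b (lsum T l).
Proof.
  induction T as [|t T IH]; intros H.
  - apply is_RInt_zero.
  - simpl. apply (is_RInt_plus (f t) (fun x => lsum T (fun t => f t x))); [apply H|apply IH]; simpl; auto.
    intros; apply H; simpl; auto.
Qed.

Section L2.
Context {A : Type}.
Variables (T : list A) (lo hi : A -> R) (fc fs : A -> R -> R) (Psi : R -> R) (c G0 omega : R).
Hypothesis Hin : forall t, In t T -> 0 <= lo t /\ lo t <= hi t /\ hi t <= 1.
Hypothesis Hfc : forall t x, In t T -> lo t <= x <= hi t -> continuous (fc t) x.
Hypothesis Hfs : forall t x, In t T -> lo t <= x <= hi t -> continuous (fs t) x.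
Hypothesis HPsi : forall x, continuous Psi x.
Hypothesis HPc : forall x, Rabs (Psi x) <= c.
Hypothesis Hc : 0 < c.
Hypothesis HG0 : 0 < G0.

(** For disjoint intervals the larger lower end exceeds the smaller upper end, and the integral
    between them would not be 0; the test replaces it by 0. *)
Definition overlap (t t' : A) (g : R -> R) : R :=
  if Rle_dec (Rmax (lo t) (lo t')) (Rmin (hi t) (hi t'))
  then RInt g (Rmax (lo t) (lo t')) (Rmin (hi t) (hi t')) else 0.

Hypothesis HG : lsum T (fun t => lsum T (fun t' =>
  overlap t t' (fun x => fc t x * fc t' x + fs t x * fs t' x))) <= G0.

Let inside (t : A) (x : R) : R := indic (lo t <= x <= hi t).

Lemma is_RInt_inside t g : In t T -> (forall x, lo t <= x <= hi t -> continuous g x) ->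
  is_RInt (fun x => inside t x * g x) 0 1 (RInt g (lo t) (hi t)).
Proof using All.
  intros Ht Hg. destruct (Hin t Ht) as [H1 [H2 H3]].
  apply (is_RInt_indic (fun x => lo t <= x <= hi t) g 0 1 (lo t) (hi t)); auto.
  - intros; lra.
  - apply (RInt_correct g). apply (ex_RInt_continuous g). minmax. auto.
Qed.

Lemma is_RInt_overlap t t' g : In t T -> In t' T ->
  (forall x, lo t <= x <= hi t -> lo t' <= x <= hi t' -> continuous g x) ->
  is_RInt (fun x => inside t x * inside t' x * g x) 0 1 (overlap t t' g).
Proof using All.
  intros Ht Ht' Hg. destruct (Hin t Ht) as [H1 [H2 H3]]. destruct (Hin t' Ht') as [H1' [H2' H3']].
  pose proof (Rmax_l (lo t) (lo t')). pose proof (Rmax_r (lo t) (lo t')).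
  pose proof (Rmin_l (hi t) (hi t')). pose proof (Rmin_r (hi t) (hi t')).
  assert (HE : forall x, inside t x * inside t' x = indic (lo t <= x <= hi t /\ lo t' <= x <= hi t')).
  { intros x. unfold inside, indic. repeat destruct excluded_middle_informative; try ring; tauto. }
  apply (is_RInt_ext (fun x => indic (lo t <= x <= hi t /\ lo t' <= x <= hi t') * g x)).
  { intros x _. rewrite HE. lra. }
  unfold overlap. destruct Rle_dec as [D|D].
  - apply (is_RInt_indic _ g 0 1 (Rmax (lo t) (lo t')) (Rmin (hi t) (hi t'))); auto; try lra.
    + intros; lra.
    + intros x [E1 E2]. split; [apply Rmax_lub|apply Rmin_glb]; lra.
    + apply (RInt_correct g). apply (ex_RInt_continuous g). rewrite (Rmin_left _ _ D), (Rmax_right _ _ D).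
      intros z Hz. apply Hg; lra.
  - apply (is_RInt_indic _ g 0 1 0 0); try lra; [intros; lra| |].
    + intros x [E1 E2]. exfalso. apply D. apply Rle_trans with x; [apply Rmax_lub|apply Rmin_glb]; lra.
    + exact (is_RInt_point g 0).
Qed.

(** Cauchy-Schwarz in the form [c |u| <= lam c^2 / 2 + u^2 / (2 lam)], where [lam = sqrt G0 / c]
    balances the two integrals. Cosine and sine parts are kept apart so that only differences of
    phases occur in the pair sum; [omega] disappears since [(cos omega a - sin omega b)^2 <= a^2 +
    b^2]. *)
Lemma L2_bound :
  Rabs (lsum T (fun t => RInt (fun x => Psi x * (cos omega * fc t x - sin omega * fs t x)) (lo t) (hi t)))
  <= c * sqrt G0.
Proof using All.
  set (Fc := fun x => lsum T (fun t => inside t x * fc t x)).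
  set (Fs := fun x => lsum T (fun t => inside t x * fs t x)).
  set (lam := sqrt G0 / c).
  assert (Hs : 0 < sqrt G0) by pos. assert (Hlam : 0 < lam) by pos.
  assert (I1 : is_RInt (fun x => Psi x * (cos omega * Fc x - sin omega * Fs x)) 0 1
     (lsum T (fun t => RInt (fun x => Psi x * (cos omega * fc t x - sin omega * fs t x)) (lo t) (hi t)))).
  { apply (is_RInt_ext (fun x => lsum T (fun t => inside t x * (Psi x * (cos omega * fc t x - sin omega * fs t x))))).
    - intros x _. unfold Fc, Fs.
      replace (Psi x * (cos omega * lsum T (fun t => inside t x * fc t x) - sin omega * lsum T (fun t => inside t x * fs t x)))
        with ((Psi x * cos omega) * lsum T (fun t => inside t x * fc t x) + (- Psi x * sin omega) * lsum T (fun t => inside t x * fs t x)) by ring.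
      rewrite <- !lsum_scal, <- lsum_plus. apply lsum_ext. intros; ring.
    - apply is_RInt_lsum. intros t Ht.
      apply (is_RInt_inside t (fun x => Psi x * (cos omega * fc t x - sin omega * fs t x))); auto.
      intros x Hx. apply (continuous_mult Psi (fun x => cos omega * fc t x - sin omega * fs t x)); auto.
      apply (continuous_minus (fun x => cos omega * fc t x) (fun x => sin omega * fs t x)).
      + apply (continuous_mult (fun _ => cos omega) (fc t)); auto. apply continuous_const.
      + apply (continuous_mult (fun _ => sin omega) (fs t)); auto. apply continuous_const. }
  set (G := lsum T (fun t => lsum T (fun t' => overlap t t' (fun x => fc t x * fc t' x + fs t x * fs t' x)))) in *.
  assert (I2 : is_RInt (fun x => Fc x ^ 2 + Fs x ^ 2) 0 1 G).
  { apply (is_RInt_ext (fun x => lsum T (fun t => lsum T (fun t' => inside t x * inside t' x * (fc t x * fc t' x + fs t x * fs t' x))))).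
    - intros x _. unfold Fc, Fs.
      replace (lsum T (fun t => inside t x * fc t x) ^ 2 + lsum T (fun t => inside t x * fs t x) ^ 2)
        with (lsum T (fun t => inside t x * fc t x) * lsum T (fun t => inside t x * fc t x)
         + lsum T (fun t => inside t x * fs t x) * lsum T (fun t => inside t x * fs t x)) by ring.
      rewrite <- !lsum_scal, <- lsum_plus. apply lsum_ext. intros t' _.
      rewrite (Rmult_comm _ (inside t' x * fc t' x)), (Rmult_comm _ (inside t' x * fs t' x)).
      rewrite <- !lsum_scal, <- lsum_plus. apply lsum_ext. intros; ring.
    - apply is_RInt_lsum. intros t Ht. apply is_RInt_lsum. intros t' Ht'.
      apply (is_RInt_overlap t t' (fun x => fc t x * fc t' x + fs t x * fs t' x)); auto.
      intros x Hx Hx'. apply (continuous_plus (fun x => fc t x * fc t' x) (fun x => fs t x * fs t' x)).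
      + apply (continuous_mult (fc t) (fc t')); auto.
      + apply (continuous_mult (fs t) (fs t')); auto. }
  assert (I3 : is_RInt (fun x => lam * c ^ 2 / 2 + (Fc x ^ 2 + Fs x ^ 2) / (2 * lam)) 0 1 (lam * c ^ 2 / 2 + G / (2 * lam))).
  { apply (is_RInt_plus (fun _ => lam * c ^ 2 / 2) (fun x => (Fc x ^ 2 + Fs x ^ 2) / (2 * lam))).
    - pose proof (is_RInt_const_R 0 1 (lam * c ^ 2 / 2)) as K.
      replace ((1 - 0) * (lam * c ^ 2 / 2)) with (lam * c ^ 2 / 2) in K by ring. auto.
    - apply (is_RInt_ext (fun x => / (2 * lam) * (Fc x ^ 2 + Fs x ^ 2))).
      + intros x _. lra.
      + unfold Rdiv. replace (G * / (2 * lam)) with (/ (2 * lam) * G) by ring. apply is_RInt_scal_R. auto. }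
  assert (P : forall x, 0 <= x <= 1 -> norm (Psi x * (cos omega * Fc x - sin omega * Fs x))
     <= lam * c ^ 2 / 2 + (Fc x ^ 2 + Fs x ^ 2) / (2 * lam)).
  { intros x _. unfold norm; simpl. unfold abs; simpl. rewrite Rabs_mult.
    set (u := cos omega * Fc x - sin omega * Fs x).
    assert (Hu : Rabs u ^ 2 <= Fc x ^ 2 + Fs x ^ 2).
    { replace (Rabs u ^ 2) with (u ^ 2) by (rewrite RPow_abs, Rabs_pos_eq; auto using pow2_ge_0).
      pose proof (sin2_cos2 omega) as SC. unfold Rsqr in SC. unfold u.
      pose proof (pow2_ge_0 (sin omega * Fc x + cos omega * Fs x)).
      nra. }
    apply Rle_trans with (c * Rabs u); [apply Rmult_le_compat_r; [apply Rabs_pos|auto]|].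
    apply Rle_trans with (lam * c ^ 2 / 2 + Rabs u ^ 2 / (2 * lam)).
    - apply (Rmult_le_reg_r (2 * lam)); [lra|].
      replace ((lam * c ^ 2 / 2 + Rabs u ^ 2 / (2 * lam)) * (2 * lam)) with ((lam * c) ^ 2 + Rabs u ^ 2) by (field; lra).
      pose proof (pow2_ge_0 (lam * c - Rabs u)). lra.
    - apply Rplus_le_compat_l. unfold Rdiv. apply Rmult_le_compat_r; auto. pos. }
  pose proof (norm_RInt_le _ _ 0 1 _ _ Rle_0_1 P I1 I3) as Hn.
  unfold norm in Hn; simpl in Hn. unfold abs in Hn; simpl in Hn.
  via Hn.
  apply Rle_trans with (lam * c ^ 2 / 2 + G0 / (2 * lam)).
  - apply Rplus_le_compat_l. unfold Rdiv. apply Rmult_le_compat_r; auto. pos.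
  - right. assert (E : G0 = sqrt G0 * sqrt G0) by (symmetry; apply sqrt_sqrt; lra).
    rewrite E at 1. unfold lam. field. lra.
Qed.
End L2.

(** * Rational approximation and the pieces of the horocycle *)

(** Coprimality is placed inside the existential so that a choice function defined for all [k] and
    [h] results; its value is [(0, 0)] where no matrix exists. *)
Lemma bezout_entries_exist (k h : Z) :
  exists p : Z * Z, rel_prime k h -> (- fst p * h - snd p * k = 1)%Z.
Proof.
  destruct (classic (rel_prime k h)) as [H|H].
  - destruct (rel_prime_bezout _ _ H) as [u v E]. exists ((- v)%Z, (- u)%Z). simpl. lia.
  - exists (0, 0)%Z. tauto.
Qed.

(* (av k h, bv k h; k, -h) is a matrix of SL2(Z) sending h / k to infinity when k and h are coprime;
   gam k h is its action on the real line. *)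
Definition bez (k h : Z) : Z * Z :=
  proj1_sig (constructive_indefinite_description _ (bezout_entries_exist k h)).
Definition av (k h : Z) : Z := fst (bez k h).
Definition bv (k h : Z) : Z := snd (bez k h).

Lemma bez_det k h : rel_prime k h -> (- av k h * h - bv k h * k = 1)%Z.
Proof. unfold av, bv, bez. destruct constructive_indefinite_description; auto. Qed.

Definition gam (k h : Z) (x : R) : R := (IZR (av k h) * x + IZR (bv k h)) / (IZR k * x - IZR h).

Definition near_int (q : R) (k : Z) (x : R) : Prop := exists h : Z, Rabs (IZR k * x - IZR h) <= / q.

(** An arbitrary Dirichlet denominator is not determined by [x]; the least one is, and this makes
    the arcs a partition. *)
Definition minden (q : R) (k : Z) (x : R) : Prop :=
  (1 <= k)%Z /\ near_int q k x /\ forall k', (1 <= k' < k)%Z -> ~ near_int q k' x.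

(** A common factor of [k] and [h] could be cancelled, which would leave a smaller denominator of
    the same quality. *)
Lemma minden_rel_prime q k h x : 0 < q ->
  minden q (Z.abs k) x -> Rabs (IZR k * x - IZR h) <= / q -> rel_prime k h.
Proof.
  intros Hq [Hk [_ Hmin]] Hh.
  assert (G : Z.gcd k h = 1%Z).
  { set (g := Z.gcd k h).
    assert (Hg0 : (0 <= g)%Z) by apply Z.gcd_nonneg.
    destruct (Z.eq_dec g 1) as [|N]; auto. exfalso.
    destruct (Z.gcd_divide_l k h) as [k1 Ek]. destruct (Z.gcd_divide_r k h) as [h1 Eh]. fold g in Ek, Eh.
    assert (Hk1 : (1 <= Z.abs k1 < Z.abs k)%Z) by (rewrite Ek, Z.abs_mul; nia).
    apply (Hmin (Z.abs k1) Hk1).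
    assert (Hs : Rabs (IZR k1 * x - IZR h1) <= / q).
    { replace (IZR k * x - IZR h) with (IZR g * (IZR k1 * x - IZR h1)) in Hh
        by (rewrite Ek, Eh, !mult_IZR; ring).
      rewrite Rabs_mult in Hh. pose proof (Rabs_pos (IZR k1 * x - IZR h1)).
      assert (1 <= Rabs (IZR g)) by (rewrite <- abs_IZR; apply IZR_le; lia). nra. }
    destruct (Z.abs_spec k1) as [[_ ->]|[_ ->]].
    - exists h1; auto.
    - exists (- h1)%Z. rewrite !opp_IZR. rewrite <- Rabs_Ropp.
      replace (- (- IZR k1 * x - - IZR h1)) with (IZR k1 * x - IZR h1) by ring. auto. }
  apply Zgcd_1_rel_prime. auto.
Qed.

(** Suppose a smaller [k'] served at [y] but neither at [x] nor at [z]. Then [k' u - h'] would pass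
    from below [- 1 / q] to above [1 / q] between them, so [k' (z - x) > 2 / q]. But
    [|k| (z - x) <= 2 / q] and [k' < |k|]. *)
Lemma minden_convex q k h x y z : 0 < q ->
  minden q (Z.abs k) x -> minden q (Z.abs k) z ->
  Rabs (IZR k * x - IZR h) <= / q -> Rabs (IZR k * z - IZR h) <= / q ->
  x <= y <= z -> minden q (Z.abs k) y.
Proof.
  intros Hq Hx Hz Kx Kz Hy.
  destruct Hx as [Hk1 [_ Hmx]]. destruct Hz as [_ [_ Hmz]].
  apply Rabs_le_between in Kx. apply Rabs_le_between in Kz.
  split; auto. split.
  - assert (K : Rabs (IZR k * y - IZR h) <= / q).
    { apply Rabs_le. destruct (Rle_dec 0 (IZR k)); split; nra. }
    destruct (Z.abs_spec k) as [[_ ->]|[_ ->]].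
    + exists h; auto.
    + exists (- h)%Z. rewrite !opp_IZR. rewrite <- Rabs_Ropp.
      replace (- (- IZR k * y - - IZR h)) with (IZR k * y - IZR h) by ring. auto.
  - intros k' Hk' [h' Hh'].
    assert (Nx : ~ Rabs (IZR k' * x - IZR h') <= / q) by (intros N; apply (Hmx k' Hk'); exists h'; auto).
    assert (Nz : ~ Rabs (IZR k' * z - IZR h') <= / q) by (intros N; apply (Hmz k' Hk'); exists h'; auto).
    apply Rabs_le_between in Hh'.
    assert (Hkp : 1 <= IZR k') by (apply IZR_le; lia).
    assert (IZR k' + 1 <= Rabs (IZR k)) by (rewrite <- abs_IZR, <- plus_IZR; apply IZR_le; lia).
    assert (A1 : IZR k' * x - IZR h' < - / q).
    { apply Rnot_le_lt. intros D. apply Nx. apply Rabs_le. nra. }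
    assert (A2 : / q < IZR k' * z - IZR h').
    { apply Rnot_le_lt. intros D. apply Nz. apply Rabs_le. nra. }
    assert (A3 : Rabs (IZR k) * (z - x) <= 2 * / q).
    { rewrite <- (Rabs_pos_eq (z - x)), <- Rabs_mult by lra. apply Rabs_le. lra. }
     nra.
Qed.

(** A negative value at an end point would leave a point of the open interval, on the way to the
    midpoint, with half that value. *)
Lemma linear_closure s c a b : a < b -> (forall x, a < x < b -> 0 <= s * x + c) ->
  forall x, a <= x <= b -> 0 <= s * x + c.
Proof.
  intros Hab H x Hx. apply Rnot_lt_le. intros N.
  set (m := (a + b) / 2). assert (Hm : a < m < b) by (unfold m; lra).
  pose proof (H m Hm) as Pm. set (v := s * x + c) in *. set (u := s * m + c) in *.
  set (t := - v / (2 * (u - v))).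
  assert (Ht : 0 < t < 1).
  { unfold t. split; [apply Rdiv_lt_0_compat; lra|]. apply (Rmult_lt_reg_r (2 * (u - v))); [lra|].
    field_simplify; lra. }
  assert (P : 0 <= s * (x + t * (m - x)) + c) by (apply H; split; nra).
  replace (s * (x + t * (m - x)) + c) with (v + t * (u - v)) in P by (unfold u, v; ring).
  replace (t * (u - v)) with (- v / 2) in P by (unfold t; field; lra). lra.
Qed.

Lemma Q_pos_aux rho q : 0 < rho <= 1 -> 32 <= q * rho -> 0 < q.
Proof. nra. Qed.

(** * Cutting a segment of the horocycle into arcs and unit pieces *)

Section Pieces.
Variables (eta b1 R0 B w w' rho omega xi1 xi2 : R) (Q H L : Z).
Hypothesis Hrho : 0 < rho <= 1.
Hypothesis HR0 : rho <= R0 <= b1.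
Hypothesis HR1 : 4 * R0 <= b1 ^ 2.
Hypothesis HQ : 32 <= IZR Q * rho.
Hypothesis Hw : 0 < w.
Hypothesis Hww : w <= w' <= 2 * w.
Hypothesis HwQ : w' * IZR Q <= 1.
Hypothesis HB : 0 < B.
Hypothesis H2 : IZR Q ^ 3 * R0 * b1 <= B.
Hypothesis H3 : IZR Q ^ 4 * R0 * b1 ^ 3 <= B ^ 2.
Hypothesis Hxi : eta + b1 <= xi1 /\ xi1 <= xi2 /\ xi2 <= eta + b1 + R0.
Hypothesis HDir : forall k x, minden (IZR Q) k x -> (k <= Q)%Z.

(* Each x lies in the arc of h / k for its least denominator |k| of approximation quality 1 / Q;
   the sign of k distinguishes the two sides of h / k. *)
Definition arc (k h : Z) (x : R) : Prop :=
  xi1 <= x <= xi2 /\ minden (IZR Q) (Z.abs k) x /\ w < IZR k * x - IZR h <= w'.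

(** Here [l] is the integer part of the image of [x]. After translation by [- l] all pieces lie over
    [[0, 1]], where they can be superposed. *)
Definition arcl (k h l : Z) (x : R) : Prop := arc k h x /\ IZR l <= gam k h x < IZR l + 1.

Let Qp : 0 < IZR Q := Q_pos_aux rho (IZR Q) Hrho HQ.

Lemma arc_near k h x : arc k h x -> Rabs (IZR k * x - IZR h) <= / IZR Q.
Proof using Hrho HQ Hw HwQ.
  intros [_ [_ Hx]]. rewrite Rabs_pos_eq by lra.
  apply Rle_trans with w'; [lra|]. apply (Rmult_le_reg_r (IZR Q)); auto. rewrite Rinv_l by lra. auto.
Qed.

Lemma arc_det k h x : arc k h x -> (- av k h * h - bv k h * k = 1)%Z.
Proof using Hrho HQ Hw HwQ.
  intros Hx. apply bez_det. apply (minden_rel_prime (IZR Q) k h x); auto; [apply Hx|apply arc_near; auto].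
Qed.

Lemma arc_convex k h : convex (arc k h).
Proof using Hrho HQ Hw HwQ.
  intros x y z Hx Hz Hy.
  pose proof (arc_near _ _ _ Hx) as Nx. pose proof (arc_near _ _ _ Hz) as Nz.
  destruct Hx as [Hx1 [Hx2 Hx3]]. destruct Hz as [Hz1 [Hz2 Hz3]].
  split; [lra|]. split; [apply (minden_convex (IZR Q) k h x y z); auto|].
  destruct (Rle_dec 0 (IZR k)); split; nra.
Qed.

(** Clearing the positive denominator makes the condition linear in [x], which is the source of the
    convexity of [arcl]. *)
Lemma gam_ge k h x l : 0 < IZR k * x - IZR h ->
  (IZR l <= gam k h x <-> 0 <= (IZR (av k h) - IZR l * IZR k) * x + (IZR (bv k h) + IZR l * IZR h)).
Proof.
  intros Hx. unfold gam.
  set (d := IZR k * x - IZR h) in *. set (n := IZR (av k h) * x + IZR (bv k h)).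
  replace ((IZR (av k h) - IZR l * IZR k) * x + (IZR (bv k h) + IZR l * IZR h)) with (n - IZR l * d) by (unfold n, d; ring).
  assert (E : n = n / d * d) by (field; lra). nra.
Qed.

Lemma arcl_convex k h l : convex (arcl k h l).
Proof using Hrho HQ Hw HwQ.
  intros x y z [Hx Gx] [Hz Gz] Hy.
  pose proof (arc_convex k h x y z Hx Hz Hy) as Ha. split; auto.
  assert (Px : 0 < IZR k * x - IZR h) by (destruct Hx as [_ [_ ?]]; lra).
  assert (Py : 0 < IZR k * y - IZR h) by (destruct Ha as [_ [_ ?]]; lra).
  assert (Pz : 0 < IZR k * z - IZR h) by (destruct Hz as [_ [_ ?]]; lra).
  assert (Lin : forall s c, 0 <= s * x + c -> 0 <= s * z + c -> 0 <= s * y + c).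
  { intros s c U V. destruct (Rle_dec 0 s); nra. }
  split.
  - apply gam_ge; auto. apply Lin; apply gam_ge; auto; lra.
  - apply Rnot_le_lt. intros N. rewrite <- plus_IZR in N. apply gam_ge in N; auto.
    assert (G1 : ~ IZR (l + 1) <= gam k h x) by (rewrite plus_IZR; lra).
    assert (G2 : ~ IZR (l + 1) <= gam k h z) by (rewrite plus_IZR; lra).
    rewrite gam_ge in G1, G2 by auto.
    set (s := IZR (av k h) - IZR (l + 1) * IZR k) in *.
    destruct (Rle_dec 0 s); nra.
Qed.

Lemma arcl_ends_exist k h l : exists p : R * R, xi1 <= fst p /\ fst p <= snd p /\ snd p <= xi2 /\
    (forall x, fst p < x < snd p -> arcl k h l x) /\ (forall x, arcl k h l x -> fst p <= x <= snd p).
Proof using Hrho HQ Hw HwQ Hxi.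
  apply convex_endpoints; [apply Hxi|apply arcl_convex|]. intros x [[Hx _] _]; auto.
Qed.

Definition plo k h l : R := fst (proj1_sig (constructive_indefinite_description _ (arcl_ends_exist k h l))).
Definition phi k h l : R := snd (proj1_sig (constructive_indefinite_description _ (arcl_ends_exist k h l))).

Lemma ends_spec k h l : xi1 <= plo k h l /\ plo k h l <= phi k h l /\ phi k h l <= xi2 /\
    (forall x, plo k h l < x < phi k h l -> arcl k h l x) /\ (forall x, arcl k h l x -> plo k h l <= x <= phi k h l).
Proof. unfold plo, phi. destruct constructive_indefinite_description as [p Hp]. auto. Qed.

Definition nd k h l : Prop := plo k h l < phi k h l.

Lemma nd_mid k h l : nd k h l -> arcl k h l ((plo k h l + phi k h l) / 2).
Proof. intros N. unfold nd in N. apply ends_spec. lra. Qed.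

Lemma nd_det k h l : nd k h l -> (- av k h * h - bv k h * k = 1)%Z.
Proof using Hrho HQ Hw HwQ Hxi.
  intros N. destruct (nd_mid _ _ _ N) as [A _]. exact (arc_det _ _ _ A).
Qed.

Lemma nd_closed k h l x : nd k h l -> plo k h l <= x <= phi k h l ->
  w <= IZR k * x - IZR h <= w' /\ IZR l <= gam k h x <= IZR l + 1.
Proof using Hrho HQ Hw HwQ Hxi Hww.
  intros N Hx. pose proof (ends_spec k h l) as [_ [_ [_ [E _]]]].
  assert (C1 : 0 <= IZR k * x + (- IZR h - w)).
  { apply (linear_closure _ _ _ _ N); auto. intros z Hz. destruct (E z Hz) as [[_ [_ ?]] _]. lra. }
  assert (C2 : 0 <= - IZR k * x + (w' + IZR h)).
  { apply (linear_closure _ _ _ _ N); auto. intros z Hz. destruct (E z Hz) as [[_ [_ ?]] _]. lra. }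
  split; [lra|]. assert (P : 0 < IZR k * x - IZR h) by lra. split.
  - apply gam_ge; auto. apply (linear_closure _ _ _ _ N); auto. intros z Hz.
    destruct (E z Hz) as [[_ [_ ?]] G]. apply gam_ge; lra.
  - apply Rnot_lt_le. intros G.
    assert (G2 : ~ 0 <= - (IZR (av k h) - IZR (l + 1) * IZR k) * x + - (IZR (bv k h) + IZR (l + 1) * IZR h)).
    { intros G2. unfold gam in G. rewrite plus_IZR in G2. set (d := IZR k * x - IZR h) in *.
      set (n := IZR (av k h) * x + IZR (bv k h)) in *.
      assert (E' : n = n / d * d) by (field; lra).
      assert (n - (IZR l + 1) * d <= 0) by (unfold n, d; lra). nra. }
    apply G2. apply (linear_closure _ _ _ _ N); auto. intros z Hz.
    destruct (E z Hz) as [[_ [_ ?]] G'].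
    assert (G3 : ~ IZR (l + 1) <= gam k h z) by (rewrite plus_IZR; lra).
    rewrite gam_ge in G3 by lra. lra.
Qed.

Let Good := good eta b1 R0 w w' Q av bv.

Lemma nd_good k h l : nd k h l -> Good k h l.
Proof using All.
  intros N. pose proof (nd_mid _ _ _ N) as [A G]. pose proof (nd_det _ _ _ N) as D.
  split; [|split; auto].
  - destruct A as [_ [M _]]. split; [apply M|]. apply (HDir _ _ M).
  - exists ((plo k h l + phi k h l) / 2). destruct A as [X [_ Y]]. unfold gam in G. lra.
Qed.

Let vv_nonzero := v_neq0 eta b1 R0 B w w' rho Q H L av bv Hrho HR0 HR1 HQ Hw Hww HwQ HB.
Let P1 := b1 / w'.
Let P2 := (b1 + R0) / w.
Let p := pp eta av bv.

(** Follows from the determinant. The amplitude [1 / (x - eta)^2] of the kernel times the Jacobian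
    [(k x - h)^2] becomes [1 / p^2] with [p] linear in the new variable. *)
Lemma pp_at k h l x : (- av k h * h - bv k h * k = 1)%Z -> IZR k * x - IZR h <> 0 ->
  p k h l (gam k h x - IZR l) = (x - eta) / (IZR k * x - IZR h).
Proof.
  intros D N. apply (f_equal IZR) in D. rewrite minus_IZR, !mult_IZR, opp_IZR in D.
  assert (E : p k h l (gam k h x - IZR l) * (IZR k * x - IZR h)
    = (- IZR (av k h) * IZR h - IZR (bv k h) * IZR k) * (x - eta)).
  { unfold p, pp, gam, vv, al. field. auto. }
  apply (Rmult_eq_reg_r (IZR k * x - IZR h)); auto. rewrite E, D. field. auto.
Qed.

Lemma gam_mono k h l x y : nd k h l -> plo k h l <= x -> x <= y -> y <= phi k h l -> gam k h x <= gam k h y.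
Proof using Hrho HQ Hw HwQ Hxi Hww.
  intros N Hx Hxy Hy. pose proof (nd_det _ _ _ N) as D.
  destruct (nd_closed k h l x N) as [Cx _]; [lra|]. destruct (nd_closed k h l y N) as [Cy _]; [lra|].
  apply (f_equal IZR) in D. rewrite minus_IZR, !mult_IZR, opp_IZR in D.
  unfold gam.
  assert (E : (IZR (av k h) * y + IZR (bv k h)) / (IZR k * y - IZR h) - (IZR (av k h) * x + IZR (bv k h)) / (IZR k * x - IZR h)
    = (- IZR (av k h) * IZR h - IZR (bv k h) * IZR k) * (y - x) / ((IZR k * y - IZR h) * (IZR k * x - IZR h))) by (field; lra).
  rewrite D in E. assert (0 <= 1 * (y - x) / ((IZR k * y - IZR h) * (IZR k * x - IZR h))); [|lra].
  pos.
Qed.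

Definition Xlo k h l : R := if excluded_middle_informative (nd k h l) then gam k h (plo k h l) - IZR l else 0.
Definition Xhi k h l : R := if excluded_middle_informative (nd k h l) then gam k h (phi k h l) - IZR l else 0.

(** Since [1 / p = k + v / (x - eta)], this is [2 PI B^2 / (4 (x - eta))] at the point [x] that
    corresponds to [X]. *)
Definition phase k h l (X : R) : R := 2 * PI * (B ^ 2 / 4 * ((/ p k h l X - IZR k) / vv eta k h)).
Definition fcos k h l (X : R) : R :=
  if excluded_middle_informative (nd k h l) then cos (phase k h l X) / p k h l X ^ 2 else 0.
Definition fsin k h l (X : R) : R :=
  if excluded_middle_informative (nd k h l) then sin (phase k h l X) / p k h l X ^ 2 else 0.

Lemma X_range k h l : 0 <= Xlo k h l /\ Xlo k h l <= Xhi k h l /\ Xhi k h l <= 1.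
Proof using Hrho HQ Hw HwQ Hxi Hww.
  unfold Xlo, Xhi. destruct excluded_middle_informative as [N|N]; [|lra].
  assert (N' := N). unfold nd in N'.
  destruct (nd_closed k h l (plo k h l) N) as [_ C1]; [lra|].
  destruct (nd_closed k h l (phi k h l) N) as [_ C2]; [lra|].
  pose proof (gam_mono k h l (plo k h l) (phi k h l) N). lra.
Qed.

Lemma P_pos : 0 < P1.
Proof using Hrho HR0 Hw Hww.    pos. Qed.

Lemma linear_between s c u v x : u <= x <= v -> forall m, m <= s * u + c -> m <= s * v + c -> m <= s * x + c.
Proof. intros Hx m Hu Hv. destruct (Rle_dec 0 s); nra. Qed.

Lemma p_range k h l X : nd k h l -> Xlo k h l <= X <= Xhi k h l -> P1 <= p k h l X <= P2.
Proof using All.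
  intros N HX.
  pose proof (nd_det _ _ _ N) as D.
  pose proof (ends_spec k h l) as [E1 [E2 [E3 _]]].
  assert (R : forall x, plo k h l <= x <= phi k h l -> P1 <= p k h l (gam k h x - IZR l) <= P2).
  { intros x Hx. destruct (nd_closed k h l x N Hx) as [C _]. rewrite pp_at by (auto; lra).
     split; apply Rmult_le_compat; try lra; try (left; apply Rinv_0_lt_compat; lra);
     apply Rinv_le_contravar; lra. }
  destruct (R (plo k h l)) as [A1 A2]; [lra|]. destruct (R (phi k h l)) as [A3 A4]; [lra|].
  unfold Xlo, Xhi in HX. destruct excluded_middle_informative; [|tauto].
  set (u := gam k h (plo k h l) - IZR l) in *. set (v := gam k h (phi k h l) - IZR l) in *.
  assert (EL : forall X, p k h l X = vv eta k h * X + (vv eta k h * IZR l - al eta av bv k h)) by (intros; unfold p, pp; ring).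
  rewrite EL in *. split.
  - apply (linear_between _ _ u v); auto.
  - apply Ropp_le_cancel.
    pose proof (linear_between (- vv eta k h) (- (vv eta k h * IZR l - al eta av bv k h)) u v X HX (- P2)). lra.
Qed.

Lemma f_continuous k h l X : Xlo k h l <= X <= Xhi k h l ->
  continuous (fcos k h l) X /\ continuous (fsin k h l) X.
Proof using All.
  intros HX. unfold fcos, fsin. destruct excluded_middle_informative as [N|N].
  - pose proof (p_range k h l X N HX) as R. pose proof P_pos.
    unfold p, pp in R.
    split.
    + by_derivative.
      unfold phase, p, pp. auto_derive. nra.
    + by_derivative.
      unfold phase, p, pp. auto_derive. nra.
  - split; apply continuous_const.
Qed.

Let ov k h l k' h' l' := overlap (fun t : Z * Z * Z => Xlo (fst (fst t)) (snd (fst t)) (snd t))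
   (fun t : Z * Z * Z => Xhi (fst (fst t)) (snd (fst t)) (snd t)) (k, h, l) (k', h', l')
   (fun x => fcos k h l x * fcos k' h' l' x + fsin k h l x * fsin k' h' l' x).

(** The addition theorem turns the product into the cosine of the phase difference. The parts of the
    phases that are constant in X form [th0]. A degenerate piece carries the zero functions, which
    accounts for the first alternative. *)
Lemma overlap_cases k h l k' h' l' :
  ov k h l k' h' l' = 0 \/ (nd k h l /\ nd k' h' l' /\ exists x1 x2 th0, 0 <= x1 /\ x1 <= x2 /\ x2 <= 1 /\
    (forall x, x1 <= x <= x2 -> Xlo k h l <= x <= Xhi k h l /\ Xlo k' h' l' <= x <= Xhi k' h' l') /\
    ov k h l k' h' l' = RInt (pair_integrand B (vv eta k h) (vv eta k h * IZR l - al eta av bv k h)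
        (vv eta k' h') (vv eta k' h' * IZR l' - al eta av bv k' h') th0) x1 x2).
Proof using All.
  unfold ov, overlap. simpl. destruct Rle_dec as [D|D]; [|left; auto].
  set (x1 := Rmax _ _) in *. set (x2 := Rmin _ _) in *.
  destruct (classic (nd k h l)) as [N|N].
  2:{ left. rewrite (RInt_ext _ (fun _ => 0)); [rewrite RInt_const; unfold scal; simpl; unfold mult; simpl; ring|].
      intros x _. unfold fcos at 1, fsin at 1. destruct excluded_middle_informative; [tauto|]. rring. }
  destruct (classic (nd k' h' l')) as [N'|N'].
  2:{ left. rewrite (RInt_ext _ (fun _ => 0)); [rewrite RInt_const; unfold scal; simpl; unfold mult; simpl; ring|].
      intros x _. unfold fcos at 2, fsin at 2. destruct (excluded_middle_informative (nd k' h' l')); [tauto|]. rring. }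
  right. split; auto. split; auto.
  pose proof (X_range k h l). pose proof (X_range k' h' l').
  pose proof (Rmax_l (Xlo k h l) (Xlo k' h' l')). pose proof (Rmax_r (Xlo k h l) (Xlo k' h' l')).
  pose proof (Rmin_l (Xhi k h l) (Xhi k' h' l')). pose proof (Rmin_r (Xhi k h l) (Xhi k' h' l')).
  fold x1 in H4, H5. fold x2 in H6, H7.
  assert (IN : forall x, x1 <= x <= x2 -> Xlo k h l <= x <= Xhi k h l /\ Xlo k' h' l' <= x <= Xhi k' h' l') by (intros; lra).
  exists x1, x2, (- (B ^ 2 / 4 * (IZR k / vv eta k h - IZR k' / vv eta k' h'))).
  split; [lra|]. split; auto. split; [lra|]. split; auto.
  apply RInt_ext. intros x. minmax. intros Hx.
  destruct (IN x) as [I1 I2]; [lra|].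
  pose proof (p_range k h l x N I1) as R. pose proof (p_range k' h' l' x N' I2) as R'. pose proof P_pos.
  assert (V : vv eta k h <> 0) by exact (vv_nonzero _ _ _ (nd_good _ _ _ N)).
  assert (V' : vv eta k' h' <> 0) by exact (vv_nonzero _ _ _ (nd_good _ _ _ N')).
  unfold fcos, fsin. destruct (excluded_middle_informative (nd k h l)); [|tauto].
  destruct (excluded_middle_informative (nd k' h' l')); [|tauto].
  unfold pair_integrand.
  replace (vv eta k h * x + (vv eta k h * IZR l - al eta av bv k h)) with (p k h l x) by (unfold p, pp; ring).
  replace (vv eta k' h' * x + (vv eta k' h' * IZR l' - al eta av bv k' h')) with (p k' h' l' x) by (unfold p, pp; ring).
  replace (2 * PI * (B ^ 2 / 4 * (/ (vv eta k h * p k h l x) - / (vv eta k' h' * p k' h' l' x)) + - (B ^ 2 / 4 * (IZR k / vv eta k h - IZR k' / vv eta k' h'))))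
    with (phase k h l x - phase k' h' l' x).
  2:{ unfold phase. field. lra. }
  rewrite cos_minus. generalize (cos (phase k h l x)) (cos (phase k' h' l' x)) (sin (phase k h l x)) (sin (phase k' h' l' x)).
  intros c1 c2 s1 s2. match goal with |- @eq _ ?a ?b => change (@eq Rdefinitions.R a b) end. field. lra.
Qed.

Let Lam := 1 + ln (2 + / w).

Lemma Lam_ge : 1 <= Lam.
Proof using Hw.
  unfold Lam. assert (0 < / w) by pos.
  pose proof (ln_le 1 (2 + / w)). rewrite ln_1 in *. lra.
Qed.

Lemma overlap_abs_sum :
  SG eta b1 R0 w w' Q H L av bv (fun k h l => SG eta b1 R0 w w' Q H L av bv (fun k' h' l' =>
    Rabs (ov k h l k' h' l'))) <= pair_const rho * (Lam * (R0 / (IZR Q ^ 2 * b1 ^ 4))).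
Proof using All.
  pose proof P_pos as HP.
  eapply Rle_trans; [apply (pair_sum_le eta b1 R0 B w w' rho Q H L av bv); auto|].
  - intros. f_equal. unfold ov, overlap.  rewrite (Rmax_comm (Xlo k' h' l')), (Rmin_comm (Xhi k' h' l')).
    destruct Rle_dec; auto. apply RInt_ext. intros x _. rring.
  - intros. pos.
  - intros k h l G. fold P1. destruct (overlap_cases k h l k h l) as [->|[N [_ [x1 [x2 [th0 [A1 [A2 [A3 [IN ->]]]]]]]]]].
    + rewrite Rabs_R0. pos.
    + eapply Rle_trans; [apply (pair_trivial B _ _ _ _ _ P1); auto|].
      1, 2: exact (vv_nonzero _ _ _ G).
      1, 2: intros x Hx; destruct (IN x Hx) as [I1 _]; pose proof (p_range k h l x N I1) as R; unfold p, pp in R; lra.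
      rewrite <- (Rmult_1_l (/ P1 ^ 4)) at 2. mulr; lra.
  - intros k h l k' h' l' d G G' Hd HX. fold P1 P2 in HX |- *.
    destruct (overlap_cases k h l k' h' l') as [->|[N [N' [x1 [x2 [th0 [A1 [A2 [A3 [IN ->]]]]]]]]]].
    + rewrite Rabs_R0. pos.
    + apply pair_first_derivative; auto.
      * exact (vv_nonzero _ _ _ G).
      * exact (vv_nonzero _ _ _ G').
      * intros x Hx; destruct (IN x Hx) as [I1 _]; pose proof (p_range k h l x N I1) as R; unfold p, pp in R; lra.
      * intros x Hx; destruct (IN x Hx) as [_ I1]; pose proof (p_range k' h' l' x N' I1) as R; unfold p, pp in R; lra.
      * intros x Hx. destruct (IN x Hx) as [I1 _]. pose proof (p_range k h l x N I1) as R.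
        eapply Rle_trans; [apply (HX x); [lra|exact R]|]. right. f_equal. unfold pp. ring.
  - intros k h l k' h' l' G G' S. fold P1.
    destruct (overlap_cases k h l k' h' l') as [->|[N [N' [x1 [x2 [th0 [A1 [A2 [A3 [IN ->]]]]]]]]]].
    + rewrite Rabs_R0. assert (0 < Rabs (ss eta k h k' h')) by (apply Rabs_pos_lt; auto). pos.
    + apply pair_second_derivative; auto.
      * exact (vv_nonzero _ _ _ G).
      * exact (vv_nonzero _ _ _ G').
      * intros x Hx; destruct (IN x Hx) as [I1 _]; pose proof (p_range k h l x N I1) as R; unfold p, pp in R; lra.
      * intros x Hx; destruct (IN x Hx) as [_ I1]; pose proof (p_range k' h' l' x N' I1) as R; unfold p, pp in R; lra.
  - apply pair_sum_bound; auto. apply Lam_ge.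
Qed.

Definition box : list (Z * Z * Z) := list_prod (list_prod (zr (- Q) Q) (zr (- H) H)) (zr (- L) L).

Lemma lsum_box F : lsum box (fun t => F (fst (fst t)) (snd (fst t)) (snd t))
  = lsum (zr (- Q) Q) (fun k => lsum (zr (- H) H) (fun h => lsum (zr (- L) L) (fun l => F k h l))).
Proof. unfold box. rewrite !lsum_list_prod. auto. Qed.

Variables (Psi : R -> R) (c : R).
Hypothesis HPsi : forall x, continuous Psi x.
Hypothesis HPper : forall x l, Psi (x + IZR l) = Psi x.
Hypothesis HPc : forall x, Rabs (Psi x) <= c.
Hypothesis Hc : 0 < c.

Definition kern (x : R) : R := cos (2 * PI * (B ^ 2 / (4 * (x - eta))) + omega) / (x - eta) ^ 2.

(** Substitution [X = gam x - l], with derivative [1 / (k x - h)^2] by the determinant; the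
    periodicity of [Psi] removes [l]. *)
Lemma piece_integral k h l :
  RInt (fun x => Psi (gam k h x) * kern x) (plo k h l) (phi k h l)
  = RInt (fun X => Psi X * (cos omega * fcos k h l X - sin omega * fsin k h l X)) (Xlo k h l) (Xhi k h l).
Proof using All.
  destruct (classic (nd k h l)) as [N|N].
  - pose proof (nd_det _ _ _ N) as D. pose proof (ends_spec k h l) as [E1 [E2 [E3 _]]].
    assert (EX : Xlo k h l = gam k h (plo k h l) - IZR l /\ Xhi k h l = gam k h (phi k h l) - IZR l).
    { unfold Xlo, Xhi. destruct excluded_middle_informative; tauto. }
    destruct EX as [EX1 EX2].
    pose proof (RInt_comp (fun X => Psi X * (cos omega * fcos k h l X - sin omega * fsin k h l X))
      (fun x => gam k h x - IZR l) (fun x => / (IZR k * x - IZR h) ^ 2) (plo k h l) (phi k h l)) as RC.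
    cbv beta in RC. rewrite <- EX1, <- EX2 in RC. rewrite <- RC.
    + apply RInt_ext. intros x. minmax. intros Hx.
      destruct (nd_closed k h l x N) as [C1 C2]; [lra|].
      change (Psi (gam k h x) * kern x = / (IZR k * x - IZR h) ^ 2 * (Psi (gam k h x - IZR l) *
        (cos omega * fcos k h l (gam k h x - IZR l) - sin omega * fsin k h l (gam k h x - IZR l)))).
      replace (gam k h x - IZR l) with (gam k h x + IZR (- l)) at 1 by (rewrite opp_IZR; ring).
      rewrite HPper. unfold fcos, fsin. destruct excluded_middle_informative; [|tauto].
      rewrite pp_at by (auto; lra).
      assert (V : vv eta k h <> 0) by exact (vv_nonzero _ _ _ (nd_good _ _ _ N)).
      replace (phase k h l (gam k h x - IZR l)) with (2 * PI * (B ^ 2 / (4 * (x - eta)))).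
      * unfold kern. rewrite cos_plus.
        generalize (cos (2 * PI * (B ^ 2 / (4 * (x - eta))))) (sin (2 * PI * (B ^ 2 / (4 * (x - eta))))) (Psi (gam k h x)).
        intros. field. lra.
      * unfold phase. rewrite pp_at by (auto; lra). unfold vv in *. field. lra.
    + intros x. minmax. intros Hx.
      assert (HX : Xlo k h l <= gam k h x - IZR l <= Xhi k h l).
      { pose proof (gam_mono k h l (plo k h l) x N). pose proof (gam_mono k h l x (phi k h l) N). lra. }
      destruct (f_continuous k h l _ HX) as [F1 F2].
      apply (continuous_mult Psi (fun X => cos omega * fcos k h l X - sin omega * fsin k h l X)); auto.
      apply (continuous_minus (fun X => cos omega * fcos k h l X) (fun X => sin omega * fsin k h l X)).
      * apply (continuous_mult (fun _ => cos omega) (fcos k h l)); auto. apply continuous_const.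
      * apply (continuous_mult (fun _ => sin omega) (fsin k h l)); auto. apply continuous_const.
    + intros x. minmax. intros Hx.
      destruct (nd_closed k h l x N Hx) as [C1 C2].
      assert (Nx : IZR k * x - IZR h <> 0) by lra.
      apply (f_equal IZR) in D. rewrite minus_IZR, !mult_IZR, opp_IZR in D.
      split.
      * unfold gam. auto_derive; auto.
        transitivity ((- IZR (av k h) * IZR h - IZR (bv k h) * IZR k) * / (IZR k * x - IZR h) ^ 2).
        -- field. auto.
        -- rewrite D. rring.
      * by_derivative. auto_derive.
        auto.
  - assert (E : plo k h l = phi k h l) by (pose proof (ends_spec k h l); unfold nd in N; lra).
    assert (EX : Xlo k h l = Xhi k h l).
    { unfold Xlo, Xhi. destruct excluded_middle_informative; tauto. }
    rewrite E, EX, !RInt_point. lra.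
Qed.

Lemma pieces_bound :
  Rabs (lsum (zr (- Q) Q) (fun k => lsum (zr (- H) H) (fun h => lsum (zr (- L) L) (fun l =>
    RInt (fun x => Psi (gam k h x) * kern x) (plo k h l) (phi k h l)))))
  <= c * sqrt (pair_const rho * (Lam * (R0 / (IZR Q ^ 2 * b1 ^ 4)))).
Proof using All.
  rewrite <- lsum_box.
  erewrite lsum_ext; [|intros t _; apply piece_integral].
  apply (L2_bound box (fun t : Z * Z * Z => Xlo (fst (fst t)) (snd (fst t)) (snd t))
   (fun t : Z * Z * Z => Xhi (fst (fst t)) (snd (fst t)) (snd t))
   (fun t => fcos (fst (fst t)) (snd (fst t)) (snd t)) (fun t => fsin (fst (fst t)) (snd (fst t)) (snd t))); auto.
  - intros t _. apply X_range.
  - intros t x _ Hx. destruct (f_continuous _ _ _ x Hx) as [F1 F2]. auto.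
  - intros t x _ Hx. destruct (f_continuous _ _ _ x Hx) as [F1 F2]. auto.
  - assert (0 < pair_const rho) by (apply pair_const_pos; lra). pose proof Lam_ge.
       pos.
  - below overlap_abs_sum.
    (* The box also contains triples that are not good. Their pieces are degenerate, so their
       overlaps vanish. *)
    unfold SG. rewrite <- lsum_box. apply lsum_le. intros [[k h] l] _. simpl.
    destruct (classic (nd k h l)) as [N|N].
    + assert (EI : indic (good eta b1 R0 w w' Q av bv k h l) = 1) by (apply indic_true; exact (nd_good _ _ _ N)).
      rewrite EI, Rmult_1_l. rewrite <- lsum_box. apply lsum_le.
      intros [[k' h'] l'] _. simpl. fold (ov k h l k' h' l').
      destruct (classic (nd k' h' l')) as [N'|N'].
      * assert (EI' : indic (good eta b1 R0 w w' Q av bv k' h' l') = 1) by (apply indic_true; exact (nd_good _ _ _ N')).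
        rewrite EI', Rmult_1_l. apply Rle_abs.
      * destruct (overlap_cases k h l k' h' l') as [->|[_ [N2 _]]]; [|tauto].
        pos.
    + apply Rle_trans with 0.
      * rewrite <- (Rmult_0_r (INR (length box))), <- lsum_const. apply lsum_le.
        intros [[k' h'] l'] _. simpl. fold (ov k h l k' h' l').
        destruct (overlap_cases k h l k' h' l') as [->|[N2 _]]; [lra|tauto].
      * apply Rmult_le_pos; [apply indic_bounds|]. rewrite <- lsum_box. apply lsum_nonneg. intros t _.
        pos.
Qed.
Hypothesis HLarge : forall k h x, In k (zr (- Q) Q) -> In h (zr (- H) H) -> arc k h x ->
  - IZR L <= gam k h x < IZR L.

(** [HLarge] makes the finite range of [l] exhaust every arc: the pieces with [l] in the range add
    up to the indicator of the arc. The value of [L] does not enter the bound. *)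
Lemma arc_sum_bound : exists val : Z -> Z -> R,
  (forall k h, In k (zr (- Q) Q) -> In h (zr (- H) H) ->
    is_RInt (fun x => indic (arc k h x) * (Psi (gam k h x) * kern x)) xi1 xi2 (val k h)) /\
  Rabs (lsum (zr (- Q) Q) (fun k => lsum (zr (- H) H) (fun h => val k h)))
  <= c * sqrt (pair_const rho * (Lam * (R0 / (IZR Q ^ 2 * b1 ^ 4)))).
Proof using All.
  exists (fun k h => lsum (zr (- L) L) (fun l =>
    RInt (fun x => Psi (gam k h x) * kern x) (plo k h l) (phi k h l))).
  split; [|apply pieces_bound].
  intros k h Hk Hh.
  apply (is_RInt_ext (fun x => lsum (zr (- L) L) (fun l => indic (arcl k h l x) * (Psi (gam k h x) * kern x)))).
  - intros x _.
    rewrite (lsum_ext _ _ (fun l => (Psi (gam k h x) * kern x) * indic (arcl k h l x))) by (intros; ring).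
    rewrite lsum_scal, Rmult_comm. f_equal.
    destruct (classic (arc k h x)) as [A|A].
    + rewrite (indic_true _ A). set (l0 := Zfloor (gam k h x)).
      assert (Hl0 : IZR l0 <= gam k h x < IZR l0 + 1) by apply Zfloor_bound.
      rewrite (lsum_ext _ _ (fun l => indic (l = l0))).
      * apply lsum_unique; [apply NoDup_zr|]. apply In_zr.
        destruct (HLarge k h x Hk Hh A) as [B1 B2].
        split; [|assert (l0 < L)%Z by (apply lt_IZR; lra); lia].
        assert (- L < l0 + 1)%Z by (apply lt_IZR; rewrite opp_IZR, plus_IZR; lra). lia.
      * intros l _. unfold indic. destruct excluded_middle_informative as [G|G];
        destruct excluded_middle_informative as [E|E]; auto; exfalso.
        -- apply E. destruct G as [_ [G1 G2]].
           assert (l < l0 + 1)%Z by (apply lt_IZR; rewrite plus_IZR; lra).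
           assert (l0 < l + 1)%Z by (apply lt_IZR; rewrite plus_IZR; lra). lia.
        -- apply G. subst l. split; auto.
    + rewrite (indic_false _ A). rewrite (lsum_ext _ _ (fun _ => 0)); [rewrite lsum_const; ring|].
      intros l _. apply indic_false. intros [G _]; auto.
  - apply is_RInt_lsum. intros l _. destruct (ends_spec k h l) as [E1 [E2 [E3 [E4 E5]]]].
    apply (is_RInt_indic (arcl k h l) (fun x => Psi (gam k h x) * kern x) xi1 xi2 (plo k h l) (phi k h l)); auto.
    apply (RInt_correct (fun x => Psi (gam k h x) * kern x)).
    destruct (classic (nd k h l)) as [N|N].
    + apply (ex_RInt_continuous (fun x => Psi (gam k h x) * kern x)).
      minmax. intros x Hx.
      destruct (nd_closed k h l x N Hx) as [C1 _].
      apply (continuous_mult (fun x => Psi (gam k h x)) kern).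
      * apply (continuous_comp (gam k h) Psi); [|apply HPsi].
        by_derivative. unfold gam. auto_derive. lra.
      * by_derivative. unfold kern. auto_derive.
         split; [lra|]. nra.
    + replace (phi k h l) with (plo k h l) by (unfold nd in N; lra).
      exists 0. exact (is_RInt_point _ _).
Qed.
End Pieces.

Lemma NoDup_prod {A B} (l : list A) (m : list B) : NoDup l -> NoDup m -> NoDup (list_prod l m).
Proof.
  intros Hl Hm. induction Hl as [|a l Ha Hl IH]; simpl; [constructor|].
  apply NoDup_app; auto.
  - apply NoDup_map_NoDup_ForallPairs; auto. intros x y _ _ E. inversion E; auto.
  - intros [x y] H1 H2. apply in_map_iff in H1. destruct H1 as [z [E _]]. inversion E; subst.
    apply in_prod_iff in H2. tauto.
Qed.

(** Pigeonhole: the fractional parts of the multiples of [x] from 0 to Q fall into Q bins. *)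
Lemma dirichlet (Q : Z) (x : R) : (1 <= Q)%Z -> exists k, (1 <= k <= Q)%Z /\ near_int (IZR Q) k x.
Proof.
  intros HQ. assert (HQ1 : 1 <= IZR Q) by (apply IZR_le; auto).
  set (fr := fun i : nat => INR i * x - IZR (Zfloor (INR i * x))).
  assert (Hfr : forall i, 0 <= fr i < 1) by (intros i; unfold fr; pose proof (Zfloor_bound (INR i * x)); lra).
  set (bin := fun i : nat => Z.to_nat (Zfloor (IZR Q * fr i))).
  assert (Hb : forall i, IZR (Zfloor (IZR Q * fr i)) = INR (bin i)).
  { intros i. unfold bin. rewrite INR_IZR_INZ, Z2Nat.id; auto. apply Zfloor_lub. pose proof (Hfr i). nra. }
  destruct (classic (exists i j, (i < j <= Z.to_nat Q)%nat /\ bin i = bin j)) as [[i [j [Hij E]]]|N].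
  - exists (Z.of_nat (j - i)). split; [lia|].
    exists (Zfloor (INR j * x) - Zfloor (INR i * x))%Z.
    rewrite <- INR_IZR_INZ, minus_INR, minus_IZR by lia.
    replace ((INR j - INR i) * x - (IZR (Zfloor (INR j * x)) - IZR (Zfloor (INR i * x)))) with (fr j - fr i) by (unfold fr; ring).
    pose proof (Zfloor_bound (IZR Q * fr i)) as Bi. pose proof (Zfloor_bound (IZR Q * fr j)) as Bj.
    rewrite Hb in Bi, Bj. rewrite E in Bi.
    apply (Rmult_le_reg_l (IZR Q)); [lra|]. rewrite Rinv_r by lra.
    rewrite <- (Rabs_pos_eq (IZR Q)) by lra. rewrite <- Rabs_mult. apply Rabs_le. lra.
  - exfalso.
    assert (ND : NoDup (map bin (seq 0 (Z.to_nat Q + 1)))).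
    { apply NoDup_map_NoDup_ForallPairs; [|apply seq_NoDup]. intros i j Hi Hj E.
      apply in_seq in Hi. apply in_seq in Hj.
      destruct (Nat.lt_trichotomy i j) as [L|[L|L]]; auto; exfalso; apply N.
      - exists i, j. lia.
      - exists j, i. lia. }
    apply (NoDup_incl_length (l' := seq 0 (Z.to_nat Q))) in ND.
    + rewrite length_map, !length_seq in ND. lia.
    + intros b Hbin. apply in_map_iff in Hbin. destruct Hbin as [i [<- _]]. apply in_seq.
      assert (INR (bin i) < IZR Q).
      { rewrite <- Hb. pose proof (Zfloor_bound (IZR Q * fr i)). pose proof (Hfr i). nra. }
      rewrite INR_IZR_INZ in H. apply lt_IZR in H. lia.
Qed.

Lemma minden_exists (Q : Z) (x : R) : (1 <= Q)%Z -> exists k, minden (IZR Q) k x.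
Proof.
  intros HQ. destruct (dirichlet Q x HQ) as [k0 [Hk0 Nk0]].
  assert (G : forall n : nat, forall k, (1 <= k <= Z.of_nat n)%Z -> near_int (IZR Q) k x -> exists k, minden (IZR Q) k x).
  { induction n as [|n IH]; intros k Hk Nk; [lia|].
    destruct (classic (exists k', (1 <= k' < k)%Z /\ near_int (IZR Q) k' x)) as [[k' [Hk' Nk']]|N].
    - apply (IH k'); auto. lia.
    - exists k. repeat split; auto; try lia. intros k' Hk' Nk'. apply N. eauto. }
  apply (G (Z.to_nat k0) k0); auto. lia.
Qed.

Lemma minden_le (Q : Z) k x : (1 <= Q)%Z -> minden (IZR Q) k x -> (k <= Q)%Z.
Proof.
  intros HQ [H1 [_ Hm]]. destruct (dirichlet Q x HQ) as [k0 [Hk0 Nk0]].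
  destruct (Z_lt_le_dec k0 k) as [L|L]; [|lia]. exfalso. apply (Hm k0); auto. lia.
Qed.

(** * Integrals over a segment of the horocycle *)

Lemma is_RInt_abs_le (u g : R -> R) a b Iu Ig : a <= b ->
  (forall x, a <= x <= b -> Rabs (u x) <= g x) -> is_RInt u a b Iu -> is_RInt g a b Ig -> Rabs Iu <= Ig.
Proof. intros Hab Hu. exact (norm_RInt_le u g a b Iu Ig Hab Hu). Qed.

Lemma is_RInt_indic_const E a b len m : a <= b -> 0 <= len -> 0 <= m -> convex E ->
  (forall x, E x -> a <= x <= b) -> (forall x y, E x -> E y -> x <= y -> y - x <= len) ->
  exists I, is_RInt (fun x => indic (E x) * m) a b I /\ I <= len * m.
Proof.
  intros Hab Hlen Hm HE Hin Hl.
  destruct (convex_endpoints E a b Hab HE Hin) as [[p q] [H1 [H2 [H3 [H4 H5]]]]]. simpl in *.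
  exists ((q - p) * m). split.
  - apply (is_RInt_indic E (fun _ => m) a b p q); auto. apply is_RInt_const_R.
  - apply Rmult_le_compat_r; auto. apply Rnot_lt_le. intros N.
    set (e := (q - p - len) / 4).
    assert (A : p + e < q - e) by (unfold e; lra).
    pose proof (Hl (p + e) (q - e) ltac:(apply H4; unfold e in *; lra) ltac:(apply H4; unfold e in *; lra) ltac:(lra)).
    unfold e in *. lra.
Qed.

Lemma ex_RInt_indic E g a b : a <= b -> convex E -> (forall x, E x -> a <= x <= b) ->
  (forall x, a <= x <= b -> continuous g x) -> exists I, is_RInt (fun x => indic (E x) * g x) a b I.
Proof.
  intros Hab HE Hin Hg.
  destruct (convex_endpoints E a b Hab HE Hin) as [[p q] [H1 [H2 [H3 [H4 H5]]]]]. simpl in *.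
  exists (RInt g p q). apply (is_RInt_indic E g a b p q); auto.
  apply (RInt_correct g). apply (ex_RInt_continuous g). minmax.
  intros x Hx. apply Hg. lra.
Qed.

(** The two arguments are the real and imaginary parts of [(a z + b) / (c z + d)] at [z = x + i y],
    written out since [f] is a real function of two real variables. *)
Definition moebius_invariant (f : R -> R -> R) : Prop :=
  forall (a b c d : Z) x y, (a * d - b * c = 1)%Z -> 0 < y ->
  f (((IZR a * x + IZR b) * (IZR c * x + IZR d) + IZR a * IZR c * y ^ 2)
      / ((IZR c * x + IZR d) ^ 2 + IZR c ^ 2 * y ^ 2))
    (y / ((IZR c * x + IZR d) ^ 2 + IZR c ^ 2 * y ^ 2)) = f x y.

(** A Lipschitz condition in the hyperbolic metric, limited to the range in which that metric is
    comparable with [(|dx| + |dy|) / y]. *)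
Definition hyperbolic_lipschitz (f : R -> R -> R) (C : R) : Prop :=
  forall x y x' y', 0 < y -> Rabs (x - x') <= y / 2 -> Rabs (y - y') <= y / 2 ->
  Rabs (f x y - f x' y') <= C * ((Rabs (x - x') + Rabs (y - y')) / y).

Section Core.
Variables (f : R -> R -> R) (Cf : R).
Hypothesis HCf : 0 < Cf.
Hypothesis finv : moebius_invariant f.
Hypothesis fbound : forall x y, 0 < y -> Rabs (f x y) <= Cf.
Hypothesis flip : hyperbolic_lipschitz f Cf.

Lemma f_continuous_x y x : 0 < y -> continuous (fun x => f x y) x.
Proof using All.
  intros Hy. apply continuity_pt_filterlim. intros e He. simpl.
  set (d := Rmin (y / 2) (e * y / (2 * Cf))).
  assert (Hd : 0 < d) by (unfold d; apply Rmin_glb_lt; pos).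
  exists d. split; auto. intros z [_ Hz]. simpl in *. unfold R_dist in *.
  assert (H1 : Rabs (z - x) <= y / 2) by (unfold d in Hz; pose proof (Rmin_l (y / 2) (e * y / (2 * Cf))); lra).
  pose proof (flip z y x y Hy H1) as F. rewrite Rminus_diag_eq, Rabs_R0 in F by auto.
  eapply Rle_lt_trans; [apply F; lra|].
  assert (H2 : Rabs (z - x) <= e * y / (2 * Cf)) by (unfold d in Hz; pose proof (Rmin_r (y / 2) (e * y / (2 * Cf))); lra).
  rewrite Rplus_0_r.
  apply Rle_lt_trans with (Cf * (e * y / (2 * Cf) / y)).
  - mull. unfold Rdiv at 1 2. mulr; auto.
  - replace (Cf * (e * y / (2 * Cf) / y)) with (e / 2) by (field; lra). lra.
Qed.

Lemma f_translate x y (l : Z) : 0 < y -> f (x + IZR l) y = f x y.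
Proof using finv.
  intros Hy. rewrite <- (finv 1%Z l 0%Z 1%Z x y) by (auto; lia). f_equal; field_simplify; lra.
Qed.

(* Along a horocycle away from its base point h/k, the matrix moves x + iy to the point
   gam x + i y / (k x - h)^2 up to a small hyperbolic distance. *)
Lemma f_moebius_approx k h x y : (- av k h * h - bv k h * k = 1)%Z -> 0 < y ->
  0 < IZR k * x - IZR h -> Rabs (IZR k) * y / (IZR k * x - IZR h) <= / 2 ->
  Rabs (f x y - f (gam k h x) (y / (IZR k * x - IZR h) ^ 2)) <= Cf * (2 * (Rabs (IZR k) * y / (IZR k * x - IZR h))).
Proof using All.
  intros D Hy Hx Hs.
  rewrite <- (finv (av k h) (bv k h) k (- h)%Z x y) by (auto; lia).
  rewrite opp_IZR. apply (f_equal IZR) in D. rewrite minus_IZR, !mult_IZR, opp_IZR in D.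
  set (a := IZR (av k h)) in *. set (b := IZR (bv k h)) in *. set (K := IZR k) in *.
  replace (K * x + - IZR h) with (K * x - IZR h) by ring.
  set (q := K * x - IZR h) in *. set (Y := y / q ^ 2). set (e := Rabs K * y / q) in *.
  assert (Hq2 : 0 < q ^ 2) by pos.
  assert (HY : 0 < Y) by pos.
  set (N := q ^ 2 + K ^ 2 * y ^ 2).
  assert (HK : 0 <= K ^ 2 * y ^ 2) by pos.
  assert (HN : q ^ 2 <= N) by (unfold N; lra).
  assert (He : 0 <= e) by pos.
  assert (EK : K ^ 2 * y ^ 2 = e ^ 2 * q ^ 2).
  { unfold e. rewrite <- (Rabs_pos_eq (K ^ 2)), <- RPow_abs by apply pow2_ge_0. field. lra. }
  assert (E1 : ((a * x + b) * q + a * K * y ^ 2) / N - gam k h x = K * y ^ 2 / (N * q)).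
  { unfold gam. fold a b K q.
    replace (K * y ^ 2 / (N * q)) with (K * y ^ 2 * (- a * IZR h - b * K) / (N * q)) by (rewrite D; field; split; lra).
    unfold N. assert (q ^ 2 + K ^ 2 * y ^ 2 <> 0) by lra.
    assert (Eh : IZR h = K * x - q) by (unfold q; ring). rewrite Eh. field. lra. }
  assert (A1 : Rabs (((a * x + b) * q + a * K * y ^ 2) / N - gam k h x) <= Y * e).
  { rewrite E1. unfold Rdiv. rewrite Rabs_mult, Rabs_mult, (Rabs_pos_eq (y ^ 2)) by apply pow2_ge_0.
    rewrite (Rabs_pos_eq (/ (N * q))) by pos.
    replace (Y * e) with (Rabs K * y ^ 2 * / (q ^ 2 * q)) by (unfold Y, e; field; lra).
    apply Rmult_le_compat_l; [apply Rmult_le_pos; [apply Rabs_pos|apply pow2_ge_0]|].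
    apply Rinv_le_contravar; [pos|]. nra. }
  assert (A2 : Rabs (y / N - Y) <= Y * e).
  { replace (y / N - Y) with (- (Y * (K ^ 2 * y ^ 2 / N))) by (unfold Y, N; field; split; fold N; lra).
    rewrite Rabs_Ropp, Rabs_mult, (Rabs_pos_eq Y) by lra. mull.
    rewrite Rabs_pos_eq by pos.
    rewrite EK. apply (Rmult_le_reg_r N); [lra|]. unfold Rdiv. rewrite Rmult_assoc, Rinv_l, Rmult_1_r by lra.
    nra. }
  assert (Ye : Y * e <= Y / 2) by nra.
  rewrite Rabs_minus_sym. rewrite Rabs_minus_sym in A1, A2.
  eapply Rle_trans; [apply flip; auto; lra|].
  mull. apply (Rmult_le_reg_r Y); auto.
  unfold Rdiv. rewrite Rmult_assoc, Rinv_l, Rmult_1_r by lra. lra.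
Qed.

(** A relative change [1 / n] of [u] changes the height by at most the relative amount [3 / n]; for
    [n >= 6] this is at most [1/2], as [hyperbolic_lipschitz] demands. *)
Lemma f_level_approx X y u v n : 0 < y -> 0 < u -> u <= v -> 6 <= n -> v <= u * (1 + / n) ->
  Rabs (f X (y / v ^ 2) - f X (y / u ^ 2)) <= Cf * (3 / n).
Proof using All.
  intros Hy Hu Huv Hn Hv.
  assert (Hi : 0 < / n <= / 6) by (split; [apply Rinv_0_lt_compat; lra|apply Rinv_le_contravar; lra]).
  assert (HV : 0 < y / v ^ 2) by pos.
  assert (R1 : v ^ 2 <= u ^ 2 * (1 + 3 * / n)).
  { apply Rle_trans with ((u * (1 + / n)) ^ 2); [apply pow_incr; lra|].
    nra. }
  assert (R2 : u ^ 2 <= v ^ 2) by nra.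
  assert (D : 0 <= y / u ^ 2 - y / v ^ 2 <= y / v ^ 2 * (3 / n)).
  { assert (0 < u ^ 2) by pos. assert (0 < v ^ 2) by lra.
    replace (y / u ^ 2 - y / v ^ 2) with (y / v ^ 2 * ((v ^ 2 - u ^ 2) / u ^ 2)) by (field; lra).
    split.
    - pos.
    - mull. apply (Rmult_le_reg_r (u ^ 2)); auto.
      unfold Rdiv. rewrite Rmult_assoc, Rinv_l by lra. lra. }
  assert (D3 : y / v ^ 2 * (3 / n) <= y / v ^ 2 / 2).
  { nra. }
  eapply Rle_trans; [apply flip; auto|].
  - rewrite Rminus_diag_eq, Rabs_R0 by auto. lra.
  - rewrite Rabs_minus_sym, Rabs_pos_eq by lra. lra.
  - rewrite Rminus_diag_eq, Rabs_R0 by auto. rewrite Rabs_minus_sym, Rabs_pos_eq by lra.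
    mull. rewrite Rplus_0_l.
    apply (Rmult_le_reg_r (y / v ^ 2)); auto. unfold Rdiv at 1. rewrite Rmult_assoc, Rinv_l by lra. lra.
Qed.

Lemma telescope (n q0 : nat) (a : nat -> R) : (q0 <= n)%nat ->
  lsum (seq 1 n) (fun q => indic (q <= q0)%nat * (a q - a (q - 1)%nat)) = a q0 - a 0%nat.
Proof.
  revert q0. induction n as [|n IH]; intros q0 Hq.
  - replace q0 with 0%nat by lia. simpl. ring.
  - rewrite seq_S, lsum_app. simpl lsum at 2. replace (1 + n - 1)%nat with n by lia.
    destruct (Nat.eq_dec q0 (S n)) as [->|N].
    + rewrite (lsum_ext _ _ (fun q => indic (q <= n)%nat * (a q - a (q - 1)%nat))).
      * rewrite (IH n) by lia. rewrite indic_true by lia. replace (n - 0)%nat with n by lia. ring.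
      * intros q Hi. apply in_seq in Hi. rewrite !indic_true by lia. lra.
    + rewrite (IH q0) by lia. rewrite indic_false by lia. ring.
Qed.

Variables (eta b1 R0 B rho omega xi1 xi2 y : R) (Q H : Z).
Hypothesis Hrho : 0 < rho <= 1.
Hypothesis HR0 : rho <= R0 <= b1.
Hypothesis HR1 : 4 * R0 <= b1 ^ 2.
Hypothesis HQ : 32 <= IZR Q * rho.
Hypothesis HB : 0 < B.
Hypothesis H2 : IZR Q ^ 3 * R0 * b1 <= B.
Hypothesis H3 : IZR Q ^ 4 * R0 * b1 ^ 3 <= B ^ 2.
Hypothesis Hxi : eta + b1 <= xi1 /\ xi1 <= xi2 /\ xi2 <= eta + b1 + R0.
Hypothesis Hy : 0 < y.
(** Brings the error terms [R0 Q^2 y / b1^2] below the main term [sqrt R0 / (Q b1^2)]. *)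
Hypothesis Hy2 : IZR Q ^ 3 * sqrt R0 * y <= 1.

Let Qp : 0 < IZR Q := Q_pos_aux rho (IZR Q) Hrho HQ.

Lemma Q_ge1 : (1 <= Q)%Z.
Proof using Hrho HQ. apply le_IZR. nra. Qed.

Let krn := kern eta B omega.

Definition hsum (F : Z -> Z -> R) : R := lsum (zr (- Q) Q) (fun k => lsum (zr (- H) H) (fun h => F k h)).

Lemma hsum_plus F G : hsum (fun k h => F k h + G k h) = hsum F + hsum G.
Proof. unfold hsum. rewrite <- lsum_plus. apply lsum_ext. intros. rewrite <- lsum_plus. lra. Qed.

Lemma hsum_lsum {A} (l : list A) F : hsum (fun k h => lsum l (fun a => F a k h)) = lsum l (fun a => hsum (F a)).
Proof.
  unfold hsum.
  transitivity (lsum (zr (- Q) Q) (fun k => lsum l (fun a => lsum (zr (- H) H) (fun h => F a k h)))).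
  - apply lsum_ext. intros k _. apply lsum_swap.
  - apply (lsum_swap (zr (- Q) Q) l (fun k a => lsum (zr (- H) H) (fun h => F a k h))).
Qed.

Lemma hsum_abs_le F G : (forall k h, In k (zr (- Q) Q) -> In h (zr (- H) H) -> Rabs (F k h) <= G k h) ->
  Rabs (hsum F) <= hsum G.
Proof.
  intros HF. unfold hsum. via Rabs_lsum. apply lsum_le. intros k Hk.
  via Rabs_lsum. apply lsum_le. auto.
Qed.

Lemma kern_continuous x : xi1 <= x <= xi2 -> continuous krn x.
Proof using All.
  intros Hx. assert (0 < x - eta) by lra.
  by_derivative. unfold krn, kern. auto_derive.
  nra.
Qed.

Lemma kern_bound x : xi1 <= x <= xi2 -> Rabs (krn x) <= / b1 ^ 2.
Proof using All.
  intros Hx. assert (0 < b1) by lra. unfold krn, kern, Rdiv. rewrite Rabs_mult.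
  rewrite (Rabs_pos_eq (/ _)) by pos.
  rewrite <- (Rmult_1_l (/ b1 ^ 2)). apply Rmult_le_compat; try apply Rabs_pos.
  - pos.
  - apply Rabs_cos_le.
  - apply Rinv_le_contravar; [pos|]. nra.
Qed.

Section Class.
Variable w : R.
Hypothesis Hw : 0 < w.
Hypothesis HwQ : 2 * w * IZR Q <= 1.
Hypothesis Hwy : 2 * IZR Q * y <= w.

Let arcw w' := arc w w' xi1 xi2 Q.
Let G := pair_const rho * ((1 + ln (2 + / w)) * (R0 / (IZR Q ^ 2 * b1 ^ 4))).

Lemma gam_large w' : exists L : Z, forall k h x, In k (zr (- Q) Q) -> In h (zr (- H) H) ->
  arcw w' k h x -> - IZR L <= gam k h x < IZR L.
Proof using All.
  set (X := Rabs xi1 + Rabs xi2).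
  destruct (list_upper_bound (list_prod (zr (- Q) Q) (zr (- H) H))
    (fun t => (Rabs (IZR (av (fst t) (snd t))) * X + Rabs (IZR (bv (fst t) (snd t)))) / w)) as [m Hm].
  exists (Zfloor m + 1)%Z. intros k h x Hk Hh [Hx [_ Hq]].
  specialize (Hm (k, h) ltac:(apply in_prod_iff; auto)). simpl in Hm.
  assert (Hg : Rabs (gam k h x) <= m).
  { below Hm. unfold gam, Rdiv. rewrite Rabs_mult.
    apply Rmult_le_compat; try apply Rabs_pos.
    - via Rabs_triang. rewrite Rabs_mult. apply Rplus_le_compat_r.
      mull. unfold X.
      unfold Rabs; repeat destruct Rcase_abs; lra.
    - rewrite Rabs_pos_eq by pos. apply Rinv_le_contravar; lra. }
  apply Rabs_le_between in Hg. rewrite plus_IZR. pose proof (Zfloor_bound m). lra.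
Qed.

Lemma level_sum w' Psi c : w <= w' <= 2 * w -> (forall x, continuous Psi x) ->
  (forall x l, Psi (x + IZR l) = Psi x) -> (forall x, Rabs (Psi x) <= c) -> 0 < c ->
  exists val : Z -> Z -> R,
  (forall k h, In k (zr (- Q) Q) -> In h (zr (- H) H) ->
    is_RInt (fun x => indic (arcw w' k h x) * (Psi (gam k h x) * krn x)) xi1 xi2 (val k h)) /\
  Rabs (hsum val) <= c * sqrt G.
Proof using All.
  intros Hww P1 P2 P3 P4. destruct (gam_large w') as [L HL].
  apply (arc_sum_bound eta b1 R0 B w w' rho omega xi1 xi2 Q H L); auto.
  - nra.
  - intros k x. apply minden_le. apply Q_ge1.
Qed.

Lemma arcw_convex w' k h : w' <= 2 * w -> convex (arcw w' k h).
Proof using All.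
  intros Hw'. apply (arc_convex w w' rho); auto. nra.
Qed.

(** Along an arc the transformed height [y / u^2], with [u = k x - h], depends on [x]. The levels
    [wq] descend from [2 w] towards [w] in steps of [w / n]. With [q0] the last level such that
    [u <= wq q0], the height is replaced by [y / (wq q0)^2], and [Psi q0] is [Psi 0] plus the
    differences [Psi q - Psi (q - 1)] for [q <= q0]. The q-th difference lives on [u <= wq q], which
    is again an arc, so [level_sum] applies with [3 Cf / n] in place of [Cf]. Fewer than [n]
    differences and [Psi 0] together give the factor 4. *)
Lemma class_bound (n : nat) : 6 <= INR n -> 3 / (IZR Q ^ 2 * y) <= INR n ->
  exists val : Z -> Z -> R,
  (forall k h, In k (zr (- Q) Q) -> In h (zr (- H) H) ->
    is_RInt (fun x => indic (arcw (2 * w) k h x) * (f x y * krn x)) xi1 xi2 (val k h)) /\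
  Rabs (hsum val) <= 4 * Cf * sqrt G + 23 / rho * Cf * (R0 * IZR Q ^ 2 * y / b1 ^ 2).
Proof using All.
  intros Hn6 Hn. set (N := INR n) in *.
  assert (HN : 0 < / N <= / 6) by (split; [apply Rinv_0_lt_compat; lra|apply Rinv_le_contravar; lra]).
  set (wq := fun q : nat => w * (2 - INR q / N)).
  assert (Hwq : forall q, (q < n)%nat -> w < wq q <= 2 * w).
  { intros q Hq. assert (0 <= INR q <= N - 1).
    { split; [apply pos_INR|]. unfold N. apply le_INR in Hq. rewrite S_INR in Hq. lra. }
    assert (0 <= INR q / N < 1).
    { split; [apply Rmult_le_pos; lra|]. apply (Rmult_lt_reg_r N); [lra|]. unfold Rdiv. rewrite Rmult_assoc, Rinv_l by lra. lra. }
    unfold wq. nra. }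
  assert (Hstep : forall q, wq q = wq (S q) + w * / N).
  { intros q. unfold wq. rewrite S_INR. lra. }
  set (Psi := fun (q : nat) X => f X (y / wq q ^ 2)).
  assert (HY : forall q, (q < n)%nat -> 0 < y / wq q ^ 2).
  { intros q Hq. pose proof (Hwq q Hq). pos. }
  assert (Pc : forall q x, (q < n)%nat -> continuous (Psi q) x) by (intros; apply f_continuous_x; auto).
  assert (Pp : forall q x l, (q < n)%nat -> Psi q (x + IZR l) = Psi q x) by (intros; apply f_translate; auto).
  assert (Hn0 : (0 < n)%nat) by (destruct n; [unfold N in Hn6; simpl in Hn6; lra|lia]).
  assert (W0 : wq 0%nat = 2 * w) by (unfold wq; simpl; field; lra).
  destruct (level_sum (2 * w) (Psi 0%nat) Cf) as [val0 [V0 V0b]]; auto; [lra|intros; apply fbound; auto|].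
  assert (HA : forall q : nat, exists val : Z -> Z -> R, (1 <= q < n)%nat ->
     (forall k h, In k (zr (- Q) Q) -> In h (zr (- H) H) ->
       is_RInt (fun x => indic (arcw (wq q) k h x) * ((Psi q (gam k h x) - Psi (q - 1)%nat (gam k h x)) * krn x)) xi1 xi2 (val k h)) /\
     Rabs (hsum val) <= Cf * (3 / N) * sqrt G).
  { intros q. destruct (classic (1 <= q < n)%nat) as [Hq|Hq]; [|exists (fun _ _ => 0); tauto].
    pose proof (Hwq q ltac:(lia)) as Wq. pose proof (Hwq (q - 1)%nat ltac:(lia)) as Wq1.
    pose proof (Hstep (q - 1)%nat) as St. replace (S (q - 1)) with q in St by lia.
    destruct (level_sum (wq q) (fun X => Psi q X - Psi (q - 1)%nat X) (Cf * (3 / N))) as [val V].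
    - lra.
    - intros x. apply (continuous_minus (Psi q) (Psi (q - 1)%nat)); apply Pc; lia.
    - intros x l. rewrite !Pp by lia. reflexivity.
    - assert (0 < w * / N) by (destruct HN; pos).
      assert (w * / N <= wq q * / N) by (apply Rmult_le_compat_r; lra).
      intros x. rewrite Rabs_minus_sym. apply f_level_approx; auto; lra.
    - pos.
    - exists val. auto. }
  set (V := fun q => proj1_sig (constructive_indefinite_description _ (HA q))).
  assert (HV := fun q => proj2_sig (constructive_indefinite_description _ (HA q))).
  change (forall q, (1 <= q < n)%nat ->
     (forall k h, In k (zr (- Q) Q) -> In h (zr (- H) H) ->
       is_RInt (fun x => indic (arcw (wq q) k h x) * ((Psi q (gam k h x) - Psi (q - 1)%nat (gam k h x)) * krn x)) xi1 xi2 (V q k h)) /\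
     Rabs (hsum (V q)) <= Cf * (3 / N) * sqrt G) in HV.
  clearbody V.
  assert (HF : forall t : Z * Z, exists v, is_RInt (fun x => indic (arcw (2 * w) (fst t) (snd t) x) * (f x y * krn x)) xi1 xi2 v).
  { intros [k h]. apply ex_RInt_indic; [lra|apply arcw_convex; lra|intros x [A _]; exact A|].
    intros x Hx. apply (continuous_mult (fun x => f x y) krn); [apply f_continuous_x; auto|apply kern_continuous; auto]. }
  set (val := fun k h => proj1_sig (constructive_indefinite_description _ (HF (k, h)))).
  assert (Hval : forall k h, is_RInt (fun x => indic (arcw (2 * w) k h x) * (f x y * krn x)) xi1 xi2 (val k h)).
  { intros k h. unfold val. destruct constructive_indefinite_description as [v Hv]. auto. }
  clearbody val.
  exists val. split; [intros; apply Hval|].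
  set (VA := fun k h => val0 k h + lsum (seq 1 (n - 1)) (fun q => V q k h)).
  assert (Hb1 : 0 < b1) by lra.
  (* Pointwise error: [2 Q y / w] from the Moebius approximation and [3 / N] from the replaced
     height, times the bound [1 / b1^2] of the kernel. *)
  set (m := Cf * (2 * (IZR Q * y / w) + 3 / N) * / b1 ^ 2).
  assert (Hm : 0 <= m).
  { pos. }
  assert (HD : forall k h, In k (zr (- Q) Q) -> In h (zr (- H) H) ->
    is_RInt (fun x => indic (arcw (2 * w) k h x) * (f x y * krn x) -
      (indic (arcw (2 * w) k h x) * (Psi 0%nat (gam k h x) * krn x) +
       lsum (seq 1 (n - 1)) (fun q => indic (arcw (wq q) k h x) * ((Psi q (gam k h x) - Psi (q - 1)%nat (gam k h x)) * krn x))))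
     xi1 xi2 (val k h - VA k h)).
  { intros k h Hk Hh. apply (is_RInt_minus (fun x => indic (arcw (2 * w) k h x) * (f x y * krn x))); auto.
    apply (is_RInt_plus (fun x => indic (arcw (2 * w) k h x) * (Psi 0%nat (gam k h x) * krn x))); auto.
    apply is_RInt_lsum. intros q Hq. apply in_seq in Hq. apply HV; auto. lia. }
  assert (PW : forall k h x,
    Rabs (indic (arcw (2 * w) k h x) * (f x y * krn x) -
      (indic (arcw (2 * w) k h x) * (Psi 0%nat (gam k h x) * krn x) +
       lsum (seq 1 (n - 1)) (fun q => indic (arcw (wq q) k h x) * ((Psi q (gam k h x) - Psi (q - 1)%nat (gam k h x)) * krn x))))
    <= indic (arcw (2 * w) k h x) * m).
  { intros k h x. destruct (classic (arcw (2 * w) k h x)) as [A|A].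
    - rewrite !(indic_true _ A). rewrite !Rmult_1_l.
      assert (A' := A). destruct A' as [Ax [Am Aq]].
      assert (Det : (- av k h * h - bv k h * k = 1)%Z) by (apply (arc_det w (2 * w) rho xi1 xi2 Q Hrho HQ Hw HwQ k h x A)).
      assert (HkQ : Rabs (IZR k) <= IZR Q).
      { rewrite <- abs_IZR. apply IZR_le. apply (minden_le Q (Z.abs k) x); auto. apply Q_ge1. }
      set (u := IZR k * x - IZR h) in *.
      (* [t] is the real solution of [u = w (2 - t / N)], so its integer part [q0] is the last level
         that is still at least [u]. *)
      set (t := (2 - u / w) * N).
      assert (Hu1 : 1 < u / w <= 2).
      { split; [apply (Rmult_lt_reg_r w)|apply (Rmult_le_reg_r w)]; auto; unfold Rdiv; rewrite Rmult_assoc, Rinv_l by lra; lra. }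
      assert (Ht : 0 <= t < N) by (unfold t; split; nra).
      set (q0 := Z.to_nat (Zfloor t)).
      assert (Hq0 : INR q0 <= t < INR q0 + 1).
      { unfold q0. rewrite INR_IZR_INZ, Z2Nat.id by (apply Zfloor_lub; lra). apply Zfloor_bound. }
      assert (Hq0n : (q0 < n)%nat) by (apply INR_lt; fold N; lra).
      assert (Hle : forall q : nat, u <= wq q <-> INR q <= t).
      { intros q. unfold t, wq.
        assert (Eq : u = w * (u / w)) by (field; lra).
        assert (Eq2 : INR q = INR q / N * N) by (field; lra).
        split; intros G1.
        - rewrite Eq2. mulr. rewrite Eq in G1. apply Rmult_le_reg_l in G1; lra.
        - rewrite Eq2 in G1. apply Rmult_le_reg_r in G1; [|lra]. rewrite Eq at 1. apply Rmult_le_compat_l; lra. }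
      rewrite (lsum_ext _ _ (fun q => krn x * (indic (q <= q0)%nat * (Psi q (gam k h x) - Psi (q - 1)%nat (gam k h x))))).
      2:{ intros q Hq. apply in_seq in Hq. pose proof (Hwq q ltac:(lia)) as Wq.
          assert (Ei : indic (arcw (wq q) k h x) = indic (q <= q0)%nat).
          { unfold indic. destruct excluded_middle_informative as [G1|G1]; destruct excluded_middle_informative as [G2|G2]; auto; exfalso.
            - destruct G1 as [_ [_ [_ G1]]]. fold u in G1. apply Hle in G1.
              assert (INR q < INR (q0 + 1)) by (rewrite plus_INR; simpl; lra). apply INR_lt in H0. lia.
            - apply G1. split; auto. split; auto. fold u. split; [lra|]. apply Hle. apply le_INR in G2. lra. }
          rewrite Ei. ring. }
      rewrite lsum_scal, (telescope (n - 1) q0 (fun q => Psi q (gam k h x))) by lia.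
      replace (f x y * krn x - (Psi 0%nat (gam k h x) * krn x + krn x * (Psi q0 (gam k h x) - Psi 0%nat (gam k h x))))
        with ((f x y - Psi q0 (gam k h x)) * krn x) by ring.
      rewrite Rabs_mult. unfold m. apply Rmult_le_compat; try apply Rabs_pos; [|apply kern_bound; auto].
      assert (Hu : 0 < u) by lra.
      assert (Ke : Rabs (IZR k) * y / u <= IZR Q * y / w).
      { unfold Rdiv. apply Rmult_le_compat.
        - pos.
        - pos.
        - apply Rmult_le_compat_r; lra.
        - apply Rinv_le_contravar; lra. }
      assert (Ke2 : IZR Q * y / w <= / 2).
      { apply (Rmult_le_reg_r w); auto. unfold Rdiv. rewrite Rmult_assoc, Rinv_l by lra. lra. }
      pose proof (f_moebius_approx k h x y Det Hy Hu ltac:(fold u; lra)) as M1. fold u in M1.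
      assert (L0 : u <= wq q0) by (apply Hle; lra).
      assert (L1 : ~ u <= wq (S q0)) by (rewrite Hle, S_INR; lra).
      pose proof (f_level_approx (gam k h x) y u (wq q0) N Hy Hu L0 Hn6) as M2.
      assert (L2 : wq q0 <= u * (1 + / N)) by (rewrite Hstep; nra).
      specialize (M2 L2). rewrite Rabs_minus_sym in M2.
      replace (f x y - Psi q0 (gam k h x)) with ((f x y - f (gam k h x) (y / u ^ 2)) + (f (gam k h x) (y / u ^ 2) - Psi q0 (gam k h x))) by ring.
      via Rabs_triang. unfold Psi at 1.
      apply Rle_trans with (Cf * (2 * (Rabs (IZR k) * y / u)) + Cf * (3 / N)); [lra|].
      rewrite <- Rmult_plus_distr_l. apply Rmult_le_compat_l; lra.
    - rewrite !(indic_false _ A). rewrite (lsum_ext _ _ (fun _ => 0)).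
      + rewrite lsum_const. rewrite !Rmult_0_l, Rmult_0_r, Rplus_0_r, Rminus_0_r, Rabs_R0. lra.
      + intros q Hq. apply in_seq in Hq. pose proof (Hwq q ltac:(lia)) as Wq.
        rewrite indic_false; [ring|]. intros [G1 [G2 G3]]. apply A. split; auto. split; auto. lra. }
  assert (DB : forall k h, In k (zr (- Q) Q) -> In h (zr (- H) H) ->
    Rabs (val k h - VA k h) <= indic (exists l, good eta b1 R0 w (2 * w) Q av bv k h l) * (w * m / Rabs (IZR k))).
  { intros k h Hk Hh.
    destruct (classic (exists x, arcw (2 * w) k h x)) as [[x0 A]|Em].
    - assert (A' := A). destruct A' as [Ax [Am Aq]].
      assert (Det : (- av k h * h - bv k h * k = 1)%Z) by (apply (arc_det w (2 * w) rho xi1 xi2 Q Hrho HQ Hw HwQ k h x0 A)).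
      assert (HkQ : (1 <= Z.abs k <= Q)%Z).
      { split; [apply Am|]. apply (minden_le Q (Z.abs k) x0); auto. apply Q_ge1. }
      assert (Hk1 : 1 <= Rabs (IZR k)) by (rewrite <- abs_IZR; apply IZR_le; lia).
      rewrite indic_true, Rmult_1_l.
      2:{ exists (Zfloor (gam k h x0)). split; auto. split; auto. exists x0. split; [lra|]. split; [lra|].
          pose proof (Zfloor_bound (gam k h x0)). unfold gam in *. lra. }
      destruct (is_RInt_indic_const (arcw (2 * w) k h) xi1 xi2 (w / Rabs (IZR k)) m) as [I [HI1 HI2]]; auto; try lra.
      + pos.
      + apply arcw_convex; lra.
      + intros x [A1 _]; exact A1.
      + intros x z [_ [_ A1]] [_ [_ A2]] Hxz.
        apply (Rmult_le_reg_l (Rabs (IZR k))); [lra|].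
        replace (Rabs (IZR k) * (w / Rabs (IZR k))) with w by (field; lra).
        rewrite <- (Rabs_pos_eq (z - x)) by lra. rewrite <- Rabs_mult. apply Rabs_le. lra.
      + replace (w * m / Rabs (IZR k)) with (w / Rabs (IZR k) * m) by lra.
        below HI2.
        apply (is_RInt_abs_le _ _ xi1 xi2 _ _ ltac:(lra) (fun x _ => PW k h x) (HD k h Hk Hh) HI1).
    - apply Rle_trans with 0.
      + refine (is_RInt_abs_le _ (fun _ => 0) xi1 xi2 _ 0 ltac:(lra) _ (HD k h Hk Hh) (is_RInt_zero _ _)).
        intros x _. via PW. rewrite indic_false; [lra|]. intros A; apply Em; eauto.
      + apply Rmult_le_pos; [apply indic_bounds|]. unfold Rdiv. apply Rmult_le_pos; [apply Rmult_le_pos; lra|].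
        destruct (Req_dec (Rabs (IZR k)) 0) as [E|E]; [rewrite E, Rinv_0; lra|].
        left. apply Rinv_0_lt_compat. pose proof (Rabs_pos (IZR k)). lra. }
  (* A given pair [(k, h)] has an arc of length at most [w / |k|]; these lengths are summed over the
     pairs by [SH_inv_k]. *)
  assert (S1 : Rabs (hsum (fun k h => val k h - VA k h)) <= 3 * IZR Q * (3 / rho * R0 * (w * m))).
  { via (hsum_abs_le _ _ DB).
    apply (SH_inv_k eta b1 R0 B w (2 * w) rho Q H 0 av bv); auto; try lra. pos. }
  assert (S2 : Rabs (hsum VA) <= 4 * Cf * sqrt G).
  { unfold VA. rewrite hsum_plus, hsum_lsum. via Rabs_triang.
    assert (SG : 0 <= sqrt G) by apply sqrt_pos.
    assert (Rabs (lsum (seq 1 (n - 1)) (fun q => hsum (fun k h => V q k h))) <= N * (Cf * (3 / N) * sqrt G)).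
    { via Rabs_lsum. apply Rle_trans with (lsum (seq 1 (n - 1)) (fun _ => Cf * (3 / N) * sqrt G)).
      - apply lsum_le. intros q Hq. apply in_seq in Hq. apply HV. lia.
      - rewrite lsum_const, length_seq. apply Rmult_le_compat_r.
        + pos.
        + unfold N. apply le_INR. lia. }
    replace (N * (Cf * (3 / N) * sqrt G)) with (3 * (Cf * sqrt G)) in H0 by (field; lra).
    change (Rabs (hsum val0) + Rabs (lsum (seq 1 (n - 1)) (fun q => hsum (fun k h => V q k h))) <= 4 * Cf * sqrt G). lra. }
  assert (Eh : hsum val = hsum (fun k h => val k h - VA k h) + hsum VA).
  { rewrite <- hsum_plus. unfold hsum. apply lsum_ext. intros. apply lsum_ext. intros.
    lra. }
  rewrite Eh. via Rabs_triang.
  (* By [n >= 3 / (Q^2 y)] and [2 w Q <= 1] the bracket [2 Q^2 y + 3 Q w / N] is at most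
     [5/2 Q^2 y], and [5/2 <= 23/9]. *)
  assert (S3 : 3 * IZR Q * (3 / rho * R0 * (w * m)) <= 23 / rho * Cf * (R0 * IZR Q ^ 2 * y / b1 ^ 2)).
  { unfold m.
    replace (3 * IZR Q * (3 / rho * R0 * (w * (Cf * (2 * (IZR Q * y / w) + 3 / N) * / b1 ^ 2))))
      with (9 / rho * Cf * R0 * / b1 ^ 2 * (2 * IZR Q ^ 2 * y + 3 * (IZR Q * w) * / N)) by (field; repeat split; lra).
    replace (23 / rho * Cf * (R0 * IZR Q ^ 2 * y / b1 ^ 2)) with (9 / rho * Cf * R0 * / b1 ^ 2 * (23 / 9 * (IZR Q ^ 2 * y))) by lra.
    mull.
    assert (HQy : 0 < IZR Q ^ 2 * y) by pos.
    assert (/ N <= IZR Q ^ 2 * y / 3).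
    { replace (IZR Q ^ 2 * y / 3) with (/ (3 / (IZR Q ^ 2 * y))) by (field; repeat split; lra).
      apply Rinv_le_contravar; [pos|auto]. }
    nra. }
  lra.
Qed.
End Class.

Lemma lsum_zr_le (g : Z -> R) c : 0 <= c -> (forall k, In k (zr (- Q) Q) -> g k <= c) ->
  lsum (zr (- Q) Q) g <= 3 * IZR Q * c.
Proof using All.
  intros Hc Hg. eapply Rle_trans; [apply lsum_le; apply Hg|].
  rewrite lsum_const. apply Rmult_le_compat_r; auto.
  unfold zr. rewrite length_map, length_seq, INR_IZR_INZ, Z2Nat.id by (pose proof Q_ge1; lia).
  rewrite plus_IZR, minus_IZR, opp_IZR. nra.
Qed.

Section Left.
Variable wT : R.
Hypothesis HwT : 0 < wT.
Hypothesis HwTQ : wT <= / IZR Q.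
Hypothesis HwTy : wT <= 4 * IZR Q * y.

Definition left_arc (k h : Z) (x : R) : Prop :=
  xi1 <= x <= xi2 /\ minden (IZR Q) k x /\ Rabs (IZR k * x - IZR h) <= wT.

Lemma left_convex k h : convex (left_arc k h).
Proof using All.
  intros x z u [X1 [X2 X3]] [Z1 [Z2 Z3]] Hz.
  assert (Hk : (1 <= k)%Z) by apply X2.
  split; [lra|]. split.
  - replace k with (Z.abs k) by lia. replace k with (Z.abs k) in X2 at 1 by lia.
    replace k with (Z.abs k) in Z2 at 1 by lia.
    apply (minden_convex (IZR Q) k h x z u); auto; lra.
  - apply Rabs_le_between in X3. apply Rabs_le_between in Z3.
    assert (1 <= IZR k) by (apply IZR_le; auto). apply Rabs_le. nra.
Qed.

(** Only lengths matter: at most [3 / rho k R0] values of [h] for each [k], an arc of length at most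
    [2 wT / k] for each pair, and [wT <= 4 Q y]. *)
Lemma left_bound : exists val : Z -> Z -> R,
  (forall k h, is_RInt (fun x => indic (left_arc k h x) * (f x y * krn x)) xi1 xi2 (val k h)) /\
  Rabs (hsum val) <= 72 / rho * Cf * (R0 * IZR Q ^ 2 * y / b1 ^ 2).
Proof using All.
  assert (Hb1 : 0 < b1) by lra.
  assert (HF : forall t : Z * Z, exists v, is_RInt (fun x => indic (left_arc (fst t) (snd t) x) * (f x y * krn x)) xi1 xi2 v).
  { intros [k h]. apply ex_RInt_indic; [lra|apply left_convex|intros x [A _]; exact A|].
    intros x Hx. apply (continuous_mult (fun x => f x y) krn); [apply f_continuous_x; auto|apply kern_continuous; auto]. }
  set (val := fun k h => proj1_sig (constructive_indefinite_description _ (HF (k, h)))).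
  assert (Hval : forall k h, is_RInt (fun x => indic (left_arc k h x) * (f x y * krn x)) xi1 xi2 (val k h)).
  { intros k h. unfold val. destruct constructive_indefinite_description as [v Hv]. auto. }
  clearbody val. exists val. split; auto.
  set (D := 2 * wT * (Cf * / b1 ^ 2)). assert (HD : 0 < D) by pos.
  assert (Hq1 : / IZR Q <= / 32).
  { apply Rinv_le_contravar; [lra|]. nra. }
  set (x0 := fun k => IZR k * xi1 - wT). set (nn := fun k => IZR k * R0 + 2 * wT).
  assert (Vb : forall k h, Rabs (val k h) <= indic ((1 <= k)%Z /\ x0 k <= IZR h <= x0 k + nn k) * (D / IZR k)).
  { intros k h. assert (Hk0 : forall P, 0 <= indic ((1 <= k)%Z /\ P) * (D / IZR k)).
    { intros P. unfold indic. destruct excluded_middle_informative as [[G _]|]; [|lra].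
      apply IZR_le in G. pos. }
    destruct (classic (exists x, left_arc k h x)) as [[x A]|Em].
    - assert (A' := A). destruct A' as [A1 [A2 A3]]. assert (Hk : (1 <= k)%Z) by apply A2.
      assert (Hk1 : 1 <= IZR k) by (apply IZR_le; auto).
      apply Rabs_le_between in A3.
      rewrite indic_true, Rmult_1_l.
      2:{ split; auto. unfold x0, nn.
          assert (IZR k * xi1 <= IZR k * x) by nra.
          assert (IZR k * x <= IZR k * (xi1 + R0)) by nra. lra. }
      destruct (is_RInt_indic_const (left_arc k h) xi1 xi2 (2 * wT / IZR k) (Cf * / b1 ^ 2)) as [I [HI1 HI2]]; auto; try lra.
      + pos.
      + pos.
      + apply left_convex.
      + intros z [B1 _]; exact B1.
      + intros u v [_ [_ B1]] [_ [_ B2]] Huv. apply Rabs_le_between in B1. apply Rabs_le_between in B2.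
        apply (Rmult_le_reg_l (IZR k)); [lra|].
        replace (IZR k * (2 * wT / IZR k)) with (2 * wT) by (field; lra). lra.
      + replace (D / IZR k) with (2 * wT / IZR k * (Cf * / b1 ^ 2)) by (unfold D, Rdiv; ring).
        below HI2.
        refine (is_RInt_abs_le _ _ xi1 xi2 _ _ ltac:(lra) _ (Hval k h) HI1).
        intros z Hz. rewrite Rabs_mult, (Rabs_pos_eq (indic _)) by apply indic_bounds.
        apply Rmult_le_compat_l; [apply indic_bounds|]. rewrite Rabs_mult.
        apply Rmult_le_compat; try apply Rabs_pos; [apply fbound; auto|apply kern_bound; auto].
    - below Hk0.
      refine (is_RInt_abs_le _ (fun _ => 0) xi1 xi2 _ 0 ltac:(lra) _ (Hval k h) (is_RInt_zero _ _)).
      intros z _. rewrite indic_false; [rewrite Rmult_0_l, Rabs_R0; lra|]. intros A; apply Em; eauto. }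
  via (hsum_abs_le val _ (fun k h _ _ => Vb k h)).
  assert (Hc : 0 <= 3 / rho * R0 * D) by pos.
  eapply Rle_trans.
  - apply lsum_zr_le; [exact Hc|]. intros k Hk.
    destruct (Z_lt_le_dec k 1) as [L|L].
    + rewrite (lsum_ext _ _ (fun _ => 0)); [rewrite lsum_const; lra|].
      intros h _. rewrite indic_false; [ring|lia].
    + assert (Hk1 : 1 <= IZR k) by (apply IZR_le; auto).
      apply Rle_trans with (D / IZR k * (nn k + 1)).
      * rewrite (lsum_ext _ _ (fun h => D / IZR k * indic (x0 k <= IZR h <= x0 k + nn k))).
        -- rewrite lsum_scal. mull.
           apply lsum_count. unfold nn. nra.
        -- intros h _. rewrite Rmult_comm. f_equal. unfold indic.
           destruct excluded_middle_informative; destruct excluded_middle_informative; auto; tauto.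
      * unfold nn. apply (Rmult_le_reg_l (IZR k * rho)); [apply Rmult_lt_0_compat; lra|].
        replace (IZR k * rho * (D / IZR k * (IZR k * R0 + 2 * wT + 1))) with (D * (rho * (IZR k * R0 + 2 * wT + 1))) by (field; lra).
        replace (IZR k * rho * (3 / rho * R0 * D)) with (D * (3 * (IZR k * R0))) by (field; lra).
        mull.
        assert (rho <= IZR k * R0) by nra.
        assert (rho * (IZR k * R0) <= 1 * (IZR k * R0)) by (apply Rmult_le_compat_r; lra).
        assert (rho * (2 * wT + 1) <= rho * 2) by (apply Rmult_le_compat_l; lra). lra.
  - unfold D.
    replace (3 * IZR Q * (3 / rho * R0 * (2 * wT * (Cf * / b1 ^ 2)))) with (18 / rho * Cf * R0 * IZR Q * / b1 ^ 2 * wT) by lra.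
    replace (72 / rho * Cf * (R0 * IZR Q ^ 2 * y / b1 ^ 2)) with (18 / rho * Cf * R0 * IZR Q * / b1 ^ 2 * (4 * IZR Q * y)) by lra.
    apply Rmult_le_compat_l; auto. pos.
Qed.
End Left.

Hypothesis HH : forall k h x, In k (zr (- Q) Q) -> xi1 <= x <= xi2 -> Rabs (IZR k * x - IZR h) <= 1 ->
  In h (zr (- H) H).

Lemma near_unique k x h h' : Rabs (IZR k * x - IZR h) <= / IZR Q -> Rabs (IZR k * x - IZR h') <= / IZR Q -> h = h'.
Proof using All.
  intros A B'. apply Rabs_le_between in A. apply Rabs_le_between in B'.
  assert (/ IZR Q <= / 32) by (apply Rinv_le_contravar; nra).
  assert (IZR h < IZR h' + 1) by lra. assert (IZR h' < IZR h + 1) by lra.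
  rewrite <- plus_IZR in *. apply lt_IZR in H1. apply lt_IZR in H4. lia.
Qed.

Lemma minden_unique k k' x : minden (IZR Q) k x -> minden (IZR Q) k' x -> k = k'.
Proof.
  intros [A1 [A2 A3]] [B1 [B2 B3]]. destruct (Z.lt_trichotomy k k') as [L|[L|L]]; auto; exfalso.
  - apply (B3 k); auto; lia.
  - apply (A3 k'); auto; lia.
Qed.

(** The dyadic windows descend from [1 / Q] and stop just above [2 Q y], the smallest [w] that
    [class_bound] admits. [Hy2] makes [Q^2 y] small, so that the first window lies above this
    limit. *)
Lemma dyadic_level : exists T : nat, 2 * IZR Q * y < (1 / 2) ^ T / IZR Q <= 4 * IZR Q * y.
Proof using All.
  assert (HQ32 : 32 <= IZR Q) by nra.
  assert (Hr : rho <= sqrt R0).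
  { rewrite <- (sqrt_pow2 rho) by lra. apply sqrt_le_1_alt. nra. }
  assert (HQy : IZR Q ^ 2 * y <= / 32).
  { assert (32 <= IZR Q * sqrt R0).
    { nra. }
    nra. }
  assert (E : forall T : nat, (1 / 2) ^ T / IZR Q <= 4 * IZR Q * y <-> (1 / 2) ^ T <= 4 * (IZR Q ^ 2 * y)).
  { intros T. replace ((1 / 2) ^ T) with ((1 / 2) ^ T / IZR Q * IZR Q) at 2 by (field; lra).
    nra. }
  destruct (pow_lt_1_zero (1 / 2) ltac:(rewrite Rabs_pos_eq; lra) (4 * (IZR Q ^ 2 * y)) ltac:(pos)) as [N HN].
  specialize (HN N (le_n N)). rewrite Rabs_pos_eq in HN by pos.
  assert (G : forall n : nat, (1 / 2) ^ n <= 4 * (IZR Q ^ 2 * y) -> exists T : nat, 2 * IZR Q * y < (1 / 2) ^ T / IZR Q <= 4 * IZR Q * y).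
  { induction n as [|n IH]; intros Hn; [simpl in Hn; lra|].
    destruct (Rle_dec ((1 / 2) ^ n) (4 * (IZR Q ^ 2 * y))) as [D|D]; auto.
    exists (S n). split; [|apply E; auto].
    apply Rnot_le_lt in D. simpl. apply (Rmult_lt_reg_r (IZR Q)); auto.
    replace (1 / 2 * (1 / 2) ^ n / IZR Q * IZR Q) with ((1 / 2) ^ n / 2) by (field; lra). lra. }
  apply (G N). lra.
Qed.

Definition core_const : R := 8 * sqrt (pair_const rho) + 118 / rho.

(** Every [x] of the segment lies in exactly one dyadic arc or leftover arc. There are at most
    [2 Lg] dyadic classes, and each costs at most a factor [Lg] through the square root of [Lam];
    hence the square of the logarithm. *)
Lemma horocycle_bound_box :
  Rabs (RInt (fun x => f x y * krn x) xi1 xi2)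
  <= core_const * Cf * (1 + ln (2 + / y)) ^ 2 * (sqrt R0 / (IZR Q * b1 ^ 2)).
Proof using All.
  assert (HQ32 : 32 <= IZR Q) by nra. assert (Hb1 : 0 < b1) by lra.
  destruct dyadic_level as [T [HT1 HT2]].
  set (wt := fun t : nat => (1 / 2) ^ (S t) / IZR Q).
  assert (Hwt : forall t, 0 < wt t) by (intros; unfold wt; pos).
  assert (Hdbl : forall t, 2 * wt t = (1 / 2) ^ t / IZR Q) by (intros; unfold wt; simpl; field; lra).
  assert (Hmono : forall s t, (s <= t)%nat -> (1 / 2) ^ t / IZR Q <= (1 / 2) ^ s / IZR Q).
  { intros s t Hst. unfold Rdiv. mulr.
    replace t with (s + (t - s))%nat by lia. rewrite pow_add.
    rewrite <- (Rmult_1_r ((1 / 2) ^ s)) at 2. mull.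
    apply Rle_trans with (1 ^ (t - s)); [apply pow_incr; lra|rewrite pow1; lra]. }
  set (wT := (1 / 2) ^ T / IZR Q) in *.
  assert (HwT : 0 < wT) by lra.
  assert (HwTQ : wT <= / IZR Q).
  { unfold wT. pose proof (Hmono 0%nat T ltac:(lia)). lra. }
  destruct (INR_unbounded (Rmax 6 (3 / (IZR Q ^ 2 * y)))) as [n Hn].
  assert (Hn6 : 6 <= INR n) by (pose proof (Rmax_l 6 (3 / (IZR Q ^ 2 * y))); lra).
  assert (Hn3 : 3 / (IZR Q ^ 2 * y) <= INR n) by (pose proof (Rmax_r 6 (3 / (IZR Q ^ 2 * y))); lra).
  set (Lg := 1 + ln (2 + / y)).
  assert (Hiy : 0 < / y) by pos.
  assert (HLg1 : 1 <= Lg).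
  { unfold Lg. assert (0 <= ln (2 + / y)); [|lra]. rewrite <- ln_1. apply ln_le; lra. }
  set (V := sqrt R0 / (IZR Q * b1 ^ 2)).
  assert (HR : 0 < R0) by lra.
  assert (Hsr : 0 < sqrt R0) by pos.
  assert (HV : 0 < V) by pos.
  set (pc := pair_const rho). assert (Hpc : 0 < pc) by (apply pair_const_pos; lra).
  set (E := R0 * IZR Q ^ 2 * y / b1 ^ 2).
  assert (HE : E <= V).
  { unfold E, V. replace (R0 * IZR Q ^ 2 * y / b1 ^ 2) with (sqrt R0 / (IZR Q * b1 ^ 2) * (IZR Q ^ 3 * sqrt R0 * y)).
    - rewrite <- (Rmult_1_r (sqrt R0 / (IZR Q * b1 ^ 2))) at 2. apply Rmult_le_compat_l; [left; exact HV|auto].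
    - replace R0 with (sqrt R0 * sqrt R0) at 3 by (apply sqrt_sqrt; lra). field. lra. }
  assert (HG : forall t, (t < T)%nat -> sqrt (pc * ((1 + ln (2 + / wt t)) * (R0 / (IZR Q ^ 2 * b1 ^ 4)))) <= sqrt pc * Lg * V).
  { intros t Ht.
    assert (Hw2 : wT <= wt t).
    { unfold wt, wT. auto. }
    assert (/ wt t <= / y).
    { apply Rinv_le_contravar; auto. assert (1 * y <= 2 * IZR Q * y) by (apply Rmult_le_compat_r; lra). lra. }
    assert (0 < / wt t) by pos.
    assert (ln (2 + / wt t) <= ln (2 + / y)) by (apply ln_le; lra).
    apply Rle_trans with (sqrt ((sqrt pc * Lg * V) ^ 2)).
    - apply sqrt_le_1_alt.
      replace ((sqrt pc * Lg * V) ^ 2) with ((sqrt pc * sqrt pc) * (Lg * Lg * ((sqrt R0 * sqrt R0) / (IZR Q ^ 2 * b1 ^ 4)))) by (unfold V; field; lra).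
      rewrite !sqrt_sqrt by lra. mull.
      assert (HX : 0 < R0 / (IZR Q ^ 2 * b1 ^ 4)) by pos.
      mulr. apply Rle_trans with Lg; [unfold Lg; lra|]. nra.
    - rewrite sqrt_pow2; [lra|]. pos. }
  (* Indices below [T] are the dyadic classes, the index [T] is the leftover set. *)
  set (At := fun (t : nat) k h x => if lt_dec t T then arc (wt t) (2 * wt t) xi1 xi2 Q k h x else left_arc wT k h x).
  assert (HA : forall t : nat, exists val : Z -> Z -> R, (t <= T)%nat ->
     (forall k h, In k (zr (- Q) Q) -> In h (zr (- H) H) ->
        is_RInt (fun x => indic (At t k h x) * (f x y * krn x)) xi1 xi2 (val k h)) /\
     Rabs (hsum val) <= if lt_dec t T then 4 * Cf * (sqrt pc * Lg * V) + 23 / rho * Cf * V else 72 / rho * Cf * V).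
  { intros t. unfold At. destruct (lt_dec t T) as [L|L].
    - assert (wT <= wt t) by (unfold wt, wT; apply Hmono; lia).
      destruct (class_bound (wt t) (Hwt t)) with (n := n) as [val [C1 C2]]; auto.
      + rewrite Hdbl. pose proof (Hmono 0%nat t ltac:(lia)). simpl in H1. unfold Rdiv in *.
        apply (Rmult_le_reg_r (/ IZR Q)); [pos|]. rewrite Rmult_assoc, Rinv_r by lra. lra.
      + lra.
      + exists val. intros _. split; auto. via C2.
        apply Rplus_le_compat; apply Rmult_le_compat_l.
        * lra.
        * auto.
        * pos.
        * auto.
    - destruct (left_bound wT HwT HwTQ ltac:(lra)) as [val [C1 C2]].
      exists val. intros _. split; auto. via C2.
      mull; exact HE. }
  set (W := fun t => proj1_sig (constructive_indefinite_description _ (HA t))).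
  assert (HW := fun t => proj2_sig (constructive_indefinite_description _ (HA t))).
  change (forall t : nat, (t <= T)%nat ->
     (forall k h, In k (zr (- Q) Q) -> In h (zr (- H) H) ->
        is_RInt (fun x => indic (At t k h x) * (f x y * krn x)) xi1 xi2 (W t k h)) /\
     Rabs (hsum (W t)) <= if lt_dec t T then 4 * Cf * (sqrt pc * Lg * V) + 23 / rho * Cf * V else 72 / rho * Cf * V) in HW.
  clearbody W.
  (* The least denominator of [x] and its nearest numerator are unique. The size of [k0 x - h0] then
     determines the class and, in a dyadic class, its sign determines the sign of [k]. *)
  assert (Part : forall x, xi1 <= x <= xi2 -> hsum (fun k h => lsum (seq 0 (S T)) (fun t => indic (At t k h x))) = 1).
  { intros x Hx.
    set (box2 := list_prod (list_prod (zr (- Q) Q) (zr (- H) H)) (seq 0 (S T))).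
    transitivity (lsum box2 (fun p => indic (At (snd p) (fst (fst p)) (snd (fst p)) x))).
    { unfold box2, hsum. rewrite !lsum_list_prod. auto. }
    destruct (minden_exists Q x Q_ge1) as [k0 Hk0]. assert (Hk0' := Hk0).
    destruct Hk0' as [K1 [[h0 Hh0] K2]].
    assert (HkQ : (k0 <= Q)%Z) by (apply (minden_le Q k0 x); auto; apply Q_ge1).
    set (u := IZR k0 * x - IZR h0) in *.
    assert (Hq1 : / IZR Q <= 1) by (rewrite <- Rinv_1; apply Rinv_le_contravar; lra).
    assert (In_h : forall k h, In k (zr (- Q) Q) -> Rabs (IZR k * x - IZR h) <= / IZR Q -> In h (zr (- H) H)).
    { intros k h Hk Hh. apply (HH k h x); auto. lra. }
    assert (Char : exists p, In p box2 /\ forall q, In q box2 -> (At (snd q) (fst (fst q)) (snd (fst q)) x <-> q = p)).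
    { destruct (Rle_dec (Rabs u) wT) as [Lf|Lf].
      - exists ((k0, h0), T). split.
        { apply in_prod_iff. split; [apply in_prod_iff; split; [apply In_zr; lia|]|apply in_seq; lia].
          apply (In_h k0); [apply In_zr; lia|auto]. }
        intros [[k h] t] Hq. simpl. apply in_prod_iff in Hq. destruct Hq as [_ Ht]. apply in_seq in Ht.
        split.
        + intros A. unfold At in A. destruct (lt_dec t T) as [L|L].
          * exfalso. destruct A as [_ [Am Aq]].
            pose proof (minden_unique _ _ _ Am Hk0) as Ek.
            assert (wT <= wt t) by (unfold wt, wT; apply Hmono; lia).
            assert (2 * wt t <= / IZR Q).
            { rewrite Hdbl. pose proof (Hmono 0%nat t ltac:(lia)). lra. }
            assert (Hn' : Rabs (IZR k * x - IZR h) <= / IZR Q) by (rewrite Rabs_pos_eq; lra).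
            destruct (Z.abs_spec k) as [[_ Ek2]|[_ Ek2]]; rewrite Ek2 in Ek.
            -- subst k. assert (h = h0) by (apply (near_unique k0 x); auto). subst h. fold u in Aq.
               rewrite Rabs_pos_eq in Lf by lra. lra.
            -- assert (E2 : IZR k * x - IZR h = - (IZR k0 * x - IZR (- h))) by (rewrite <- Ek, !opp_IZR; ring).
               rewrite E2, Rabs_Ropp in Hn'.
               assert (E3 : (- h)%Z = h0) by (apply (near_unique k0 x); auto).
               rewrite E2, E3 in Aq. fold u in Aq. rewrite Rabs_left1 in Lf by lra. lra.
          * destruct A as [_ [Am Aq]]. pose proof (minden_unique _ _ _ Am Hk0) as Ek. subst k.
            assert (h = h0) by (apply (near_unique k0 x); auto; lra). subst h. f_equal. lia.
        + intros E0. inversion E0; subst. unfold At. destruct (lt_dec T T); [lia|]. split; auto.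
      - apply Rnot_le_lt in Lf.
        assert (Lev : exists t, (t < T)%nat /\ wt t < Rabs u <= 2 * wt t).
        { assert (G : forall s, (s <= T)%nat -> Rabs u <= (1 / 2) ^ (T - s) / IZR Q -> exists t, (t < T)%nat /\ wt t < Rabs u <= 2 * wt t).
          { induction s as [|s IH]; intros Hs Hu.
            - rewrite Nat.sub_0_r in Hu. fold wT in Hu. lra.
            - destruct (Rle_dec (Rabs u) ((1 / 2) ^ (T - s) / IZR Q)) as [D|D]; [apply IH; auto; lia|].
              exists (T - S s)%nat. split; [lia|]. rewrite Hdbl. split; auto.
              unfold wt. replace (S (T - S s)) with (T - s)%nat by lia. lra. }
          apply (G T); auto. rewrite Nat.sub_diag. lra. }
        destruct Lev as [t0 [Ht0 Hu0]].
        (* Dyadic arcs require [k x - h > 0], so [(k0, h0)] is negated when [u] is negative. *)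
        set (sg := if Rle_dec 0 u then 1%Z else (-1)%Z).
        assert (Hsg : IZR (sg * k0) * x - IZR (sg * h0) = Rabs u /\ Z.abs (sg * k0) = k0 /\ (sg = 1 \/ sg = -1)%Z).
        { unfold sg. destruct (Rle_dec 0 u) as [D|D].
          - rewrite Rabs_pos_eq by auto. rewrite !Z.mul_1_l. unfold u. repeat split; auto. lia.
          - rewrite Rabs_left by lra. rewrite !mult_IZR. unfold u. repeat split; auto; [ring|lia]. }
        destruct Hsg as [S1 [S2 S3]].
        exists ((sg * k0, sg * h0), t0)%Z. split.
        { apply in_prod_iff. split; [|apply in_seq; lia]. apply in_prod_iff.
          assert (In (sg * k0)%Z (zr (- Q) Q)) by (apply In_zr; lia). split; auto.
          apply (In_h (sg * k0)%Z); auto. rewrite S1, Rabs_Rabsolu. auto. }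
        intros [[k h] t] Hq. simpl. apply in_prod_iff in Hq. destruct Hq as [_ Ht]. apply in_seq in Ht.
        split.
        + intros A. unfold At in A. destruct (lt_dec t T) as [L|L].
          * destruct A as [_ [Am Aq]].
            pose proof (minden_unique _ _ _ Am Hk0) as Ek.
            assert (wT <= wt t) by (unfold wt, wT; apply Hmono; lia).
            assert (2 * wt t <= / IZR Q).
            { rewrite Hdbl. pose proof (Hmono 0%nat t ltac:(lia)). lra. }
            assert (Hn' : Rabs (IZR k * x - IZR h) <= / IZR Q) by (rewrite Rabs_pos_eq; lra).
            assert (Eu : IZR k * x - IZR h = Rabs u /\ k = (sg * k0)%Z /\ h = (sg * h0)%Z).
            { destruct (Z.abs_spec k) as [[_ Ek2]|[_ Ek2]]; rewrite Ek2 in Ek.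
              - subst k. assert (h = h0) by (apply (near_unique k0 x); auto). subst h. fold u in Aq |- *.
                unfold sg. destruct (Rle_dec 0 u); [|lra]. rewrite Rabs_pos_eq by auto. repeat split; lia.
              - assert (E2 : IZR k * x - IZR h = - (IZR k0 * x - IZR (- h))) by (rewrite <- Ek, !opp_IZR; ring).
                rewrite E2, Rabs_Ropp in Hn'.
                assert (E3 : (- h)%Z = h0) by (apply (near_unique k0 x); auto).
                rewrite E2, E3 in Aq |- *. fold u in Aq |- *.
                unfold sg. destruct (Rle_dec 0 u); [lra|]. rewrite Rabs_left by lra. repeat split; lia. }
            destruct Eu as [Eu [-> ->]]. rewrite Eu in Aq. f_equal.
            destruct (Nat.lt_trichotomy t t0) as [L2|[L2|L2]]; auto; exfalso.
            -- pose proof (Hmono (S t) t0 ltac:(lia)). rewrite <- (Hdbl t0) in H4. fold (wt t) in H4. lra.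
            -- pose proof (Hmono (S t0) t ltac:(lia)). rewrite <- (Hdbl t) in H4. fold (wt t0) in H4. lra.
          * exfalso. destruct A as [_ [Am Aq]]. pose proof (minden_unique _ _ _ Am Hk0) as Ek. subst k.
            assert (h = h0) by (apply (near_unique k0 x); auto; lra). subst h. fold u in Aq. lra.
        + intros E0. inversion E0; subst. unfold At. destruct (lt_dec t0 T); [|lia].
          split; auto. split; [rewrite S2; auto|]. lra. }
    destruct Char as [p [Hp1 Hp2]].
    rewrite (lsum_ext _ _ (fun q => indic (q = p))).
    - apply lsum_unique; auto. apply NoDup_prod; [apply NoDup_prod; apply NoDup_zr|apply seq_NoDup].
    - intros q Hq. pose proof (Hp2 q Hq) as C. unfold indic.
      destruct excluded_middle_informative; destruct excluded_middle_informative; auto; tauto. }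
  assert (Int : is_RInt (fun x => f x y * krn x) xi1 xi2 (hsum (fun k h => lsum (seq 0 (S T)) (fun t => W t k h)))).
  { apply (is_RInt_ext (fun x => hsum (fun k h => lsum (seq 0 (S T)) (fun t => indic (At t k h x) * (f x y * krn x))))).
    - intros x. minmax. intros Hx.
      transitivity (f x y * krn x * hsum (fun k h => lsum (seq 0 (S T)) (fun t => indic (At t k h x)))).
      + unfold hsum. rewrite <- lsum_scal. apply lsum_ext; intros k _. rewrite <- lsum_scal. apply lsum_ext; intros h _.
        rewrite <- lsum_scal. apply lsum_ext; intros t _. lra.
      + rewrite Part by lra. lra.
    - unfold hsum. apply is_RInt_lsum. intros k Hk. apply is_RInt_lsum. intros h Hh.
      apply is_RInt_lsum. intros t Ht. apply in_seq in Ht. apply HW; auto. lia. }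
  apply RInt_eq in Int. rewrite Int.
  rewrite hsum_lsum. rewrite seq_S, lsum_app. simpl lsum at 2. rewrite Rplus_0_r.
  via Rabs_triang.
  assert (B1 : Rabs (lsum (seq 0 T) (fun t => hsum (W t))) <= INR T * (4 * Cf * (sqrt pc * Lg * V) + 23 / rho * Cf * V)).
  { via Rabs_lsum.
    replace (INR T) with (INR (length (seq 0 T))) by (rewrite length_seq; reflexivity). rewrite <- lsum_const.
    apply lsum_le. intros t Ht. apply in_seq in Ht. destruct (HW t ltac:(lia)) as [_ K].
    destruct (lt_dec t T); [exact K|lia]. }
  assert (B2 : Rabs (hsum (W T)) <= 72 / rho * Cf * V).
  { destruct (HW T ltac:(lia)) as [_ K]. destruct (lt_dec T T); [lia|exact K]. }
  (* [2 Q y < wT] gives [2^T <= 1 / y], and [ln 2 > 1/2]. *)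
  assert (HTL : INR T <= 2 * Lg).
  { assert (2 ^ T <= / y).
    { apply (Rmult_le_reg_r (y * (1 / 2) ^ T)); [pos|].
      replace (/ y * (y * (1 / 2) ^ T)) with ((1 / 2) ^ T) by (field; lra).
      replace (2 ^ T * (y * (1 / 2) ^ T)) with (y * (2 * (1 / 2)) ^ T) by (rewrite Rpow_mult_distr; ring).
      replace (2 * (1 / 2)) with 1 by field. rewrite pow1, Rmult_1_r.
      unfold wT in HT1. apply (Rmult_lt_compat_r (IZR Q)) in HT1; auto.
      replace ((1 / 2) ^ T / IZR Q * IZR Q) with ((1 / 2) ^ T) in HT1 by (field; lra).
      assert (y * 1 <= 2 * IZR Q * y * IZR Q).
      { replace (2 * IZR Q * y * IZR Q) with (y * (2 * (IZR Q * IZR Q))) by ring. mull; [nra]. }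
      lra. }
    assert (ln (2 ^ T) <= ln (/ y)) by (apply ln_le; auto; apply pow_lt; lra).
    rewrite <- Rpower_pow in H1 by lra. unfold Rpower in H1. rewrite ln_exp in H1.
    assert (ln (/ y) <= ln (2 + / y)) by (apply ln_le; lra).
    pose proof ln_lt_2. pose proof (pos_INR T). unfold Lg. nra. }
  change (Rabs (lsum (seq 0 T) (fun t => hsum (W t))) + Rabs (hsum (W T)) <= core_const * Cf * Lg ^ 2 * V).
  apply Rle_trans with (2 * Lg * (4 * Cf * (sqrt pc * Lg * V) + 23 / rho * Cf * V) + 72 / rho * Cf * V).
  - apply Rplus_le_compat; auto. via B1. apply Rmult_le_compat_r; auto.
    pos.
  - unfold core_const. fold pc.
    replace ((8 * sqrt pc + 118 / rho) * Cf * Lg ^ 2 * V) with (8 * sqrt pc * Cf * Lg ^ 2 * V + (Cf * V * / rho) * (46 * Lg ^ 2 + 72 * Lg ^ 2)) by lra.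
    replace (2 * Lg * (4 * Cf * (sqrt pc * Lg * V) + 23 / rho * Cf * V) + 72 / rho * Cf * V)
      with (8 * sqrt pc * Cf * Lg ^ 2 * V + (Cf * V * / rho) * (46 * Lg + 72)) by lra.
    apply Rplus_le_compat_l. mull. nra.
Qed.
End Core.

Lemma horocycle_bound f Cf eta b1 R0 B rho omega xi1 xi2 y Q : 0 < Cf ->
  (moebius_invariant f) ->
  (forall x y, 0 < y -> Rabs (f x y) <= Cf) ->
  (hyperbolic_lipschitz f Cf) ->
  0 < rho <= 1 -> rho <= R0 <= b1 -> 4 * R0 <= b1 ^ 2 -> 32 <= IZR Q * rho -> 0 < B ->
  IZR Q ^ 3 * R0 * b1 <= B -> IZR Q ^ 4 * R0 * b1 ^ 3 <= B ^ 2 ->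
  eta + b1 <= xi1 /\ xi1 <= xi2 /\ xi2 <= eta + b1 + R0 ->
  0 < y -> IZR Q ^ 3 * sqrt R0 * y <= 1 ->
  Rabs (RInt (fun x => f x y * kern eta B omega x) xi1 xi2)
  <= core_const rho * Cf * (1 + ln (2 + / y)) ^ 2 * (sqrt R0 / (IZR Q * b1 ^ 2)).
Proof.
  intros HC finv fb fl Hrho HR0 HR1 HQ HB H2 H3 Hxi Hy Hy2.
  set (H := Zceil (IZR Q * (Rabs xi1 + Rabs xi2) + 2)).
  apply (horocycle_bound_box f Cf HC finv fb fl eta b1 R0 B rho omega xi1 xi2 y Q H); auto.
  intros k h x Hk Hx Hh. apply In_zr in Hk. apply In_zr. apply Rabs_le_between in Hh.
  assert (Hk' : Rabs (IZR k) <= IZR Q) by (apply Rabs_le; rewrite <- opp_IZR; split; apply IZR_le; lia).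
  assert (Hx' : Rabs x <= Rabs xi1 + Rabs xi2).
  { unfold Rabs; repeat destruct Rcase_abs; lra. }
  assert (HH : IZR Q * (Rabs xi1 + Rabs xi2) + 2 <= IZR H) by (pose proof (Zceil_bound (IZR Q * (Rabs xi1 + Rabs xi2) + 2)); unfold H; lra).
  assert (HK : Rabs (IZR k * x) <= IZR Q * (Rabs xi1 + Rabs xi2)).
  { rewrite Rabs_mult. apply Rmult_le_compat; auto using Rabs_pos. }
  apply Rabs_le_between in HK.
  split; apply le_IZR; rewrite ?opp_IZR; lra.
Qed.

(** * Bounds for the Bessel function *)

Lemma exp_le x y : x <= y -> exp x <= exp y.
Proof. intros [H| ->]; [left; apply exp_increasing|]; lra. Qed.

Lemma is_RInt_exp_decay c a b : c <> 0 ->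
  is_RInt (fun u => exp (- c * u)) a b ((exp (- c * a) - exp (- c * b)) / c).
Proof.
  intros Hc.
  replace ((exp (- c * a) - exp (- c * b)) / c) with (minus (- exp (- c * b) / c) (- exp (- c * a) / c)).
  2:{ unfold minus, plus, opp; simpl. lra. }
  apply (is_RInt_derive (fun u => - exp (- c * u) / c)).
  - intros x _. auto_derive; auto. field. auto.
  - intros x _. by_derivative. auto_derive. auto.
Qed.

Lemma lim_abs_le (g : R -> R) l m a : is_lim g p_infty (Finite l) ->
  (forall x, a < x -> Rabs (g x) <= m) -> Rabs l <= m.
Proof.
  intros Hl Hg. apply Rabs_le. split.
  - apply (is_lim_le_loc (fun _ => - m) g p_infty (Finite (- m)) (Finite l)); try apply is_lim_const; auto.
    exists a. intros x Hx. specialize (Hg x Hx). apply Rabs_le_between in Hg. lra.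
  - apply (is_lim_le_loc g (fun _ => m) p_infty (Finite l) (Finite m)); try apply is_lim_const; auto.
    exists a. intros x Hx. specialize (Hg x Hx). apply Rabs_le_between in Hg. lra.
Qed.

Section Decay.
Variables (f : R -> R) (A c : R).
Hypothesis Hc : 0 < c.
Hypothesis Hf : forall u, continuous f u.
Hypothesis Hb : forall u, 0 <= u -> Rabs (f u) <= A * exp (- c * u).

Lemma ex_RInt_cont a b : ex_RInt f a b.
Proof. apply (ex_RInt_continuous f). auto. Qed.

Lemma RInt_tail a b d : RInt f a d - RInt f a b = RInt f b d :> R.
Proof using Hf.
  assert (E : RInt f a b + RInt f b d = RInt f a d) by (apply (RInt_Chasles f a b d); apply ex_RInt_cont).
  lra.
Qed.

Lemma decay_nonneg : 0 <= A.
Proof using All. pose proof (Hb 0 (Rle_refl 0)). rewrite Rmult_0_r, exp_0 in H. pose proof (Rabs_pos (f 0)). lra. Qed.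

Lemma RInt_decay a b : 0 <= a <= b -> Rabs (RInt f a b) <= A / c * exp (- c * a).
Proof using All.
  intros [Ha Hab]. apply Rle_trans with (A * ((exp (- c * a) - exp (- c * b)) / c)).
  - apply (is_RInt_abs_le f (fun u => A * exp (- c * u)) a b); auto.
    + intros x Hx. apply Hb. lra.
    + apply (RInt_correct f). apply ex_RInt_cont.
    + apply is_RInt_scal_R. apply is_RInt_exp_decay. lra.
  - pose proof decay_nonneg. pose proof (exp_pos (- c * b)).
    replace (A / c * exp (- c * a)) with (A * (exp (- c * a) / c)) by lra.
    apply Rmult_le_compat_l; auto. unfold Rdiv. mulr; lra.
Qed.

Lemma decay_limit : exists l, filterlim (fun U => RInt f 0 U) (Rbar_locally p_infty) (locally l).
Proof using All.
  apply (filterlim_locally_cauchy (U := R_CompleteSpace) (F := Rbar_locally p_infty) (fun U => RInt f 0 U)).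
  intros eps. pose proof decay_nonneg as HA.
  (* From [exp (c x) >= c x >= m] a tail is at most [A / (c m)], which this choice keeps below
     [eps]. *)
  set (m := (2 * A / c + 1) / eps). assert (Hm : 0 < m).
  { unfold m. pose proof (cond_pos eps). assert (0 <= 2 * A / c) by pos. pos. }
  assert (Hs : forall x y, Rmax 0 (m / c) < x -> x <= y -> Rabs (RInt f 0 y - RInt f 0 x) < eps).
  { intros x y Hx Hxy. pose proof (Rmax_l 0 (m / c)). pose proof (Rmax_r 0 (m / c)).
    rewrite RInt_tail.
    eapply Rle_lt_trans; [apply RInt_decay; lra|].
    assert (E : m <= c * x).
    { apply (Rmult_le_reg_r (/ c)); [pos|]. replace (c * x * / c) with x by (field; lra). lra. }
    assert (E2 : exp (- c * x) <= / m).
    { replace (- c * x) with (- (c * x)) by ring. rewrite exp_Ropp. apply Rinv_le_contravar; auto.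
      pose proof (exp_ineq1_le (c * x)). lra. }
    assert (0 <= A / c) by pos.
    apply Rle_lt_trans with (A / c * / m); [apply Rmult_le_compat_l; auto|].
    pose proof (cond_pos eps) as He. unfold m. set (q := A / c) in *.
    replace (2 * A / c) with (2 * q) by (unfold q; field; lra).
    replace (q * / ((2 * q + 1) / eps)) with (eps * (q / (2 * q + 1))) by (field; lra).
    rewrite <- (Rmult_1_r eps) at 2. apply Rmult_lt_compat_l; auto.
    apply (Rmult_lt_reg_r (2 * q + 1)); [lra|]. unfold Rdiv. rewrite Rmult_assoc, Rinv_l; lra. }
  exists (fun u => Rmax 0 (m / c) < u). split; [exists (Rmax 0 (m / c)); auto|].
  intros u v Hu Hv. change (Rabs (RInt f 0 v - RInt f 0 u) < eps).
  destruct (Rle_dec u v); [apply Hs; auto|rewrite Rabs_minus_sym; apply Hs; auto; lra].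
Qed.

Lemma decay_RInt_gen : filterlim (fun U => RInt f 0 U) (Rbar_locally p_infty)
  (locally (RInt_gen f (at_point 0) (Rbar_locally p_infty))).
Proof using All.
  destruct decay_limit as [l Hl].
  assert (E : RInt_gen f (at_point 0) (Rbar_locally p_infty) = l).
  { apply (is_RInt_gen_unique f). intros P HP. specialize (Hl P HP). unfold filtermapi.
    apply (Filter_prod _ _ _ (fun a => a = 0) (fun b => P (RInt f 0 b))).
    - reflexivity.
    - auto.
    - intros a b -> Hb'. exists (RInt f 0 b). split; auto. apply (RInt_correct f). apply ex_RInt_cont. }
  rewrite E. auto.
Qed.

Lemma RInt_gen_decay a : 0 <= a ->
  Rabs (RInt_gen f (at_point 0) (Rbar_locally p_infty) - RInt f 0 a) <= A / c * exp (- c * a).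
Proof using All.
  intros Ha. pose proof decay_RInt_gen as Hl. set (l := RInt_gen _ _ _) in *. clearbody l.
  assert (L : is_lim (fun U => RInt f 0 U - RInt f 0 a) p_infty (l - RInt f 0 a)).
  { apply is_lim_minus'; [exact Hl|apply is_lim_const]. }
  apply (lim_abs_le _ _ _ a L). intros x Hx. rewrite RInt_tail. apply RInt_decay. lra.
Qed.
End Decay.

(** Both follow from [cosh u >= 1 + u^2 / 8], because [1 + u^2 / 8 - (u + 1) / 2 = (u - 2)^2 / 8].
    The linear bound replaces [exp (- v cosh u)] by a pure exponential in [u]. *)
Lemma cosh_lower u : (u + 1) / 2 <= cosh u /\ 1 <= cosh u.
Proof.
  assert (G : 1 + u ^ 2 / 8 <= cosh u).
  { unfold cosh. destruct (Rle_dec 0 u) as [H|H].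
    - assert (E : exp u = exp (u / 2) * exp (u / 2)) by (rewrite <- exp_plus; f_equal; field).
      pose proof (exp_ineq1_le (u / 2)). pose proof (exp_ineq1_le (- u)).
      nra.
    - assert (E : exp (- u) = exp (- u / 2) * exp (- u / 2)) by (rewrite <- exp_plus; f_equal; field).
      pose proof (exp_ineq1_le (- u / 2)). pose proof (exp_ineq1_le u).
      nra. }
  pose proof (pow2_ge_0 (u - 2)). nra.
Qed.

Definition bk (kappa v u : R) : R := exp (- v * cosh u) * cos (kappa * u).

Lemma bk_continuous kappa v u : continuous (bk kappa v) u.
Proof. by_derivative. unfold bk, cosh. auto_derive. auto. Qed.

Lemma bk_bound kappa v u : 0 < v -> Rabs (bk kappa v u) <= exp (- v / 2) * exp (- (v / 2) * u).
Proof.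
  intros Hv. unfold bk. rewrite Rabs_mult, Rabs_pos_eq by (left; apply exp_pos).
  rewrite <- exp_plus. rewrite <- (Rmult_1_r (exp (- v / 2 + - (v / 2) * u))).
  apply Rmult_le_compat; auto using Rabs_pos, Rabs_cos_le; [left; apply exp_pos|].
  apply exp_le. destruct (cosh_lower u) as [H _]. nra.
Qed.

Lemma BesselKi_bound kappa v : 0 < v -> Rabs (BesselKi kappa v) <= 2 / v * exp (- v / 2).
Proof.
  intros Hv. pose proof (RInt_gen_decay (bk kappa v) (exp (- v / 2)) (v / 2) ltac:(lra) (bk_continuous _ _)
    (fun u _ => bk_bound kappa v u Hv) 0 (Rle_refl 0)) as H.
  rewrite RInt_point in H. unfold zero in H; simpl in H. rewrite Rmult_0_r, exp_0, Rminus_0_r in H.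
  unfold BesselKi. replace (2 / v * exp (- v / 2)) with (exp (- v / 2) / (v / 2) * 1) by (field; lra). auto.
Qed.

Lemma exp_neg_mult_le x : 0 <= x -> x * exp (- x) <= 2 * exp (- x / 2).
Proof.
  intros Hx. replace (exp (- x)) with (exp (- x / 2) * exp (- x / 2)) by (rewrite <- exp_plus; f_equal; field).
  assert (E : exp (- x / 2) * exp (x / 2) = 1) by (rewrite <- exp_plus, <- exp_0; f_equal; field).
  pose proof (exp_ineq1_le (x / 2)). pose proof (exp_pos (- x / 2)).
  nra.
Qed.

(** [1 - exp (- (v' - v) ch) <= (v' - v) ch], and half of the decay of [exp (- v ch)] absorbs the
    factor [ch]. *)
Lemma bk_lipschitz kappa v v' u : 0 < v <= v' ->
  Rabs (bk kappa v u - bk kappa v' u) <= (v' - v) * (2 / v) * exp (- v / 4) * exp (- (v / 4) * u).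
Proof.
  intros [Hv Hvv]. unfold bk. rewrite <- Rmult_minus_distr_r, Rabs_mult.
  destruct (cosh_lower u) as [H1 H2]. set (ch := cosh u) in *.
  assert (E : exp (- v' * ch) = exp (- v * ch) * exp (- ((v' - v) * ch))) by (rewrite <- exp_plus; f_equal; ring).
  pose proof (exp_pos (- v * ch)) as P. pose proof (exp_ineq1_le (- ((v' - v) * ch))) as P2.
  assert (P3 : exp (- ((v' - v) * ch)) <= 1) by (rewrite <- exp_0; apply exp_le; nra).
  rewrite <- (Rmult_1_r ((v' - v) * _ * _ * _)).
  apply Rmult_le_compat; auto using Rabs_pos, Rabs_cos_le.
  rewrite Rabs_pos_eq by nra. rewrite E.
  apply Rle_trans with ((v' - v) * (ch * exp (- v * ch))).
  { nra. }
  rewrite !Rmult_assoc. mull.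
  pose proof (exp_neg_mult_le (v * ch) ltac:(nra)) as P4.
  replace (- (v * ch)) with (- v * ch) in P4 by ring.
  apply (Rmult_le_reg_l v); auto. replace (v * (2 / v * (exp (- v / 4) * exp (- (v / 4) * u)))) with (2 * (exp (- v / 4) * exp (- (v / 4) * u))) by (field; lra).
  rewrite <- Rmult_assoc. via P4. mull.
  rewrite <- exp_plus. apply exp_le. nra.
Qed.

Lemma BesselKi_lipschitz kappa v v' : 0 < v <= v' ->
  Rabs (BesselKi kappa v - BesselKi kappa v') <= (v' - v) * (8 / v ^ 2) * exp (- v / 4).
Proof.
  intros Hv.
  pose proof (decay_RInt_gen (bk kappa v) (exp (- v / 2)) (v / 2) ltac:(lra) (bk_continuous _ _)
    (fun u _ => bk_bound kappa v u ltac:(lra))) as H1.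
  pose proof (decay_RInt_gen (bk kappa v') (exp (- v' / 2)) (v' / 2) ltac:(lra) (bk_continuous _ _)
    (fun u _ => bk_bound kappa v' u ltac:(lra))) as H2.
  unfold BesselKi. fold (bk kappa v) (bk kappa v').
  set (l1 := RInt_gen (bk kappa v) _ _) in *. set (l2 := RInt_gen (bk kappa v') _ _) in *.
  assert (L : is_lim (fun U => RInt (bk kappa v) 0 U - RInt (bk kappa v') 0 U) p_infty (l1 - l2)).
  { apply is_lim_minus'; [exact H1|exact H2]. }
  apply (lim_abs_le _ _ _ 0 L). intros U HU.
    assert (E : RInt (bk kappa v) 0 U - RInt (bk kappa v') 0 U = RInt (fun u => bk kappa v u - bk kappa v' u) 0 U).
    { symmetry. apply (RInt_minus (V := R_CompleteNormedModule)); apply (ex_RInt_continuous (V := R_CompleteNormedModule)); intros; apply bk_continuous. }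
    rewrite E.
    pose proof (RInt_decay (fun u => bk kappa v u - bk kappa v' u) ((v' - v) * (2 / v) * exp (- v / 4)) (v / 4) ltac:(lra)) as Q.
    via Q.
    + intros u. apply (continuous_minus (bk kappa v) (bk kappa v')); apply bk_continuous.
    + intros u _. apply bk_lipschitz; auto.
    + lra.
    + rewrite Rmult_0_r, exp_0. right. field. lra.
Qed.

Lemma cosh_mono a b : 0 <= a <= b -> cosh a <= cosh b.
Proof.
  intros H. unfold cosh. pose proof (exp_pos a). pose proof (exp_pos b).
  assert (exp a <= exp b) by (apply exp_le; lra).
  assert (1 <= exp a) by (rewrite <- exp_0; apply exp_le; lra).
  rewrite !exp_Ropp.
  assert (E : exp b + / exp b - (exp a + / exp a) = (exp b - exp a) * (1 - / (exp a * exp b))) by (field; lra).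
  assert (/ (exp a * exp b) <= 1) by (rewrite <- Rinv_1; apply Rinv_le_contravar; nra).
  nra.
Qed.

Lemma exp_1_bounds : 5 / 2 <= exp 1 <= 3.
Proof.
  split; [|apply exp_le_3].
  assert (E : exp 1 = exp (1/2) * exp (1/2)) by (rewrite <- exp_plus; f_equal; field).
  assert (E2 : exp (1/2) = exp (1/4) * exp (1/4)) by (rewrite <- exp_plus; f_equal; field).
  assert (E3 : exp (1/4) = exp (1/8) * exp (1/8)) by (rewrite <- exp_plus; f_equal; field).
  pose proof (exp_ineq1_le (1/8)).
  assert ((1 + 1/8)*(1+1/8) <= exp (1/4)) by nra.
  assert (((1 + 1/8)*(1+1/8))*((1 + 1/8)*(1+1/8)) <= exp (1/2)) by nra.
  nra.
Qed.

Lemma cosh_gap u : 0 < u -> cosh (u / 2) < cosh u.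
Proof.
  intros H. assert (E : cosh u = 2 * cosh (u / 2) ^ 2 - 1).
  { unfold cosh. replace u with (u / 2 + u / 2) at 1 2 by field. rewrite exp_plus.
    replace (- (u / 2 + u / 2)) with (- (u / 2) + - (u / 2)) by ring. rewrite exp_plus.
    assert (exp (u / 2) * exp (- (u / 2)) = 1) by (rewrite <- exp_plus, <- exp_0; f_equal; ring). nra. }
  assert (1 < cosh (u / 2)).
  { unfold cosh. rewrite exp_Ropp.
    assert (1 < exp (u / 2)) by (rewrite <- exp_0; apply exp_increasing; lra).
    assert (E2 : (exp (u / 2) + / exp (u / 2)) / 2 - 1 = (exp (u / 2) - 1) ^ 2 / (2 * exp (u / 2))) by (field; lra).
    assert (0 < (exp (u / 2) - 1) ^ 2 / (2 * exp (u / 2))).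
    { pos. }
    lra. }
  nra.
Qed.

(** The factor [cos (kappa u)] oscillates, so positivity is obtained for large [v], where the
    integral concentrates near 0. On [[0, u0]] the cosine is at least [1/2]. The main part is taken
    from [[0, u0 / 2]] while the tail begins at [u0]; the gap between [cosh (u0 / 2)] and [cosh u0]
    makes the tail exponentially smaller. The exponent [- 2 v] comes from [cosh (u0 / 2) <= 2]. *)
Lemma BesselKi_lower kappa : exists c v0, 0 < c /\ 0 < v0 /\ forall v, v0 <= v -> c * exp (- 2 * v) <= BesselKi kappa v.
Proof.
  set (u0 := / (1 + Rabs kappa)). pose proof (Rabs_pos kappa) as Hk.
  assert (Hu0 : 0 < u0) by pos.
  assert (Hu1 : u0 <= 1) by (unfold u0; rewrite <- Rinv_1; apply Rinv_le_contravar; lra).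
  assert (Hku : Rabs kappa * u0 <= 1).
  { unfold u0. apply (Rmult_le_reg_r (1 + Rabs kappa)); [lra|]. rewrite Rmult_assoc, Rinv_l; lra. }
  assert (Hcos : forall u, 0 <= u <= u0 -> 1 / 2 <= cos (kappa * u)).
  { intros u Hu. pose proof PI_4.
    assert (Rabs (kappa * u) <= 1).
    { rewrite Rabs_mult, (Rabs_pos_eq u) by lra. nra. }
    assert (E : cos (kappa * u) = cos (Rabs (kappa * u))).
    { unfold Rabs at 1. destruct Rcase_abs; auto. rewrite cos_neg; auto. }
    rewrite E. rewrite <- cos_PI3. pose proof PI2_3_2.
    pose proof (Rabs_pos (kappa * u)).
    apply cos_decr_1; lra. }
  set (C0 := 2 * exp (- 1 / 2)). assert (HC0 : 0 < C0) by pos.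
  set (ch := cosh u0). set (ch2 := cosh (u0 / 2)).
  assert (Hgap : 0 < ch - ch2) by (pose proof (cosh_gap u0 Hu0); unfold ch, ch2; lra).
  assert (Hch2 : ch2 <= 2).
  { unfold ch2. apply Rle_trans with (cosh 1); [apply cosh_mono; lra|]. unfold cosh. rewrite exp_Ropp.
    pose proof exp_1_bounds. assert (/ exp 1 <= / 1) by (apply Rinv_le_contravar; lra). lra. }
  (* tail <= C0 exp (-(v-1) ch), to be beaten by (u0/8) exp (-v ch2) *)
  set (v0 := 1 + 8 * C0 * exp ch / (u0 * (ch - ch2))).
  assert (Hec : 0 < exp ch) by apply exp_pos.
  assert (Hv0 : 1 < v0) by (unfold v0; assert (0 < 8 * C0 * exp ch / (u0 * (ch - ch2))) by pos; lra).
  exists (u0 / 8), v0. split; [lra|]. split; [lra|]. intros v Hv.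
  assert (Hv1 : 1 <= v) by lra.
  assert (HL := decay_RInt_gen (bk kappa v) (exp (- v / 2)) (v / 2) ltac:(lra) (bk_continuous _ _)
    (fun u _ => bk_bound kappa v u ltac:(lra))).
  unfold BesselKi. fold (bk kappa v). set (l := RInt_gen (bk kappa v) _ _) in *.
  assert (EX : forall a b, ex_RInt (bk kappa v) a b) by (intros; apply ex_RInt_cont; intros; apply bk_continuous).
  assert (M1 : u0 / 4 * exp (- v * ch2) <= RInt (bk kappa v) 0 u0).
  { rewrite <- (RInt_Chasles (bk kappa v) 0 (u0 / 2) u0) by apply EX. unfold plus; simpl.
    assert (0 <= RInt (bk kappa v) (u0 / 2) u0).
    { apply RInt_ge_0; [lra|apply EX|]. intros x Hx. unfold bk. apply Rmult_le_pos; [left; apply exp_pos|].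
      pose proof (Hcos x ltac:(lra)). lra. }
    assert (u0 / 4 * exp (- v * ch2) <= RInt (bk kappa v) 0 (u0 / 2)); [|lra].
    replace (u0 / 4 * exp (- v * ch2)) with (RInt (fun _ => 1 / 2 * exp (- v * ch2)) 0 (u0 / 2)).
    2:{ rewrite RInt_const. unfold scal; simpl. unfold mult; simpl. field. }
    apply RInt_le; [lra|apply ex_RInt_const|apply EX|]. intros x Hx. unfold bk.
    rewrite Rmult_comm. apply Rmult_le_compat; [left; apply exp_pos|lra| |apply Hcos; lra].
    apply exp_le. pose proof (cosh_mono x (u0 / 2) ltac:(lra)). unfold ch2. nra. }
  assert (M2 : forall U, u0 <= U -> Rabs (RInt (bk kappa v) u0 U) <= C0 * exp (- (v - 1) * ch)).
  { intros U HU. set (e1 := exp (- (v - 1) * ch)).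
    assert (0 < e1) by apply exp_pos.
    apply Rle_trans with (e1 * exp (- 1 / 2) * ((exp (- (1/2) * u0) - exp (- (1/2) * U)) / (1/2))).
    - apply (is_RInt_abs_le (bk kappa v) (fun u => e1 * exp (- 1 / 2) * exp (- (1/2) * u)) u0 U); auto.
      + intros x Hx. unfold bk. rewrite Rabs_mult, Rabs_pos_eq by (left; apply exp_pos).
        rewrite <- (Rmult_1_r (e1 * exp (- 1 / 2) * _)). apply Rmult_le_compat; auto using Rabs_pos, Rabs_cos_le; [left; apply exp_pos|].
        unfold e1. rewrite <- !exp_plus. apply exp_le.
        pose proof (cosh_mono u0 x ltac:(lra)). fold ch in H0. destruct (cosh_lower x) as [H3 _]. nra.
      + apply (RInt_correct (bk kappa v)). auto.
      + apply is_RInt_scal_R. apply is_RInt_exp_decay. lra.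
    - unfold C0. pose proof (exp_pos (- 1 / 2)). pose proof (exp_pos (- (1/2) * U)).
      assert (exp (- (1/2) * u0) <= exp 0) by (apply exp_le; lra). rewrite exp_0 in *.
      replace (2 * exp (-1 / 2) * e1) with (e1 * exp (- 1 / 2) * 2) by ring.
      mull. lra. }
  assert (M3 : C0 * exp (- (v - 1) * ch) <= u0 / 8 * exp (- v * ch2)).
  { replace (- (v - 1) * ch) with (- v * ch2 + (ch + - (v * (ch - ch2)))) by ring. rewrite !exp_plus.
    rewrite exp_Ropp. pose proof (exp_pos (- v * ch2)) as P.
    replace (C0 * (exp (- v * ch2) * (exp ch * / exp (v * (ch - ch2))))) with ((C0 * exp ch * / exp (v * (ch - ch2))) * exp (- v * ch2)) by ring.
    mulr.
    assert (G : 8 * C0 * exp ch / u0 <= exp (v * (ch - ch2))).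
    { pose proof (exp_ineq1_le (v * (ch - ch2))).
      apply Rle_trans with (v * (ch - ch2)); [|lra].
      apply Rle_trans with (v0 * (ch - ch2)); [|apply Rmult_le_compat_r; lra].
      unfold v0. replace ((1 + 8 * C0 * exp ch / (u0 * (ch - ch2))) * (ch - ch2)) with ((ch - ch2) + 8 * C0 * exp ch / u0) by (field; lra). lra. }
    pose proof (exp_pos (v * (ch - ch2))) as P2.
    apply (Rmult_le_reg_r (exp (v * (ch - ch2)))); auto. rewrite Rmult_assoc, Rinv_l, Rmult_1_r by lra.
    apply (Rmult_le_reg_r (8 / u0)); [pos|].
    replace (u0 / 8 * exp (v * (ch - ch2)) * (8 / u0)) with (exp (v * (ch - ch2))) by (field; lra).
    lra. }
  assert (M4 : u0 / 8 * exp (- v * ch2) <= l).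
  { apply (is_lim_le_loc (fun _ => u0 / 8 * exp (- v * ch2)) (fun U => RInt (bk kappa v) 0 U) p_infty
      (Finite (u0 / 8 * exp (- v * ch2))) (Finite l)); try apply is_lim_const; auto.
    exists u0. intros U HU. rewrite <- (RInt_Chasles (bk kappa v) 0 u0 U) by apply EX. unfold plus; simpl.
    pose proof (M2 U ltac:(lra)) as M. apply Rabs_le_between in M. lra. }
  below M4. mull. apply exp_le. nra.
Qed.

Lemma series_geom_bound (a : nat -> R) S A q : is_series a S -> 0 <= q < 1 ->
  (forall n, Rabs (a n) <= A * q ^ n) -> Rabs S <= A / (1 - q).
Proof.
  intros Ha Hq Hb.
  assert (G : is_series (fun n => A * q ^ n) (A / (1 - q))).
  { apply (is_series_scal_l A (fun n => q ^ n) (/ (1 - q))). apply is_series_geom. rewrite Rabs_pos_eq; lra. }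
  assert (EA : ex_series (fun n => Rabs (a n))).
  { apply (ex_series_le (fun n => Rabs (a n)) (fun n => A * q ^ n)); [|exists (A / (1 - q)); auto].
    intros n. unfold norm; simpl. unfold abs; simpl. rewrite Rabs_Rabsolu. auto. }
  rewrite <- (is_series_unique _ _ Ha), <- (is_series_unique _ _ G).
  eapply Rle_trans; [apply Series_Rabs; auto|]. apply Series_le; [|exists (A / (1 - q)); auto].
  intros n. split; auto using Rabs_pos.
Qed.

Lemma exp_pow x n : exp (INR n * x) = exp x ^ n.
Proof.
  induction n as [|n IH]; [rewrite Rmult_0_l; apply exp_0|].
  rewrite S_INR, Rmult_plus_distr_r, Rmult_1_l, exp_plus, IH. simpl. ring.
Qed.

(** * Real functions with the Fourier expansion and invariance of a Maass form *)

Section RealForm.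
Variables (f : R -> R -> R) (kappa : R) (al be : nat -> R).

Definition harmonic (n : nat) (x : R) : R :=
  al n * cos (2 * PI * (INR n * x)) + be n * sin (2 * PI * (INR n * x)).
Definition bessel_weight (n : nat) (y : R) : R := sqrt y * BesselKi kappa (2 * PI * INR n * y).

Definition bessel_expansion : Prop := forall x y, 0 < y ->
  is_series (fun n => bessel_weight (S n) y * harmonic (S n) x) (f x y).
(** [coefficient_exponent] speaks of positive indices, whereas the real and imaginary parts of the
    form involve both signs; growth of this kind follows for both from the convergence of the
    expansion. *)
Definition subexponential : Prop := forall d, 0 < d -> exists A, forall n, (1 <= n)%nat ->
  Rabs (al n) + Rabs (be n) <= A * exp (d * INR n).

Hypothesis Hser : bessel_expansion.
Hypothesis Hgrow : subexponential.
Hypothesis finv : moebius_invariant f.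

Lemma sin_lipschitz x y : Rabs (sin x - sin y) <= Rabs (x - y).
Proof.
  destruct (MVT_gen sin y x cos) as [c [_ Hc]].
  - intros z _. apply is_derive_sin.
  - intros z _. apply continuity_sin.
  - rewrite Hc, Rabs_mult. pose proof (Rabs_cos_le c). pose proof (Rabs_pos (x - y)). nra.
Qed.

Lemma cos_lipschitz x y : Rabs (cos x - cos y) <= Rabs (x - y).
Proof.
  rewrite !cos_sin. via sin_lipschitz. right. f_equal. ring.
Qed.

Lemma harmonic_bound n x : Rabs (harmonic n x) <= Rabs (al n) + Rabs (be n).
Proof.
  unfold harmonic. via Rabs_triang. rewrite !Rabs_mult.
  apply Rplus_le_compat; rewrite <- Rmult_1_r; apply Rmult_le_compat_l;
    auto using Rabs_pos, Rabs_sin_le, Rabs_cos_le.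
Qed.

Lemma harmonic_lipschitz n x x' :
  Rabs (harmonic n x - harmonic n x') <= (Rabs (al n) + Rabs (be n)) * (2 * PI * INR n * Rabs (x - x')).
Proof.
  unfold harmonic. pose proof PI_RGT_0. pose proof (pos_INR n).
  set (u := 2 * PI * (INR n * x)). set (v := 2 * PI * (INR n * x')).
  assert (E : Rabs (u - v) = 2 * PI * INR n * Rabs (x - x')).
  { unfold u, v. replace (2 * PI * (INR n * x) - 2 * PI * (INR n * x')) with (2 * PI * INR n * (x - x')) by ring.
    rewrite Rabs_mult, Rabs_pos_eq; auto. pos. }
  rewrite <- E.
  replace (al n * cos u + be n * sin u - (al n * cos v + be n * sin v)) with (al n * (cos u - cos v) + be n * (sin u - sin v)) by ring.
  via Rabs_triang. rewrite !Rabs_mult, Rmult_plus_distr_r.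
  apply Rplus_le_compat; apply Rmult_le_compat_l; auto using Rabs_pos, cos_lipschitz, sin_lipschitz.
Qed.

Lemma bessel_weight_bound n y : (1 <= n)%nat -> 0 < y ->
  Rabs (bessel_weight n y) <= / sqrt y * exp (- (PI * INR n * y)).
Proof.
  intros Hn Hy. unfold bessel_weight. pose proof PI_RGT_0. pose proof PI2_3_2.
  assert (1 <= INR n) by (apply (le_INR 1); auto).
  assert (Hs : 0 < sqrt y) by pos.
  rewrite Rabs_mult, Rabs_pos_eq by lra.
  assert (Hv : 0 < 2 * PI * INR n * y) by pos.
  eapply Rle_trans; [mull; [apply BesselKi_bound; auto]|].
  replace (- (2 * PI * INR n * y) / 2) with (- (PI * INR n * y)) by field.
  rewrite <- Rmult_assoc. apply Rmult_le_compat_r; [left; apply exp_pos|].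
  replace (sqrt y * (2 / (2 * PI * INR n * y))) with (/ sqrt y * / (PI * INR n)).
  - rewrite <- Rmult_1_r. mull. rewrite <- Rinv_1. apply Rinv_le_contravar; nra.
  - assert (E1 : sqrt y * sqrt y = y) by (apply sqrt_sqrt; lra).
    replace (2 / (2 * PI * INR n * y)) with (/ (PI * INR n) * / (sqrt y * sqrt y)) by (rewrite E1; field; lra). field. lra.
Qed.

Lemma bessel_weight_lipschitz n y y' : (1 <= n)%nat -> 0 < y <= y' -> y' <= 2 * y ->
  Rabs (bessel_weight n y - bessel_weight n y') <= (/ sqrt y * (4 / y)) * (y' - y) * exp (- (PI * INR n * y / 2)).
Proof.
  intros Hn Hy Hyy. unfold bessel_weight. pose proof PI_RGT_0 as HPI. pose proof PI2_3_2.
  assert (H1 : 1 <= INR n) by (apply (le_INR 1); auto).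
  assert (Hs : 0 < sqrt y) by pos.
  assert (Hs2 : sqrt y <= sqrt y') by (apply sqrt_le_1_alt; lra).
  assert (E1 : sqrt y * sqrt y = y) by (apply sqrt_sqrt; lra).
  assert (E2 : sqrt y' * sqrt y' = y') by (apply sqrt_sqrt; lra).
  assert (Hs3 : sqrt y' <= 2 * sqrt y) by nra.
  set (v := 2 * PI * INR n * y). set (v' := 2 * PI * INR n * y').
  assert (Hn2 : 0 < 2 * PI * INR n) by pos.
  assert (Hv : 0 < v <= v') by (unfold v, v'; split; [pos|apply Rmult_le_compat_l; lra]).
  pose proof (BesselKi_bound kappa v ltac:(lra)) as B1.
  pose proof (BesselKi_lipschitz kappa v v' Hv) as B2.
  set (k := BesselKi kappa v) in *. set (k' := BesselKi kappa v') in *.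
  replace (sqrt y * k - sqrt y' * k') with ((sqrt y - sqrt y') * k + sqrt y' * (k - k')) by ring.
  via Rabs_triang. rewrite !Rabs_mult.
  rewrite (Rabs_left1 (sqrt y - sqrt y')) by lra. rewrite (Rabs_pos_eq (sqrt y')) by lra.
  set (E := exp (- (PI * INR n * y / 2))). assert (HE : 0 < E) by apply exp_pos.
  assert (D1 : - (sqrt y - sqrt y') <= (y' - y) * / (2 * sqrt y)).
  { apply (Rmult_le_reg_r (2 * sqrt y)); [lra|]. rewrite Rmult_assoc, Rinv_l by lra. nra. }
  assert (Hev : exp (- v / 2) <= E) by (unfold E, v; apply exp_le; assert (0 < PI * INR n * y) by pos; lra).
  assert (Hev2 : exp (- v / 4) = E) by (unfold E, v; f_equal; field).
  rewrite Hev2 in B2.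
  assert (Hiv : 2 / v <= 1 / y).
  { unfold v. assert (0 < y) by lra. replace (2 / (2 * PI * INR n * y)) with (/ (PI * INR n) * (1 / y)) by (field; lra).
    rewrite <- (Rmult_1_l (1 / y)) at 2. mulr.
    rewrite <- Rinv_1. apply Rinv_le_contravar; nra. }
  assert (Hiy : 0 < 1 / y) by pos.
  assert (B1' : Rabs k <= 1 / y * E).
  { via B1. apply Rmult_le_compat; auto; [left; pos|left; apply exp_pos]. }
  assert (B2' : Rabs (k - k') <= (y' - y) * (4 / 3 * (1 / y ^ 2)) * E).
  { via B2. mulr. unfold v, v'.
    replace ((2 * PI * INR n * y' - 2 * PI * INR n * y) * (8 / (2 * PI * INR n * y) ^ 2))
      with ((y' - y) * (4 * / (PI * INR n) * (1 / y ^ 2))) by (field; lra).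
    mull. mulr.
    assert (/ (PI * INR n) <= / 3) by (apply Rinv_le_contravar; nra). lra. }
  apply Rle_trans with ((y' - y) * / (2 * sqrt y) * (1 / y * E) + (2 * sqrt y) * ((y' - y) * (4 / 3 * (1 / y ^ 2)) * E)).
  - apply Rplus_le_compat.
    + apply Rmult_le_compat; auto using Rabs_pos. lra.
    + apply Rmult_le_compat; auto using Rabs_pos; lra.
  - replace (2 * sqrt y * ((y' - y) * (4 / 3 * (1 / y ^ 2)) * E)) with (/ sqrt y * (8 / 3 / y) * (y' - y) * E).
    2:{ replace (1 / y ^ 2) with (1 / y * / (sqrt y * sqrt y)) by (rewrite E1; field; lra). field. lra. }
    replace ((y' - y) * / (2 * sqrt y) * (1 / y * E)) with (/ sqrt y * (1 / 2 / y) * (y' - y) * E) by (field; lra).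
    assert (HX : 0 <= / sqrt y * (y' - y) * E * (1 / y)).
    { pos. }
    lra.
Qed.

(** Part of the decay [exp (- PI n y / 2)] pays for the coefficients and for the factor n of a
    derivative; the rest is split into a decay in [y] and a geometric factor in n. *)
Lemma harmonic_growth y1 : 0 < y1 -> exists A, 0 < A /\ forall n, (1 <= n)%nat -> forall y, y1 <= y ->
  (Rabs (al n) + Rabs (be n)) * (1 + 2 * PI * INR n) * exp (- (PI * INR n * y / 2)) <= A * exp (- (y / 4)) * exp (- (y1 / 4)) ^ n.
Proof using Hgrow.
  intros Hy1. pose proof PI_RGT_0. pose proof PI2_3_2.
  destruct (Hgrow (y1 / 4) ltac:(lra)) as [A HA].
  assert (HA1 : 0 <= A).
  { pose proof (HA 1%nat (le_n 1)) as H1. pose proof (exp_pos (y1 / 4 * INR 1)). pose proof (Rabs_pos (al 1)). pose proof (Rabs_pos (be 1)). nra. }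
  set (c := 1 + 8 * PI / y1). assert (Hc : 1 < c) by (unfold c; assert (0 < 8 * PI / y1) by pos; lra).
  exists ((A + 1) * c). split; [nra|]. intros n Hn y Hy.
  assert (H1 : 1 <= INR n) by (apply (le_INR 1); auto).
  assert (P1 : 1 + 2 * PI * INR n <= c * exp (y1 / 4 * INR n)).
  { pose proof (exp_ineq1_le (y1 / 4 * INR n)).
    apply Rle_trans with (c * (1 + y1 / 4 * INR n)); [|apply Rmult_le_compat_l; lra].
    unfold c. replace ((1 + 8 * PI / y1) * (1 + y1 / 4 * INR n)) with (1 + 2 * PI * INR n + y1 / 4 * INR n + 8 * PI / y1) by (field; lra).
    assert (0 < 8 * PI / y1) by pos. nra. }
  pose proof (exp_pos (y1 / 4 * INR n)).
  assert (P2 : (Rabs (al n) + Rabs (be n)) * (1 + 2 * PI * INR n) <= (A + 1) * exp (y1 / 4 * INR n) * (c * exp (y1 / 4 * INR n))).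
  { apply Rmult_le_compat; auto.
    - pos.
    - pos.
    - eapply Rle_trans; [apply HA; auto|]. lra. }
  eapply Rle_trans; [apply Rmult_le_compat_r; [left; apply exp_pos|apply P2]|].
  rewrite <- exp_pow.
  replace ((A + 1) * exp (y1 / 4 * INR n) * (c * exp (y1 / 4 * INR n)) * exp (- (PI * INR n * y / 2)))
    with ((A + 1) * c * exp (y1 / 4 * INR n + y1 / 4 * INR n + - (PI * INR n * y / 2))) by (rewrite !exp_plus; ring).
  rewrite (Rmult_assoc ((A + 1) * c)), <- exp_plus. mull. apply exp_le.
  assert (INR n * y1 <= INR n * y) by nra.
  assert (1 * y <= INR n * y) by nra.
  nra.
Qed.

(* Uniform bounds away from the real axis; [1 / y] stands for the exponential decay. *)
Lemma high_bounds y1 : 0 < y1 -> exists C, 0 < C /\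
  (forall x y, y1 <= y -> Rabs (f x y) <= C / y) /\
  (forall x y x' y', y1 <= y -> y1 <= y' -> Rabs (f x y - f x' y') <= C * ((Rabs (x - x') + Rabs (y - y')) / Rmin y y')).
Proof using Hser Hgrow.
  intros Hy1. pose proof PI_RGT_0. pose proof PI2_3_2.
  destruct (harmonic_growth y1 Hy1) as [A [HA Hh]].
  set (q := exp (- (y1 / 4))) in *.
  assert (Hq : 0 < q < 1).
  { split; [apply exp_pos|]. rewrite <- exp_0. apply exp_increasing. lra. }
  set (s1 := / sqrt y1). assert (Hs1 : 0 < s1) by pos.
  set (G := A * q / (1 - q) * 4). assert (HG : 0 < G) by pos.
  assert (Hdec : forall y, y1 <= y -> A * exp (- (y / 4)) * q / (1 - q) <= G / y).
  { intros y Hy. assert (exp (- (y / 4)) <= 4 / y).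
    { rewrite exp_Ropp. replace (4 / y) with (/ (y / 4)) by (field; lra). apply Rinv_le_contravar; [lra|].
      pose proof (exp_ineq1_le (y / 4)). lra. }
    unfold G. replace (A * q / (1 - q) * 4 / y) with (A * q / (1 - q) * (4 / y)) by lra.
    replace (A * exp (- (y / 4)) * q / (1 - q)) with (A * q / (1 - q) * exp (- (y / 4))) by lra.
    apply Rmult_le_compat_l; auto. pos. }
  assert (Hsq : forall y, y1 <= y -> / sqrt y <= s1).
  { intros y Hy. unfold s1. apply Rinv_le_contravar; [pos|]. apply sqrt_le_1_alt; auto. }
  assert (B1 : forall x y, y1 <= y -> Rabs (f x y) <= s1 * G / y).
  { intros x y Hy.
    assert (Hyp : 0 < y) by lra.
    eapply Rle_trans; [apply (series_geom_bound _ _ (s1 * A * exp (- (y / 4)) * q) q (Hser x y Hyp)); [lra|]|].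
    - intros n. rewrite Rabs_mult.
      assert (Hn : (1 <= S n)%nat) by lia. pose proof (Hh (S n) Hn y Hy) as K. simpl pow in K.
      assert (Hn1 : 1 <= INR (S n)) by (apply (le_INR 1); auto).
      assert (HPn : 0 < PI * INR (S n) * y) by pos.
      assert (HPn2 : 0 < PI * INR (S n)) by pos.
      apply Rle_trans with (s1 * exp (- (PI * INR (S n) * y / 2)) * (Rabs (al (S n)) + Rabs (be (S n)))).
      + apply Rmult_le_compat; auto using Rabs_pos, harmonic_bound.
        eapply Rle_trans; [apply bessel_weight_bound; auto|].
        apply Rmult_le_compat; auto; [left; pos|left; apply exp_pos|apply exp_le; lra].
      + replace (s1 * A * exp (- (y / 4)) * q * q ^ n) with (s1 * (A * exp (- (y / 4)) * (q * q ^ n))) by ring.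
        rewrite Rmult_assoc. mull. below K.
        rewrite (Rmult_comm (exp _)). apply Rmult_le_compat_r; [left; apply exp_pos|].
        rewrite <- (Rmult_1_r (_ + _)) at 1. apply Rmult_le_compat_l; [apply Rplus_le_le_0_compat; apply Rabs_pos|]. lra.
    - pose proof (Hdec y Hy). nra. }
  set (C2 := s1 * G * (3 + 4 / y1) + 2 * (s1 * G) / y1).
  assert (HC2 : s1 * G <= C2 /\ s1 * G * (3 + 4 / y1) <= C2 /\ 2 * (s1 * G) / y1 <= C2).
  { assert (0 < s1 * G) by pos. assert (0 < 4 / y1) by pos. assert (0 < 2 * (s1 * G) / y1) by pos. unfold C2.
    lra. }
  destruct HC2 as [C2a [C2b C2c]]. assert (HsG : 0 < s1 * G) by pos.
  assert (B2 : forall x y x' y', y1 <= y -> y <= y' -> Rabs (f x y - f x' y') <= C2 * ((Rabs (x - x') + Rabs (y - y')) / y)).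
  { intros x y x' y' Hy Hyy. pose proof (Rabs_pos (x - x')) as Px.
    rewrite (Rabs_left1 (y - y')) by lra.
    (* For [y' > 2 y] the numerator on the right is at least [y >= y1], so the bounds for the two
       values suffice. *)
    destruct (Rle_dec y' (2 * y)) as [D|D].
    - assert (Hyp : 0 < y) by lra. assert (Hyp' : 0 < y') by lra.
      pose proof (is_series_minus _ _ _ _ (Hser x y Hyp) (Hser x' y' Hyp')) as HS.
      set (del := Rabs (x - x') + - (y - y')). assert (Hdel : 0 <= del) by pos.
      eapply Rle_trans; [apply (series_geom_bound _ _ (s1 * (3 + 4 / y1) * del * (A * exp (- (y / 4)) * q)) q HS); [lra|]|].
      + intros n. change (Rabs (bessel_weight (S n) y * harmonic (S n) x - bessel_weight (S n) y' * harmonic (S n) x') <= s1 * (3 + 4 / y1) * del * (A * exp (- (y / 4)) * q) * q ^ n).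
        assert (Hn : (1 <= S n)%nat) by lia. pose proof (Hh (S n) Hn y Hy) as K. simpl pow in K.
        assert (Hn1 : 1 <= INR (S n)) by (apply (le_INR 1); auto).
        assert (HPn : 0 < PI * INR (S n) * y) by pos.
        assert (HPn2 : 0 < PI * INR (S n)) by pos.
        set (W := Rabs (al (S n)) + Rabs (be (S n))) in *. assert (HW : 0 <= W) by pos.
        set (E := exp (- (PI * INR (S n) * y / 2))) in *. assert (HE : 0 < E) by apply exp_pos.
        replace (bessel_weight (S n) y * harmonic (S n) x - bessel_weight (S n) y' * harmonic (S n) x')
          with (bessel_weight (S n) y * (harmonic (S n) x - harmonic (S n) x') + (bessel_weight (S n) y - bessel_weight (S n) y') * harmonic (S n) x') by ring.
        via Rabs_triang. rewrite !Rabs_mult.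
        assert (T1 : Rabs (bessel_weight (S n) y) <= s1 * E).
        { eapply Rle_trans; [apply bessel_weight_bound; auto|].
          apply Rmult_le_compat; auto; [left; pos|left; apply exp_pos|apply exp_le; lra]. }
        assert (T2 : Rabs (bessel_weight (S n) y - bessel_weight (S n) y') <= s1 * (4 / y1) * (y' - y) * E).
        { eapply Rle_trans; [apply bessel_weight_lipschitz; auto; lra|]. fold E.
          mulr. mulr.
          apply Rmult_le_compat; auto; [left; pos|left; pos|].
          unfold Rdiv. mull. apply Rinv_le_contravar; lra. }
        assert (T3 := harmonic_bound (S n) x'). fold W in T3.
        assert (T4 := harmonic_lipschitz (S n) x x'). fold W in T4.
        replace (s1 * (3 + 4 / y1) * del * (A * exp (- (y / 4)) * q) * q ^ n) with (s1 * (3 + 4 / y1) * del * (A * exp (- (y / 4)) * (q * q ^ n))) by ring.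
        assert (H31 : 0 < 4 / y1) by pos.
        apply Rle_trans with (s1 * (3 + 4 / y1) * del * (W * (1 + 2 * PI * INR (S n)) * E)).
        2:{ apply Rmult_le_compat_l; auto. pos. }
        apply Rle_trans with (s1 * E * (W * (2 * PI * INR (S n) * Rabs (x - x'))) + s1 * (4 / y1) * (y' - y) * E * W).
        * apply Rplus_le_compat; apply Rmult_le_compat; auto using Rabs_pos.
        * set (nn := 2 * PI * INR (S n)). assert (Hnn : 0 < nn) by pos.
          assert (HZ : 0 <= s1 * E * W) by pos.
          replace (s1 * E * (W * (nn * Rabs (x - x'))) + s1 * (4 / y1) * (y' - y) * E * W)
            with (s1 * E * W * (nn * Rabs (x - x') + 4 / y1 * (y' - y))) by ring.
          replace (s1 * (3 + 4 / y1) * del * (W * (1 + nn) * E)) with (s1 * E * W * ((3 + 4 / y1) * del * (1 + nn))) by ring.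
          apply Rmult_le_compat_l; auto. unfold del.
          set (r := 4 / y1) in *. set (dx := Rabs (x - x')) in *.
          assert (0 <= nn * dx) by pos. assert (0 <= r * (y' - y)) by pos.
          assert (0 <= r * dx) by pos.
          assert (0 <= nn * (y' - y)) by pos.
          assert (0 <= r * (dx * nn)) by pos.
          assert (0 <= r * ((y' - y) * nn)) by pos.
          lra.
      + replace (s1 * (3 + 4 / y1) * del * (A * exp (- (y / 4)) * q) / (1 - q)) with (s1 * (3 + 4 / y1) * del * (A * exp (- (y / 4)) * q / (1 - q))) by lra.
        assert (H31 : 0 < 4 / y1) by pos.
        apply Rle_trans with (s1 * (3 + 4 / y1) * del * (G / y)).
        * apply Rmult_le_compat_l; [apply Rmult_le_pos; auto; apply Rmult_le_pos; lra|apply Hdec; auto].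
        * replace (s1 * (3 + 4 / y1) * del * (G / y)) with (s1 * G * (3 + 4 / y1) * (del / y)) by lra.
          apply Rmult_le_compat_r; auto. pos.
    - apply Rnot_le_lt in D.
      assert (T1 := B1 x y Hy). assert (T2 := B1 x' y' ltac:(lra)).
      assert (T3 : s1 * G / y' <= s1 * G / y) by (mull; apply Rinv_le_contravar; lra).
      apply Rle_trans with (2 * (s1 * G) / y).
      + unfold Rminus. via Rabs_triang. rewrite Rabs_Ropp. lra.
      + apply Rle_trans with (2 * (s1 * G) / y1 * (y1 / y)); [right; field; lra|].
        apply Rmult_le_compat; auto; [left; pos|left; pos|].
        unfold Rdiv. mulr. lra. }
  exists C2. split; [lra|]. split.
  - intros x y Hy. eapply Rle_trans; [apply B1; auto|]. unfold Rdiv. mulr; auto.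
  - intros x y x' y' Hy Hy'. destruct (Rle_dec y y') as [L|L].
    + rewrite Rmin_left by auto. auto.
    + rewrite Rmin_right by lra. rewrite Rabs_minus_sym, (Rabs_minus_sym x), (Rabs_minus_sym y). apply B2; lra.
Qed.

Lemma pow2_Rabs x : x ^ 2 = Rabs x ^ 2.
Proof. symmetry. apply pow2_abs. Qed.

(** A Dirichlet approximation of [x] with [Q] the integer part of [1 / sqrt y] gives
    [|k x - h| <= 2 sqrt y] and [k sqrt y <= 1], so the squared modulus of [c z + d] is at most
    [5 y]. The image then has height at least [1/5], which replaces the passage to a fundamental
    domain. *)
Lemma reduction x y : 0 < y <= 1 -> exists a b c d : Z,
  (a * d - b * c = 1)%Z /\ (1 <= c)%Z /\ (IZR c * x + IZR d) ^ 2 + IZR c ^ 2 * y ^ 2 <= 5 * y.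
Proof.
  intros [Hy Hy1].
  assert (Hs : 0 < sqrt y) by pos. assert (Es : sqrt y * sqrt y = y) by (apply sqrt_sqrt; lra).
  assert (Hs1 : sqrt y <= 1) by nra.
  assert (Hi : 1 <= / sqrt y) by (rewrite <- Rinv_1; apply Rinv_le_contravar; lra).
  set (Q := Zfloor (/ sqrt y)). pose proof (Zfloor_bound (/ sqrt y)) as [F1 F2]. fold Q in F1, F2.
  assert (HQ : (1 <= Q)%Z) by (apply Zfloor_lub; auto).
  assert (HQ1 : 1 <= IZR Q) by (apply IZR_le; auto).
  destruct (minden_exists Q x HQ) as [k Hk]. pose proof (minden_le Q k x HQ Hk) as HkQ.
  assert (Hk' := Hk). destruct Hk' as [K1 [[h Hh] _]].
  assert (Hrp : rel_prime k h).
  { apply (minden_rel_prime (IZR Q) k h x); auto; [lra|]. rewrite Z.abs_eq by lia. auto. }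
  exists (av k h), (bv k h), k, (- h)%Z. split; [pose proof (bez_det k h Hrp); lia|]. split; auto.
  rewrite opp_IZR. change (IZR k * x + - IZR h) with (IZR k * x - IZR h).
  assert (G1 : (IZR k * x - IZR h) ^ 2 <= 4 * y).
  { rewrite pow2_Rabs. apply Rle_trans with ((/ IZR Q) ^ 2); [apply pow_incr; split; auto using Rabs_pos|].
    assert (/ IZR Q <= 2 * sqrt y).
    { assert (IZR Q >= / sqrt y / 2) by lra.
      replace (2 * sqrt y) with (/ (/ sqrt y / 2)) by (field; lra). apply Rinv_le_contravar; lra. }
    replace (4 * y) with ((2 * sqrt y) ^ 2) by lra.
    apply pow_incr. split; auto. pos. }
  assert (G2 : IZR k ^ 2 * y ^ 2 <= y).
  { assert (0 <= IZR k * sqrt y <= 1).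
    { assert (1 <= IZR k) by (apply IZR_le; auto). assert (IZR k <= IZR Q) by (apply IZR_le; auto).
      split; [apply Rmult_le_pos; lra|]. rewrite <- (Rinv_l (sqrt y)) by lra. nra. }
    replace (IZR k ^ 2 * y ^ 2) with ((IZR k * sqrt y) ^ 2 * y) by nra.
    assert ((IZR k * sqrt y) ^ 2 <= 1 ^ 2) by nra. nra. }
  lra.
Qed.

Lemma abs_sum_le (u v s : R) : 0 <= s -> u ^ 2 + v ^ 2 <= s ^ 2 / 2 -> Rabs u + Rabs v <= s.
Proof.
  intros Hs H. rewrite (pow2_Rabs u), (pow2_Rabs v) in H.
  pose proof (Rabs_pos u). pose proof (Rabs_pos v). pose proof (pow2_ge_0 (Rabs u - Rabs v)). nra.
Qed.

(** For [y < 1] both points are moved by the matrix that [reduction] provides for the first. Their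
    squared distance is divided by [N N'], the squared moduli of [c z + d] at the two points, and
    these are comparable. The first image has height at least [1/5] and the second at least a sixth
    of that, hence the threshold [1/30]. *)
Lemma form_bounds : exists C, 0 < C /\ (forall x y, 0 < y -> Rabs (f x y) <= C) /\
  (hyperbolic_lipschitz f C).
Proof using All.
  destruct (high_bounds (1 / 30) ltac:(lra)) as [C [HC [HB HL]]].
  exists (30 * C). split; [lra|]. split.
  - intros x y Hy. destruct (Rle_dec 1 y) as [D|D].
    + eapply Rle_trans; [apply HB; lra|]. assert (/ y <= 1) by (rewrite <- Rinv_1; apply Rinv_le_contravar; lra). nra.
    + destruct (reduction x y ltac:(lra)) as [a [b [c [d [H1 [H2 H3]]]]]].
      rewrite <- (finv a b c d x y H1 Hy). set (N := (IZR c * x + IZR d) ^ 2 + IZR c ^ 2 * y ^ 2) in *.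
      assert (HN : 0 < N).
      { unfold N. assert (1 <= IZR c) by (apply IZR_le; auto). assert (0 < IZR c ^ 2 * y ^ 2) by pos.
        pose proof (pow2_ge_0 (IZR c * x + IZR d)). lra. }
      assert (HyN : 1 / 5 <= y / N).
      { apply (Rmult_le_reg_r N); auto. unfold Rdiv at 2. rewrite Rmult_assoc, Rinv_l by lra. lra. }
      eapply Rle_trans; [apply HB; lra|].
      assert (/ (y / N) <= / (1 / 5)) by (apply Rinv_le_contravar; lra). nra.
  - intros x y x' y' Hy Hx Hyy.
    pose proof (Rabs_pos (x - x')) as Px. pose proof (Rabs_pos (y - y')) as Py.
    assert (Hyy' := Hyy). apply Rabs_le_between in Hyy'.
    destruct (Rle_dec 1 y) as [D|D].
    + eapply Rle_trans; [apply HL; lra|].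
      assert (E : / Rmin y y' <= 2 * / y).
      { replace (2 * / y) with (/ (y / 2)) by (field; lra). apply Rinv_le_contravar; [lra|]. apply Rmin_glb; lra. }
      unfold Rdiv. assert (0 < / y) by pos.
      apply Rle_trans with (C * ((Rabs (x - x') + Rabs (y - y')) * (2 * / y))).
      * mull. nra.
      * assert (0 <= C * ((Rabs (x - x') + Rabs (y - y')) * / y)) by pos. lra.
    + destruct (reduction x y ltac:(lra)) as [a [b [c [d [H1 [H2 H3]]]]]].
      rewrite <- (finv a b c d x y H1 Hy), <- (finv a b c d x' y' H1 ltac:(lra)).
      assert (Hc1 : 1 <= IZR c) by (apply IZR_le; auto).
      assert (Hdet : IZR a * IZR d - IZR b * IZR c = 1) by (rewrite <- !mult_IZR, <- minus_IZR, H1; auto).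
      set (u := IZR c * x + IZR d) in *. set (u' := IZR c * x' + IZR d).
      set (N := u ^ 2 + IZR c ^ 2 * y ^ 2) in *. set (N' := u' ^ 2 + IZR c ^ 2 * y' ^ 2).
      assert (Hcy : 0 < IZR c ^ 2 * y ^ 2) by pos.
      assert (HN : 0 < N) by (unfold N; pose proof (pow2_ge_0 u); lra).
      assert (HN' : 0 < N').
      { unfold N'. assert (0 < IZR c ^ 2 * y' ^ 2) by pos. nra. }
      set (D2 := (x - x') ^ 2 + (y - y') ^ 2).
      assert (HD2 : D2 <= y ^ 2 / 2).
      { unfold D2. rewrite (pow2_Rabs (x - x')), (pow2_Rabs (y - y')).
        nra. }
      assert (HcD : IZR c ^ 2 * D2 <= N / 2).
      { assert (IZR c ^ 2 * D2 <= IZR c ^ 2 * (y ^ 2 / 2)) by nra.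
        unfold N. nra. }
      assert (EcD : IZR c ^ 2 * D2 = (u - u') ^ 2 + (IZR c * y - IZR c * y') ^ 2) by (unfold D2, u, u'; ring).
      (* The values of [c z + d] at the two points differ by at most [sqrt (N / 2)];
         [(1 + 1 / sqrt 2)^2 < 3] and [(1 - 1 / sqrt 2)^2 > 1/12]. *)
      assert (N1 : N' <= 3 * N).
      { unfold N' in *. replace (IZR c ^ 2 * y' ^ 2) with ((IZR c * y') ^ 2) by ring.
        unfold N in *. replace (IZR c ^ 2 * y ^ 2) with ((IZR c * y) ^ 2) in * by ring.
        set (v := IZR c * y) in *. set (v' := IZR c * y') in *. clearbody u u' v v'. clear - HcD EcD.
        pose proof (pow2_ge_0 (u - (u' - u))). pose proof (pow2_ge_0 (v - (v' - v))). nra. }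
      assert (N2 : N <= 12 * N').
      { unfold N' in *. replace (IZR c ^ 2 * y' ^ 2) with ((IZR c * y') ^ 2) by ring.
        unfold N in *. replace (IZR c ^ 2 * y ^ 2) with ((IZR c * y) ^ 2) in * by ring.
        set (v := IZR c * y) in *. set (v' := IZR c * y') in *. clearbody u u' v v'. clear - HcD EcD.
        pose proof (pow2_ge_0 (3 * u' - (u - u'))). pose proof (pow2_ge_0 (3 * v' - (v - v'))). nra. }
      set (X := (((IZR a * x + IZR b) * u + IZR a * IZR c * y ^ 2) / N)).
      set (X' := (((IZR a * x' + IZR b) * u' + IZR a * IZR c * y' ^ 2) / N')).
      assert (EX : X = IZR a / IZR c - u / (IZR c * N)).
      { assert (E0 : ((IZR a * x + IZR b) * u + IZR a * IZR c * y ^ 2) * IZR c = IZR a * N - u).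
        { apply Rminus_diag_uniq. transitivity (u * (1 - (IZR a * IZR d - IZR b * IZR c))); [unfold N, u; ring|rewrite Hdet; ring]. }
        unfold X. replace ((IZR a * x + IZR b) * u + IZR a * IZR c * y ^ 2) with ((IZR a * N - u) / IZR c) by (rewrite <- E0; field; lra).
        clearbody N u. field. lra. }
      assert (EX' : X' = IZR a / IZR c - u' / (IZR c * N')).
      { assert (E0 : ((IZR a * x' + IZR b) * u' + IZR a * IZR c * y' ^ 2) * IZR c = IZR a * N' - u').
        { apply Rminus_diag_uniq. transitivity (u' * (1 - (IZR a * IZR d - IZR b * IZR c))); [unfold N', u'; ring|rewrite Hdet; ring]. }
        unfold X'. replace ((IZR a * x' + IZR b) * u' + IZR a * IZR c * y' ^ 2) with ((IZR a * N' - u') / IZR c) by (rewrite <- E0; field; lra).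
        clearbody N' u'. field. lra. }
      assert (EE : (X - X') ^ 2 + (y / N - y' / N') ^ 2 = D2 / (N * N')).
      { rewrite EX, EX'.
        assert (Ex : x - x' = (u - u') / IZR c) by (unfold u, u'; field; lra).
        unfold D2. rewrite Ex.
        assert (Z1 : u ^ 2 = N - IZR c ^ 2 * y ^ 2) by (unfold N; ring).
        assert (Z2 : u' ^ 2 = N' - IZR c ^ 2 * y' ^ 2) by (unfold N'; ring).
        clearbody N N' u u'.
        apply (Rmult_eq_reg_r (IZR c ^ 2 * N ^ 2 * N' ^ 2)).
        2:{ assert (0 < IZR c) by lra. apply Rgt_not_eq. pos. }
        transitivity ((u' ^ 2 + IZR c ^ 2 * y' ^ 2) * N ^ 2 + (u ^ 2 + IZR c ^ 2 * y ^ 2) * N' ^ 2 - 2 * (u * u' + IZR c ^ 2 * y * y') * N * N').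
        { field. lra. }
        transitivity (((u ^ 2 + IZR c ^ 2 * y ^ 2) + (u' ^ 2 + IZR c ^ 2 * y' ^ 2) - 2 * (u * u' + IZR c ^ 2 * y * y')) * N * N').
        { nra. }
        field. lra. }
      assert (HY : 1 / 5 <= y / N).
      { apply (Rmult_le_reg_r N); auto. unfold Rdiv at 2. rewrite Rmult_assoc, Rinv_l by lra. lra. }
      assert (HY' : y / N / 6 <= y' / N').
      { apply (Rmult_le_reg_r N'); auto. unfold Rdiv at 3. rewrite Rmult_assoc, Rinv_l, Rmult_1_r by lra.
        apply Rle_trans with (y / N / 6 * (3 * N)); [apply Rmult_le_compat_l; lra|].
        replace (y / N / 6 * (3 * N)) with (y / 2) by (field; lra). lra. }
      assert (HS : Rabs (X - X') + Rabs (y / N - y' / N') <= 5 * (Rabs (x - x') + Rabs (y - y')) / N).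
      { apply abs_sum_le; [apply Rle_mult_inv_pos; lra|]. rewrite EE.
        assert (D2 <= (Rabs (x - x') + Rabs (y - y')) ^ 2).
        { unfold D2. rewrite (pow2_Rabs (x - x')), (pow2_Rabs (y - y')). nra. }
        apply Rle_trans with ((Rabs (x - x') + Rabs (y - y')) ^ 2 * (12 / N ^ 2)).
        - unfold Rdiv. apply Rmult_le_compat; auto; [unfold D2; pose proof (pow2_ge_0 (x - x')); pose proof (pow2_ge_0 (y - y')); lra|left; pos|].
          replace (12 * / N ^ 2) with (/ (N * (N / 12))) by (field; lra).
          apply Rinv_le_contravar; [apply Rmult_lt_0_compat; lra|]. nra.
        - set (S := Rabs (x - x') + Rabs (y - y')).
          replace ((5 * S / N) ^ 2 / 2) with (S ^ 2 * (12 / N ^ 2) + S ^ 2 * (/ 2 * / N ^ 2)) by (field; lra).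
          assert (0 <= S ^ 2 * (/ 2 * / N ^ 2)); [|lra]. pos. }
      eapply Rle_trans; [apply HL; lra|].
      assert (HM : y / N / 6 <= Rmin (y / N) (y' / N')) by (apply Rmin_glb; lra).
      apply Rle_trans with (C * (5 * (Rabs (x - x') + Rabs (y - y')) / N * / (y / N / 6))).
      * mull. unfold Rdiv at 1. apply Rmult_le_compat; auto.
        -- pos.
        -- pos.
        -- apply Rinv_le_contravar; lra.
      * right. field. lra.
Qed.
End RealForm.

(** * Real and imaginary parts of the Maass form *)

Lemma is_series_fst (a : nat -> C) l : is_series (V := C_R_NormedModule) a l -> is_series (fun n => fst (a n)) (fst l).
Proof.
  intros H. unfold is_series in *.
  apply (filterlim_ext (fun n => fst (sum_n (G := C_R_NormedModule) a n))).
  - induction x as [|n IH]; [rewrite !sum_O; reflexivity|]. rewrite !sum_Sn, <- IH. auto.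
  - apply (filterlim_comp _ _ _ (sum_n (G := C_R_NormedModule) a) fst eventually (locally l)); auto.
    apply (continuous_fst (fst l) (snd l)) || (destruct l; apply continuous_fst).
Qed.

Lemma is_series_snd (a : nat -> C) l : is_series (V := C_R_NormedModule) a l -> is_series (fun n => snd (a n)) (snd l).
Proof.
  intros H. unfold is_series in *.
  apply (filterlim_ext (fun n => snd (sum_n (G := C_R_NormedModule) a n))).
  - induction x as [|n IH]; [rewrite !sum_O; reflexivity|]. rewrite !sum_Sn, <- IH. auto.
  - apply (filterlim_comp _ _ _ (sum_n (G := C_R_NormedModule) a) snd eventually (locally l)); auto.
    apply (continuous_snd (fst l) (snd l)) || (destruct l; apply continuous_snd).
Qed.

Lemma finite_bound (u : nat -> R) N : exists A, 0 <= A /\ forall n, (n < N)%nat -> Rabs (u n) <= A.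
Proof.
  destruct (list_upper_bound (seq 0 N) (fun n => Rabs (u n))) as [m Hm].
  exists (Rmax 0 m). split; [apply Rmax_l|]. intros n Hn. below Rmax_r. apply Hm. apply in_seq. lia.
Qed.

Lemma series_terms_bounded (a : nat -> R) l : is_series a l -> exists A, 0 <= A /\ forall n, Rabs (a n) <= A.
Proof.
  intros H. assert (L : is_lim_seq a 0) by (apply ex_series_lim_0; exists l; auto).
  apply is_lim_seq_spec in L. destruct (L (mkposreal 1 Rlt_0_1)) as [N HN]. simpl in HN.
  destruct (finite_bound a N) as [A [HA1 HA]]. exists (A + 1). split; [lra|]. intros n.
  destruct (le_lt_dec N n) as [D|D]; [specialize (HN n D); rewrite Rminus_0_r in HN; lra|specialize (HA n D); lra].
Qed.

(** Boundedness at height [y] is turned by the lower bound of the Bessel function into growth at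
    most [exp (4 PI n y)]; [y = d / (4 PI)] gives the rate [d]. The finitely many [n] with too small
    a Bessel argument go into the constant. *)
Lemma coefficient_growth kappa (u : nat -> R) :
  (forall y, 0 < y -> exists A, 0 <= A /\ forall n, (1 <= n)%nat -> Rabs (u n * BesselKi kappa (2 * PI * INR n * y)) <= A) ->
  forall d, 0 < d -> exists A, 0 <= A /\ forall n, (1 <= n)%nat -> Rabs (u n) <= A * exp (d * INR n).
Proof.
  intros Hu d Hd. pose proof PI_RGT_0.
  destruct (BesselKi_lower kappa) as [c [v0 [Hc [Hv0 HK]]]].
  set (y := d / (4 * PI)). assert (Hy : 0 < y) by pos.
  destruct (Hu y Hy) as [A [HA0 HA]].
  destruct (INR_unbounded (v0 / (2 * PI * y))) as [N HN].
  destruct (finite_bound u N) as [A' [HA'0 HA']].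
  assert (0 <= A / c) by pos.
  exists (A / c + A'). split; [lra|]. intros n Hn.
  assert (H1 : 1 <= INR n) by (apply (le_INR 1); auto).
  assert (P0 : 1 <= exp (d * INR n)) by (pose proof (exp_ineq1_le (d * INR n)); nra).
  destruct (le_lt_dec N n) as [D|D].
  - apply Rle_trans with (A / c * exp (d * INR n)); [|apply Rmult_le_compat_r; lra].
    specialize (HA n Hn). rewrite Rabs_mult in HA.
    assert (Hv : v0 <= 2 * PI * INR n * y).
    { assert (v0 / (2 * PI * y) <= INR n) by (apply le_INR in D; lra).
      apply (Rmult_le_reg_r (/ (2 * PI * y))); [pos|]. replace (2 * PI * INR n * y * / (2 * PI * y)) with (INR n) by (field; lra). auto. }
    specialize (HK _ Hv).
    assert (E : exp (- 2 * (2 * PI * INR n * y)) = / exp (d * INR n)).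
    { rewrite <- exp_Ropp. f_equal. unfold y. field. lra. }
    rewrite E in HK. pose proof (Rle_abs (BesselKi kappa (2 * PI * INR n * y))).
    assert (P3 : Rabs (u n) * (c * / exp (d * INR n)) <= A).
    { eapply Rle_trans; [mull|apply HA]. lra. }
    apply (Rmult_le_compat_r (/ c * exp (d * INR n))) in P3.
    2:{ pos. }
    replace (A / c * exp (d * INR n)) with (A * (/ c * exp (d * INR n))) by lra.
    below P3. right. field. lra.
  - apply Rle_trans with (A' * exp (d * INR n)); [|apply Rmult_le_compat_r; lra].
    specialize (HA' n D). nra.
Qed.

Section Split.
Variables (psi : C -> C) (kappa : R) (t : Z -> C).
Hypothesis Hinv : SL2Z_invariant psi.
Hypothesis Hexp : fourier_expansion psi kappa t.

Definition tp (n : nat) : C := t (Z.of_nat n).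
Definition tm (n : nat) : C := t (- Z.of_nat n)%Z.

Lemma moebius_pair (a b c d : Z) x y : (a * d - b * c = 1)%Z -> 0 < y ->
  psi (((IZR a * x + IZR b) * (IZR c * x + IZR d) + IZR a * IZR c * y ^ 2)
          / ((IZR c * x + IZR d) ^ 2 + IZR c ^ 2 * y ^ 2),
       y / ((IZR c * x + IZR d) ^ 2 + IZR c ^ 2 * y ^ 2)) = psi (x, y).
Proof using Hinv.
  intros H Hy. rewrite <- (Hinv a b c d (x, y) H Hy). f_equal.
  assert (Hdet : IZR a * IZR d - IZR b * IZR c = 1) by (rewrite <- !mult_IZR, <- minus_IZR, H; auto).
  assert (HN : (IZR c * x + IZR d) ^ 2 + IZR c ^ 2 * y ^ 2 <> 0).
  { intros E. assert (E1 : (IZR c * x + IZR d) ^ 2 = 0 /\ (IZR c * y) ^ 2 = 0).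
    { pose proof (pow2_ge_0 (IZR c * x + IZR d)). nra. }
    destruct E1 as [E1 E2].
    assert (Z1 : IZR c * y = 0) by nra. assert (Z2 : IZR c = 0) by nra. rewrite Z2 in *.
    nra. }
  unfold RtoC, Cdiv, Cmult, Cplus, Cinv. simpl.
  apply injective_projections; simpl.
  - field. lra.
  - apply (Rmult_eq_reg_r ((IZR c * x + IZR d) ^ 2 + IZR c ^ 2 * y ^ 2)).
    2:{ lra. }
    replace y with ((IZR a * IZR d - IZR b * IZR c) * y) at 1 by nra.
    field. lra.
Qed.

Lemma Cmod_bessel_bounded : forall y, 0 < y -> exists A, 0 <= A /\ forall n, (1 <= n)%nat ->
  let K := BesselKi kappa (2 * PI * INR n * y) in
  Rabs (fst (tp n) * K) <= A /\ Rabs (snd (tp n) * K) <= A /\ Rabs (fst (tm n) * K) <= A /\ Rabs (snd (tm n) * K) <= A.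
Proof using Hexp.
  intros y Hy. destruct (Hexp 0 y Hy) as [Sp [Sm [H1 [H2 _]]]].
  destruct (series_terms_bounded _ _ (is_series_fst _ _ H1)) as [A1 [P1 B1]].
  destruct (series_terms_bounded _ _ (is_series_snd _ _ H1)) as [A2 [P2 B2]].
  destruct (series_terms_bounded _ _ (is_series_fst _ _ H2)) as [A3 [P3 B3]].
  destruct (series_terms_bounded _ _ (is_series_snd _ _ H2)) as [A4 [P4 B4]].
  exists (A1 + A2 + A3 + A4). split; [lra|]. intros [|n] Hn K; [lia|].
  specialize (B1 n). specialize (B2 n). specialize (B3 n). specialize (B4 n).
  assert (E1 : Rabs (IZR (Z.of_nat (S n))) = INR (S n)) by (rewrite <- INR_IZR_INZ; apply Rabs_pos_eq; apply pos_INR).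
  assert (E2 : Rabs (IZR (- Z.of_nat (S n))) = INR (S n)) by (rewrite opp_IZR, Rabs_Ropp; auto).
  unfold fourier_term in *. rewrite E1 in B1, B2. rewrite E2 in B3, B4.
  unfold e in *. rewrite !Rmult_0_r, cos_0, sin_0 in *. unfold tp, tm. fold K in B1, B2, B3, B4.
  unfold Cmult, RtoC in *. cbn [fst snd] in *.
  rewrite !Rmult_0_r, !Rmult_1_r, !Rminus_0_r, ?Rplus_0_l in *.
  lra.
Qed.

(* The cosine and sine coefficients of the real and imaginary parts of psi. *)
Definition alR n := fst (tp n) + fst (tm n).
Definition beR n := snd (tm n) - snd (tp n).
Definition alI n := snd (tp n) + snd (tm n).
Definition beI n := fst (tp n) - fst (tm n).

Lemma parts_subexponential : forall d, 0 < d -> exists A, forall n, (1 <= n)%nat ->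
  Rabs (alR n) + Rabs (beR n) <= A * exp (d * INR n) /\ Rabs (alI n) + Rabs (beI n) <= A * exp (d * INR n).
Proof using Hexp.
  intros d Hd.
  assert (G : forall u : nat -> R, (u = (fun n => fst (tp n)) \/ u = (fun n => snd (tp n)) \/ u = (fun n => fst (tm n)) \/ u = (fun n => snd (tm n))) ->
    exists A, 0 <= A /\ forall n, (1 <= n)%nat -> Rabs (u n) <= A * exp (d * INR n)).
  { intros u Hu. apply (coefficient_growth kappa u); auto. intros y Hy.
    destruct (Cmod_bessel_bounded y Hy) as [A [HA0 HA]]. exists A. split; auto. intros n Hn.
    destruct (HA n Hn) as [B1 [B2 [B3 B4]]].
    destruct Hu as [E|[E|[E|E]]]; rewrite E; auto. }
  destruct (G (fun n => fst (tp n))) as [A1 [P1 B1]]; auto.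
  destruct (G (fun n => snd (tp n))) as [A2 [P2 B2]]; auto.
  destruct (G (fun n => fst (tm n))) as [A3 [P3 B3]]; auto.
  destruct (G (fun n => snd (tm n))) as [A4 [P4 B4]]; auto.
  exists (A1 + A2 + A3 + A4). intros n Hn. specialize (B1 n Hn). specialize (B2 n Hn). specialize (B3 n Hn). specialize (B4 n Hn).
  unfold alR, beR, alI, beI.
  pose proof (Rabs_triang (fst (tp n)) (fst (tm n))). pose proof (Rabs_triang (snd (tm n)) (- snd (tp n))).
  pose proof (Rabs_triang (snd (tp n)) (snd (tm n))). pose proof (Rabs_triang (fst (tp n)) (- fst (tm n))).
  rewrite Rabs_Ropp in *. unfold Rminus. lra.
Qed.

Lemma series_split : forall x y, 0 < y ->
  is_series (fun n => bessel_weight kappa (S n) y * harmonic alR beR (S n) x) (fst (psi (x, y))) /\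
  is_series (fun n => bessel_weight kappa (S n) y * harmonic alI beI (S n) x) (snd (psi (x, y))).
Proof using Hexp.
  intros x y Hy. destruct (Hexp x y Hy) as [Sp [Sm [H1 [H2 H3]]]]. rewrite H3.
  assert (E1 : forall n, Rabs (IZR (Z.of_nat (S n))) = INR (S n)) by (intros; rewrite <- INR_IZR_INZ; apply Rabs_pos_eq; apply pos_INR).
  assert (E2 : forall n, Rabs (IZR (- Z.of_nat (S n))) = INR (S n)) by (intros; rewrite opp_IZR, Rabs_Ropp; auto).
  split.
  - replace (fst (RtoC (sqrt y) * (Sp + Sm))%C) with (sqrt y * (fst Sp + fst Sm)) by (simpl; ring).
    apply (is_series_ext (fun n => sqrt y * (fst (fourier_term kappa t x y (Z.of_nat (S n))) + fst (fourier_term kappa t x y (- Z.of_nat (S n))%Z)))).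
    + intros n. unfold fourier_term. rewrite E1, E2. unfold bessel_weight, harmonic, alR, beR, e, tp, tm.
      rewrite opp_IZR, <- INR_IZR_INZ. unfold Cmult, RtoC. cbn [fst snd].
      replace (2 * PI * (- INR (S n) * x)) with (- (2 * PI * (INR (S n) * x))) by ring. rewrite cos_neg, sin_neg. rring.
    + apply (is_series_scal_l (sqrt y) (fun n => fst (fourier_term kappa t x y (Z.of_nat (S n))) + fst (fourier_term kappa t x y (- Z.of_nat (S n))%Z)) (fst Sp + fst Sm)).
      apply (is_series_plus (fun n => fst (fourier_term kappa t x y (Z.of_nat (S n)))) (fun n => fst (fourier_term kappa t x y (- Z.of_nat (S n))%Z)) (fst Sp) (fst Sm)); apply is_series_fst; auto.
  - replace (snd (RtoC (sqrt y) * (Sp + Sm))%C) with (sqrt y * (snd Sp + snd Sm)) by (simpl; ring).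
    apply (is_series_ext (fun n => sqrt y * (snd (fourier_term kappa t x y (Z.of_nat (S n))) + snd (fourier_term kappa t x y (- Z.of_nat (S n))%Z)))).
    + intros n. unfold fourier_term. rewrite E1, E2. unfold bessel_weight, harmonic, alI, beI, e, tp, tm.
      rewrite opp_IZR, <- INR_IZR_INZ. unfold Cmult, RtoC. cbn [fst snd].
      replace (2 * PI * (- INR (S n) * x)) with (- (2 * PI * (INR (S n) * x))) by ring. rewrite cos_neg, sin_neg. rring.
    + apply (is_series_scal_l (sqrt y) (fun n => snd (fourier_term kappa t x y (Z.of_nat (S n))) + snd (fourier_term kappa t x y (- Z.of_nat (S n))%Z)) (snd Sp + snd Sm)).
      apply (is_series_plus (fun n => snd (fourier_term kappa t x y (Z.of_nat (S n)))) (fun n => snd (fourier_term kappa t x y (- Z.of_nat (S n))%Z)) (snd Sp) (snd Sm)); apply is_series_snd; auto.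
Qed.
End Split.

(** * Isolating Fourier modes by a finite Fourier transform *)

Lemma Rdiv_mult_l a x : x <> 0 -> a / x * x = a.
Proof. intros. field. auto. Qed.

Lemma cos_progression_sum Y h n :
  2 * sin h * lsum (seq 0 n) (fun j => cos (Y + 2 * INR j * h)) = sin (Y + (2 * INR n - 1) * h) - sin (Y - h).
Proof.
  induction n as [|n IH].
  - simpl. replace (Y + (2 * 0 - 1) * h) with (Y - h) by ring. ring.
  - rewrite seq_S, lsum_app, Rmult_plus_distr_l, IH. simpl lsum. rewrite Rplus_0_r, S_INR.
    replace (Y + (2 * (INR n + 1) - 1) * h) with ((Y + 2 * INR n * h) + h) by ring.
    replace (Y + (2 * INR n - 1) * h) with ((Y + 2 * INR n * h) - h) by ring.
    rewrite sin_plus, (sin_minus (Y + 2 * INR n * h) h). ring.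
Qed.

Lemma cos_progression_bound Y h n : sin h <> 0 ->
  Rabs (lsum (seq 0 n) (fun j => cos (Y + 2 * INR j * h))) <= / Rabs (sin h).
Proof.
  intros Hh. assert (P : 0 < Rabs (sin h)) by (apply Rabs_pos_lt; auto).
  apply (Rmult_le_reg_l (2 * Rabs (sin h))); [lra|].
  rewrite <- (Rabs_pos_eq 2) at 1 by lra. rewrite <- !Rabs_mult, cos_progression_sum.
  replace (2 * Rabs (sin h) * / Rabs (sin h)) with (1 + 1) by (field; lra).
  unfold Rminus. via Rabs_triang. rewrite Rabs_Ropp.
  apply Rplus_le_compat; apply Rabs_sin_le.
Qed.

Lemma sin_half_le x : 0 <= x <= PI / 2 -> x / 2 <= sin x.
Proof.
  intros H. pose proof PI_RGT_0. pose proof PI_4.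
  destruct (Rle_dec x (PI / 3)) as [D|D].
  - destruct (MVT_gen sin 0 x cos) as [c [Hc1 Hc]].
    + intros z _. apply is_derive_sin.
    + intros z _. apply continuity_sin.
    + rewrite Rmin_left, Rmax_right in Hc1 by lra. rewrite sin_0 in Hc.
      assert (1 / 2 <= cos c) by (rewrite <- cos_PI3; apply cos_decr_1; lra). nra.
  - assert (sin (PI / 6) <= sin (PI / 3)) by (apply sin_incr_1; lra).
    assert (sin (PI / 3) <= sin x) by (apply sin_incr_1; lra).
    assert (E : sin (PI / 3) ^ 2 = 3 / 4).
    { pose proof (sin2_cos2 (PI / 3)) as E. rewrite cos_PI3 in E. unfold Rsqr in E. lra. }
    rewrite sin_PI6 in *.
    assert (86 / 100 <= sin (PI / 3)) by nra.
    assert (PI <= 344 / 100) by (pose proof PI_ineq 2 as P; unfold tg_alt, PI_tg in P; simpl in P; lra). lra.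
Qed.

(** The progression closes up after [L] steps because [2 L h = 2 PI k]; [sin h = 0] would make [L]
    divide [k]. *)
Lemma root_sum_zero Y (k : Z) (L : nat) : (1 <= L)%nat -> ~ (Z.of_nat L | k)%Z ->
  lsum (seq 0 L) (fun j => cos (Y + 2 * PI * (IZR k * (INR j / INR L)))) = 0.
Proof.
  intros HL Hk. assert (HL1 : 1 <= INR L) by (apply (le_INR 1); auto).
  set (h := PI * IZR k / INR L). pose proof PI_RGT_0.
  assert (E : lsum (seq 0 L) (fun j => cos (Y + 2 * PI * (IZR k * (INR j / INR L)))) = lsum (seq 0 L) (fun j => cos (Y + 2 * INR j * h))).
  { apply lsum_ext. intros j _. f_equal. unfold h. lra. }
  rewrite E. apply (Rmult_eq_reg_l (2 * sin h)).
  - rewrite cos_progression_sum, Rmult_0_r.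
    assert (E2 : Y + (2 * INR L - 1) * h = (Y - h) + 2 * IZR k * PI) by (unfold h; field; lra).
    rewrite E2. assert (P : forall z : Z, sin ((Y - h) + 2 * IZR z * PI) = sin (Y - h)).
    { intros z. destruct (Z_le_gt_dec 0 z) as [D|D].
      - rewrite <- (Z2Nat.id z D), <- INR_IZR_INZ. apply sin_period.
      - rewrite <- (sin_period _ (Z.to_nat (- z))). rewrite INR_IZR_INZ, Z2Nat.id, opp_IZR by lia. f_equal. ring. }
    rewrite P. ring.
  - intros E2. assert (E3 : sin h = 0) by lra. apply sin_eq_0_0 in E3. destruct E3 as [z Hz].
    apply Hk. exists z. apply eq_IZR. rewrite mult_IZR, <- INR_IZR_INZ.
    apply (Rmult_eq_reg_l (PI / INR L)); [|apply Rgt_not_eq; pos].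
    unfold h in Hz. replace (PI / INR L * (IZR z * INR L)) with (IZR z * PI) by (field; lra). lra.
Qed.

(* [x + lambda] with [lambda = L / n] interpolates between the trivial bound and the geometric sum. *)
Lemma kernel_bound (L n m0 j : nat) ph : (1 <= n)%nat -> (2 * j <= L)%nat -> (1 <= L)%nat ->
  Rabs (lsum (seq m0 n) (fun m => cos (ph + 2 * PI * (INR j * (INR m / INR L))))) <= 2 * INR L / (INR j + INR L / INR n).
Proof.
  intros Hn Hj HL. assert (HL1 : 1 <= INR L) by (apply (le_INR 1); auto).
  assert (Hn1 : 1 <= INR n) by (apply (le_INR 1); auto). pose proof (pos_INR j) as Hj0. pose proof PI_RGT_0. pose proof PI2_3_2.
  assert (Hlam : 0 < INR L / INR n) by pos.
  destruct (Rle_dec (INR j) (INR L / INR n)) as [D|D].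
  - apply Rle_trans with (INR n).
    + via Rabs_lsum. replace (INR n) with (INR (length (seq m0 n)) * 1) by (rewrite length_seq; ring).
      rewrite <- lsum_const. apply lsum_le. intros; apply Rabs_cos_le.
    + apply (Rmult_le_reg_r (INR j + INR L / INR n)); [lra|].
      rewrite Rdiv_mult_l by lra.
      apply Rle_trans with (INR n * (INR L / INR n + INR L / INR n)); [apply Rmult_le_compat_l; lra|]. right. field. lra.
  - apply Rnot_le_lt in D. set (h := PI * INR j / INR L).
    assert (Hh : 0 < h <= PI / 2).
    { unfold h. split; [apply Rdiv_lt_0_compat; [apply Rmult_lt_0_compat|]; lra|]. apply (Rmult_le_reg_r (INR L)); [lra|].
      replace (PI * INR j / INR L * INR L) with (PI / 2 * (2 * INR j)) by (field; lra).
      mull. apply le_INR in Hj. rewrite mult_INR in Hj. auto. }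
    pose proof (sin_half_le h ltac:(lra)) as Hs.
    assert (E : lsum (seq m0 n) (fun m => cos (ph + 2 * PI * (INR j * (INR m / INR L)))) =
      lsum (seq 0 n) (fun i => cos ((ph + 2 * INR m0 * h) + 2 * INR i * h))).
    { replace (seq m0 n) with (map (fun i => m0 + i)%nat (seq 0 n)).
      - rewrite lsum_map. apply lsum_ext. intros i _. f_equal. rewrite plus_INR. unfold h. lra.
      - clear. revert m0. induction n as [|n IH]; intros m0; [reflexivity|]. rewrite !seq_S, map_app, IH. auto. }
    rewrite E. eapply Rle_trans; [apply cos_progression_bound; lra|].
    rewrite Rabs_pos_eq by lra.
    apply Rle_trans with (/ (h / 2)); [apply Rinv_le_contravar; lra|].
    unfold h. replace (/ (PI * INR j / INR L / 2)) with (2 * INR L * / (PI * INR j)) by (field; lra).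
    unfold Rdiv at 1. mull. apply Rinv_le_contravar; [lra|]. nra.
Qed.

Lemma inv_shift_sum lam N : 2 <= lam ->
  lsum (seq 0 (S N)) (fun j => / (INR j + lam)) <= ln ((INR N + lam) / (lam - 1)).
Proof.
  intros Hl. induction N as [|N IH].
  - simpl lsum. rewrite ln_div by (simpl; lra). simpl INR. rewrite !Rplus_0_l, Rplus_0_r.
    replace (lam - 1) with (lam * (1 - / lam)) by (field; lra).
    assert (/ lam <= / 2) by (apply Rinv_le_contravar; lra). assert (0 < / lam) by pos.
    rewrite ln_mult by lra.
    assert (ln (1 - / lam) <= - / lam).
    { rewrite <- (ln_exp (- / lam)). apply ln_le; [lra|]. pose proof (exp_ineq1_le (- / lam)). lra. }
    lra.
  - rewrite seq_S, lsum_app. unfold lsum at 2. cbn [fold_right]. rewrite Rplus_0_r, Nat.add_0_l.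
    eapply Rle_trans; [apply Rplus_le_compat_r, IH|]. pose proof (pos_INR N).
    rewrite S_INR, !ln_div by lra.
    set (z := INR N + 1 + lam). replace (INR N + lam) with (z * (1 - / z)) by (unfold z; field; lra).
    assert (2 < z) by (unfold z; lra).
    assert (/ z <= / 2) by (apply Rinv_le_contravar; lra). assert (0 < / z) by pos.
    rewrite ln_mult by lra.
    assert (ln (1 - / z) <= - / z).
    { rewrite <- (ln_exp (- / z)). apply ln_le; [lra|]. pose proof (exp_ineq1_le (- / z)). lra. }
    lra.
Qed.

(** Indices [j > N] are reflected to [L - j], which only changes the sign of [ph]. Each half is then
    at most [2 L] times the sum of [1 / (j + lam)] over [j <= N], with [lam = L / n]; the cost is a
    logarithm of [n], whatever the degree [N]. *)
Lemma kernel_sum_bound (N n m0 : nat) ph : (1 <= n <= N)%nat ->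
  lsum (seq 0 (2 * N + 1)) (fun j => Rabs (lsum (seq m0 n) (fun m => cos (ph + 2 * PI * (INR j * (INR m / INR (2 * N + 1)))))))
  <= 4 * INR (2 * N + 1) * ln (2 + 2 * INR n).
Proof.
  intros Hn. set (L := (2 * N + 1)%nat).
  assert (HL1 : 1 <= INR L) by (apply (le_INR 1); unfold L; lia).
  assert (Hn1 : 1 <= INR n) by (apply (le_INR 1); lia).
  set (lam := INR L / INR n).
  assert (Hlam : 2 <= lam).
  { unfold lam. apply (Rmult_le_reg_r (INR n)); [lra|]. replace (INR L / INR n * INR n) with (INR L) by (field; lra).
    rewrite <- (mult_INR 2). apply le_INR. lia. }
  assert (HG : lsum (seq 0 (S N)) (fun j => / (INR j + lam)) <= ln (2 + 2 * INR n)).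
  { eapply Rle_trans; [apply inv_shift_sum; auto|]. pose proof (pos_INR N). apply ln_le; [apply Rdiv_lt_0_compat; lra|].
    apply (Rmult_le_reg_r (lam - 1)); [lra|]. replace ((INR N + lam) / (lam - 1) * (lam - 1)) with (INR N + lam) by (field; lra).
    assert (INR N <= INR n * lam).
    { unfold lam. replace (INR n * (INR L / INR n)) with (INR L) by (field; lra). apply le_INR. lia. }
    nra. }
  replace (seq 0 L) with (seq 0 (S N) ++ seq (S N) N).
  2:{ rewrite <- seq_app. f_equal. lia. }
  rewrite lsum_app.
  assert (H1 : lsum (seq 0 (S N)) (fun j => Rabs (lsum (seq m0 n) (fun m => cos (ph + 2 * PI * (INR j * (INR m / INR L)))))) <= 2 * INR L * ln (2 + 2 * INR n)).
  { eapply Rle_trans; [|mull; [apply HG]]. rewrite <- lsum_scal. apply lsum_le.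
    intros j Hj. apply in_seq in Hj. apply kernel_bound; unfold L; lia. }
  assert (H2 : lsum (seq (S N) N) (fun j => Rabs (lsum (seq m0 n) (fun m => cos (ph + 2 * PI * (INR j * (INR m / INR L)))))) <= 2 * INR L * ln (2 + 2 * INR n)).
  { eapply Rle_trans; [|mull; [apply HG]]. rewrite <- lsum_scal.
    assert (Hrev : forall g : nat -> R, lsum (seq (S N) N) g = lsum (seq 1 N) (fun i => g (L - i)%nat)).
    { intros g. rewrite <- (lsum_map (fun i => L - i)%nat (seq 1 N) g).
      unfold lsum. assert (P : forall l, fold_right (fun a s => g a + s) 0 l = lsum l g) by reflexivity. rewrite !P.
      assert (ER : forall k, (k <= N)%nat -> lsum (seq (L - k) k) g = lsum (map (fun i => L - i)%nat (seq 1 k)) g).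
      { induction k as [|k IH]; intros Hk; [reflexivity|].
        rewrite (seq_S k 1), map_app, lsum_app, <- IH by lia. simpl map. simpl seq.
        replace (S (L - S k))%nat with (L - k)%nat by lia. unfold lsum at 1 3. simpl. fold (lsum (seq (L - k) k) g).
        lra. }
      rewrite <- (ER N) by lia. replace (L - N)%nat with (S N) by lia. lra. }
    rewrite Hrev.
    apply Rle_trans with (lsum (seq 1 N) (fun i => 2 * INR L * / (INR i + lam))).
    - apply lsum_le. intros i Hi. apply in_seq in Hi.
      assert (E : Rabs (lsum (seq m0 n) (fun m => cos (ph + 2 * PI * (INR (L - i) * (INR m / INR L))))) =
        Rabs (lsum (seq m0 n) (fun m => cos (- ph + 2 * PI * (INR i * (INR m / INR L)))))).
      { f_equal. apply lsum_ext. intros m _. rewrite minus_INR by lia.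
        replace (ph + 2 * PI * ((INR L - INR i) * (INR m / INR L))) with (- (- ph + 2 * PI * (INR i * (INR m / INR L))) + 2 * INR m * PI) by (field; lra).
        rewrite cos_period, cos_neg. lra. }
      rewrite E. apply kernel_bound; unfold L; lia.
    - replace (seq 0 (S N)) with (0%nat :: seq 1 N) by reflexivity. unfold lsum at 2. simpl fold_right.
      change (fold_right (fun (a : nat) (s : R) => 2 * INR L * / (INR a + lam) + s) 0 (seq 1 N)) with (lsum (seq 1 N) (fun i => 2 * INR L * / (INR i + lam))).
      assert (0 < 2 * INR L * / (0 + lam)) by pos. lra. }
  lra.
Qed.

Lemma root_sum Y (k : Z) (L : nat) : (1 <= L)%nat -> (Z.abs k < Z.of_nat L)%Z ->
  lsum (seq 0 L) (fun j => cos (Y + 2 * PI * (IZR k * (INR j / INR L)))) = indic (k = 0%Z) * (INR L * cos Y).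
Proof.
  intros HL Hk. destruct (Z.eq_dec k 0) as [-> |D].
  - rewrite indic_true by auto. rewrite (lsum_ext _ _ (fun _ => cos Y)).
    + rewrite lsum_const, length_seq. ring.
    + intros j _. f_equal. ring.
  - rewrite indic_false by auto. rewrite root_sum_zero; auto; [ring|].
    intros [z Hz]. assert (z = 0 \/ z <= -1 \/ 1 <= z)%Z by lia. destruct H as [-> |[H|H]]; nia.
Qed.

Lemma cos_minus_quarter x : cos (x - PI / 2) = sin x.
Proof. rewrite cos_minus, cos_PI2, sin_PI2. ring. Qed.

Section Isolation.
Variables (f0 u A phi : R -> R) (a b : nat -> R) (r1 r2 E Um : R).
Hypothesis f0cont : forall x, continuous f0 x.
(** The lower bound [N0] on the degree lets the truncation include all m of the range to be
    isolated. *)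
Hypothesis approx : forall d (N0 : nat), 0 < d -> exists N, (N0 <= N)%nat /\
  forall x, Rabs (f0 x - lsum (seq 1 N) (fun n => harmonic a b n x)) <= d.
Hypothesis Hr : r1 <= r2.
Hypothesis ucont : forall r, r1 <= r <= r2 -> continuous u r.
Hypothesis Acont : forall r, r1 <= r <= r2 -> continuous A r.
Hypothesis pcont : forall r, r1 <= r <= r2 -> continuous phi r.
Hypothesis ubound : forall r, r1 <= r <= r2 -> Rabs (u r) <= Um.
Hypothesis Ec : forall th, Rabs (RInt (fun r => u r * cos (A r) * f0 (th + phi r)) r1 r2) <= E.
Hypothesis Es : forall th, Rabs (RInt (fun r => u r * sin (A r) * f0 (th + phi r)) r1 r2) <= E.

(** Product formulas leave the frequencies [k - m] and [- (m + k)] in [j]. Both are below [L] in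
    absolute value and the second is nonzero, so only [k = m] survives; the negative frequency
    contained in a real harmonic disappears as well. *)
Lemma single_mode (L m k : nat) B x : (1 <= m)%nat -> (1 <= k)%nat -> (m + k < L)%nat ->
  lsum (seq 0 L) (fun j => 2 * cos (B - 2 * PI * (INR m * (INR j / INR L))) * harmonic a b k (x + INR j / INR L))
  = indic (k = m) * (INR L * (a m * cos (B + 2 * PI * (INR m * x)) + b m * sin (B + 2 * PI * (INR m * x)))).
Proof.
  intros Hm Hk HL. set (X := 2 * PI * (INR k * x)).
  transitivity (a k * (lsum (seq 0 L) (fun j => cos ((B + X) + 2 * PI * (IZR (Z.of_nat k - Z.of_nat m) * (INR j / INR L))))
     + lsum (seq 0 L) (fun j => cos ((B - X) + 2 * PI * (IZR (- (Z.of_nat m + Z.of_nat k)) * (INR j / INR L)))))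
   + b k * (lsum (seq 0 L) (fun j => cos ((B + X - PI / 2) + 2 * PI * (IZR (Z.of_nat k - Z.of_nat m) * (INR j / INR L))))
     + (-1) * lsum (seq 0 L) (fun j => cos ((B - X - PI / 2) + 2 * PI * (IZR (- (Z.of_nat m + Z.of_nat k)) * (INR j / INR L)))))).
  - rewrite <- lsum_scal, <- !lsum_plus, <- !lsum_scal, <- lsum_plus. apply lsum_ext. intros j _.
    rewrite minus_IZR, opp_IZR, plus_IZR, <- !INR_IZR_INZ. set (q := INR j / INR L). unfold harmonic.
    replace (B + X - PI / 2 + 2 * PI * ((INR k - INR m) * q)) with ((B + X + 2 * PI * ((INR k - INR m) * q)) - PI / 2) by ring.
    replace (B - X - PI / 2 + 2 * PI * (- (INR m + INR k) * q)) with ((B - X + 2 * PI * (- (INR m + INR k) * q)) - PI / 2) by ring.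
    rewrite !cos_minus_quarter.
    replace (2 * PI * (INR k * (x + q))) with (X + 2 * PI * (INR k * q)) by (unfold X; ring).
    set (P := B - 2 * PI * (INR m * q)). set (T := X + 2 * PI * (INR k * q)).
    replace (B + X + 2 * PI * ((INR k - INR m) * q)) with (P + T) by (unfold P, T; ring).
    replace (B - X + 2 * PI * (- (INR m + INR k) * q)) with (P - T) by (unfold P, T; ring).
    rewrite cos_plus, cos_minus, sin_plus, sin_minus. ring.
  - rewrite !root_sum by lia. rewrite (indic_false (- _ = _)%Z) by lia.
    destruct (Nat.eq_dec k m) as [-> |D].
    + rewrite !indic_true by lia. rewrite cos_minus_quarter. fold X. ring.
    + rewrite !indic_false by lia. ring.
Qed.

Let fN N x := lsum (seq 1 N) (fun n => harmonic a b n x).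
(** The transform of the indicator of the range of m. The sine sum is written as a shifted cosine
    sum so that [kernel_sum_bound] covers both. *)
Let Dc m0 n L j := lsum (seq m0 n) (fun m => cos (0 + 2 * PI * (INR j * (INR m / INR L)))).
Let Ds m0 n L j := lsum (seq m0 n) (fun m => cos (- (PI / 2) + 2 * PI * (INR j * (INR m / INR L)))).

Lemma pointwise_isolation (N m0 n : nat) B x : (1 <= m0)%nat -> (m0 + n <= S N)%nat ->
  let L := (2 * N + 1)%nat in
  lsum (seq 0 L) (fun j => (2 * Dc m0 n L j * cos B + 2 * Ds m0 n L j * sin B) * fN N (x + INR j / INR L))
  = INR L * lsum (seq m0 n) (fun m => a m * cos (B + 2 * PI * (INR m * x)) + b m * sin (B + 2 * PI * (INR m * x))).
Proof.
  intros Hm HN L.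
  transitivity (lsum (seq m0 n) (fun m => lsum (seq 1 N) (fun k =>
     lsum (seq 0 L) (fun j => 2 * cos (B - 2 * PI * (INR m * (INR j / INR L))) * harmonic a b k (x + INR j / INR L))))).
  - transitivity (lsum (seq 0 L) (fun j => lsum (seq m0 n) (fun m => lsum (seq 1 N) (fun k =>
      2 * cos (B - 2 * PI * (INR m * (INR j / INR L))) * harmonic a b k (x + INR j / INR L))))).
    + apply lsum_ext. intros j _. unfold Dc, Ds, fN.
      set (S0 := lsum (seq 1 N) _).
      transitivity (lsum (seq m0 n) (fun m => S0 * (2 * cos (B - 2 * PI * (INR m * (INR j / INR L)))))).
      * rewrite lsum_scal, lsum_scal, (Rmult_comm _ S0). f_equal.
        rewrite (Rmult_comm (2 * _) (cos B)), (Rmult_comm (2 * _) (sin B)), <- !lsum_scal, <- lsum_plus.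
        apply lsum_ext. intros m _. rewrite Rplus_0_l.
        replace (- (PI / 2) + 2 * PI * (INR j * (INR m / INR L))) with (2 * PI * (INR j * (INR m / INR L)) - PI / 2) by ring.
        rewrite cos_minus_quarter, cos_minus.
        replace (INR m * (INR j / INR L)) with (INR j * (INR m / INR L)) by lra. ring.
      * apply lsum_ext. intros m _. unfold S0. rewrite Rmult_comm, <- lsum_scal. lra.
    + rewrite lsum_swap. apply lsum_ext. intros m _. apply lsum_swap.
  - rewrite <- lsum_scal. apply lsum_ext. intros m Hm'. apply in_seq in Hm'.
    set (v := INR L * (a m * cos (B + 2 * PI * (INR m * x)) + b m * sin (B + 2 * PI * (INR m * x)))).
    transitivity (lsum (seq 1 N) (fun k => v * indic (k = m))).
    + apply lsum_ext. intros k Hk. apply in_seq in Hk. rewrite single_mode by lia. unfold v. ring.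
    + rewrite lsum_scal, lsum_unique; [ring|apply seq_NoDup|apply in_seq; lia].
Qed.

Lemma harmonic_continuous k x : continuous (harmonic a b k) x.
Proof. by_derivative. unfold harmonic. auto_derive. auto. Qed.

Lemma cosA_cont r : r1 <= r <= r2 -> continuous (fun r => u r * cos (A r)) r.
Proof using ucont Acont.
  intros H. apply (continuous_mult u (fun r => cos (A r))); auto. apply continuous_comp; auto. apply continuous_cos.
Qed.

Lemma sinA_cont r : r1 <= r <= r2 -> continuous (fun r => u r * sin (A r)) r.
Proof using ucont Acont.
  intros H. apply (continuous_mult u (fun r => sin (A r))); auto. apply continuous_comp; auto. apply continuous_sin.
Qed.

Lemma shift_cont (g : R -> R) th r : (forall x, continuous g x) -> r1 <= r <= r2 -> continuous (fun r => g (th + phi r)) r.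
Proof using pcont.
  intros Hg H. apply continuous_comp; auto. apply (continuous_plus (fun _ => th) phi); auto. apply continuous_const.
Qed.

Lemma lsum_continuous {X} (l : list X) (g : X -> R -> R) x : (forall i, In i l -> continuous (g i) x) ->
  continuous (fun x => lsum l (fun i => g i x)) x.
Proof.
  induction l as [|i l IH]; intros H; [apply continuous_const|].
  apply (continuous_plus (g i) (fun x => lsum l (fun i => g i x))); [apply H; left; auto|apply IH; intros; apply H; right; auto].
Qed.

Lemma ex_RInt_on (g : R -> R) : (forall r, r1 <= r <= r2 -> continuous g r) -> ex_RInt g r1 r2.
Proof using Hr.
  intros H. apply (ex_RInt_continuous g). intros z. minmax. auto.
Qed.

(** [INR L] times the sum is a combination, with coefficients [2 Dc] and [2 Ds], of integrals
    translated by [j / L]. Each integral is at most [E] up to the truncation error, uniformly in the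
    translation, and the coefficients are summed by [kernel_sum_bound]. *)
Lemma isolation th m0 n : (1 <= m0)%nat -> (1 <= n)%nat ->
  Rabs (lsum (seq m0 n) (fun m => RInt (fun r => u r *
    (a m * cos (A r + 2 * PI * (INR m * (th + phi r))) + b m * sin (A r + 2 * PI * (INR m * (th + phi r))))) r1 r2))
  <= 16 * E * ln (2 + 2 * INR n).
Proof using All.
  intros Hm Hn. set (S0 := lsum _ _).
  assert (Hn1 : 1 <= INR n) by (apply (le_INR 1); auto).
  assert (Hln : 0 < ln (2 + 2 * INR n)) by (rewrite <- ln_1; apply ln_increasing; lra).
  assert (HU : 0 <= Um) by (eapply Rle_trans; [apply Rabs_pos|apply (ubound r1); lra]).
  assert (fNc : forall N x, continuous (fN N) x).
  { intros N x. apply (lsum_continuous (seq 1 N) (fun k x => harmonic a b k x)). intros k _. apply harmonic_continuous. }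
  assert (Key : forall d, 0 < d -> Rabs S0 <= 16 * (E + d * Um * (r2 - r1)) * ln (2 + 2 * INR n)).
  { intros d Hd. destruct (approx d (m0 + n) Hd) as [N [HN Hap]].
    set (L := (2 * N + 1)%nat). assert (HL : 1 <= INR L) by (apply (le_INR 1); unfold L; lia).
    set (Ic := fun j => RInt (fun r => u r * cos (A r) * fN N (th + INR j / INR L + phi r)) r1 r2).
    set (Is := fun j => RInt (fun r => u r * sin (A r) * fN N (th + INR j / INR L + phi r)) r1 r2).
    assert (HI : INR L * S0 = lsum (seq 0 L) (fun j => 2 * Dc m0 n L j * Ic j + 2 * Ds m0 n L j * Is j)).
    { set (g := fun r => INR L * lsum (seq m0 n) (fun m => u r * (a m * cos (A r + 2 * PI * (INR m * (th + phi r))) + b m * sin (A r + 2 * PI * (INR m * (th + phi r)))))).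
      transitivity (RInt g r1 r2).
      - symmetry. apply RInt_eq. apply is_RInt_scal_R. apply is_RInt_lsum. intros m _.
        apply (RInt_correct (V := R_CompleteNormedModule)). apply ex_RInt_on. intros r H.
        apply (continuous_mult u (fun r => a m * cos (A r + 2 * PI * (INR m * (th + phi r))) + b m * sin (A r + 2 * PI * (INR m * (th + phi r))))); auto.
        assert (Cc : continuous (fun r => A r + 2 * PI * (INR m * (th + phi r))) r).
        { apply (continuous_plus A (fun r => 2 * PI * (INR m * (th + phi r)))); auto.
          apply (continuous_scal_r (2 * PI) (fun r => INR m * (th + phi r))).
          apply (continuous_scal_r (INR m) (fun r => th + phi r)). apply (shift_cont (fun x => x)); auto. intros; apply continuous_id. }
        apply (continuous_plus (fun r => a m * cos _) (fun r => b m * sin _)).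
        + apply (continuous_scal_r (a m) (fun r => cos _)). apply continuous_comp; auto. apply continuous_cos.
        + apply (continuous_scal_r (b m) (fun r => sin _)). apply continuous_comp; auto. apply continuous_sin.
      - apply RInt_eq.
        apply (is_RInt_ext (fun r => lsum (seq 0 L) (fun j => 2 * Dc m0 n L j * (u r * cos (A r) * fN N (th + INR j / INR L + phi r))
            + 2 * Ds m0 n L j * (u r * sin (A r) * fN N (th + INR j / INR L + phi r))))).
        + intros r _. unfold g. rewrite (lsum_scal (seq m0 n)).
          match goal with |- _ = INR L * (u r * ?q) => transitivity (u r * (INR L * q)); [|change (@eq R (u r * (INR L * q)) (INR L * (u r * q))); ring] end.
          pose proof (pointwise_isolation N m0 n (A r) (th + phi r) Hm ltac:(lia)) as PE. cbv zeta in PE. fold L in PE. rewrite <- PE. rewrite <- lsum_scal. apply lsum_ext. intros j _.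
          replace (th + INR j / INR L + phi r) with (th + phi r + INR j / INR L) by ring. rring.
        + apply is_RInt_lsum. intros j _.
          apply (is_RInt_plus (fun r => 2 * Dc m0 n L j * (u r * cos (A r) * fN N (th + INR j / INR L + phi r)))
            (fun r => 2 * Ds m0 n L j * (u r * sin (A r) * fN N (th + INR j / INR L + phi r))) r1 r2
            (2 * Dc m0 n L j * Ic j) (2 * Ds m0 n L j * Is j)); apply is_RInt_scal_R; apply (RInt_correct (V := R_CompleteNormedModule)); apply ex_RInt_on; intros r H.
          * apply (continuous_mult (fun r => u r * cos (A r)) (fun r => fN N (th + INR j / INR L + phi r))); [apply cosA_cont; auto|apply shift_cont; auto].
          * apply (continuous_mult (fun r => u r * sin (A r)) (fun r => fN N (th + INR j / INR L + phi r))); [apply sinA_cont; auto|apply shift_cont; auto]. }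
    assert (HE : forall (cs : R -> R), (forall x, Rabs (cs x) <= 1) -> (forall r, r1 <= r <= r2 -> continuous (fun r => u r * cs (A r)) r) ->
       (forall t, Rabs (RInt (fun r => u r * cs (A r) * f0 (t + phi r)) r1 r2) <= E) ->
       forall t, Rabs (RInt (fun r => u r * cs (A r) * fN N (t + phi r)) r1 r2) <= E + d * Um * (r2 - r1)).
    { intros cs Hcs Hcc Hcb t. specialize (Hcb t).
      set (g1 := fun r => u r * cs (A r) * f0 (t + phi r)) in *. set (g2 := fun r => u r * cs (A r) * fN N (t + phi r)).
      assert (X1 : ex_RInt g1 r1 r2) by (apply ex_RInt_on; intros; apply (continuous_mult (fun r => u r * cs (A r)) (fun r => f0 (t + phi r))); auto; apply shift_cont; auto).
      assert (X2 : ex_RInt g2 r1 r2) by (apply ex_RInt_on; intros; apply (continuous_mult (fun r => u r * cs (A r)) (fun r => fN N (t + phi r))); auto; apply shift_cont; auto).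
      apply (RInt_correct g1) in X1. apply (RInt_correct g2) in X2.
      pose proof (is_RInt_minus _ _ _ _ _ _ X2 X1) as X3.
      assert (X4 : Rabs (RInt g2 r1 r2 - RInt g1 r1 r2) <= d * Um * (r2 - r1)).
      { refine (is_RInt_abs_le _ (fun _ => d * Um) r1 r2 _ _ Hr _ X3 _).
        - intros r H. change (Rabs (g2 r - g1 r) <= d * Um). unfold g1, g2.
          rewrite <- Rmult_minus_distr_l, Rabs_mult, Rabs_mult, Rabs_minus_sym, (Rmult_comm d).
          apply Rmult_le_compat; auto using Rabs_pos; [apply Rmult_le_pos; apply Rabs_pos|].
          rewrite <- (Rmult_1_r Um). apply Rmult_le_compat; auto using Rabs_pos.
        - replace (d * Um * (r2 - r1)) with ((r2 - r1) * (d * Um)) by ring. apply is_RInt_const_R. }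
      replace (RInt g2 r1 r2) with (RInt g1 r1 r2 + (RInt g2 r1 r2 - RInt g1 r1 r2) : R) by lra.
      via Rabs_triang. lra. }
    set (E' := E + d * Um * (r2 - r1)) in *.
    assert (HE' : 0 <= E') by (eapply Rle_trans; [apply Rabs_pos|apply (HE cos Rabs_cos_le cosA_cont Ec 0)]).
    apply (Rmult_le_reg_l (INR L)); [lra|].
    rewrite <- (Rabs_pos_eq (INR L)) at 1 by lra. rewrite <- Rabs_mult, HI.
    via Rabs_lsum.
    apply Rle_trans with (lsum (seq 0 L) (fun j => (2 * E') * Rabs (Dc m0 n L j) + (2 * E') * Rabs (Ds m0 n L j))).
    - apply lsum_le. intros j _. via Rabs_triang.
      rewrite !Rabs_mult, (Rabs_pos_eq 2) by lra.
      pose proof (HE cos Rabs_cos_le cosA_cont Ec (th + INR j / INR L)) as Y1.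
      pose proof (HE sin Rabs_sin_le sinA_cont Es (th + INR j / INR L)) as Y2.
      pose proof (Rabs_pos (Dc m0 n L j)). pose proof (Rabs_pos (Ds m0 n L j)).
      fold (Ic j) in Y1. fold (Is j) in Y2.
      nra.
    - rewrite lsum_plus, !lsum_scal.
      pose proof (kernel_sum_bound N n m0 0 ltac:(lia)) as K1. pose proof (kernel_sum_bound N n m0 (- (PI / 2)) ltac:(lia)) as K2.
      fold L in K1, K2.
      apply Rle_trans with (2 * E' * (4 * INR L * ln (2 + 2 * INR n)) + 2 * E' * (4 * INR L * ln (2 + 2 * INR n))).
      + apply Rplus_le_compat; apply Rmult_le_compat_l; auto; lra.
      + lra. }
  (* The truncation degree depends on [d], but the bound [Key] does not; a [d] small against the gap
     contradicts it. *)
  apply Rnot_lt_le. intros Hc. set (ln0 := ln (2 + 2 * INR n)) in *.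
  set (K := 16 * Um * (r2 - r1) * ln0). assert (HK : 0 <= K) by pos.
  set (gap := Rabs S0 - 16 * E * ln0). assert (Hg : 0 < gap) by (unfold gap; lra).
  assert (Hd : 0 < gap / (2 * (K + 1))) by pos.
  specialize (Key _ Hd). set (d := gap / (2 * (K + 1))) in *.
  assert (d * K < gap).
  { apply Rle_lt_trans with (d * (K + 1)); [apply Rmult_le_compat_l; lra|].
    replace (d * (K + 1)) with (gap / 2) by (unfold d; field; lra). lra. }
  assert (16 * (E + d * Um * (r2 - r1)) * ln0 = 16 * E * ln0 + d * K) by (unfold K; ring).
  unfold gap in *. lra.
Qed.
End Isolation.

(** * Fresnel integrals *)

Lemma ex_RInt_closed (g : R -> R) p q : p <= q -> (forall r, p <= r <= q -> continuous g r) -> ex_RInt g p q.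
Proof. intros Hpq H. apply (ex_RInt_continuous g). intros z. minmax. auto. Qed.

(** Integration by parts with an antiderivative that vanishes at [p]; as [w] is monotone, its total
    variation is [|w q - w p|]. *)
Lemma ibp_bound (w dw H dH : R -> R) p q T : p <= q ->
  (forall r, p <= r <= q -> is_derive w r (dw r)) -> (forall r, p <= r <= q -> is_derive H r (dH r)) ->
  (forall r, p <= r <= q -> continuous dw r) -> (forall r, p <= r <= q -> continuous dH r) ->
  (forall r, p <= r <= q -> Rabs (H r) <= T) -> H p = 0 ->
  (forall r, p <= r <= q -> 0 <= dw r) \/ (forall r, p <= r <= q -> dw r <= 0) ->
  Rabs (RInt (fun r => w r * dH r) p q) <= T * (Rabs (w q) + Rabs (w q - w p)).
Proof.
  intros Hpq Hw HH Cw CH HT H0 Hsg.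
  assert (Cw0 : forall r, p <= r <= q -> continuous w r) by (intros r Hr; by_derivative; eexists; apply Hw; auto).
  assert (CH0 : forall r, p <= r <= q -> continuous H r) by (intros r Hr; by_derivative; eexists; apply HH; auto).
  assert (HT0 : 0 <= T) by (eapply Rle_trans; [apply Rabs_pos|apply (HT p); lra]).
  assert (I1 : is_RInt (fun r => dw r * H r + w r * dH r) p q (w q * H q - w p * H p)).
  { apply (is_RInt_derive (fun r => w r * H r)); minmax; intros r Hr.
    - apply (is_derive_mult w H); auto. intros; apply Rmult_comm.
    - apply (continuous_plus (fun r => dw r * H r) (fun r => w r * dH r)); [apply (continuous_mult dw H)|apply (continuous_mult w dH)]; auto. }
  assert (I2 : is_RInt (fun r => dw r * H r) p q (RInt (fun r => dw r * H r) p q)).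
  { apply (RInt_correct (fun r => dw r * H r)). apply ex_RInt_closed; auto. intros; apply (continuous_mult dw H); auto. }
  assert (I3 : is_RInt (fun r => w r * dH r) p q (w q * H q - RInt (fun r => dw r * H r) p q)).
  { apply (is_RInt_ext (fun r => minus (dw r * H r + w r * dH r) (dw r * H r))).
    - intros r _. unfold minus, plus, opp; simpl. rring.
    - replace (w q * H q - RInt (fun r => dw r * H r) p q) with (minus (w q * H q - w p * H p) (RInt (fun r => dw r * H r) p q)).
      + apply (is_RInt_minus (V := R_NormedModule)); auto.
      + rewrite H0. unfold minus, plus, opp; simpl. lra. }
  apply RInt_eq in I3. rewrite I3.
  assert (I4 : is_RInt dw p q (w q - w p)).
  { apply (is_RInt_derive w); minmax; auto. }
  assert (B : Rabs (RInt (fun r => dw r * H r) p q) <= T * Rabs (w q - w p)).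
  { destruct Hsg as [Hsg|Hsg].
    - eapply Rle_trans; [apply (is_RInt_abs_le (fun r => dw r * H r) (fun r => T * dw r) p q _ _ Hpq) with (2 := I2)|].
      + intros r Hr. rewrite Rabs_mult, Rabs_pos_eq by auto. rewrite Rmult_comm. apply Rmult_le_compat_r; auto.
      + apply is_RInt_scal_R. exact I4.
      + apply Rmult_le_compat_l; auto. apply Rle_abs.
    - eapply Rle_trans; [apply (is_RInt_abs_le (fun r => dw r * H r) (fun r => (- T) * dw r) p q _ _ Hpq) with (2 := I2)|].
      + intros r Hr. rewrite Rabs_mult, Rabs_left1 by auto. specialize (HT r Hr). specialize (Hsg r Hr). nra.
      + apply is_RInt_scal_R. exact I4.
      + rewrite <- Rabs_Ropp. replace (- T * (w q - w p)) with (T * (- (w q - w p))) by ring.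
        apply Rmult_le_compat_l; auto. apply Rle_abs. }
  unfold Rminus at 1. via Rabs_triang. rewrite Rabs_Ropp, Rabs_mult, Rmult_plus_distr_l.
  apply Rplus_le_compat; auto. rewrite Rmult_comm. mulr. apply HT; lra.
Qed.

Lemma increasing_by_derivative (f df : R -> R) a b : a <= b -> (forall x, a <= x <= b -> is_derive f x (df x)) ->
  (forall x, a <= x <= b -> 0 <= df x) -> f a <= f b.
Proof.
  intros Hab Hd Hp. destruct (MVT_gen f a b df) as [c [Hc E]].
  - minmax. intros; apply Hd; lra.
  - minmax. intros x Hx. apply continuity_pt_filterlim, (ex_derive_continuous f). eexists; apply Hd; auto.
  - rewrite Rmin_left, Rmax_right in Hc by auto. pose proof (Hp c Hc). nra.
Qed.

Section Fresnel.
Variable be : R.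
Hypothesis Hbe : 0 < be.

(** The phase [om] treats both Fresnel integrals at once: 0 gives the cosine integral and
    [- (PI / 2)] the sine integral, with rate [be]. *)
Definition fphase (om w : R) : R := cos (be * w ^ 2 + om).
Definition fres (om w : R) : R := RInt (fphase om) 0 w.

Lemma fphase_continuous om w : continuous (fphase om) w.
Proof. by_derivative. unfold fphase. auto_derive. auto. Qed.

Lemma fres_derive om w : is_derive (fres om) w (fphase om w).
Proof.
  apply (is_derive_RInt (fphase om) (fres om) 0).
  - apply filter_forall. intros x. apply (RInt_correct (fphase om)). apply (ex_RInt_continuous (fphase om)). intros; apply fphase_continuous.
  - apply fphase_continuous.
Qed.

Lemma fres_0 om : fres om 0 = 0.
Proof. unfold fres. rewrite RInt_point. auto. Qed.

Lemma fres_odd om w : fres om (- w) = - fres om w.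
Proof.
  assert (E : forall x, is_derive (fun x => fres om (- x) + fres om x) x 0).
  { intros x. replace 0 with (plus (scal (-1) (fphase om (- x))) (fphase om x)).
    - apply (is_derive_plus (fun x => fres om (- x)) (fres om)); [|apply fres_derive].
      apply (is_derive_comp (fres om) Ropp); [apply fres_derive|]. auto_derive; auto.
    - unfold plus, scal; simpl. unfold mult; simpl. unfold fphase. replace ((- x) ^ 2) with (x ^ 2) by ring. rring. }
  destruct (MVT_gen (fun x => fres om (- x) + fres om x) 0 w (fun _ => 0)) as [c [_ Hc]].
  - auto.
  - intros x _. apply continuity_pt_filterlim, (ex_derive_continuous (fun x => fres om (- x) + fres om x)). eexists; apply E.
  - rewrite Ropp_0, fres_0 in Hc. lra.
Qed.

(** After subtraction of the boundary term [sin / (2 be x)] the derivative is at most that of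
    [- 1 / (2 be x)] in absolute value; adding or subtracting [1 / (2 be x)] therefore leaves
    monotone functions. *)
Lemma fres_tail om w w' : 0 < w <= w' -> Rabs (fres om w' - fres om w) <= / (be * w).
Proof.
  intros [Hw Hww].
  set (G := fun x => fres om x - sin (be * x ^ 2 + om) / (2 * be * x)).
  assert (dG : forall x, w <= x <= w' -> is_derive G x (sin (be * x ^ 2 + om) / (2 * be * x ^ 2))).
  { intros x Hx. unfold G.
    replace (sin (be * x ^ 2 + om) / (2 * be * x ^ 2)) with (minus (fphase om x) (fphase om x - sin (be * x ^ 2 + om) / (2 * be * x ^ 2))) by (unfold minus, plus, opp; simpl; rring).
    apply (is_derive_minus (fres om) (fun x => sin (be * x ^ 2 + om) / (2 * be * x))); [apply fres_derive|].
    unfold fphase. auto_derive; [nra|]. replace (x * (x * 1)) with (x ^ 2) by ring. field. lra. }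
  assert (dI : forall x, w <= x <= w' -> is_derive (fun x => / (2 * be * x)) x (- / (2 * be * x ^ 2))).
  { intros x Hx. auto_derive; [nra|]. field. lra. }
  assert (Sb : forall x, w <= x <= w' -> Rabs (sin (be * x ^ 2 + om) / (2 * be * x ^ 2)) <= / (2 * be * x ^ 2)).
  { intros x Hx. unfold Rdiv. rewrite Rabs_mult. rewrite <- (Rmult_1_l (/ (2 * be * x ^ 2))) at 2. assert (0 < x) by lra.
    apply Rmult_le_compat; auto using Rabs_pos, Rabs_sin_le. right. apply Rabs_pos_eq. pos. }
  assert (M1 : G w + / (2 * be * w') <= G w' + / (2 * be * w) ).
  { assert (G w - / (2 * be * w) <= G w' - / (2 * be * w')); [|lra].
    apply (increasing_by_derivative (fun x => G x - / (2 * be * x)) (fun x => sin (be * x ^ 2 + om) / (2 * be * x ^ 2) - - / (2 * be * x ^ 2))); auto.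
    - intros x Hx. apply (is_derive_minus G (fun x => / (2 * be * x))); auto.
    - intros x Hx. specialize (Sb x Hx). apply Rabs_le_between in Sb. lra. }
  assert (M2 : G w' + / (2 * be * w') <= G w + / (2 * be * w)).
  { assert (- G w - / (2 * be * w) <= - G w' - / (2 * be * w')); [|lra].
    apply (increasing_by_derivative (fun x => - G x - / (2 * be * x)) (fun x => - (sin (be * x ^ 2 + om) / (2 * be * x ^ 2)) - - / (2 * be * x ^ 2))); auto.
    - intros x Hx. apply (is_derive_minus (fun x => - G x) (fun x => / (2 * be * x))); auto. apply (is_derive_opp G); auto.
    - intros x Hx. specialize (Sb x Hx). apply Rabs_le_between in Sb. lra. }
  assert (B : forall x, 0 < x -> Rabs (sin (be * x ^ 2 + om) / (2 * be * x)) <= / (2 * be * x)).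
  { intros x Hx. unfold Rdiv. rewrite Rabs_mult. rewrite <- (Rmult_1_l (/ (2 * be * x))) at 2.
    apply Rmult_le_compat; auto using Rabs_pos, Rabs_sin_le. right. apply Rabs_pos_eq. pos. }
  pose proof (B w Hw) as B1. pose proof (B w' ltac:(lra)) as B2. apply Rabs_le_between in B1. apply Rabs_le_between in B2.
  replace (/ (be * w)) with (/ (2 * be * w) + / (2 * be * w)) by (field; lra).
  unfold G in *. apply Rabs_le. lra.
Qed.

Definition fresnel_sine := fres (- (PI / 2)).

Lemma one_minus_cos_le x : 0 <= 1 - cos x <= Rabs x.
Proof.
  pose proof (COS_bound x). split; [lra|]. pose proof (cos_lipschitz 0 x) as H1. rewrite cos_0 in H1.
  pose proof (Rle_abs (1 - cos x)). replace (0 - x) with (- x) in H1 by ring. rewrite Rabs_Ropp in H1. lra.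
Qed.

(* (1 - cos) instead of - cos as the antiderivative makes the boundary term nonnegative. *)
Lemma fresnel_sine_lower w : 2 / sqrt be <= w -> / (25 * sqrt be) <= fresnel_sine w.
Proof.
  intros Hw. assert (Hs : 0 < sqrt be) by pos. assert (Es : sqrt be * sqrt be = be) by (apply sqrt_sqrt; lra).
  pose proof PI_RGT_0. pose proof PI_4. pose proof PI2_3_2.
  set (G := fun x => fresnel_sine x - (1 - cos (be * x ^ 2)) / (2 * be * x)).
  assert (dG : forall x, 0 < x -> is_derive G x ((1 - cos (be * x ^ 2)) / (2 * be * x ^ 2))).
  { intros x Hx. unfold G.
    replace ((1 - cos (be * x ^ 2)) / (2 * be * x ^ 2)) with (fphase (- (PI / 2)) x - (sin (be * x ^ 2) - (1 - cos (be * x ^ 2)) / (2 * be * x ^ 2))).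
    2:{ unfold fphase. change (be * x ^ 2 + - (PI / 2)) with (be * x ^ 2 - PI / 2). rewrite cos_minus_quarter. ring. }
    apply (is_derive_minus fresnel_sine (fun x => (1 - cos (be * x ^ 2)) / (2 * be * x))
      x (fphase (- (PI / 2)) x) (sin (be * x ^ 2) - (1 - cos (be * x ^ 2)) / (2 * be * x ^ 2))); [apply fres_derive|].
    auto_derive; [nra|]. replace (x * (x * 1)) with (x ^ 2) by ring. field. lra. }
  assert (dGp : forall x, 0 < x -> 0 <= (1 - cos (be * x ^ 2)) / (2 * be * x ^ 2)).
  { intros x Hx. apply Rle_mult_inv_pos; [apply one_minus_cos_le|pos]. }
  assert (Gm : forall x x', 0 < x <= x' -> G x <= G x').
  { intros x x' Hx. apply (increasing_by_derivative G (fun x => (1 - cos (be * x ^ 2)) / (2 * be * x ^ 2))); try lra.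
    - intros; apply dG; lra.
    - intros; apply dGp; lra. }
  assert (Gs : forall x, 0 < x -> - (2 * x) <= G x).
  { intros x Hx. unfold G. pose proof (one_minus_cos_le (be * x ^ 2)) as [_ O]. rewrite Rabs_pos_eq in O by pos.
    assert ((1 - cos (be * x ^ 2)) / (2 * be * x) <= x / 2).
    { apply (Rmult_le_reg_r (2 * be * x)); [pos|]. rewrite Rdiv_mult_l by nra.
      lra. }
    assert (Rabs (fresnel_sine x) <= x).
    { unfold fresnel_sine, fres. replace x with ((x - 0) * 1) at 2 by ring.
      apply (is_RInt_abs_le (fphase (- (PI / 2))) (fun _ => 1) 0 x); try lra.
      - intros; apply Rabs_cos_le.
      - apply (RInt_correct (fphase (- (PI / 2)))). apply (ex_RInt_continuous (fphase (- (PI / 2)))). intros; apply fphase_continuous.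
      - apply is_RInt_const_R. }
    apply Rabs_le_between in H3. lra. }
  (* On [[a, b]] the argument [be x^2] runs from 25/16 to 49/16. There the cosine is at most 7/16,
     so [G] increases by a definite amount. *)
  set (a := 5 / 4 / sqrt be). set (b := 7 / 4 / sqrt be).
  assert (Ha : 0 < a) by pos. assert (Hab : b - a = / (2 * sqrt be)) by (unfold a, b; field; lra).
  assert (0 < / (2 * sqrt be)) by pos.
  (* [G x >= - 2 x] for small [x], and [G] is nondecreasing. *)
  assert (Ga : 0 <= G a).
  { apply Rnot_lt_le. intros N. set (x := Rmin a (- G a / 4)).
    assert (Hx : 0 < x <= a) by (unfold x; split; [apply Rmin_glb_lt; lra|apply Rmin_l]).
    pose proof (Gs x ltac:(lra)). pose proof (Gm x a Hx). pose proof (Rmin_r a (- G a / 4)). fold x in H5. lra. }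
  assert (Gb : / (25 * sqrt be) <= G b - G a).
  { destruct (MVT_gen G a b (fun x => (1 - cos (be * x ^ 2)) / (2 * be * x ^ 2))) as [c [Hc E]].
    - minmax. intros; apply dG; lra.
    - minmax. intros x Hx. apply continuity_pt_filterlim, (ex_derive_continuous G). eexists; apply dG; lra.
    - rewrite Rmin_left, Rmax_right in Hc by lra. rewrite E, Hab.
      assert (Ec : be * c ^ 2 = (sqrt be * c) ^ 2) by nra.
      assert (Hc2 : 5 / 4 <= sqrt be * c <= 7 / 4).
      { assert (Xa : sqrt be * a = 5 / 4) by (unfold a; field; lra). assert (Xb : sqrt be * b = 7 / 4) by (unfold b; field; lra).
        nra. }
      assert (Hc3 : 25 / 16 <= be * c ^ 2 <= 49 / 16) by nra.
      assert (Hcos : cos (be * c ^ 2) <= 7 / 16).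
      { destruct (Rle_dec (be * c ^ 2) (PI / 2)) as [D|D].
        - pose proof (cos_lipschitz (be * c ^ 2) (PI / 2)) as Lp. rewrite cos_PI2, Rminus_0_r in Lp.
          pose proof (Rle_abs (cos (be * c ^ 2))). rewrite (Rabs_left1 (be * c ^ 2 - PI / 2)) in Lp by lra. lra.
        - apply Rle_trans with 0; [|lra]. apply cos_le_0; lra. }
      apply Rle_trans with ((1 - 7 / 16) / (2 * (49 / 16)) * / (2 * sqrt be)).
      + replace ((1 - 7 / 16) / (2 * (49 / 16)) * / (2 * sqrt be)) with (9 / 196 * / sqrt be) by (field; lra).
        replace (/ (25 * sqrt be)) with (/ 25 * / sqrt be) by (field; lra). mulr; lra.
      + mulr. apply Rmult_le_compat; [lra|left; apply Rinv_0_lt_compat; lra|lra|].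
        apply Rinv_le_contravar; [lra|]. lra. }
  assert (b <= w) by (below Hw; unfold b, Rdiv; mulr; lra).
  pose proof (Gm b w ltac:(lra)) as Gw. unfold G at 2 in Gw.
  assert (0 <= (1 - cos (be * w ^ 2)) / (2 * be * w)).
  { apply Rle_mult_inv_pos; [apply one_minus_cos_le|]. pos. }
  lra.
Qed.

(** * Averaged cutoffs *)

(** For [s = sqrt m] and [be = PI B] the phase [PI B (r + m / r)] equals
    [be (wvar s r)^2 + 2 PI B s]. In this variable the phase of the m-th mode is exactly quadratic,
    with no Taylor remainder. *)
Definition wvar (s r : R) : R := / sqrt r * (r - s).

Lemma wvar_derive_r s r : 0 < r -> is_derive (wvar s) r ((r + s) / (2 * r * sqrt r)).
Proof.
  intros Hr. assert (Hs : 0 < sqrt r) by pos. unfold wvar. auto_derive; [lra|].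
  assert (E : sqrt r * sqrt r = r) by (apply sqrt_sqrt; lra).
  replace (2 * r * sqrt r) with (2 * (sqrt r * sqrt r) * sqrt r) by nra.
  replace (r + - s) with (sqrt r * sqrt r - s) by lra.
  replace (r + s) with (sqrt r * sqrt r + s) by lra. field. lra.
Qed.

(** For a fixed end point [r] the derivative in [s] has size [1 / sqrt r]. It oscillates in [r], so
    the average over end points has a much smaller derivative. *)
Definition averaged om p q s : R := RInt (fun r => fres om (wvar s r)) p q.

Lemma averaged_derive om p q s : 0 < p <= q ->
  is_derive (averaged om p q) s (RInt (fun r => - / sqrt r * fphase om (wvar s r)) p q).
Proof.
  intros [Hp Hpq].
  assert (D : forall z t, is_derive (fun z => fres om (wvar z t)) z (- / sqrt t * fphase om (wvar z t))).
  { intros z t. apply (is_derive_comp (fres om) (fun z => wvar z t)); [apply fres_derive|].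
    unfold wvar. auto_derive; auto. ring. }
  assert (DE : forall z t, Derive (fun z => fres om (wvar z t)) z = - / sqrt t * fphase om (wvar z t)) by (intros; apply is_derive_unique, D).
  replace (RInt (fun r => - / sqrt r * fphase om (wvar s r)) p q) with (RInt (fun t => Derive (fun u => fres om (wvar u t)) s) p q).
  2:{ apply (RInt_ext (V := R_CompleteNormedModule)). auto. }
  apply (is_derive_RInt_param (fun s r => fres om (wvar s r))).
  - apply filter_forall. intros z t _. eexists; apply D.
  - minmax. intros t Ht.
    apply (continuity_2d_pt_ext (fun u v => - / sqrt v * fphase om (wvar u v))); [intros; symmetry; apply DE|].
    assert (C1 : continuity_2d_pt (fun u v : R => / sqrt v) s t).
    { apply (continuity_1d_2d_pt_comp (fun v => / sqrt v) (fun u v => v)); [|apply continuity_2d_pt_id2].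
      apply continuity_pt_filterlim, (ex_derive_continuous (fun v => / sqrt v)). assert (0 < sqrt t) by pos. auto_derive. lra. }
    apply continuity_2d_pt_mult.
    + apply continuity_2d_pt_opp. auto.
    + apply (continuity_1d_2d_pt_comp (fphase om)); [apply continuity_pt_filterlim, fphase_continuous|].
      unfold wvar. apply continuity_2d_pt_mult; [exact C1|]. apply continuity_2d_pt_minus; [apply continuity_2d_pt_id2|apply continuity_2d_pt_id1].
  - apply filter_forall. intros z. apply ex_RInt_closed; auto. intros r Hr. apply (continuous_comp (wvar z) (fres om)).
    + by_derivative. eexists; apply wvar_derive_r; lra.
    + by_derivative. eexists; apply fres_derive.
Qed.

(* Trading the s-derivative for an r-derivative makes the integrand exact up to a monotone weight. *)
Lemma averaged_derive_bound om p q s w0 : 0 < p <= q -> 0 <= s -> 0 < w0 ->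
  (forall r, p <= r <= q -> w0 <= wvar s r) \/ (forall r, p <= r <= q -> wvar s r <= - w0) ->
  Rabs (RInt (fun r => - / sqrt r * fphase om (wvar s r)) p q) <= 4 / (be * w0).
Proof.
  intros [Hp Hpq] Hs Hw0 Hsg.
  assert (Hbw : 0 < / (be * w0)) by pos.
  assert (T : forall r, p <= r <= q -> Rabs (fres om (wvar s r) - fres om (wvar s p)) <= / (be * w0)).
  { assert (G : forall u v, w0 <= u -> w0 <= v -> Rabs (fres om u - fres om v) <= / (be * w0)).
    { intros u v Hu Hv. assert (K : forall a b, w0 <= a -> a <= b -> / (be * a) <= / (be * w0)).
      { intros a b Ha _. apply Rinv_le_contravar; [pos|]. nra. }
      destruct (Rle_dec u v) as [L|L].
      - rewrite Rabs_minus_sym. eapply Rle_trans; [apply fres_tail; lra|]. eapply K; eauto.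
      - eapply Rle_trans; [apply fres_tail; lra|]. apply (K v u); lra. }
    intros r Hr. destruct Hsg as [Hsg|Hsg].
    - apply G; apply Hsg; lra.
    - pose proof (Hsg r Hr). pose proof (Hsg p ltac:(lra)).
      replace (fres om (wvar s r) - fres om (wvar s p)) with (- (fres om (- wvar s r) - fres om (- wvar s p))) by (rewrite !fres_odd; ring).
      rewrite Rabs_Ropp. apply G; lra. }
  assert (Hsq : forall r, p <= r <= q -> 0 < sqrt r) by (intros; apply sqrt_lt_R0; lra).
  set (dH := fun r => (r + s) / (2 * r * sqrt r) * fphase om (wvar s r)).
  rewrite (RInt_ext (V := R_CompleteNormedModule) _ (fun r => (- (2 * r / (r + s))) * dH r)).
  2:{ minmax. intros r Hr. unfold dH. specialize (Hsq r ltac:(lra)).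
      assert (0 < r) by lra. change (@eq R (- / sqrt r * fphase om (wvar s r)) (- (2 * r / (r + s)) * ((r + s) / (2 * r * sqrt r) * fphase om (wvar s r)))). field. lra. }
  eapply Rle_trans; [apply (ibp_bound (fun r => - (2 * r / (r + s))) (fun r => - (2 * s / (r + s) ^ 2)) (fun r => fres om (wvar s r) - fres om (wvar s p)) dH p q (/ (be * w0))); auto|].
  - intros r Hr. auto_derive; [lra|]. field. lra.
  - intros r Hr. unfold dH.
    replace ((r + s) / (2 * r * sqrt r) * fphase om (wvar s r)) with ((r + s) / (2 * r * sqrt r) * fphase om (wvar s r) - 0) by ring.
    apply (is_derive_minus (fun r => fres om (wvar s r)) (fun _ => fres om (wvar s p)) r ((r + s) / (2 * r * sqrt r) * fphase om (wvar s r)) 0); [|apply (is_derive_const (V := R_NormedModule))].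
    apply (is_derive_comp (fres om) (wvar s)); [apply fres_derive|apply wvar_derive_r; lra].
  - intros r Hr. by_derivative. auto_derive. assert (0 < r + s) by lra. apply Rgt_not_eq. nra.
  - intros r Hr. apply (continuous_mult (fun r => (r + s) / (2 * r * sqrt r)) (fun r => fphase om (wvar s r))).
    + by_derivative. specialize (Hsq r Hr). auto_derive. split; [lra|]. split; auto. apply Rgt_not_eq. assert (0 < r) by lra. pos.
    + apply (continuous_comp (wvar s) (fphase om)); [|apply fphase_continuous].
      by_derivative. eexists; apply wvar_derive_r; lra.
  - ring.
  - right. intros r Hr. assert (0 <= 2 * s / (r + s) ^ 2); [|lra]. pos.
  - assert (P : forall r, p <= r <= q -> 0 <= 2 * r / (r + s) <= 2).
    { intros r Hr. split; [apply Rle_mult_inv_pos; lra|]. apply (Rmult_le_reg_r (r + s)); [lra|]. rewrite Rdiv_mult_l by lra. lra. }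
    pose proof (P p ltac:(lra)). pose proof (P q ltac:(lra)).
    replace (4 / (be * w0)) with (/ (be * w0) * (2 + 2)) by lra.
    mull. apply Rplus_le_compat; apply Rabs_le; lra.
Qed.

Lemma averaged_lipschitz om p q s s' w0 : 0 < p <= q -> 0 <= s <= s' -> 0 < w0 ->
  (forall r z, p <= r <= q -> s <= z <= s' -> w0 <= wvar z r) \/ (forall r z, p <= r <= q -> s <= z <= s' -> wvar z r <= - w0) ->
  Rabs (averaged om p q s' - averaged om p q s) <= 4 / (be * w0) * (s' - s).
Proof.
  intros Hp Hs Hw0 Hsg.
  destruct (MVT_gen (averaged om p q) s s' (fun z => RInt (fun r => - / sqrt r * fphase om (wvar z r)) p q)) as [c [Hc E]].
  - intros z _. apply averaged_derive; auto.
  - intros z _. apply continuity_pt_filterlim, (ex_derive_continuous (averaged om p q)). eexists; apply averaged_derive; auto.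
  - rewrite Rmin_left, Rmax_right in Hc by lra. rewrite E, Rabs_mult, (Rabs_pos_eq (s' - s)) by lra.
    mulr. apply averaged_derive_bound; auto; [lra|].
    destruct Hsg as [H|H]; [left|right]; intros; apply H; auto.
Qed.
End Fresnel.

(** * Partial summation *)

Lemma lsum_seq_S (x : nat -> R) m0 k : lsum (seq m0 (S k)) x = lsum (seq m0 k) x + x (m0 + k)%nat.
Proof. rewrite seq_S, lsum_app. unfold lsum at 2. cbn [fold_right]. ring. Qed.

(** The variation of the weights is majorised by increments of a function [D], so that the total
    variation telescopes. *)
Lemma abel (x om D : nat -> R) m0 n E W0 : (1 <= n)%nat ->
  (forall k, (k <= n)%nat -> Rabs (lsum (seq m0 k) x) <= E) ->
  (forall m, (m0 <= m < m0 + n)%nat -> Rabs (om m) <= W0) ->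
  (forall m, (m0 <= m)%nat -> (S m < m0 + n)%nat -> Rabs (om (S m) - om m) <= D (S m) - D m) ->
  Rabs (lsum (seq m0 n) (fun m => om m * x m)) <= E * (W0 + (D (m0 + n - 1)%nat - D m0)).
Proof.
  intros Hn HP HW HD.
  assert (G : forall k, (S k <= n)%nat ->
    Rabs (lsum (seq m0 (S k)) (fun m => om m * x m) - om (m0 + k)%nat * lsum (seq m0 (S k)) x) <= E * (D (m0 + k)%nat - D m0)).
  { induction k as [|k IH]; intros Hk.
    - rewrite !lsum_seq_S, Nat.add_0_r. unfold lsum. cbn [seq fold_right].
      replace (0 + om m0 * x m0 - om m0 * (0 + x m0)) with 0 by ring. rewrite Rabs_R0. lra.
    - specialize (IH ltac:(lia)). rewrite (lsum_seq_S _ m0 (S k)), (lsum_seq_S x m0 (S k)).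
      set (S1 := lsum (seq m0 (S k)) (fun m => om m * x m)) in *. set (P1 := lsum (seq m0 (S k)) x) in *.
      pose proof (HP (S k) ltac:(lia)) as Q1.
      pose proof (HD (m0 + k)%nat ltac:(lia) ltac:(lia)) as Q2.
      replace (m0 + S k)%nat with (S (m0 + k)) by lia.
      replace (S1 + om (S (m0 + k)) * x (S (m0 + k)) - om (S (m0 + k)) * (P1 + x (S (m0 + k))))
        with ((S1 - om (m0 + k)%nat * P1) + - ((om (S (m0 + k)) - om (m0 + k)%nat) * P1)) by ring.
      via Rabs_triang. rewrite Rabs_Ropp, Rabs_mult.
      assert (Rabs (om (S (m0 + k)) - om (m0 + k)%nat) * Rabs P1 <= (D (S (m0 + k)) - D (m0 + k)%nat) * E).
      { apply Rmult_le_compat; auto using Rabs_pos. }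
      lra. }
  destruct n as [|n]; [lia|]. specialize (G n (le_n _)). replace (m0 + S n - 1)%nat with (m0 + n)%nat by lia.
  set (S1 := lsum (seq m0 (S n)) (fun m => om m * x m)) in *. set (P1 := lsum (seq m0 (S n)) x) in *.
  pose proof (HP (S n) (le_n _)) as Q1.
  replace S1 with ((S1 - om (m0 + n)%nat * P1) + om (m0 + n)%nat * P1) by ring.
  via Rabs_triang. rewrite Rabs_mult.
  assert (Rabs (om (m0 + n)%nat) * Rabs P1 <= W0 * E) by (apply Rmult_le_compat; auto using Rabs_pos; apply HW; lia).
  lra.
Qed.

Lemma lsum_prefix_zero m0 (x : nat -> R) : lsum (seq m0 0) x = 0.
Proof. auto. Qed.

Lemma double_average (g : R -> R) p1 q1 p2 q2 I1 I2 E : p1 <= q1 -> p2 <= q2 ->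
  is_RInt g p1 q1 I1 -> is_RInt g p2 q2 I2 ->
  (forall x z, p1 <= x <= q1 -> p2 <= z <= q2 -> Rabs (g z - g x) <= E) ->
  Rabs ((q1 - p1) * I2 - (q2 - p2) * I1) <= (q1 - p1) * ((q2 - p2) * E).
Proof.
  intros H1 H2 X1 X2 HE.
  assert (Y : forall x, p1 <= x <= q1 -> Rabs (I2 - (q2 - p2) * g x) <= (q2 - p2) * E).
  { intros x Hx.
    apply (is_RInt_abs_le (fun z => minus (g z) (g x)) (fun _ => E) p2 q2 _ _ H2).
    - auto.
    - apply (is_RInt_minus g (fun _ => g x) p2 q2 I2 ((q2 - p2) * g x)); auto. apply is_RInt_const_R.
    - apply is_RInt_const_R. }
  apply (is_RInt_abs_le (fun x => minus I2 ((q2 - p2) * g x)) (fun _ => (q2 - p2) * E) p1 q1 _ _ H1).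
  - auto.
  - apply (is_RInt_minus (fun _ => I2) (fun x => (q2 - p2) * g x) p1 q1 ((q1 - p1) * I2) ((q2 - p2) * I1)).
    + apply is_RInt_const_R.
    + apply is_RInt_scal_R; auto.
  - apply is_RInt_const_R.
Qed.

(** [(c, s) / (c^2 + s^2)] is the inversion in the unit circle; it divides the distance of two
    points by the product of their norms, which are at least [nu]. *)
Lemma inversion_lipschitz c s c' s' nu : 0 < nu -> nu <= s -> nu <= s' ->
  Rabs (c / (c ^ 2 + s ^ 2) - c' / (c' ^ 2 + s' ^ 2)) <= (Rabs (c - c') + Rabs (s - s')) / nu ^ 2 /\
  Rabs (s / (c ^ 2 + s ^ 2) - s' / (c' ^ 2 + s' ^ 2)) <= (Rabs (c - c') + Rabs (s - s')) / nu ^ 2 /\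
  Rabs (c / (c ^ 2 + s ^ 2)) <= / nu /\ Rabs (s / (c ^ 2 + s ^ 2)) <= / nu.
Proof.
  intros Hnu Hs Hs'.
  set (N := c ^ 2 + s ^ 2). set (N' := c' ^ 2 + s' ^ 2).
  assert (HN : nu ^ 2 <= N) by (unfold N; pose proof (pow2_ge_0 c); nra).
  assert (HN' : nu ^ 2 <= N') by (unfold N'; pose proof (pow2_ge_0 c'); nra).
  assert (Hn2 : 0 < nu ^ 2) by pos.
  set (d := (Rabs (c - c') + Rabs (s - s')) / nu ^ 2).
  assert (Hd : 0 <= d) by pos.
  assert (EE : (c / N - c' / N') ^ 2 + (s / N - s' / N') ^ 2 = ((c - c') ^ 2 + (s - s') ^ 2) / (N * N')).
  { unfold N, N'. field. nra. }
  assert (LE : ((c - c') ^ 2 + (s - s') ^ 2) / (N * N') <= d ^ 2).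
  { assert (E2 : d ^ 2 = (Rabs (c - c') + Rabs (s - s')) ^ 2 / (nu ^ 2 * nu ^ 2)) by (unfold d; field; lra). rewrite E2.
     apply Rmult_le_compat.
    - pos.
    - pos.
    - rewrite (pow2_Rabs (c - c')), (pow2_Rabs (s - s')). pose proof (Rabs_pos (c - c')). pose proof (Rabs_pos (s - s')). nra.
    - apply Rinv_le_contravar; [pos|]. nra. }
  rewrite <- EE in LE.
  assert (Q : forall u v e, 0 <= e -> u ^ 2 + v ^ 2 <= e ^ 2 -> Rabs u <= e /\ Rabs v <= e).
  { intros u v e He H.
    split; apply Rabs_le; split; nra. }
  destruct (Q _ _ d Hd LE) as [Q1 Q2].
  assert (E3 : (c / N) ^ 2 + (s / N) ^ 2 = / N) by (unfold N; field; fold N; lra).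
  assert (H4 : / N <= (/ nu) ^ 2).
  { replace ((/ nu) ^ 2) with (/ (nu ^ 2)) by (field; lra). apply Rinv_le_contravar; auto. }
  rewrite <- E3 in H4. destruct (Q _ _ (/ nu) ltac:(pos) H4) as [Q3 Q4].
  auto.
Qed.

(** * From integrals along the horocycle to the sum over m *)

Section Stationary.
Variables (f0 : R -> R) (a b : nat -> R) (B eta s1 s2 sigma E0 : R).
Hypothesis f0cont : forall x, continuous f0 x.
Hypothesis approx : forall d (N0 : nat), 0 < d -> exists N, (N0 <= N)%nat /\
  forall x, Rabs (f0 x - lsum (seq 1 N) (fun n => harmonic a b n x)) <= d.
Hypothesis HB : 0 < B.
Hypothesis Hsig : 0 < sigma.
Hypothesis Hs12 : s1 <= s2 <= s1 + 4 * sigma.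
Hypothesis Hs2 : s2 <= 2 * (s1 - 2 * sigma).
(** Puts the Fresnel variable beyond [2 / sqrt be] in absolute value at all end points in use, where
    [fresnel_sine_lower] applies. *)
Hypothesis Hw0 : 2 / sqrt (PI * B) <= sigma / sqrt (s2 + 2 * sigma).
Hypothesis HE : forall om th r1 r2, s1 - 2 * sigma <= r1 -> r1 <= r2 -> r2 <= s2 + 2 * sigma ->
  Rabs (RInt (fun r => cos (PI * B * r + om) * f0 (th + B / (2 * r))) r1 r2) <= E0.

Let ra := s1 - 2 * sigma.
Let be := PI * B.

Lemma ra_pos : 0 < ra.
Proof using Hsig Hs12 Hs2. unfold ra. lra. Qed.

Lemma be_pos : 0 < be.
Proof using HB.  pose proof PI_RGT_0. pos. Qed.

Lemma E0_nonneg : 0 <= E0.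
Proof using All.
  eapply Rle_trans; [apply Rabs_pos|apply (HE 0 0 (s1 - 2 * sigma) (s1 - 2 * sigma)); lra].
Qed.

(** [HE] holds for every subinterval, so it bounds the antiderivative in [ibp_bound]; for
    nonnegative nonincreasing [u] the factor there is [u r1], at most [u ra]. *)
Lemma amplitude_bound (u du : R -> R) om th r1 r2 : ra <= r1 -> r1 <= r2 -> r2 <= s2 + 2 * sigma ->
  (forall r, ra <= r -> is_derive u r (du r)) -> (forall r, ra <= r -> continuous du r) ->
  (forall r, ra <= r -> du r <= 0) -> (forall r, ra <= r -> 0 <= u r) ->
  Rabs (RInt (fun r => u r * cos (PI * B * r + om) * f0 (th + B / (2 * r))) r1 r2) <= E0 * u ra.
Proof using All.
  intros H1 H2 H3 Hu Cu Hdu Hu0. pose proof ra_pos as Hra.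
  set (dH := fun r => cos (PI * B * r + om) * f0 (th + B / (2 * r))).
  assert (CdH : forall r, 0 < r -> continuous dH r).
  { intros r Hr. apply (continuous_mult (fun r => cos (PI * B * r + om)) (fun r => f0 (th + B / (2 * r)))).
    - by_derivative. auto_derive. auto.
    - apply (continuous_comp (fun r => th + B / (2 * r)) f0); [|apply f0cont].
      by_derivative. auto_derive. lra. }
  assert (XI : forall p q, 0 < p -> 0 < q -> ex_RInt dH p q).
  { intros p q Hp Hq. apply (ex_RInt_continuous dH). intros z Hz. apply CdH.
    destruct Hz as [Hz _]. eapply Rlt_le_trans; [|apply Hz]. apply Rmin_glb_lt; auto. }
  apply Rle_trans with (E0 * (Rabs (u r2) + Rabs (u r2 - u r1))).
  - rewrite (RInt_ext (V := R_CompleteNormedModule) _ (fun r => u r * dH r)) by (intros; unfold dH; apply Rmult_assoc).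
    apply (ibp_bound u du (fun r => RInt dH r1 r) dH r1 r2 E0); auto.
    + intros r Hr. apply Hu; lra.
    + intros r Hr. apply (is_derive_RInt dH (fun r => RInt dH r1 r) r1).
      * exists (mkposreal r ltac:(lra)). intros z Hz. apply (RInt_correct dH). apply XI; [lra|].
        apply Rabs_def2 in Hz.  unfold minus, plus, opp in Hz; simpl in Hz. lra.
      * apply CdH. lra.
    + intros r Hr. apply Cu; lra.
    + intros r Hr. apply CdH; lra.
    + intros r Hr. apply HE; unfold ra in *; lra.
    + apply (RInt_point (V := R_CompleteNormedModule)).
    + right. intros r Hr. apply Hdu. lra.
  - apply Rmult_le_compat_l; [apply E0_nonneg|].
    assert (Mono : forall p q, ra <= p -> p <= q -> u q <= u p).
    { intros p q Hp Hpq. assert (- u p <= - u q); [|lra].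
      apply (increasing_by_derivative (fun r => - u r) (fun r => - du r)); auto.
      - intros x Hx. apply (is_derive_opp u). apply Hu. lra.
      - intros x Hx. pose proof (Hdu x ltac:(lra)). lra. }
    pose proof (Mono r1 r2 H1 H2). pose proof (Mono ra r1 (Rle_refl _) H1).
    rewrite Rabs_pos_eq by (apply Hu0; lra). rewrite Rabs_left1 by lra. lra.
Qed.

Let Am om r := PI * B * r + om.
Let phi r := B / (2 * r).
Let mode om m r := a m * cos (Am om r + 2 * PI * (INR m * (eta + phi r))) + b m * sin (Am om r + 2 * PI * (INR m * (eta + phi r))).

Lemma isolation_weighted (u du : R -> R) om r1 r2 m0 n : ra <= r1 -> r1 <= r2 -> r2 <= s2 + 2 * sigma ->
  (forall r, ra <= r -> is_derive u r (du r)) -> (forall r, ra <= r -> continuous du r) ->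
  (forall r, ra <= r -> du r <= 0) -> (forall r, ra <= r -> 0 <= u r) -> (1 <= m0)%nat -> (1 <= n)%nat ->
  Rabs (lsum (seq m0 n) (fun m => RInt (fun r => u r * mode om m r) r1 r2))
  <= 16 * (E0 * u ra) * ln (2 + 2 * INR n).
Proof using All.
  intros H1 H2 H3 Hu Cu Hdu Hu0 Hm Hn. pose proof ra_pos as Hra.
  assert (Mono : forall p q, ra <= p -> p <= q -> u q <= u p).
  { intros p q Hp Hpq. assert (- u p <= - u q); [|lra].
    apply (increasing_by_derivative (fun r => - u r) (fun r => - du r)); auto.
    - intros x Hx. apply (is_derive_opp u). apply Hu. lra.
    - intros x Hx. pose proof (Hdu x ltac:(lra)). lra. }
  apply (isolation f0 u (Am om) phi a b r1 r2 (E0 * u ra) (u ra)); auto.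
  - intros r Hr. by_derivative. eexists. apply Hu. lra.
  - intros r Hr. by_derivative. unfold Am. auto_derive. auto.
  - intros r Hr. by_derivative. unfold phi. auto_derive. lra.
  - intros r Hr. rewrite Rabs_pos_eq by (apply Hu0; lra). apply Mono; lra.
  - intros th. apply (amplitude_bound u du om th); auto.
  - intros th. rewrite (RInt_ext (V := R_CompleteNormedModule) _ (fun r => u r * cos (PI * B * r + (om - PI / 2)) * f0 (th + B / (2 * r)))).
    + apply (amplitude_bound u du); auto.
    + intros r _.  replace (PI * B * r + (om - PI / 2)) with (PI * B * r + om - PI / 2) by ring.
      rewrite cos_minus_quarter. auto.
Qed.

Definition stat_phase om (m : nat) : R := om + 2 * PI * (eta * INR m + B * sqrt (INR m)).
(** Together with its shift by [PI / 2] in [om] this takes the place of a complex term. *)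
Definition stat_term om (m : nat) : R := a m * cos (stat_phase om m) + b m * sin (stat_phase om m).
Let G om m r := stat_term om m * fres be 0 (wvar (sqrt (INR m)) r)
  + stat_term (om + PI / 2) m * fres be (- (PI / 2)) (wvar (sqrt (INR m)) r).

(** The derivative [(r + s) / (2 r sqrt r)] of [wvar] is the sum of [1 / (2 sqrt r)] and
    [s / (2 r sqrt r)]. This gives two decreasing weights free of m, as [isolation_weighted]
    demands, with [s = sqrt m] outside the second integral. *)
Lemma mode_integral om m r1 r2 : 0 < r1 <= r2 ->
  G om m r2 - G om m r1 =
  1 / 2 * RInt (fun r => / sqrt r * mode om m r) r1 r2
  + 1 / 2 * (sqrt (INR m) * RInt (fun r => / (r * sqrt r) * mode om m r) r1 r2).
Proof using HB.
  intros Hr. set (s := sqrt (INR m)). assert (Es : s * s = INR m) by (apply sqrt_sqrt, pos_INR).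
  assert (Hsq : forall r, r1 <= r <= r2 -> 0 < sqrt r) by (intros; apply sqrt_lt_R0; lra).
  set (h := mode om m).
  assert (Ch : forall r, r1 <= r <= r2 -> continuous h r).
  { intros r Hr'. by_derivative. unfold h, mode, Am, phi. auto_derive. lra. }
  assert (X1 : is_RInt (fun r => / sqrt r * h r) r1 r2 (RInt (fun r => / sqrt r * h r) r1 r2)).
  { apply (RInt_correct (fun r => / sqrt r * h r)), ex_RInt_closed; [lra|]. intros r Hr'. apply (continuous_mult (fun r => / sqrt r) h); auto.
    by_derivative. specialize (Hsq r Hr'). auto_derive. lra. }
  assert (X2 : is_RInt (fun r => / (r * sqrt r) * h r) r1 r2 (RInt (fun r => / (r * sqrt r) * h r) r1 r2)).
  { apply (RInt_correct (fun r => / (r * sqrt r) * h r)), ex_RInt_closed; [lra|]. intros r Hr'. apply (continuous_mult (fun r => / (r * sqrt r)) h); auto.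
    by_derivative.  auto_derive. split; [lra|]. split; auto. apply Rgt_not_eq.  pos. }
  assert (X3 := is_RInt_plus _ _ _ _ _ _ (is_RInt_scal_R _ _ _ (1 / 2) _ X1) (is_RInt_scal_R _ _ _ (1 / 2) _ (is_RInt_scal_R _ _ _ s _ X2))).
  assert (X4 : is_RInt (fun r => (r + s) / (2 * r * sqrt r) * (stat_term om m * fphase be 0 (wvar s r) + stat_term (om + PI / 2) m * fphase be (- (PI / 2)) (wvar s r))) r1 r2 (G om m r2 - G om m r1)).
  { apply (is_RInt_derive (G om m)); minmax; intros r Hr'.
    -
      replace ((r + s) / (2 * r * sqrt r) * (stat_term om m * fphase be 0 (wvar s r) + stat_term (om + PI / 2) m * fphase be (- (PI / 2)) (wvar s r)))
        with (stat_term om m * ((r + s) / (2 * r * sqrt r) * fphase be 0 (wvar s r)) + stat_term (om + PI / 2) m * ((r + s) / (2 * r * sqrt r) * fphase be (- (PI / 2)) (wvar s r))) by ring.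
      apply (is_derive_plus (fun r => stat_term om m * fres be 0 (wvar s r)) (fun r => stat_term (om + PI / 2) m * fres be (- (PI / 2)) (wvar s r)));
      apply (is_derive_scal (fun r => fres be _ (wvar s r))); apply (is_derive_comp (fres be _) (wvar s)); try apply fres_derive; apply wvar_derive_r; lra.
    - apply (continuous_mult (fun r => (r + s) / (2 * r * sqrt r)) (fun r => stat_term om m * fphase be 0 (wvar s r) + stat_term (om + PI / 2) m * fphase be (- (PI / 2)) (wvar s r))).
      + by_derivative.  auto_derive. split; [lra|]. split; auto. apply Rgt_not_eq.  pos.
      + assert (Cw : continuous (wvar s) r) by (by_derivative; eexists; apply wvar_derive_r; lra).
        apply (continuous_plus (fun r => stat_term om m * fphase be 0 (wvar s r)) (fun r => stat_term (om + PI / 2) m * fphase be (- (PI / 2)) (wvar s r)));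
        apply (continuous_scal_r (stat_term _ m) (fun r => fphase be _ (wvar s r))); apply (continuous_comp (wvar s)); auto; apply fphase_continuous. }
  transitivity (RInt (fun r => (r + s) / (2 * r * sqrt r) * (stat_term om m * fphase be 0 (wvar s r) + stat_term (om + PI / 2) m * fphase be (- (PI / 2)) (wvar s r))) r1 r2).
  - symmetry. apply RInt_eq. auto.
  - apply RInt_eq. refine (is_RInt_ext _ _ _ _ _ _ X3).
    minmax. intros r Hr'. specialize (Hsq r ltac:(lra)).
    change (@eq R (1 / 2 * (/ sqrt r * h r) + 1 / 2 * (s * (/ (r * sqrt r) * h r)))
     ((r + s) / (2 * r * sqrt r) * (stat_term om m * fphase be 0 (wvar s r) + stat_term (om + PI / 2) m * fphase be (- (PI / 2)) (wvar s r)))).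
    assert (Eh : h r = stat_term om m * fphase be 0 (wvar s r) + stat_term (om + PI / 2) m * fphase be (- (PI / 2)) (wvar s r)).
    { unfold h, mode, stat_term, fphase.
      assert (Ew : wvar s r ^ 2 = (r - s) ^ 2 / r).
      { unfold wvar. assert (E : sqrt r * sqrt r = r) by (apply sqrt_sqrt; lra).
        replace ((r - s) ^ 2 / r) with ((r - s) ^ 2 / (sqrt r * sqrt r)) by (rewrite E; auto). field. lra. }
      rewrite Ew. set (z := be * ((r - s) ^ 2 / r)). set (T := stat_phase om m).
      replace (stat_phase (om + PI / 2) m) with (T + PI / 2) by (unfold T, stat_phase; ring).
      replace (Am om r + 2 * PI * (INR m * (eta + phi r))) with (T + z).
      2:{ unfold T, z, stat_phase, Am, phi, be. fold s. rewrite <- Es. field. lra. }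
      replace (z + - (PI / 2)) with (z - PI / 2) by ring. rewrite cos_minus_quarter, Rplus_0_r.
      rewrite (cos_plus T (PI / 2)), (sin_plus T (PI / 2)), cos_PI2, sin_PI2, cos_plus, sin_plus. ring. }
    rewrite Eh. field. lra.
Qed.

Lemma sqrt_step m : sqrt (INR m) <= sqrt (INR (S m)).
Proof. apply sqrt_le_1_alt. rewrite S_INR. lra. Qed.

Lemma ln_nonneg_2 n : 0 < ln (2 + 2 * INR n).
Proof. pose proof (pos_INR n). rewrite <- ln_1. apply ln_increasing; lra. Qed.

Definition stat_bound n := 40 * E0 * ln (2 + 2 * INR n) / sqrt ra.

(** The factor [sqrt m] of the second integral is removed by partial summation, and [s2 <= 2 ra]
    makes both parts comparable: [16 / 2 + 64 / 2 = 40]. *)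
Lemma edge_bound om r1 r2 m0 n : ra <= r1 -> r1 <= r2 -> r2 <= s2 + 2 * sigma -> (1 <= m0)%nat -> (1 <= n)%nat ->
  (forall m, (m0 <= m < m0 + n)%nat -> sqrt (INR m) <= s2) ->
  Rabs (lsum (seq m0 n) (fun m => G om m r2 - G om m r1)) <= stat_bound n.
Proof using All.
  intros H1 H2 H3 Hm Hn HI. pose proof ra_pos as Hra. pose proof E0_nonneg as HE0. pose proof (ln_nonneg_2 n) as Hl.
  assert (Hsq : 0 < sqrt ra) by pos.
  set (Xa := fun m => RInt (fun r => / sqrt r * mode om m r) r1 r2).
  set (Xb := fun m => RInt (fun r => / (r * sqrt r) * mode om m r) r1 r2).
  assert (Pos : forall r, ra <= r -> 0 < r /\ 0 < sqrt r) by (intros r Hr; split; [lra|apply sqrt_lt_R0; lra]).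
  assert (Ba : forall k, (1 <= k)%nat -> Rabs (lsum (seq m0 k) Xa) <= 16 * (E0 * / sqrt ra) * ln (2 + 2 * INR k)).
  { intros k Hk. apply (isolation_weighted (fun r => / sqrt r) (fun r => - / (2 * r * sqrt r)) om r1 r2 m0 k); auto; intros r Hr; destruct (Pos r Hr) as [P1 P2].
    - auto_derive; [split; lra|]. assert (E : sqrt r * sqrt r = r) by (apply sqrt_sqrt; lra).
      replace (2 * r * sqrt r) with (2 * (sqrt r * sqrt r) * sqrt r) by (rewrite E; ring). field. lra.
    - by_derivative. auto_derive. split; [lra|]. split; auto. apply Rgt_not_eq. pos.
    - assert (0 < / (2 * r * sqrt r)) by pos. lra.
    - pos. }
  assert (Bb : forall k, (1 <= k)%nat -> Rabs (lsum (seq m0 k) Xb) <= 16 * (E0 * / (ra * sqrt ra)) * ln (2 + 2 * INR k)).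
  { intros k Hk. apply (isolation_weighted (fun r => / (r * sqrt r)) (fun r => - (3 / (2 * r ^ 2 * sqrt r))) om r1 r2 m0 k); auto; intros r Hr; destruct (Pos r Hr) as [P1 P2].
    - auto_derive; [split; [lra|]; split; auto; apply Rgt_not_eq; pos|]. assert (E : sqrt r * sqrt r = r) by (apply sqrt_sqrt; lra).
      set (q := sqrt r) in *. rewrite <- E. field. lra.
    - by_derivative. auto_derive. split; [lra|]. split; auto. apply Rgt_not_eq. pos.
    - assert (0 < 3 / (2 * r ^ 2 * sqrt r)) by pos. lra.
    - pos. }
  rewrite (lsum_ext _ _ (fun m => 1 / 2 * Xa m + 1 / 2 * (sqrt (INR m) * Xb m))) by (intros; apply mode_integral; lra).
  rewrite lsum_plus, !lsum_scal.
  assert (Bc : Rabs (lsum (seq m0 n) (fun m => sqrt (INR m) * Xb m)) <= 16 * (E0 * / (ra * sqrt ra)) * ln (2 + 2 * INR n) * (s2 + s2)).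
  { set (Eb := 16 * (E0 * / (ra * sqrt ra)) * ln (2 + 2 * INR n)).
    assert (0 <= 16 * (E0 * / (ra * sqrt ra))) by pos.
    assert (0 <= Eb) by pos.
    eapply Rle_trans; [apply (abel Xb (fun m => sqrt (INR m)) (fun m => sqrt (INR m)) m0 n Eb s2); auto|].
    - intros [|k] Hk; [rewrite lsum_prefix_zero, Rabs_R0; auto|].
      eapply Rle_trans; [apply Bb; lia|].  apply Rmult_le_compat_l; auto. pose proof (pos_INR (S k)). apply le_INR in Hk. apply ln_le; lra.
    - intros m Hm'. rewrite Rabs_pos_eq by apply sqrt_pos. auto.
    - intros m _ _. pose proof (sqrt_step m). rewrite Rabs_pos_eq; lra.
    - apply Rmult_le_compat_l; auto. pose proof (HI (m0 + n - 1)%nat ltac:(lia)). pose proof (sqrt_pos (INR m0)). lra. }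
  specialize (Ba n Hn). via Rabs_triang. rewrite !Rabs_mult, (Rabs_pos_eq (1 / 2)) by lra.
  assert (16 * (E0 * / (ra * sqrt ra)) * ln (2 + 2 * INR n) * (s2 + s2) <= 64 * (E0 * / sqrt ra) * ln (2 + 2 * INR n)).
  { replace (64 * (E0 * / sqrt ra) * ln (2 + 2 * INR n)) with (16 * (E0 * / (ra * sqrt ra)) * ln (2 + 2 * INR n) * (4 * ra)) by (field; lra).
    apply Rmult_le_compat_l; [|fold ra in Hs2; lra]. pos. }
  unfold stat_bound.
  lra.
Qed.

(** The averaged cutoff factor. Upper ends run through [[s2 + sigma, s2 + 2 sigma]] and lower ends
    through [[ra, s1 - sigma]], so all of them keep distance [sigma] from the stationary points
    [sqrt m]. *)
Let VV om m := averaged be om (s2 + sigma) (s2 + 2 * sigma) (sqrt (INR m)) - averaged be om ra (s1 - sigma) (sqrt (INR m)).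

Lemma averaged_bound om m0 n : (1 <= m0)%nat -> (1 <= n)%nat -> (forall m, (m0 <= m < m0 + n)%nat -> sqrt (INR m) <= s2) ->
  Rabs (lsum (seq m0 n) (fun m => stat_term om m * VV 0 m + stat_term (om + PI / 2) m * VV (- (PI / 2)) m)) <= sigma * stat_bound n.
Proof using All.
  intros Hm Hn HI. pose proof ra_pos as Hra.
  assert (XI : forall p q, 0 < p -> p <= q -> is_RInt (fun r => lsum (seq m0 n) (fun m => G om m r)) p q
    (lsum (seq m0 n) (fun m => stat_term om m * averaged be 0 p q (sqrt (INR m)) + stat_term (om + PI / 2) m * averaged be (- (PI / 2)) p q (sqrt (INR m))))).
  { intros p q Hp Hpq. apply is_RInt_lsum. intros m _.
    assert (Z : forall th, is_RInt (fun r => fres be th (wvar (sqrt (INR m)) r)) p q (averaged be th p q (sqrt (INR m)))).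
    { intros th. apply (RInt_correct (fun r => fres be th (wvar (sqrt (INR m)) r))), ex_RInt_closed; auto.
      intros r Hr. apply (continuous_comp (wvar (sqrt (INR m))) (fres be th)).
      - by_derivative. eexists; apply wvar_derive_r; lra.
      - by_derivative. eexists; apply fres_derive. }
    apply (is_RInt_plus (fun r => stat_term om m * fres be 0 (wvar (sqrt (INR m)) r)) (fun r => stat_term (om + PI / 2) m * fres be (- (PI / 2)) (wvar (sqrt (INR m)) r)) p q
      (stat_term om m * averaged be 0 p q (sqrt (INR m))) (stat_term (om + PI / 2) m * averaged be (- (PI / 2)) p q (sqrt (INR m)))); apply is_RInt_scal_R; apply Z. }
  pose proof (double_average _ ra (s1 - sigma) (s2 + sigma) (s2 + 2 * sigma) _ _ (stat_bound n) ltac:(unfold ra; lra) ltac:(lra)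
    (XI ra (s1 - sigma) Hra ltac:(unfold ra; lra)) (XI (s2 + sigma) (s2 + 2 * sigma) ltac:(lra) ltac:(lra))) as DA.
  replace (s1 - sigma - ra) with sigma in DA by (unfold ra; ring). replace (s2 + 2 * sigma - (s2 + sigma)) with sigma in DA by ring.
  apply (Rmult_le_reg_l sigma); auto. rewrite <- (Rabs_pos_eq sigma) at 1 by lra. rewrite <- Rabs_mult.
  below DA.
  - right. f_equal. rewrite <- Rmult_minus_distr_l. f_equal.
    rewrite <- (Rplus_0_r (lsum _ _)).  unfold VV.
    match goal with |- _ = ?x - ?z => replace (x - z) with (x + (-1) * z) by ring end.
    rewrite <- lsum_scal, <- lsum_plus. replace (0 + - 0) with 0 by ring. rewrite Rplus_0_r. apply lsum_ext. intros m _. ring.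
  - intros x z Hx Hz.
    replace (lsum (seq m0 n) (fun m => G om m z) - lsum (seq m0 n) (fun m => G om m x)) with (lsum (seq m0 n) (fun m => G om m z - G om m x)).
    + apply edge_bound; auto; unfold ra in *; lra.
    + rewrite (lsum_ext _ _ (fun m => G om m z + (-1) * G om m x)) by (intros; ring). rewrite lsum_plus, lsum_scal. ring.
Qed.

Let w0 := sigma / sqrt (s2 + 2 * sigma).

Lemma w0_bounds z : s1 <= z <= s2 ->
  (forall r, s2 + sigma <= r <= s2 + 2 * sigma -> w0 <= wvar z r) /\ (forall r, ra <= r <= s1 - sigma -> wvar z r <= - w0).
Proof using All.
  intros Hz. pose proof ra_pos as Hra. unfold wvar, w0, Rdiv.
  assert (K : forall r, ra <= r -> r <= s2 + 2 * sigma -> / sqrt (s2 + 2 * sigma) <= / sqrt r).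
  { intros r H1 H2. apply Rinv_le_contravar; [apply sqrt_lt_R0; lra|apply sqrt_le_1_alt; lra]. }
  assert (P0 : 0 < / sqrt (s2 + 2 * sigma)) by pos.
  split; intros r Hr.
  - pose proof (K r ltac:(unfold ra in *; lra) ltac:(lra)). nra.
  - pose proof (K r ltac:(lra) ltac:(lra)).
    nra.
Qed.

(** With [x] the term, [x'] its shift by [PI / 2] and [c], [s] the two cutoffs [VV], the sums of
    [x c + x' s] are small. A further shift gives the same for [x' c - x s]. Multiplying by [c / N]
    and [- s / N], where [N = c^2 + s^2], and adding returns [x]; since [s >= nu] and both cutoffs
    vary slowly, partial summation admits these multipliers. *)
Lemma stationary_sum om m0 n : (1 <= m0)%nat -> (1 <= n)%nat -> (forall m, (m0 <= m < m0 + n)%nat -> s1 <= sqrt (INR m) <= s2) ->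
  Rabs (lsum (seq m0 n) (stat_term om)) <= 500000 * sqrt be * E0 * ln (2 + 2 * INR n) / sqrt ra.
Proof using All.
  intros Hm Hn HI. pose proof ra_pos as Hra. pose proof be_pos as Hbe. pose proof E0_nonneg as HE0. pose proof (ln_nonneg_2 n) as Hl.
  assert (Hsb : 0 < sqrt be) by pos. assert (Esb : sqrt be * sqrt be = be) by (apply sqrt_sqrt; lra).
  assert (Hsr : 0 < sqrt ra) by pos.
  assert (Hw2 : 2 / sqrt be <= w0) by exact Hw0.
  assert (H2b : 0 < 2 / sqrt be) by pos.
  (* The upper and the lower ends contribute [sigma / (25 sqrt be)] each: the Fresnel variable is
     positive at the former and negative at the latter, and the sine integral is odd. *)
  set (nu := 2 * sigma / (25 * sqrt be)). assert (Hnu : 0 < nu) by pos.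
  assert (VSl : forall m, s1 <= sqrt (INR m) <= s2 -> nu <= VV (- (PI / 2)) m).
  { intros m Hm'. destruct (w0_bounds _ Hm') as [L1 L2]. unfold VV, averaged.
    set (g := fun r => fres be (- (PI / 2)) (wvar (sqrt (INR m)) r)).
    assert (Cg : forall r, 0 < r -> continuous g r).
    { intros r Hr. apply (continuous_comp (wvar (sqrt (INR m))) (fres be (- (PI / 2)))).
      - by_derivative. eexists; apply wvar_derive_r; lra.
      - by_derivative. eexists; apply fres_derive. }
    assert (I1 : sigma * / (25 * sqrt be) <= RInt g (s2 + sigma) (s2 + 2 * sigma)).
    { replace (sigma * / (25 * sqrt be)) with (RInt (fun _ => / (25 * sqrt be)) (s2 + sigma) (s2 + 2 * sigma)).
      - apply RInt_le; [lra|apply ex_RInt_const|apply ex_RInt_closed; [lra|intros; apply Cg; unfold ra in *; lra]|].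
        intros r Hr. apply (fresnel_sine_lower be Hbe). pose proof (L1 r ltac:(lra)). lra.
      - rewrite (RInt_const (V := R_CompleteNormedModule)). unfold scal; simpl. unfold mult; simpl. ring. }
    assert (I2 : RInt g ra (s1 - sigma) <= sigma * - / (25 * sqrt be)).
    { replace (sigma * - / (25 * sqrt be)) with (RInt (fun _ => - / (25 * sqrt be)) ra (s1 - sigma)).
      - apply RInt_le; [unfold ra; lra|apply ex_RInt_closed; [unfold ra; lra|intros; apply Cg; lra]|apply ex_RInt_const|].
        intros r Hr. unfold g. pose proof (L2 r ltac:(lra)).
        rewrite <- (Ropp_involutive (wvar _ r)), fres_odd. apply Ropp_le_contravar. apply (fresnel_sine_lower be Hbe). lra.
      - rewrite (RInt_const (V := R_CompleteNormedModule)). unfold scal; simpl. unfold mult; simpl. unfold ra. ring. }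
    unfold nu.  lra. }
  assert (Hw0p : 0 < w0) by lra.
  assert (VVl : forall th m, s1 <= sqrt (INR m) <= s2 -> s1 <= sqrt (INR (S m)) <= s2 ->
    Rabs (VV th (S m) - VV th m) <= 8 / (be * w0) * (sqrt (INR (S m)) - sqrt (INR m))).
  { intros th m H1 H2. pose proof (sqrt_step m) as St. unfold VV.
    pose proof (averaged_lipschitz be Hbe th (s2 + sigma) (s2 + 2 * sigma) (sqrt (INR m)) (sqrt (INR (S m))) w0 ltac:(lra) ltac:(lra) Hw0p) as A1.
    pose proof (averaged_lipschitz be Hbe th ra (s1 - sigma) (sqrt (INR m)) (sqrt (INR (S m))) w0 ltac:(unfold ra in *; lra) ltac:(lra) Hw0p) as A2.
    assert (B1 : Rabs (averaged be th (s2 + sigma) (s2 + 2 * sigma) (sqrt (INR (S m)))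
        - averaged be th (s2 + sigma) (s2 + 2 * sigma) (sqrt (INR m))) <= 4 / (be * w0) * (sqrt (INR (S m)) - sqrt (INR m))).
    { apply A1. left. intros r z Hr Hz. apply (w0_bounds z ltac:(lra)); auto. }
    assert (B2 : Rabs (averaged be th ra (s1 - sigma) (sqrt (INR (S m))) - averaged be th ra (s1 - sigma) (sqrt (INR m))) <= 4 / (be * w0) * (sqrt (INR (S m)) - sqrt (INR m))).
    { apply A2. right. intros r z Hr Hz. apply (w0_bounds z ltac:(lra)); auto. }
    apply Rabs_le_between in B1. apply Rabs_le_between in B2.
    apply Rabs_le. lra. }
  set (N := fun m => VV 0 m ^ 2 + VV (- (PI / 2)) m ^ 2).
  set (Eb := sigma * stat_bound n).
  assert (Hsb0 : forall k, 0 <= stat_bound k).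
  { intros k.  apply Rle_mult_inv_pos; auto. pose proof (ln_nonneg_2 k). pos. }
  assert (Part : forall th k, (k <= n)%nat -> Rabs (lsum (seq m0 k) (fun m => stat_term th m * VV 0 m + stat_term (th + PI / 2) m * VV (- (PI / 2)) m)) <= Eb).
  { intros th [|k] Hk; [rewrite lsum_prefix_zero, Rabs_R0; apply Rmult_le_pos; auto; lra|].
    eapply Rle_trans; [apply averaged_bound; auto; [lia|intros; apply HI; lia]|].
     mull.  mulr.
    mull. pose proof (pos_INR (S k)). apply le_INR in Hk. apply ln_le; lra. }
  set (D := fun m => 16 / (be * w0) / nu ^ 2 * sqrt (INR m)).
  assert (Wd : forall m, (m0 <= m)%nat -> (S m < m0 + n)%nat ->
     (Rabs (VV 0 (S m) - VV 0 m) + Rabs (VV (- (PI / 2)) (S m) - VV (- (PI / 2)) m)) / nu ^ 2 <= D (S m) - D m).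
  { intros m H1 H2. pose proof (VVl 0 m (HI m ltac:(lia)) (HI (S m) ltac:(lia))). pose proof (VVl (- (PI / 2)) m (HI m ltac:(lia)) (HI (S m) ltac:(lia))).
    unfold D. replace (16 / (be * w0) / nu ^ 2 * sqrt (INR (S m)) - 16 / (be * w0) / nu ^ 2 * sqrt (INR m))
      with ((8 / (be * w0) * (sqrt (INR (S m)) - sqrt (INR m)) + 8 / (be * w0) * (sqrt (INR (S m)) - sqrt (INR m))) / nu ^ 2) by lra.
    mulr. lra. }
  assert (Ab : forall th, forall wt : nat -> R, (wt = (fun m => VV 0 m / N m) \/ wt = (fun m => VV (- (PI / 2)) m / N m)) ->
     Rabs (lsum (seq m0 n) (fun m => wt m * (stat_term th m * VV 0 m + stat_term (th + PI / 2) m * VV (- (PI / 2)) m))) <= Eb * (5013 * sqrt be / sigma)).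
  { intros th wt Hwt.
    via (abel _ wt D m0 n Eb (/ nu) Hn (Part th)).
    - intros m Hm'. destruct (inversion_lipschitz (VV 0 m) _ (VV 0 m) _ nu Hnu (VSl m (HI m Hm')) (VSl m (HI m Hm'))) as [_ [_ [X1 X2]]].
      destruct Hwt as [-> | ->]; [exact X1|exact X2].
    - intros m H1 H2.
      destruct (inversion_lipschitz (VV 0 (S m)) _ (VV 0 m) _ nu Hnu (VSl (S m) (HI (S m) ltac:(lia))) (VSl m (HI m ltac:(lia)))) as [X1 [X2 _]].
      specialize (Wd m H1 H2). destruct Hwt as [-> | ->]; cbv beta; [exact (Rle_trans _ _ _ X1 Wd)|exact (Rle_trans _ _ _ X2 Wd)].
    - assert (HEb : 0 <= Eb) by pos. apply Rmult_le_compat_l; auto.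
      assert (HD : D (m0 + n - 1)%nat - D m0 <= 16 / (be * w0) / nu ^ 2 * (4 * sigma)).
      { unfold D. rewrite <- Rmult_minus_distr_l. mull.
        pose proof (HI (m0 + n - 1)%nat ltac:(lia)). pose proof (HI m0 ltac:(lia)). lra. }
      assert (Hnu1 : / nu = 25 / 2 * (sqrt be / sigma)) by (unfold nu; field; lra).
      (* [16 * 4 * (25 / 2)^2 = 10000] and [w0 >= 2 / sqrt be]; with [1 / nu = 25/2 sqrt be / sigma]
         the total stays below [5013 sqrt be / sigma]. *)
      assert (HD2 : 16 / (be * w0) / nu ^ 2 * (4 * sigma) = 10000 / (sigma * w0)).
      { replace (be * w0) with (sqrt be * sqrt be * w0) by nra. unfold nu. field. lra. }
      assert (HD3 : 10000 / (sigma * w0) <= 5000 * (sqrt be / sigma)).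
      { assert (/ w0 <= / (2 / sqrt be)) by (apply Rinv_le_contravar; auto).
        replace (/ (2 / sqrt be)) with (sqrt be / 2) in H by (field; lra).
        replace (10000 / (sigma * w0)) with (10000 / sigma * / w0) by (field; lra).
        replace (5000 * (sqrt be / sigma)) with (10000 / sigma * (sqrt be / 2)) by lra.
        apply Rmult_le_compat_l; auto. pos. }
      assert (0 < sqrt be / sigma) by pos. lra. }
  pose proof (Ab om (fun m => VV 0 m / N m) (or_introl eq_refl)) as F1.
  pose proof (Ab (om + PI / 2) (fun m => VV (- (PI / 2)) m / N m) (or_intror eq_refl)) as F2.
  rewrite (lsum_ext _ _ (fun m => VV 0 m / N m * (stat_term om m * VV 0 m + stat_term (om + PI / 2) m * VV (- (PI / 2)) m)
     + (-1) * (VV (- (PI / 2)) m / N m * (stat_term (om + PI / 2) m * VV 0 m + stat_term (om + PI / 2 + PI / 2) m * VV (- (PI / 2)) m)))).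
  2:{ intros m Hm'. apply in_seq in Hm'. pose proof (VSl m (HI m Hm')).
      assert (HN : N m <> 0) by (unfold N; pose proof (pow2_ge_0 (VV 0 m)); nra).
      assert (Epi : stat_term (om + PI / 2 + PI / 2) m = - stat_term om m).
      { unfold stat_term, stat_phase. replace (om + PI / 2 + PI / 2 + 2 * PI * (eta * INR m + B * sqrt (INR m))) with (om + 2 * PI * (eta * INR m + B * sqrt (INR m)) + PI) by field.
        rewrite neg_cos, neg_sin. ring. }
      rewrite Epi. unfold N in *. field. auto. }
  rewrite lsum_plus, lsum_scal. via Rabs_triang.
  replace ((-1) * lsum (seq m0 n) (fun m => VV (- (PI / 2)) m / N m * (stat_term (om + PI / 2) m * VV 0 m + stat_term (om + PI / 2 + PI / 2) m * VV (- (PI / 2)) m)))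
    with (- lsum (seq m0 n) (fun m => VV (- (PI / 2)) m / N m * (stat_term (om + PI / 2) m * VV 0 m + stat_term (om + PI / 2 + PI / 2) m * VV (- (PI / 2)) m))) by ring.
  rewrite Rabs_Ropp. apply Rle_trans with (Eb * (5013 * sqrt be / sigma) + Eb * (5013 * sqrt be / sigma)); [lra|].
  unfold Eb, stat_bound.
  replace (sigma * (40 * E0 * ln (2 + 2 * INR n) / sqrt ra) * (5013 * sqrt be / sigma) + sigma * (40 * E0 * ln (2 + 2 * INR n) / sqrt ra) * (5013 * sqrt be / sigma))
    with (401040 * (sqrt be * E0 * ln (2 + 2 * INR n) / sqrt ra)) by (field; lra).
  replace (500000 * sqrt be * E0 * ln (2 + 2 * INR n) / sqrt ra) with (500000 * (sqrt be * E0 * ln (2 + 2 * INR n) / sqrt ra)) by lra.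
  apply Rmult_le_compat_r; [|lra]. pos.
Qed.
End Stationary.

(** * The horocycle bound applied to one block of the sum *)

Lemma series_tail_bound (g : nat -> R) l A q N : is_series (fun n => g (S n)) l -> 0 <= q < 1 ->
  (forall n, Rabs (g (S n)) <= A * q ^ n) -> Rabs (l - lsum (seq 1 (S N)) g) <= A * q ^ S N / (1 - q).
Proof.
  intros Hg Hq Hb.
  assert (E : forall N, sum_n (fun n => g (S n)) N = lsum (seq 1 (S N)) g).
  { induction N0 as [|k IH]; [rewrite sum_O; unfold lsum; simpl; rring|].
    rewrite sum_Sn, IH, (lsum_seq_S g 1 (S k)). auto. }
  assert (T : is_series (fun k => g (S (S N + k))) (l - lsum (seq 1 (S N)) g)).
  { apply (is_series_incr_n (fun n => g (S n)) (S N) (l - lsum (seq 1 (S N)) g)); [lia|].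
    simpl pred. rewrite E. set (u := lsum (seq 1 (S N)) g).
    refine (eq_ind l (fun z => is_series (fun n => g (S n)) z) Hg _ _). change (l = l - u + u). lra. }
  apply (series_geom_bound _ _ (A * q ^ S N) q T Hq). intros n.
  via Hb. rewrite pow_add. lra.
Qed.

(** With [x = th + B / (2 r)] the differential [dr] contributes [B / (2 (x - th)^2)], the amplitude
    of [kern] times [B / 2], and [PI B r] is [2 PI B^2 / (4 (x - th))]. *)
Lemma substitution (f : R -> R -> R) y B om th r1 r2 : (forall x, continuous (fun x => f x y) x) -> 0 < B -> 0 < r1 <= r2 ->
  RInt (fun r => cos (PI * B * r + om) * f (th + B / (2 * r)) y) r1 r2 =
  B / 2 * RInt (fun x => f x y * kern th B om x) (th + B / (2 * r2)) (th + B / (2 * r1)).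
Proof.
  intros Hf HB Hr.
  set (F := fun x => f x y * kern th B om x).
  set (g := fun r => th + B / (2 * r)). set (dg := fun r => - (B / (2 * r ^ 2))).
  assert (P : forall r, r1 <= r <= r2 -> 0 < B / (2 * r)) by (intros; apply Rdiv_lt_0_compat; lra).
  assert (CF : forall r, r1 <= r <= r2 -> continuous F (g r)).
  { intros r Hr'. specialize (P r Hr'). apply (continuous_mult (fun x => f x y) (kern th B om)); auto.
    by_derivative. unfold kern, g. auto_derive.
    nra. }
  assert (X : is_RInt (fun r => scal (dg r) (F (g r))) r1 r2 (RInt F (g r1) (g r2))).
  { apply (is_RInt_comp F g dg); minmax; auto.
    intros r Hr'. split.
    - unfold g, dg. auto_derive; [lra|]. field. lra.
    - by_derivative. unfold dg. auto_derive. nra. }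
  apply RInt_eq.
  replace (B / 2 * RInt F (th + B / (2 * r2)) (th + B / (2 * r1))) with ((- (B / 2)) * RInt F (g r1) (g r2)).
  - apply (is_RInt_ext (fun r => (- (B / 2)) * scal (dg r) (F (g r)))).
    + minmax. intros r Hr'. specialize (P r ltac:(lra)).
      unfold scal; simpl. unfold mult; simpl. unfold dg, F, kern, g.
      replace (th + B / (2 * r) - th) with (B / (2 * r)) by ring.
      replace (2 * PI * (B ^ 2 / (4 * (B / (2 * r)))) + om) with (PI * B * r + om) by (field; lra).
      set (c := cos _). set (f1 := f _ _). change (@eq R (- (B / 2) * (- (B / (2 * (r * (r * 1)))) * (f1 * (c / (B / (2 * r) * (B / (2 * r) * 1)))))) (c * f1)). field. lra.
    + apply is_RInt_scal_R. auto.
  - assert (EX : ex_RInt F (g r1) (g r2)).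
    { apply (ex_RInt_continuous F). intros x Hx.
      apply (continuous_mult (fun x => f x y) (kern th B om)); auto.
      assert (0 < x - th).
      { destruct Hx as [Hx _]. assert (th < Rmin (g r1) (g r2)); [|lra].
        pose proof (P r1 ltac:(lra)). pose proof (P r2 ltac:(lra)). apply Rmin_glb_lt; unfold g; lra. }
      by_derivative. unfold kern. auto_derive.
      nra. }
    fold (g r1) (g r2).
    assert (SW : RInt F (g r2) (g r1) = - RInt F (g r1) (g r2) :> R).
    { apply RInt_eq. apply (is_RInt_swap F). apply (RInt_correct F). auto. }
    nra.
Qed.

Section KeyBound.
Variables (f : R -> R -> R) (kappa : R) (al be : nat -> R).
Hypothesis Hser : bessel_expansion f kappa al be.
Hypothesis Hgrow : subexponential al be.
Hypothesis finv : moebius_invariant f.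

Lemma horizontal_approx y : 0 < y -> forall d (N0 : nat), 0 < d -> exists N, (N0 <= N)%nat /\
  forall x, Rabs (f x y - lsum (seq 1 N) (fun n => harmonic (fun n => bessel_weight kappa n y * al n) (fun n => bessel_weight kappa n y * be n) n x)) <= d.
Proof using Hser Hgrow.
  intros Hy d N0 Hd. pose proof PI_RGT_0 as HPI.
  destruct (harmonic_growth al be Hgrow y Hy) as [A [HA Hh]].
  set (q := exp (- (y / 4))) in *.
  assert (Hq : 0 < q < 1) by (split; [apply exp_pos|rewrite <- exp_0; apply exp_increasing; lra]).
  assert (Hs : 0 < / sqrt y) by pos.
  set (A' := / sqrt y * (A * q * q)).
  assert (HA' : 0 < A') by pos.
  assert (Hb : forall x n, Rabs (bessel_weight kappa (S n) y * harmonic al be (S n) x) <= A' * q ^ n).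
  { intros x n. rewrite Rabs_mult. pose proof (Hh (S n) ltac:(lia) y (Rle_refl y)) as K. simpl pow in K. fold q in K.
    assert (Hn1 : 1 <= INR (S n)) by (apply (le_INR 1); lia).
    assert (HPn : 0 < PI * INR (S n) * y) by pos. assert (HPn2 : 0 < PI * INR (S n)) by pos.
    pose proof (harmonic_bound al be (S n) x) as HB1.
    set (W := Rabs (al (S n)) + Rabs (be (S n))) in *. assert (HW : 0 <= W) by pos.
    apply Rle_trans with (/ sqrt y * exp (- (PI * INR (S n) * y / 2)) * W).
    - apply Rmult_le_compat; auto using Rabs_pos.
      eapply Rle_trans; [apply bessel_weight_bound; auto; lia|].
      mull. apply exp_le. lra.
    - replace (A' * q ^ n) with (/ sqrt y * (A * q * (q * q ^ n))) by (unfold A'; ring). rewrite (Rmult_assoc (/ sqrt y)). mull.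
      below K.
      rewrite (Rmult_comm (exp _)). apply Rmult_le_compat_r; [left; apply exp_pos|].
      nra. }
  destruct (pow_lt_1_zero q ltac:(rewrite Rabs_pos_eq; lra) (d * (1 - q) / A') ltac:(pos)) as [N1 HN1].
  exists (S (N0 + N1)). split; [lia|]. intros x.
  assert (E : forall n, harmonic (fun n => bessel_weight kappa n y * al n) (fun n => bessel_weight kappa n y * be n) n x
    = bessel_weight kappa n y * harmonic al be n x) by (intros; unfold harmonic; ring).
  rewrite (lsum_ext _ _ _ (fun n _ => E n)).
  eapply Rle_trans; [apply (series_tail_bound (fun n => bessel_weight kappa n y * harmonic al be n x) (f x y) A' q (N0 + N1)); auto; lra|].
  specialize (HN1 (S (N0 + N1)) ltac:(lia)). rewrite Rabs_pos_eq in HN1 by pos.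
  apply (Rmult_le_reg_r (1 - q)); [lra|]. rewrite Rdiv_mult_l by lra.
  apply (Rmult_le_reg_r (/ A')); [pos|]. replace (A' * q ^ S (N0 + N1) * / A') with (q ^ S (N0 + N1)) by (field; lra). lra.
Qed.

Definition osc_term (eta B om : R) (m : nat) : R :=
  al m * cos (om + 2 * PI * (eta * INR m + B * sqrt (INR m))) + be m * sin (om + 2 * PI * (eta * INR m + B * sqrt (INR m))).

Section Constants.
Variables (Cf vst k0 : R).
Hypothesis HCf : 0 < Cf.
Hypothesis fbound : forall x y, 0 < y -> Rabs (f x y) <= Cf.
Hypothesis flip : hyperbolic_lipschitz f Cf.
Hypothesis Hvst : 1 <= vst.
Hypothesis Hk0 : 0 < k0.
(** The height [y = vst / (2 PI M)] places the Bessel arguments [2 PI m y] into [[vst, 2 vst]],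
    where the weights can be divided out. *)
Hypothesis HK : forall v, vst <= v <= 2 * vst -> k0 <= BesselKi kappa v.

Lemma form_continuous y x : 0 < y -> continuous (fun x => f x y) x.
Proof using All. intros Hy. apply (f_continuous_x f Cf HCf finv fbound flip y x Hy). Qed.

Section Regime.
Variables (M De B eta : R) (Q : Z) (rho : R).
Let F := B * sqrt M.
Let y := vst / (2 * PI * M).
Let R0 := F * De / M ^ 2.
Hypothesis HM : 1 <= M.
Hypothesis HDe : 1 <= De <= M / 4.
Hypothesis HB : 0 < B.
Hypothesis Hrho : 0 < rho <= 1.
Hypothesis HR0 : rho <= R0.
(** [HF] yields [4 R0 <= b1^2], since 23 exceeds [361/16]. [HQ1] and [HQ2] give the two conditions
    on [B] in [horocycle_bound], [HQ3] its condition on [y], and [HV] the condition on the Fresnel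
    variable in [stationary_sum]. *)
Hypothesis HF : 23 * De <= F.
Hypothesis HQ : 32 <= IZR Q * rho.
Hypothesis HQ1 : IZR Q ^ 3 * (F * De) <= M ^ 2 * sqrt M.
Hypothesis HQ2 : IZR Q * F <= 8 * (M * sqrt M).
Hypothesis HQ3 : IZR Q ^ 3 * sqrt R0 * y <= 1.
Hypothesis HV : 102 * M ^ 2 <= F * De ^ 2.

Let s1 := sqrt M.
Let s2 := sqrt (M + De).
(** [sqrt (M + De) - sqrt M] is at most [De / (2 sqrt M) = 4 sigma]. *)
Let sigma := De / (8 * sqrt M).
Let ra := s1 - 2 * sigma.
Let rb := s2 + 2 * sigma.
Let b1 := B / (2 * rb).
Let Ecore := core_const rho * Cf * (1 + ln (2 + / y)) ^ 2 * (sqrt R0 / (IZR Q * b1 ^ 2)).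

Lemma regime_geometry : 0 < s1 /\ s1 * s1 = M /\ 0 < sigma /\ 32 * sigma <= s1 /\ s1 <= s2 /\ s2 <= s1 + 4 * sigma /\ 8 * sigma * s1 = De.
Proof using HM HDe.
  assert (H1 : 0 < s1) by pos.
  assert (E1 : s1 * s1 = M) by (apply sqrt_sqrt; lra).
  assert (Hs : 0 < sigma) by pos.
  assert (E2 : 8 * sigma * s1 = De) by (unfold sigma; fold s1; field; lra).
  repeat split; auto.
  - nra.
  - apply sqrt_le_1_alt. lra.
  - unfold s2. rewrite <- (sqrt_pow2 (s1 + 4 * sigma)) by lra. apply sqrt_le_1_alt. nra.
Qed.

Lemma core_applies om th r1 r2 : ra <= r1 -> r1 <= r2 -> r2 <= rb ->
  Rabs (RInt (fun r => cos (PI * B * r + om) * f (th + B / (2 * r)) y) r1 r2) <= B / 2 * Ecore.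
Proof using All.
  intros H1 H2 H3. destruct regime_geometry as [G1 [G2 [G3 [G4 [G5 [G6 G7]]]]]].
  pose proof PI_RGT_0 as HPI.
  assert (Hy : 0 < y) by pos.
  assert (Hra : 15 / 16 * s1 <= ra) by (unfold ra; lra).
  assert (Hrb : s1 <= rb <= 19 / 16 * s1) by (unfold rb; lra).
  assert (HFs : F = B * s1) by reflexivity.
  assert (HR0e : R0 = B * De / (M * s1)) by (unfold R0; rewrite HFs, <- G2; field; lra).
  assert (Hq : 0 < IZR Q) by nra.
  assert (Hb1u : b1 <= B / (2 * s1)).
  { unfold b1, Rdiv. mull. apply Rinv_le_contravar; lra. }
  assert (Hb1l : B * / (19 / 8 * s1) <= b1).
  { unfold b1, Rdiv. mull. apply Rinv_le_contravar; lra. }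
  assert (Hb1 : 0 < b1) by pos.
  rewrite substitution; auto; [|intros; apply form_continuous; auto|lra].
  rewrite Rabs_mult, Rabs_pos_eq by lra. mull.
  apply (horocycle_bound f Cf th b1 R0 B rho om _ _ y Q); auto.
  - split; auto. apply Rle_trans with (B * / (19 / 8 * s1)); auto. rewrite HR0e.
    replace (B * De / (M * s1)) with (B * / s1 * (De / M)) by (field; lra).
    replace (B * / (19 / 8 * s1)) with (B * / s1 * (8 / 19)) by (field; lra).
    mull. apply (Rmult_le_reg_r M); [lra|]. rewrite Rdiv_mult_l; lra.
  - apply Rle_trans with ((B * / (19 / 8 * s1)) ^ 2).
    + rewrite HR0e. replace (4 * (B * De / (M * s1))) with (B * / (s1 * M) * (4 * De)) by (field; lra).
      replace ((B * / (19 / 8 * s1)) ^ 2) with (B * / (s1 * M) * (64 / 361 * F)) by (rewrite HFs, <- G2; field; lra).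
      mull. lra.
    + apply pow_incr. split; auto. pos.
  - apply Rle_trans with (IZR Q ^ 3 * R0 * (B / (2 * s1))).
    + apply Rmult_le_compat_l; auto. pos.
    + unfold R0. replace (IZR Q ^ 3 * (F * De / M ^ 2) * (B / (2 * s1))) with (IZR Q ^ 3 * (F * De) * (B / (2 * s1 * M ^ 2))) by (field; lra).
      apply Rle_trans with (M ^ 2 * sqrt M * (B / (2 * s1 * M ^ 2))).
      * apply Rmult_le_compat_r; auto. pos.
      * fold s1. replace (M ^ 2 * s1 * (B / (2 * s1 * M ^ 2))) with (B / 2) by (field; lra). lra.
  - apply Rle_trans with (IZR Q ^ 4 * R0 * (B / (2 * s1)) ^ 3).
    + apply Rmult_le_compat_l; [apply Rmult_le_pos; [apply pow_le; lra|lra]|]. apply pow_incr. lra.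
    + unfold R0. replace (IZR Q ^ 4 * (F * De / M ^ 2) * (B / (2 * s1)) ^ 3) with ((IZR Q ^ 3 * (F * De)) * ((IZR Q * F) * (B ^ 2 / (8 * s1 ^ 4 * M ^ 2)))).
      2:{ rewrite HFs. field. lra. }
      apply Rle_trans with ((M ^ 2 * s1) * ((8 * (M * s1)) * (B ^ 2 / (8 * s1 ^ 4 * M ^ 2)))).
      * assert (0 <= B ^ 2 / (8 * s1 ^ 4 * M ^ 2)) by pos.
        assert (0 <= F) by lra.
        apply Rmult_le_compat; auto; [apply Rmult_le_pos; [apply pow_le; lra|nra]|apply Rmult_le_pos; auto; nra|].
        apply Rmult_le_compat_r; auto.
      * right. rewrite <- G2. field. lra.
  - split; [|split].
    + apply Rplus_le_compat_l. unfold b1, Rdiv. mull. apply Rinv_le_contravar; lra.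
    + apply Rplus_le_compat_l. unfold Rdiv. mull. apply Rinv_le_contravar; lra.
    + assert (B / (2 * r1) <= b1 + R0); [|lra].
      apply Rle_trans with (B / (2 * ra)); [unfold Rdiv; mull; apply Rinv_le_contravar; lra|].
      assert (E : B / (2 * ra) - b1 = B / 2 * ((rb - ra) / (ra * rb))) by (unfold b1; field; lra).
      assert (L : (rb - ra) / (ra * rb) <= De / s1 * (16 / 15 * / M)).
      { unfold Rdiv at 1. apply Rmult_le_compat; [lra|left; apply Rinv_0_lt_compat; apply Rmult_lt_0_compat; lra| |].
        - apply (Rmult_le_reg_r s1); auto. rewrite Rdiv_mult_l by lra. unfold rb, ra. nra.
        - replace (16 / 15 * / M) with (/ (15 / 16 * M)) by (field; lra). apply Rinv_le_contravar; [lra|]. rewrite <- G2.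
          replace (15 / 16 * (s1 * s1)) with (15 / 16 * s1 * s1) by ring. apply Rmult_le_compat; lra. }
      assert (L2 : B / 2 * ((rb - ra) / (ra * rb)) <= R0).
      { eapply Rle_trans; [mull; [apply L]|]. rewrite HR0e.
        replace (B / 2 * (De / s1 * (16 / 15 * / M))) with (8 / 15 * (B * De / (M * s1))) by (field; lra).
        lra. }
      lra.
Qed.

Lemma regime_sum om m0 n : (1 <= n)%nat -> M <= INR m0 -> INR (m0 + n - 1) <= M + De ->
  Rabs (lsum (seq m0 n) (fun m => bessel_weight kappa m y * osc_term eta B om m)) <=
  500000 * sqrt (PI * B) * (B / 2 * Ecore) * ln (2 + 2 * INR n) / sqrt ra.
Proof using All.
  intros Hn Hm0 Hmn. destruct regime_geometry as [G1 [G2 [G3 [G4 [G5 [G6 G7]]]]]].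
  pose proof PI_RGT_0 as HPI. pose proof PI2_3_2 as HPI3.
  assert (Hy : 0 < y) by pos.
  assert (Hm1 : (1 <= m0)%nat) by (apply INR_le; simpl; lra).
  assert (Hrb : s1 <= rb <= 19 / 16 * s1) by (unfold rb; lra).
  pose proof (stationary_sum (fun x => f x y) (fun n => bessel_weight kappa n y * al n) (fun n => bessel_weight kappa n y * be n)
    B eta s1 s2 sigma (B / 2 * Ecore) (fun x => form_continuous y x Hy) (horizontal_approx y Hy) HB G3) as SS.
  rewrite (lsum_ext _ _ (stat_term (fun n => bessel_weight kappa n y * al n) (fun n => bessel_weight kappa n y * be n) B eta om)).
  2:{ intros m _. unfold osc_term, stat_term, stat_phase. ring. }
  apply SS; auto.
  - lra.
  - fold rb. apply Rle_trans with (sqrt (4 / (PI * B))).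
    + right. rewrite sqrt_div_alt by pos. f_equal.
      replace 4 with (2 ^ 2) by ring. rewrite sqrt_pow2; lra.
    + replace (sigma / sqrt rb) with (sqrt (sigma ^ 2 / rb)) by (rewrite sqrt_div_alt, sqrt_pow2 by lra; auto).
      apply sqrt_le_1_alt.
      apply (Rmult_le_reg_r (PI * B * rb)); [apply Rmult_lt_0_compat; [pos|lra]|].
      replace (4 / (PI * B) * (PI * B * rb)) with (4 * rb) by (field; lra).
      replace (sigma ^ 2 / rb * (PI * B * rb)) with (PI * B * sigma ^ 2) by (field; lra).
      assert (HFs : F = B * s1) by reflexivity.
      apply Rle_trans with (3 * B * sigma ^ 2).
      * apply (Rmult_le_reg_r (64 * s1 ^ 3)); [pos|].
        replace (3 * B * sigma ^ 2 * (64 * s1 ^ 3)) with (3 * (F * De ^ 2)) by (rewrite HFs, <- G7; ring).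
        apply Rle_trans with (4 * (19 / 16 * s1) * (64 * s1 ^ 3)).
        { nra. }
        (* [304 <= 3 * 102], which is where the 102 of [HV] comes from. *)
        replace (4 * (19 / 16 * s1) * (64 * s1 ^ 3)) with (304 * M ^ 2) by (rewrite <- G2; field).
        assert (0 < M ^ 2) by pos. lra.
      * rewrite !Rmult_assoc. mulr. lra.
  - intros. apply core_applies; auto.
  - intros m Hm. split; apply sqrt_le_1_alt.
    + apply Rle_trans with (INR m0); auto. apply le_INR; lia.
    + apply Rle_trans with (INR (m0 + n - 1)); auto. apply le_INR; lia.
Qed.

(** Partial summation with the reciprocal weights. By [BesselKi_lipschitz] and the lower bound [k0]
    their variation is at most a multiple of that of the Bessel argument, which moves by at most
    [vst] over the block. *)
Lemma regime_sum_unweighted om m0 n : (1 <= n)%nat -> M <= INR m0 -> INR (m0 + n - 1) <= M + De ->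
  Rabs (lsum (seq m0 n) (osc_term eta B om)) <=
  500000 * sqrt (PI * B) * (B / 2 * Ecore) * ln (2 + 2 * INR n) / sqrt ra * (/ sqrt y * (/ k0 + 8 * vst / k0 ^ 2)).
Proof using All.
  intros Hn Hm0 Hmn. destruct regime_geometry as [G1 [G2 [G3 [G4 [G5 [G6 G7]]]]]].
  pose proof PI_RGT_0 as HPI.
  assert (Hy : 0 < y) by pos.
  assert (Hsy : 0 < sqrt y) by pos.
  set (E := 500000 * sqrt (PI * B) * (B / 2 * Ecore) * ln (2 + 2 * INR n) / sqrt ra).
  assert (E2y : 2 * PI * M * y = vst) by (unfold y; field; lra).
  assert (Hv : forall m, (m0 <= m < m0 + n)%nat -> vst <= 2 * PI * INR m * y <= 2 * vst).
  { intros m Hm. assert (M <= INR m) by (apply Rle_trans with (INR m0); auto; apply le_INR; lia).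
    assert (INR m <= 2 * M) by (apply Rle_trans with (INR (m0 + n - 1)); [apply le_INR; lia|lra]).
    rewrite <- E2y. assert (0 < 2 * PI * y) by pos.
    replace (2 * PI * M * y) with (2 * PI * y * M) by ring. replace (2 * PI * INR m * y) with (2 * PI * y * INR m) by ring. nra. }
  assert (HK' : forall m, (m0 <= m < m0 + n)%nat -> k0 <= BesselKi kappa (2 * PI * INR m * y)) by auto.
  assert (HE0 : 0 <= E) by (eapply Rle_trans; [apply Rabs_pos|apply (regime_sum om m0 n); auto]).
  assert (HE : 0 <= 500000 * sqrt (PI * B) * (B / 2 * Ecore) / sqrt ra).
  { assert (L : 0 < ln (2 + 2 * INR n)) by apply ln_nonneg_2.
    apply (Rmult_le_reg_r (ln (2 + 2 * INR n))); auto. rewrite Rmult_0_l. unfold E in HE0.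
    lra. }
  rewrite (lsum_ext _ _ (fun m => / bessel_weight kappa m y * (bessel_weight kappa m y * osc_term eta B om m))).
  2:{ intros m Hm. apply in_seq in Hm. pose proof (HK' m ltac:(lia)). rewrite <- Rmult_assoc, Rinv_l, Rmult_1_l; auto.
      unfold bessel_weight. apply Rgt_not_eq. pos. }
  set (D := fun m => 8 / (sqrt y * k0 ^ 2) * (2 * PI * INR m * y)).
  via (abel (fun m => bessel_weight kappa m y * osc_term eta B om m) (fun m => / bessel_weight kappa m y) D m0 n E (/ (sqrt y * k0))); auto.
  - intros [|k] Hk; [rewrite lsum_prefix_zero, Rabs_R0; auto|].
    eapply Rle_trans; [apply regime_sum; auto; [lia|]|].
    + below Hmn. apply le_INR. lia.
    + unfold E. replace (500000 * sqrt (PI * B) * (B / 2 * Ecore) * ln (2 + 2 * INR (S k)) / sqrt ra) with (500000 * sqrt (PI * B) * (B / 2 * Ecore) / sqrt ra * ln (2 + 2 * INR (S k))) by lra.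
      replace (500000 * sqrt (PI * B) * (B / 2 * Ecore) * ln (2 + 2 * INR n) / sqrt ra) with (500000 * sqrt (PI * B) * (B / 2 * Ecore) / sqrt ra * ln (2 + 2 * INR n)) by lra.
      apply Rmult_le_compat_l; auto. pose proof (pos_INR (S k)). apply le_INR in Hk. apply ln_le; lra.
  - intros m Hm. pose proof (HK' m Hm). unfold bessel_weight.
    assert (0 < sqrt y * k0) by pos. rewrite Rabs_pos_eq by pos.
    apply Rinv_le_contravar; auto. nra.
  - intros m H1 H2. pose proof (HK' m ltac:(lia)) as K1. pose proof (HK' (S m) ltac:(lia)) as K2. unfold bessel_weight.
    pose proof (Hv m ltac:(lia)) as V1. pose proof (Hv (S m) ltac:(lia)) as V2.
    set (v := 2 * PI * INR m * y) in *. set (v' := 2 * PI * INR (S m) * y) in *.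
    assert (Hvv : v <= v').
    { unfold v, v'. mulr. mull. apply le_INR. lia. }
    pose proof (BesselKi_lipschitz kappa v v' ltac:(lra)) as L.
    assert (L2 : Rabs (BesselKi kappa v - BesselKi kappa v') <= (v' - v) * 8).
    { via L. rewrite Rmult_assoc. mull.
      assert (8 / v ^ 2 <= 8).
      { unfold Rdiv. rewrite <- (Rmult_1_r 8) at 2. mull. rewrite <- Rinv_1. apply Rinv_le_contravar; nra. }
      assert (exp (- v / 4) <= exp 0) by (apply exp_le; lra). rewrite exp_0 in *. pose proof (exp_pos (- v / 4)).
      rewrite <- (Rmult_1_r 8) at 2. apply Rmult_le_compat; try lra. pos. }
    set (k := BesselKi kappa v) in *. set (k' := BesselKi kappa v') in *.
    replace (/ (sqrt y * k') - / (sqrt y * k)) with (/ sqrt y * (/ (k * k') * (k - k'))) by (field; lra).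
    rewrite !Rabs_mult, (Rabs_pos_eq (/ sqrt y)), (Rabs_pos_eq (/ (k * k'))).
    2:{ pos. } 2:{ pos. }
    unfold D. fold v v'. replace (8 / (sqrt y * k0 ^ 2) * v' - 8 / (sqrt y * k0 ^ 2) * v) with (/ sqrt y * (/ (k0 * k0) * ((v' - v) * 8))) by (field; lra).
    mull. apply Rmult_le_compat; auto using Rabs_pos.
    + pos.
    + apply Rinv_le_contravar; [pos|]. apply Rmult_le_compat; lra.
  - apply Rmult_le_compat_l; auto.
    assert (DD : D (m0 + n - 1)%nat - D m0 <= 8 / (sqrt y * k0 ^ 2) * vst).
    { unfold D. rewrite <- Rmult_minus_distr_l. mull.
      pose proof (Hv (m0 + n - 1)%nat ltac:(lia)). pose proof (Hv m0 ltac:(lia)). lra. }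
    replace (/ sqrt y * (/ k0 + 8 * vst / k0 ^ 2)) with (/ (sqrt y * k0) + 8 / (sqrt y * k0 ^ 2) * vst) by (field; lra). lra.
Qed.
End Regime.
End Constants.
End KeyBound.

(** * The choice of [Q] and the auxiliary conditions *)

Lemma cube_le a b : 0 <= b -> a ^ 3 <= b ^ 3 -> a <= b.
Proof.
  intros Hb H. apply Rnot_lt_le. intros N.
  assert (0 < (a - b) * (a * a + a * b + b * b)) by (apply Rmult_lt_0_compat; nra).
  lra.
Qed.

Section Key.
Variables (f : R -> R -> R) (kappa : R) (al be : nat -> R).
Hypothesis Hser : bessel_expansion f kappa al be.
Hypothesis Hgrow : subexponential al be.
Hypothesis finv : moebius_invariant f.

(** The inequalities [M^2 <= c0 De F] and [F <= ct sqrt De M], with [De <= M], imply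
    [sqrt De >= 1 / (c0 ct)]. A small [ct] thus makes [De] and [X] as large as the conditions on a
    block demand; [Q] is the integer part of [X]. *)
Lemma key_bound c0 : 0 < c0 -> exists K ct, 0 < K /\ 0 < ct /\
  forall M De B eta om X m0 n, 1 <= M -> 1 <= De <= M / 4 -> 0 < B ->
  M ^ 2 <= c0 * (De * (B * sqrt M)) -> 23 * De <= B * sqrt M -> B * sqrt M <= ct * sqrt De * M ->
  0 < X -> X ^ 3 * (B * sqrt M * De) = M ^ 2 * sqrt M ->
  (1 <= n)%nat -> M <= INR m0 -> INR (m0 + n - 1) <= M + De ->
  Rabs (lsum (seq m0 n) (osc_term al be eta B om)) <= K * (1 + ln (2 + 7 * M)) ^ 3 * (sqrt M * sqrt De / X).
Proof using All.
  intros Hc0. pose proof PI_RGT_0 as HPI. pose proof PI2_3_2 as HPI3. pose proof PI_4 as HPI4.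
  destruct (form_bounds f kappa al be Hser Hgrow finv) as [Cf [HCf [fb fl]]].
  destruct (BesselKi_lower kappa) as [c' [v0 [Hc' [Hv0 HKl]]]].
  set (vst := Rmax 1 v0). assert (Hv1 : 1 <= vst) by apply Rmax_l. assert (Hv2 : v0 <= vst) by apply Rmax_r.
  set (k0 := c' * exp (- 4 * vst)). assert (Hk0 : 0 < k0) by pos.
  assert (HK : forall v, vst <= v <= 2 * vst -> k0 <= BesselKi kappa v).
  { intros v Hv. eapply Rle_trans; [|apply HKl; lra]. unfold k0. mull. apply exp_le. lra. }
  (* The hypothesis says [R0 = F De / M^2 >= 1 / c0], so the length of the x-interval has a fixed
     lower bound, on which the constants of the horocycle estimate depend. *)
  set (rho := Rmin 1 (/ c0)).
  assert (Hic : 0 < / c0) by pos.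
  assert (Hrho : 0 < rho <= 1) by (unfold rho; split; [apply Rmin_glb_lt; lra|apply Rmin_l]).
  assert (Hrho2 : rho <= / c0) by apply Rmin_r.
  set (cc := core_const rho).
  assert (Hcc : 0 < cc).
  { unfold cc, core_const. pose proof (sqrt_pos (pair_const rho)). assert (0 < 118 / rho) by pos. lra. }
  (* The bounds on [ct] serve in turn for [Q F <= 8 M^(3/2)], for [X >= 64 / rho] and for
     [sqrt De >= 102 (1 + c0) vst]. *)
  set (cv := 102 * c0 * (1 + c0) * vst). assert (Hcv : 0 < cv) by pos.
  set (ct := Rmin 1 (Rmin ((rho / 64) ^ 3) (/ cv))).
  assert (Hct : 0 < ct).
  { unfold ct. apply Rmin_glb_lt; [lra|]. apply Rmin_glb_lt; [pos|pos]. }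
  assert (Hct1 : ct <= 1) by apply Rmin_l.
  assert (Hct2 : ct <= (rho / 64) ^ 3) by (unfold ct; eapply Rle_trans; [apply Rmin_r|apply Rmin_l]).
  assert (Hct3 : ct <= / cv) by (unfold ct; eapply Rle_trans; [apply Rmin_r|apply Rmin_r]).
  set (Ck := / k0 + 8 * vst / k0 ^ 2).
  assert (HCk : 0 < Ck) by (unfold Ck; assert (0 < / k0) by pos; assert (0 < 8 * vst / k0 ^ 2) by pos; lra).
  exists (500000 * 72 * (cc * Cf * Ck)), ct. split; [pos|]. split; auto.
  intros M De B eta om X m0 n HM HDe HB HMF HF HFt HX HX3 Hn Hm0 Hmn.
  set (F := B * sqrt M) in *. set (s1 := sqrt M). set (d := sqrt De).
  assert (Hs1 : 1 <= s1) by (unfold s1; rewrite <- sqrt_1; apply sqrt_le_1_alt; lra).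
  assert (E1 : s1 * s1 = M) by (apply sqrt_sqrt; lra).
  assert (Hd : 1 <= d) by (unfold d; rewrite <- sqrt_1; apply sqrt_le_1_alt; lra).
  assert (Ed : d * d = De) by (apply sqrt_sqrt; lra).
  assert (Hds : d <= s1) by (apply sqrt_le_1_alt; lra).
  assert (HF0 : 0 < F) by lra.
  fold s1 in HX3. fold d in HFt.
  assert (HFD : 0 < F * De) by nra.
  assert (Hdl : / (c0 * ct) <= d).
  { assert (M * M <= c0 * ct * (d * De) * M).
    { replace (M * M) with (M ^ 2) by ring. via HMF.
      replace (c0 * ct * (d * De) * M) with (c0 * De * (ct * d * M)) by ring. rewrite <- Rmult_assoc.
      apply Rmult_le_compat_l; auto. nra. }
    assert (M <= c0 * ct * (d * De)) by (apply (Rmult_le_reg_r M); lra).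
    assert (1 <= c0 * ct * d) by (apply (Rmult_le_reg_r De); [lra|]; lra).
    apply (Rmult_le_reg_l (c0 * ct)); [pos|]. rewrite Rinv_r; [lra|]. apply Rgt_not_eq. pos. }
  assert (Hdl2 : 102 * (1 + c0) * vst <= d).
  { below Hdl. replace (102 * (1 + c0) * vst) with (/ (c0 * / cv)) by (unfold cv; field; lra).
    apply Rinv_le_contravar; [pos|]. apply Rmult_le_compat_l; lra. }
  (* [X^3 = M^(5/2) / (F De) >= M^(3/2) / (ct De^(3/2)) >= 1 / ct]. *)
  assert (HX64 : 64 / rho <= X).
  { apply cube_le; [lra|].
    assert (G : 1 <= X ^ 3 * ct).
    { apply (Rmult_le_reg_r (M ^ 2 * s1)); [pos|].
      rewrite Rmult_1_l. rewrite <- HX3 at 1. rewrite !Rmult_assoc. mull.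
      apply Rle_trans with (ct * d * M * De); [apply Rmult_le_compat_r; lra|].
      rewrite <- Ed, <- E1. replace (ct * d * (s1 * s1) * (d * d)) with (ct * (s1 * s1) * (d * (d * d))) by ring.
      replace (ct * ((s1 * s1) ^ 2 * s1)) with (ct * (s1 * s1) * (s1 * (s1 * s1))) by ring.
      apply Rmult_le_compat_l; [apply Rmult_le_pos; [lra|nra]|]. apply Rmult_le_compat; lra. }
    assert (1 <= X ^ 3 * (rho / 64) ^ 3).
    { via G. apply Rmult_le_compat_l; auto. pos. }
    apply (Rmult_le_reg_r ((rho / 64) ^ 3)); [pos|].
    replace ((64 / rho) ^ 3 * (rho / 64) ^ 3) with 1 by (field; lra). auto. }
  assert (HX64' : 64 <= X).
  { below HX64. apply (Rmult_le_reg_r rho); [lra|]. rewrite Rdiv_mult_l by lra. lra. }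
  set (Q := Zfloor X). pose proof (Zfloor_bound X) as [Q1 Q2]. fold Q in Q1, Q2.
  assert (HQX : X / 2 <= IZR Q) by lra.
  assert (HQ0 : 0 < IZR Q) by lra.
  assert (HQ3 : IZR Q ^ 3 <= X ^ 3) by (apply pow_incr; lra).
  set (y := vst / (2 * PI * M)). set (R0 := F * De / M ^ 2).
  assert (Hy : 0 < y) by pos.
  assert (HR0 : / c0 <= R0).
  { unfold R0. apply (Rmult_le_reg_l (c0 * M ^ 2)); [pos|].
    replace (c0 * M ^ 2 * / c0) with (M ^ 2) by (field; lra). replace (c0 * M ^ 2 * (F * De / M ^ 2)) with (c0 * (De * F)) by (field; lra). auto. }
  assert (HR0p : 0 < R0) by lra.
  assert (HsR0 : 0 < sqrt R0) by pos. assert (EsR0 : sqrt R0 * sqrt R0 = R0) by (apply sqrt_sqrt; lra).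
  assert (HisR0 : / sqrt R0 <= 1 + c0).
  { apply Rnot_lt_le. intros N. assert (N2 : (1 + c0) * (1 + c0) < / sqrt R0 * / sqrt R0) by (apply Rmult_gt_0_lt_compat; lra).
    rewrite <- Rinv_mult, EsR0 in N2. assert (/ R0 <= / / c0) by (apply Rinv_le_contravar; auto). rewrite Rinv_inv in H.
    assert (0 < c0 * c0) by pos. lra. }
  assert (C1 : 32 <= IZR Q * rho).
  { apply Rle_trans with (X / 2 * rho); [|apply Rmult_le_compat_r; lra].
    apply Rle_trans with (64 / rho / 2 * rho); [right; field; lra|]. apply Rmult_le_compat_r; lra. }
  assert (C2 : IZR Q ^ 3 * (F * De) <= M ^ 2 * s1).
  { rewrite <- HX3. apply Rmult_le_compat_r; lra. }
  assert (C3 : IZR Q * F <= 8 * (M * s1)).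
  { apply Rle_trans with (M * s1); [|assert (0 < M * s1) by pos; lra]. apply cube_le; [pos|].
    rewrite Rpow_mult_distr. apply Rle_trans with (X ^ 3 * F ^ 3); [mulr; auto|].
    apply (Rmult_le_reg_r De); [lra|].
    replace (X ^ 3 * F ^ 3 * De) with (X ^ 3 * (F * De) * F ^ 2) by ring. rewrite HX3.
    apply Rle_trans with (M ^ 2 * s1 * (ct * d * M) ^ 2).
    - mull. apply pow_incr. lra.
    - replace ((M * s1) ^ 3 * De) with (M ^ 2 * s1 * (1 * (d * M) ^ 2)) by (rewrite <- Ed, <- E1; ring).
      replace ((ct * d * M) ^ 2) with (ct ^ 2 * (d * M) ^ 2) by ring.
      mull.
      mulr. replace 1 with (1 ^ 2) by ring. apply pow_incr. lra. }
  assert (C4 : IZR Q ^ 3 * sqrt R0 * y <= 1).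
  { apply Rle_trans with (X ^ 3 * sqrt R0 * y); [repeat apply Rmult_le_compat_r; lra|].
    assert (EX : X ^ 3 = s1 * / (sqrt R0 * sqrt R0)).
    { rewrite EsR0. unfold R0. apply (Rmult_eq_reg_r (F * De)); [|lra]. rewrite HX3. field. lra. }
    rewrite EX. replace (s1 * / (sqrt R0 * sqrt R0) * sqrt R0 * y) with (s1 * / sqrt R0 * y) by (field; lra).
    apply Rle_trans with (s1 * (1 + c0) * y); [mulr; apply Rmult_le_compat_l; lra|].
    unfold y. rewrite <- E1. replace (s1 * (1 + c0) * (vst / (2 * PI * (s1 * s1)))) with ((1 + c0) * vst / (2 * PI * s1)) by (field; lra).
    apply (Rmult_le_reg_r (2 * PI * s1)); [apply Rmult_lt_0_compat; lra|]. rewrite Rdiv_mult_l by (apply Rgt_not_eq, Rmult_lt_0_compat; lra).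
    assert (3 * s1 <= PI * s1) by (apply Rmult_le_compat_r; lra). lra. }
  assert (C5 : 102 * M ^ 2 <= F * De ^ 2).
  { assert (102 * (1 + c0) <= De).
    { rewrite <- Ed. apply Rle_trans with (d * 1); [|apply Rmult_le_compat_l; lra]. assert ((1 + c0) * 1 <= (1 + c0) * vst) by (apply Rmult_le_compat_l; lra). lra. }
    apply Rle_trans with (102 * (c0 * (De * F))); [lra|].
    replace (102 * (c0 * (De * F))) with (102 * c0 * (F * De)) by ring. replace (F * De ^ 2) with (De * (F * De)) by ring.
    apply Rmult_le_compat_r; lra. }
  pose proof (regime_sum_unweighted f kappa al be Hser Hgrow finv Cf vst k0 HCf fb fl Hv1 Hk0 HK M De B eta Q rho HM HDe HB Hrho
     ltac:(fold F; fold R0; lra) HF C1 C2 C3 C4 C5 om m0 n Hn Hm0 Hmn) as RS.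
  via RS. clear RS.
  fold F. fold s1. fold y. fold R0. fold Ck. fold cc.
  set (rb := sqrt (M + De) + 2 * (De / (8 * s1))). set (ra := s1 - 2 * (De / (8 * s1))).
  destruct (regime_geometry M De HM HDe) as [_ [_ [G3 [G4 [G5 [G6 G7]]]]]]. fold s1 in G3, G4, G5, G6, G7.
  set (sg := De / (8 * s1)) in *.
  set (Lg := 1 + ln (2 + 7 * M)).
  assert (Hiy : / y <= 7 * M).
  { unfold y. replace (/ (vst / (2 * PI * M))) with (2 * PI * M * / vst) by (field; lra).
    assert (/ vst <= 1) by (rewrite <- Rinv_1; apply Rinv_le_contravar; lra).
    assert (HPI2 : 2 * PI <= 7) by (pose proof (PI_ineq 3) as P; unfold tg_alt, PI_tg in P; simpl in P; lra).
    apply Rle_trans with (2 * PI * M * 1); [apply Rmult_le_compat_l; [pos|auto]|].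
    rewrite Rmult_1_r. apply Rmult_le_compat_r; lra. }
  assert (Hiyp : 0 < / y) by pos.
  assert (HL1 : 1 <= 1 + ln (2 + / y) <= Lg).
  { split; [assert (0 <= ln (2 + / y)) by (rewrite <- ln_1; apply ln_le; lra); lra|].
    unfold Lg. apply Rplus_le_compat_l. apply ln_le; lra. }
  assert (HL2 : 0 <= ln (2 + 2 * INR n) <= Lg).
  { split; [left; apply ln_nonneg_2|]. apply Rle_trans with (ln (2 + 7 * M)); [|unfold Lg; lra].
    pose proof (pos_INR n). apply ln_le; [lra|].
    rewrite minus_INR, plus_INR in Hmn by lia. simpl in Hmn. lra. }
  set (L1 := 1 + ln (2 + / y)) in *. set (l := ln (2 + 2 * INR n)) in *.
  set (b1 := B / (2 * rb)).
  assert (Hrb : s1 <= rb <= 19 / 16 * s1) by (unfold rb; lra).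
  assert (Hra : s1 / 4 <= ra) by (unfold ra; lra).
  set (q := sqrt B). assert (Hq : 0 < q) by pos. assert (Eq : q * q = B) by (apply sqrt_sqrt; lra).
  set (p := sqrt s1). assert (Hp : 0 < p) by pos. assert (Ep : p * p = s1) by (apply sqrt_sqrt; lra).
  assert (T1 : sqrt (PI * B) <= 2 * q).
  { rewrite sqrt_mult by lra. mulr. rewrite <- (sqrt_pow2 2) by lra. apply sqrt_le_1_alt. lra. }
  assert (T3 : sqrt R0 = q * d / (s1 * p)).
  { assert (ER : R0 = (q * d / (s1 * p)) ^ 2).
    { unfold R0, F. fold s1. rewrite <- Eq, <- Ed, <- E1. replace ((q * d / (s1 * p)) ^ 2) with (q * q * (d * d) / (s1 ^ 2 * (p * p))) by (field; lra).
      rewrite Ep. field. lra. }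
    rewrite ER. apply sqrt_pow2. pos. }
  assert (T4 : / IZR Q <= 2 / X).
  { replace (2 / X) with (/ (X / 2)) by (field; lra). apply Rinv_le_contravar; lra. }
  assert (T5 : / b1 ^ 2 <= 6 * (s1 * s1) / B ^ 2).
  { unfold b1. replace (/ (B / (2 * rb)) ^ 2) with (4 * rb ^ 2 / B ^ 2) by (field; split; lra).
    unfold Rdiv. mulr. assert (rb ^ 2 <= (19 / 16 * s1) ^ 2) by (apply pow_incr; lra).
    assert (0 < s1 * s1) by pos. lra. }
  assert (T6 : / sqrt ra <= 2 / p).
  { replace (2 / p) with (/ (p / 2)) by (field; lra). apply Rinv_le_contravar; [lra|].
    rewrite <- (sqrt_pow2 (p / 2)) by lra. apply sqrt_le_1_alt. lra. }
  assert (T7 : / sqrt y <= 3 * s1).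
  { rewrite <- sqrt_inv. rewrite <- (sqrt_pow2 (3 * s1)) by lra. apply sqrt_le_1_alt. lra. }
  assert (Hb1 : 0 < b1) by pos.
  assert (Hra0 : 0 < sqrt ra) by pos. assert (Hsy : 0 < sqrt y) by pos.
  assert (Pi0 : 0 < sqrt (PI * B)) by pos.
  (* In this product the powers of [B] cancel, so that the outcome depends on [B] through [X]
     alone. *)
  set (brk := sqrt (PI * B) * (B / 2) * sqrt R0 * / IZR Q * / b1 ^ 2 * / sqrt ra * / sqrt y).
  assert (Hbrk : brk <= 72 * (s1 * d / X)).
  { apply Rle_trans with (2 * q * (B / 2) * (q * d / (s1 * p)) * (2 / X) * (6 * (s1 * s1) / B ^ 2) * (2 / p) * (3 * s1)).
    - assert (0 < / sqrt ra) by pos. assert (0 < / sqrt y) by pos. assert (0 < / b1 ^ 2) by pos. assert (0 < / IZR Q) by pos. assert (0 < B / 2) by lra.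
      unfold brk. rewrite T3. assert (0 < q * d / (s1 * p)) by pos.
      repeat (apply Rmult_le_compat; [left; pos|left; pos| |try lra]). auto.
    - right. transitivity (72 * (s1 * d / X) * (q * q / B) * (s1 / (p * p))); [field; lra|].
      rewrite Eq, Ep. field. lra. }
  assert (Hbrk0 : 0 <= brk) by pos.
  replace (500000 * sqrt (PI * B) * (B / 2 * (cc * Cf * L1 ^ 2 * (sqrt R0 / (IZR Q * b1 ^ 2)))) * l / sqrt ra * (/ sqrt y * Ck))
    with (500000 * (cc * Cf * Ck) * (L1 ^ 2 * l * brk)) by (unfold brk; field; repeat split; lra).
  replace (500000 * 72 * (cc * Cf * Ck) * Lg ^ 3 * (s1 * d / X)) with (500000 * (cc * Cf * Ck) * (Lg ^ 2 * Lg * (72 * (s1 * d / X)))) by ring.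
  mull.
  assert (L1 ^ 2 <= Lg ^ 2) by (apply pow_incr; lra).
  apply Rmult_le_compat; auto; [apply Rmult_le_pos; [apply pow2_ge_0|lra]|]. apply Rmult_le_compat; try lra. pos.
Qed.
End Key.

(* For B < 0 the bound is applied to the reflected form f(-x, y). *)
Lemma signed_key_bound (f : R -> R -> R) (kappa : R) (al be : nat -> R) c0 :
  (bessel_expansion f kappa al be) ->
  (subexponential al be) ->
  (moebius_invariant f) ->
  0 < c0 -> exists K ct, 0 < K /\ 0 < ct /\
  forall M De B eta om X m0 n, 1 <= M -> 1 <= De <= M / 4 -> B <> 0 ->
  M ^ 2 <= c0 * (De * (Rabs B * sqrt M)) -> 23 * De <= Rabs B * sqrt M -> Rabs B * sqrt M <= ct * sqrt De * M ->
  0 < X -> X ^ 3 * (Rabs B * sqrt M * De) = M ^ 2 * sqrt M ->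
  (1 <= n)%nat -> M <= INR m0 -> INR (m0 + n - 1) <= M + De ->
  Rabs (lsum (seq m0 n) (osc_term al be eta B om)) <= K * (1 + ln (2 + 7 * M)) ^ 3 * (sqrt M * sqrt De / X).
Proof.
  intros Hser Hgrow finv Hc0.
  destruct (key_bound f kappa al be Hser Hgrow finv c0 Hc0) as [K1 [ct1 [HK1 [Hct1 P1]]]].
  destruct (key_bound (fun x y => f (- x) y) kappa al (fun n => - be n)) with (c0 := c0) as [K2 [ct2 [HK2 [Hct2 P2]]]]; auto.
  - intros x y Hy. apply (is_series_ext (fun n => bessel_weight kappa (S n) y * harmonic al be (S n) (- x))); [|apply Hser; auto].
    intros n. unfold harmonic. replace (2 * PI * (INR (S n) * - x)) with (- (2 * PI * (INR (S n) * x))) by ring. rewrite cos_neg, sin_neg. rring.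
  - intros d Hd. destruct (Hgrow d Hd) as [A HA]. exists A. intros n Hn. rewrite Rabs_Ropp. auto.
  - intros a b c d x y H Hy. rewrite <- (finv a (Z.opp b) (Z.opp c) d (- x) y) by (auto; lia).
    rewrite !opp_IZR.
    replace ((- IZR c * - x + IZR d) ^ 2 + (- IZR c) ^ 2 * y ^ 2) with ((IZR c * x + IZR d) ^ 2 + IZR c ^ 2 * y ^ 2) by ring.
    f_equal. lra.
  - exists (K1 + K2), (Rmin ct1 ct2). split; [lra|]. split; [apply Rmin_glb_lt; auto|].
    intros M De B eta om X m0 n HM HDe HB H1 H2 H3 HX HX3 Hn Hm0 Hmn.
    assert (HL : 0 <= (1 + ln (2 + 7 * M)) ^ 3 * (sqrt M * sqrt De / X)).
    { assert (0 <= ln (2 + 7 * M)) by (rewrite <- ln_1; apply ln_le; lra).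
      pos. }
    assert (Hd : 0 <= sqrt De * M) by pos.
    destruct (Rlt_le_dec 0 B) as [D|D].
    + rewrite Rabs_pos_eq in * by lra.
      apply Rle_trans with (K1 * (1 + ln (2 + 7 * M)) ^ 3 * (sqrt M * sqrt De / X)).
      * apply P1; auto. via H3. rewrite !Rmult_assoc. apply Rmult_le_compat_r; auto. apply Rmin_l.
      * nra.
    + rewrite Rabs_left1 in * by lra.
      apply Rle_trans with (K2 * (1 + ln (2 + 7 * M)) ^ 3 * (sqrt M * sqrt De / X)).
      * rewrite (lsum_ext _ _ (osc_term al (fun n => - be n) (- eta) (- B) (- om))).
        -- apply P2; auto; [lra|]. via H3. rewrite !Rmult_assoc. apply Rmult_le_compat_r; auto. apply Rmin_r.
        -- intros m _. unfold osc_term.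
           replace (- om + 2 * PI * (- eta * INR m + - B * sqrt (INR m))) with (- (om + 2 * PI * (eta * INR m + B * sqrt (INR m)))) by ring.
           rewrite cos_neg, sin_neg. ring.
      * nra.
Qed.

(** * Return to the complex coefficients *)

Definition osc_summand (t : Z -> C) (eta B : R) (m : nat) : C :=
  (t (Z.of_nat m) * e (eta * INR m + B * sqrt (INR m)))%C.

(** The real and imaginary parts of the form mix [t m] with [t (- m)]. The real part of the summand
    is half the term of the real form with phase 0 plus half the term of the imaginary form with
    phase [PI / 2]; in this combination [t (- m)] cancels. The imaginary part is obtained likewise,
    with a minus sign. *)
Lemma complex_key_bound psi kappa t c0 : SL2Z_invariant psi -> fourier_expansion psi kappa t -> 0 < c0 ->
  exists K ct, 0 < K /\ 0 < ct /\
  forall M De B eta X m0 n, 1 <= M -> 1 <= De <= M / 4 -> B <> 0 ->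
  M ^ 2 <= c0 * (De * (Rabs B * sqrt M)) -> 23 * De <= Rabs B * sqrt M -> Rabs B * sqrt M <= ct * sqrt De * M ->
  0 < X -> X ^ 3 * (Rabs B * sqrt M * De) = M ^ 2 * sqrt M ->
  (1 <= n)%nat -> M <= INR m0 -> INR (m0 + n - 1) <= M + De ->
  Rabs (lsum (seq m0 n) (fun m => fst (osc_summand t eta B m))) <= K * (1 + ln (2 + 7 * M)) ^ 3 * (sqrt M * sqrt De / X) /\
  Rabs (lsum (seq m0 n) (fun m => snd (osc_summand t eta B m))) <= K * (1 + ln (2 + 7 * M)) ^ 3 * (sqrt M * sqrt De / X).
Proof.
  intros Hinv Hexp Hc0.
  destruct (signed_key_bound (fun x y => fst (psi (x, y))) kappa (alR t) (beR t) c0) as [K1 [ct1 [HK1 [Hct1 P1]]]]; auto.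
  - intros x y Hy. apply (series_split psi kappa t Hexp x y Hy).
  - intros d Hd. destruct (parts_subexponential psi kappa t Hexp d Hd) as [A HA]. exists A. intros n Hn. apply HA; auto.
  - intros a b c d x y H Hy. rewrite <- (moebius_pair psi Hinv a b c d x y H Hy). lra.
  - destruct (signed_key_bound (fun x y => snd (psi (x, y))) kappa (alI t) (beI t) c0) as [K2 [ct2 [HK2 [Hct2 P2]]]]; auto.
    + intros x y Hy. apply (series_split psi kappa t Hexp x y Hy).
    + intros d Hd. destruct (parts_subexponential psi kappa t Hexp d Hd) as [A HA]. exists A. intros n Hn. apply HA; auto.
    + intros a b c d x y H Hy. rewrite <- (moebius_pair psi Hinv a b c d x y H Hy). lra.
    + exists (K1 + K2), (Rmin ct1 ct2). split; [lra|]. split; [apply Rmin_glb_lt; auto|].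
      intros M De B eta X m0 n HM HDe HB H1 H2 H3 HX HX3 Hn Hm0 Hmn.
      assert (HL : 0 <= (1 + ln (2 + 7 * M)) ^ 3 * (sqrt M * sqrt De / X)).
      { assert (0 <= ln (2 + 7 * M)) by (rewrite <- ln_1; apply ln_le; lra).
        pos. }
      assert (Hd : 0 <= sqrt De * M) by pos.
      assert (H31 : Rabs B * sqrt M <= ct1 * sqrt De * M).
      { via H3. rewrite !Rmult_assoc. apply Rmult_le_compat_r; auto. apply Rmin_l. }
      assert (H32 : Rabs B * sqrt M <= ct2 * sqrt De * M).
      { via H3. rewrite !Rmult_assoc. apply Rmult_le_compat_r; auto. apply Rmin_r. }
      set (V := (1 + ln (2 + 7 * M)) ^ 3 * (sqrt M * sqrt De / X)) in *.
      assert (Q1 : forall om, Rabs (lsum (seq m0 n) (osc_term (alR t) (beR t) eta B om)) <= K1 * V).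
      { intros om. unfold V. rewrite <- Rmult_assoc. auto. }
      assert (Q2 : forall om, Rabs (lsum (seq m0 n) (osc_term (alI t) (beI t) eta B om)) <= K2 * V).
      { intros om. unfold V. rewrite <- Rmult_assoc. auto. }
      rewrite !Rmult_assoc. fold V.
      assert (G : forall (x : nat -> R) u1 u2 sg, (Rabs sg = 1) -> (forall m, x m = 1 / 2 * u1 m + sg / 2 * u2 m) ->
         forall A1 A2, Rabs (lsum (seq m0 n) u1) <= A1 -> Rabs (lsum (seq m0 n) u2) <= A2 -> Rabs (lsum (seq m0 n) x) <= A1 + A2).
      { intros x u1 u2 sg Hs Hx A1 A2 B1 B2. rewrite (lsum_ext _ _ _ (fun m _ => Hx m)), lsum_plus, !lsum_scal.
        via Rabs_triang. rewrite !Rabs_mult, (Rabs_pos_eq (1 / 2)) by lra.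
        unfold Rdiv at 2. rewrite Rabs_mult, Hs, (Rabs_pos_eq (/ 2)) by lra.
        pose proof (Rabs_pos (lsum (seq m0 n) u1)). pose proof (Rabs_pos (lsum (seq m0 n) u2)). lra. }
      split.
      * rewrite Rmult_plus_distr_r.
        apply (G _ (osc_term (alR t) (beR t) eta B 0) (osc_term (alI t) (beI t) eta B (PI / 2)) 1); auto; [apply Rabs_pos_eq; lra|].
        intros m. unfold osc_summand, osc_term, alR, beR, alI, beI, tp, tm, e, Cmult. cbn [fst snd].
        rewrite Rplus_0_l. set (T := 2 * PI * (eta * INR m + B * sqrt (INR m))).
        rewrite cos_plus, sin_plus, cos_PI2, sin_PI2. field.
      * rewrite Rmult_plus_distr_r, Rplus_comm.
        apply (G _ (osc_term (alI t) (beI t) eta B 0) (osc_term (alR t) (beR t) eta B (PI / 2)) (-1)); auto; [rewrite Rabs_left; lra|].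
        intros m. unfold osc_summand, osc_term, alR, beR, alI, beI, tp, tm, e, Cmult. cbn [fst snd].
        rewrite Rplus_0_l. set (T := 2 * PI * (eta * INR m + B * sqrt (INR m))).
        rewrite cos_plus, sin_plus, cos_PI2, sin_PI2. field.
Qed.

(** * Insertion of the weight [g] and conclusion *)

Lemma sum_n_m_components (f : nat -> C) p n :
  fst (sum_n_m f p (p + n)) = lsum (seq p (S n)) (fun m => fst (f m)) /\
  snd (sum_n_m f p (p + n)) = lsum (seq p (S n)) (fun m => snd (f m)).
Proof.
  induction n as [|n [IH1 IH2]].
  - rewrite Nat.add_0_r, sum_n_n. unfold lsum. simpl. lra.
  - rewrite Nat.add_succ_r, sum_n_Sm by lia. rewrite (lsum_seq_S _ p (S n)), (lsum_seq_S _ p (S n)), <- IH1, <- IH2.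
    replace (p + S n)%nat with (S (p + n)) by lia. auto.
Qed.

Lemma clamp_lipschitz a b x y : a <= b -> Rabs (Rmax a (Rmin b x) - Rmax a (Rmin b y)) <= Rabs (x - y).
Proof. intros H. unfold Rmax, Rmin, Rabs; repeat destruct Rle_dec; repeat destruct Rcase_abs; lra. Qed.

Lemma clamp_in a b x : a <= b -> a <= Rmax a (Rmin b x) <= b.
Proof. intros H. split; [apply Rmax_l|]. apply Rmax_lub; auto. apply Rmin_l. Qed.

Lemma clamp_id a b x : a <= x <= b -> Rmax a (Rmin b x) = x.
Proof. intros H. rewrite Rmin_right, Rmax_right; lra. Qed.

Lemma within_derivative (g : R -> C) d x a b :
  filterdiff (K := R_AbsRing) (U := R_NormedModule) (V := C_R_NormedModule) g
       (within (fun u : R => a <= u <= b) (locally x)) (fun h : R => scal (V := C_R_NormedModule) h d) -> a <= x <= b ->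
  forall eps, 0 < eps -> exists del, 0 < del /\ forall z, a <= z <= b -> Rabs (z - x) < del ->
    Rabs (fst (g z) - fst (g x) - (z - x) * fst d) <= eps * Rabs (z - x) /\
    Rabs (snd (g z) - snd (g x) - (z - x) * snd d) <= eps * Rabs (z - x).
Proof.
  intros [_ H] Hx eps He.
  assert (Hlim : is_filter_lim (T := R_UniformSpace) (within (fun u : R => a <= u <= b) (locally x)) x).
  { intros P HP. unfold within. apply (filter_imp P); auto. }
  destruct (H x Hlim (mkposreal eps He)) as [del Hdel]. exists del. split; [apply cond_pos|].
  intros z Hz Hzx. specialize (Hdel z Hzx Hz). simpl in Hdel.
  set (w := minus (minus (g z) (g x)) (scal (minus z x) d) : C) in *.
  change (sqrt (Rabs (fst w) ^ 2 + Rabs (snd w) ^ 2) <= eps * Rabs (z - x)) in Hdel.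
  pose proof (sqrt_plus_sqr (Rabs (fst w)) (Rabs (snd w))) as [S1 _].
  rewrite !Rabs_Rabsolu in S1.
  assert (F1 : Rabs (fst w) <= eps * Rabs (z - x)) by (via Rmax_l; eapply Rle_trans; [apply S1|auto]).
  assert (F2 : Rabs (snd w) <= eps * Rabs (z - x)) by (via Rmax_r; eapply Rle_trans; [apply S1|auto]).
  auto.
Qed.

(* u is extended by its endpoint values, since nothing is known outside [a, b]. *)
Lemma within_mvt (u du : R -> R) a b L : a < b ->
  (forall x, a <= x <= b -> forall eps, 0 < eps -> exists del, 0 < del /\ forall z, a <= z <= b -> Rabs (z - x) < del ->
    Rabs (u z - u x - (z - x) * du x) <= eps * Rabs (z - x)) ->
  (forall x, a <= x <= b -> Rabs (du x) <= L) ->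
  forall p q, a <= p -> p <= q -> q <= b -> Rabs (u q - u p) <= L * (q - p).
Proof.
  intros Hab Hd HL p q Hp Hpq Hq.
  destruct (Req_dec p q) as [<- |Hne]; [replace (u p - u p) with 0 by ring; rewrite Rabs_R0; lra|].
  set (ue := fun x => u (Rmax a (Rmin b x))).
  destruct (MVT_gen ue p q du) as [c [Hc E]].
  - minmax. intros x Hx. split; [apply is_linear_scal_l|].
    intros x' Hx' eps. assert (Ex : x = x') by (apply (is_filter_lim_locally_unique (K := R_AbsRing) (V := R_NormedModule)); exact Hx'). rewrite <- Ex. clear x' Hx' Ex.
    destruct (Hd x ltac:(lra) eps (cond_pos eps)) as [del [Hdel K]].
    assert (Hm : 0 < Rmin del (Rmin (x - a) (b - x))) by (repeat apply Rmin_glb_lt; lra).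
    exists (mkposreal _ Hm). intros z Hz. change (Rabs (z - x) < Rmin del (Rmin (x - a) (b - x))) in Hz.
    pose proof (Rmin_l del (Rmin (x - a) (b - x))). pose proof (Rmin_r del (Rmin (x - a) (b - x))).
    pose proof (Rmin_l (x - a) (b - x)). pose proof (Rmin_r (x - a) (b - x)).
    assert (Hz' := Hz). apply Rabs_def2 in Hz'.
    change (Rabs (ue z - ue x - (z - x) * du x) <= eps * Rabs (z - x)). unfold ue. rewrite !clamp_id by lra. apply K; lra.
  - intros x _. apply continuity_pt_filterlim. apply filterlim_locally. intros eps.
    set (x0 := Rmax a (Rmin b x)). pose proof (clamp_in a b x ltac:(lra)) as Hx0. fold x0 in Hx0.
    destruct (Hd x0 Hx0 1 Rlt_0_1) as [del [Hdel K]].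
    pose proof (Rabs_pos (du x0)) as Hdu.
    assert (Hm : 0 < Rmin del (eps / (2 + Rabs (du x0)))).
    { apply Rmin_glb_lt; auto. apply Rdiv_lt_0_compat; [apply cond_pos|lra]. }
    exists (mkposreal _ Hm). intros z Hz. change (Rabs (z - x) < Rmin del (eps / (2 + Rabs (du x0)))) in Hz.
    change (Rabs (u (Rmax a (Rmin b z)) - u x0) < eps). set (z0 := Rmax a (Rmin b z)).
    pose proof (clamp_in a b z ltac:(lra)) as Hz0. fold z0 in Hz0.
    pose proof (clamp_lipschitz a b z x ltac:(lra)) as Hl. fold z0 x0 in Hl.
    pose proof (Rmin_l del (eps / (2 + Rabs (du x0)))). pose proof (Rmin_r del (eps / (2 + Rabs (du x0)))).
    specialize (K z0 Hz0 ltac:(lra)).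
    replace (u z0 - u x0) with ((u z0 - u x0 - (z0 - x0) * du x0) + (z0 - x0) * du x0) by ring.
    eapply Rle_lt_trans; [apply Rabs_triang|]. rewrite Rabs_mult.
    assert (Rabs (z0 - x0) < eps / (2 + Rabs (du x0))) by lra.
    assert (B1 : Rabs (z0 - x0) * (2 + Rabs (du x0)) < eps).
    { apply (Rmult_lt_compat_r (2 + Rabs (du x0))) in H1; [|lra]. rewrite Rdiv_mult_l in H1 by lra. auto. }
    pose proof (Rabs_pos (z0 - x0)). lra.
  - rewrite Rmin_left, Rmax_right in Hc by lra. unfold ue in E. rewrite !clamp_id in E by lra. rewrite E, Rabs_mult, (Rabs_pos_eq (q - p)) by lra.
    mulr. apply HL. lra.
Qed.

Lemma Rabs_fst_le (z : C) : Rabs (fst z) <= Cmod z.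
Proof. via Rmax_l. apply Rmax_Cmod. Qed.

Lemma Rabs_snd_le (z : C) : Rabs (snd z) <= Cmod z.
Proof. via Rmax_r. apply Rmax_Cmod. Qed.

Lemma C1_on_lipschitz a b g dg L : a < b -> C1_on a b g dg -> (forall x, a <= x <= b -> Cmod (dg x) <= L) ->
  forall p q, a <= p -> p <= q -> q <= b ->
  Rabs (fst (g q) - fst (g p)) <= L * (q - p) /\ Rabs (snd (g q) - snd (g p)) <= L * (q - p).
Proof.
  intros Hab [Hg _] HL p q H1 H2 H3. split.
  - apply (within_mvt (fun x => fst (g x)) (fun x => fst (dg x)) a b L); auto.
    + intros x Hx eps He. destruct (within_derivative g (dg x) x a b (Hg x Hx) Hx eps He) as [del [Hd K]].
      exists del. split; auto. intros z Hz Hzx. apply K; auto.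
    + intros x Hx. eapply Rle_trans; [apply Rabs_fst_le|auto].
  - apply (within_mvt (fun x => snd (g x)) (fun x => snd (dg x)) a b L); auto.
    + intros x Hx eps He. destruct (within_derivative g (dg x) x a b (Hg x Hx) Hx eps He) as [del [Hd K]].
      exists del. split; auto. intros z Hz Hzx. apply K; auto.
    + intros x Hx. eapply Rle_trans; [apply Rabs_snd_le|auto].
Qed.

Lemma threshold_split m0 (k : nat) (T : R) : exists k', (k' <= k)%nat /\
  (forall m, (m0 <= m < m0 + k')%nat -> INR m < T) /\ (forall m, (m0 + k' <= m < m0 + k)%nat -> T <= INR m).
Proof.
  induction k as [|k [k' [H1 [H2 H3]]]]; [exists 0%nat; repeat split; intros; lia|].
  destruct (Rlt_le_dec (INR (m0 + k)) T) as [D|D].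
  - exists (S k). repeat split; [lia| |intros; lia].
    intros m Hm. apply Rle_lt_trans with (INR (m0 + k)); auto. apply le_INR. lia.
  - exists k'. repeat split; auto. intros m Hm. destruct (Nat.eq_dec m (m0 + k)) as [-> |Ne]; auto. apply H3. lia.
Qed.

(** Partial summation needs every initial segment, not only full blocks. A segment is cut where the
    last block begins; its tail is a possibly empty part of that block. *)
Lemma block_prefix (x : nat -> R) M De E m0 (J : nat) : 0 < De -> M <= INR m0 ->
  (forall j k0 k, (j < J)%nat -> (1 <= k)%nat -> M + INR j * De <= INR k0 -> INR (k0 + k - 1) <= M + INR j * De + De -> Rabs (lsum (seq k0 k) x) <= E) ->
  0 <= E -> forall j k, (j <= J)%nat -> (forall m, (m0 <= m < m0 + k)%nat -> INR m < M + INR j * De) -> Rabs (lsum (seq m0 k) x) <= INR j * E.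
Proof.
  intros HD Hm Hb HE. induction j as [|j IH]; intros k HJ Hk.
  - destruct k as [|k]; [rewrite lsum_prefix_zero, Rabs_R0; simpl; lra|].
    exfalso. specialize (Hk m0 ltac:(lia)). simpl in Hk. lra.
  - destruct (threshold_split m0 k (M + INR j * De)) as [k' [H1 [H2 H3]]].
    replace k with (k' + (k - k'))%nat by lia. rewrite seq_app, lsum_app.
    via Rabs_triang. rewrite S_INR, Rmult_plus_distr_r, Rmult_1_l.
    apply Rplus_le_compat; [apply IH; [lia|auto]|].
    destruct (k - k')%nat as [|d] eqn:Ed; [rewrite lsum_prefix_zero, Rabs_R0; auto|].
    apply (Hb j); [lia|lia|apply H3; lia|].
    left. eapply Rlt_le_trans; [apply Hk; lia|]. rewrite S_INR. lra.
Qed.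

Lemma Cmod_le_sum (z : C) : Cmod z <= Rabs (fst z) + Rabs (snd z).
Proof.
  unfold Cmod. rewrite <- (sqrt_pow2 (Rabs (fst z) + Rabs (snd z))) by pos.
  apply sqrt_le_1_alt. rewrite (pow2_Rabs (fst z)), (pow2_Rabs (snd z)).
  pose proof (Rabs_pos (fst z)). pose proof (Rabs_pos (snd z)). nra.
Qed.

Lemma Rpower_cube x a : 0 < x -> Rpower x a ^ 3 = Rpower x (3 * a).
Proof.
  intros Hx. rewrite <- Rpower_pow by apply exp_pos. rewrite Rpower_mult. f_equal. simpl. ring.
Qed.

(** [ln M <= (3 / eps) M^(eps / 3)], cubed. *)
Lemma log_le_power eps M : 0 < eps -> 1 <= M -> (1 + ln (2 + 14 * M)) ^ 3 <= (5 + 3 / eps) ^ 3 * Rpower M eps.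
Proof.
  intros He HM. set (p := Rpower M (eps / 3)).
  assert (E : Rpower M eps = p ^ 3) by (unfold p; rewrite Rpower_cube by lra; f_equal; field).
  assert (Hl : 0 <= ln M) by (rewrite <- ln_1; apply ln_le; lra).
  assert (Hp : 1 + eps / 3 * ln M <= p) by (unfold p, Rpower; apply exp_ineq1_le).
  assert (H3 : 0 < 3 / eps) by pos.
  assert (Hl2 : ln M <= 3 / eps * p).
  { apply Rle_trans with (3 / eps * (eps / 3 * ln M)); [right; field; lra|]. nra. }
  assert (H16 : ln 16 <= 4).
  { replace 16 with (2 * 2 * (2 * 2)) by ring. rewrite !ln_mult by lra.
    assert (ln 2 <= 1); [|lra]. rewrite <- (ln_exp 1). apply ln_le; [lra|]. pose proof exp_1_bounds. lra. }
  rewrite E, <- Rpow_mult_distr. apply pow_incr.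
  assert (0 <= eps / 3 * ln M) by pos.
  split; [assert (0 <= ln (2 + 14 * M)) by (rewrite <- ln_1; apply ln_le; lra); lra|].
  assert (ln (2 + 14 * M) <= ln 16 + ln M) by (rewrite <- ln_mult by lra; apply ln_le; lra). nra.
Qed.

(** [P] is the asserted bound without [vartheta], [eps] and the weight. Comparing cubes avoids the
    fractional powers. *)
Lemma main_identity De F M : 0 < De -> 0 < F -> 0 < M ->
  let P := Rpower De (5 / 6) * Rpower F (1 / 3) * Rpower M (- (1 / 3)) in
  0 < P /\ P ^ 3 * M = De ^ 2 * sqrt De * F.
Proof.
  intros HD HF HM P. split.
  - pos.
  - unfold P. rewrite !Rpow_mult_distr, !Rpower_cube by auto.
    replace (3 * (5 / 6)) with (INR 2 + / 2) by (simpl; field). replace (3 * (1 / 3)) with 1 by field. replace (3 * - (1 / 3)) with (- (1)) by field.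
    rewrite Rpower_plus, Rpower_pow, Rpower_sqrt, Rpower_Ropp, !Rpower_1 by auto. field. lra.
Qed.

Lemma cube_root_exists z : 0 < z -> exists X, 0 < X /\ X ^ 3 = z.
Proof.
  intros Hz. exists (Rpower z (1 / 3)). split; [apply exp_pos|]. rewrite Rpower_cube by auto.
  replace (3 * (1 / 3)) with 1 by field. apply Rpower_1; auto.
Qed.

Section Summation.
Variables (t : Z -> C) (g dg : R -> C) (M De B eta : R).
Hypothesis HM : 1 <= M.
Hypothesis HDe : 1 <= De <= M.

Let p0 := Z.to_nat (Zceil M).
Let nn := (Z.to_nat (Zfloor (M + De)) - p0)%nat.
Let S0 := sum_between M (M + De) (fun m : Z => (t m * g (IZR m) * e (eta * IZR m + B * sqrt (IZR m)))%C).

Lemma range_props : M <= INR p0 /\ INR (p0 + nn) <= M + De /\ Z.to_nat (Zfloor (M + De)) = (p0 + nn)%nat.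
Proof using HM HDe.
  pose proof (Zceil_bound M) as [C1 C2]. pose proof (Zfloor_bound (M + De)) as [F1 F2].
  assert (HC : (0 <= Zceil M)%Z) by (apply le_IZR; lra).
  assert (HCF : (Zceil M <= Zfloor (M + De))%Z) by (apply Zfloor_lub; lra).
  assert (E : Z.to_nat (Zfloor (M + De)) = (p0 + nn)%nat) by lia.
  split; [unfold p0; rewrite INR_IZR_INZ, Z2Nat.id; auto|]. split; auto.
  rewrite <- E, INR_IZR_INZ, Z2Nat.id; auto. lia.
Qed.

Lemma sum_components :
  fst S0 = lsum (seq p0 (S nn)) (fun m => fst (g (INR m)) * fst (osc_summand t eta B m)) + - lsum (seq p0 (S nn)) (fun m => snd (g (INR m)) * snd (osc_summand t eta B m)) /\
  snd S0 = lsum (seq p0 (S nn)) (fun m => snd (g (INR m)) * fst (osc_summand t eta B m)) + lsum (seq p0 (S nn)) (fun m => fst (g (INR m)) * snd (osc_summand t eta B m)).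
Proof using HM HDe.
  destruct range_props as [_ [_ E]]. unfold S0, sum_between. fold p0. rewrite E.
  destruct (sum_n_m_components (fun m : nat => (t (Z.of_nat m) * g (IZR (Z.of_nat m)) * e (eta * IZR (Z.of_nat m) + B * sqrt (IZR (Z.of_nat m))))%C) p0 nn) as [E1 E2].
  split.
  - etransitivity; [exact E1|].
    match goal with |- _ = ?x + - ?z => replace (x + - z) with (x + (-1) * z) by ring end.
    rewrite <- lsum_scal, <- lsum_plus. apply lsum_ext. intros m _. unfold osc_summand. rewrite <- !INR_IZR_INZ.
    set (u := t (Z.of_nat m)). set (v := g (INR m)). set (w := e _). unfold Cmult. cbn [fst snd]. ring.
  - etransitivity; [exact E2|]. rewrite <- lsum_plus. apply lsum_ext. intros m _. unfold osc_summand. rewrite <- !INR_IZR_INZ.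
    set (u := t (Z.of_nat m)). set (v := g (INR m)). set (w := e _). unfold Cmult. cbn [fst snd]. ring.
Qed.

(** Each of the four products of components is a real sum for [abel], with the variation of [g] at
    most [L De]. *)
Lemma weighted_sum_bound E W L : 0 <= E ->
  (forall k, (k <= S nn)%nat -> Rabs (lsum (seq p0 k) (fun m => fst (osc_summand t eta B m))) <= E /\ Rabs (lsum (seq p0 k) (fun m => snd (osc_summand t eta B m))) <= E) ->
  C1_on M (M + De) g dg -> (forall x, M <= x <= M + De -> Cmod (g x) <= W) -> (forall x, M <= x <= M + De -> Cmod (dg x) <= L) -> 0 <= L ->
  Cmod S0 <= 4 * (E * (W + L * De)).
Proof using HM HDe.
  intros HE HP HC HW HL HL0. destruct range_props as [R1 [R2 _]]. destruct sum_components as [E1 E2].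
  assert (Hin : forall m, (p0 <= m <= p0 + nn)%nat -> M <= INR m <= M + De).
  { intros m Hm. split; [apply Rle_trans with (INR p0)|apply Rle_trans with (INR (p0 + nn))]; auto; apply le_INR; lia. }
  assert (Ab : forall (om x : nat -> R), (om = (fun m => fst (g (INR m))) \/ om = (fun m => snd (g (INR m)))) ->
     (forall k, (k <= S nn)%nat -> Rabs (lsum (seq p0 k) x) <= E) -> Rabs (lsum (seq p0 (S nn)) (fun m => om m * x m)) <= E * (W + L * De)).
  { intros om x Hom Hx.
    eapply Rle_trans; [apply (abel x om (fun m => L * INR m) p0 (S nn) E W); auto; [lia| |]|].
    - intros m Hm. specialize (HW (INR m) (Hin m ltac:(lia))). destruct Hom as [-> | ->]; eapply Rle_trans; eauto using Rabs_fst_le, Rabs_snd_le.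
    - intros m H1 H2. pose proof (Hin m ltac:(lia)). pose proof (Hin (S m) ltac:(lia)).
      destruct (C1_on_lipschitz M (M + De) g dg L ltac:(lra) HC HL (INR m) (INR (S m))) as [Q1 Q2]; try lra.
      + apply le_INR; lia.
      + rewrite <- Rmult_minus_distr_l. destruct Hom as [-> | ->]; auto.
    - apply Rmult_le_compat_l; auto. apply Rplus_le_compat_l. rewrite <- Rmult_minus_distr_l. apply Rmult_le_compat_l; auto.
      replace (p0 + S nn - 1)%nat with (p0 + nn)%nat by lia. lra. }
  via Cmod_le_sum. rewrite E1, E2.
  pose proof (Ab (fun m => fst (g (INR m))) (fun m => fst (osc_summand t eta B m)) (or_introl eq_refl) (fun k Hk => proj1 (HP k Hk))) as A1.
  pose proof (Ab (fun m => snd (g (INR m))) (fun m => snd (osc_summand t eta B m)) (or_intror eq_refl) (fun k Hk => proj2 (HP k Hk))) as A2.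
  pose proof (Ab (fun m => snd (g (INR m))) (fun m => fst (osc_summand t eta B m)) (or_intror eq_refl) (fun k Hk => proj1 (HP k Hk))) as A3.
  pose proof (Ab (fun m => fst (g (INR m))) (fun m => snd (osc_summand t eta B m)) (or_introl eq_refl) (fun k Hk => proj2 (HP k Hk))) as A4.
  cbv beta in A1, A2, A3, A4.
  eapply Rle_trans; [apply Rplus_le_compat; apply Rabs_triang|]. rewrite Rabs_Ropp. lra.
Qed.

Lemma trivial_sum_bound T W : 0 <= T -> (forall m, M <= INR m <= M + De -> Cmod (t (Z.of_nat m)) <= T) ->
  (forall x, M <= x <= M + De -> Cmod (g x) <= W) -> Cmod S0 <= 4 * (De * (T * W)).
Proof using HM HDe.
  intros HT Ht HW. destruct range_props as [R1 [R2 E]].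
  assert (HW0 : 0 <= W) by (eapply Rle_trans; [apply Cmod_ge_0|apply (HW M); lra]).
  assert (Hn : INR (S nn) <= 2 * De) by (rewrite plus_INR in R2; rewrite S_INR; lra).
  unfold S0, sum_between. fold p0. rewrite E.
  destruct (sum_n_m_components (fun m : nat => (t (Z.of_nat m) * g (IZR (Z.of_nat m)) * e (eta * IZR (Z.of_nat m) + B * sqrt (IZR (Z.of_nat m))))%C) p0 nn) as [E1 E2].
  assert (Bd : forall m, In m (seq p0 (S nn)) -> Cmod (t (Z.of_nat m) * g (IZR (Z.of_nat m)) * e (eta * IZR (Z.of_nat m) + B * sqrt (IZR (Z.of_nat m))))%C <= T * W).
  { intros m Hm. apply in_seq in Hm. rewrite !Cmod_mult.
    assert (Hin : M <= INR m <= M + De).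
    { split; [apply Rle_trans with (INR p0)|apply Rle_trans with (INR (p0 + nn))]; auto; apply le_INR; lia. }
    assert (He : forall x, Cmod (e x) = 1).
    { intros x. unfold Cmod, e. cbn [fst snd]. rewrite Rplus_comm, <- !Rsqr_pow2, sin2_cos2. apply sqrt_1. }
    rewrite He, Rmult_1_r. apply Rmult_le_compat; auto using Cmod_ge_0. apply HW. rewrite <- INR_IZR_INZ. auto. }
  assert (G : forall pr : C -> R, (forall z, Rabs (pr z) <= Cmod z) -> forall x : nat -> C, (forall m, In m (seq p0 (S nn)) -> Cmod (x m) <= T * W) ->
     Rabs (lsum (seq p0 (S nn)) (fun m => pr (x m))) <= 2 * De * (T * W)).
  { intros pr Hpr x Hx. via Rabs_lsum.
    apply Rle_trans with (lsum (seq p0 (S nn)) (fun _ => T * W)).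
    - apply lsum_le. intros m Hm. eapply Rle_trans; [apply Hpr|auto].
    - rewrite lsum_const, length_seq. apply Rmult_le_compat_r; auto. pos. }
  via Cmod_le_sum.
  pose proof (G fst Rabs_fst_le _ Bd) as G1. pose proof (G snd Rabs_snd_le _ Bd) as G2.
  replace (4 * (De * (T * W))) with (2 * De * (T * W) + 2 * De * (T * W)) by ring. apply Rplus_le_compat; [exact (eq_ind_r (fun z => Rabs z <= _) G1 E1)|exact (eq_ind_r (fun z => Rabs z <= _) G2 E2)].
Qed.
End Summation.

Theorem theorem16 :
  forall (psi : C -> C) (kappa : R) (t : Z -> C) (vartheta : R),
    maass_cusp_form psi kappa ->
    even_form psi \/ odd_form psi ->
    fourier_expansion psi kappa t ->
    0 <= vartheta ->
    coefficient_exponent t vartheta ->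
  forall eps c0 c1 c2 : R,
    0 < eps -> 0 < c0 -> 0 < c1 -> 0 < c2 ->
  exists K : R, 0 < K /\
  forall M eta B Delta F : R,
    1 <= M ->
    1 <= Delta <= M ->
    F = Rabs B * sqrt M ->
    M ^ 2 <= c0 * (Delta * F) ->
  forall (g dg : R -> C) (G G' : R),
    C1_on M (M + Delta) g dg ->
    0 < G -> 0 < G' ->
    (forall x : R, M <= x <= M + Delta -> Cmod (g x) <= c1 * G) ->
    (forall x : R, M <= x <= M + Delta -> Cmod (dg x) <= c2 * G') ->
    Cmod (sum_between M (M + Delta)
            (fun m : Z =>
               (t m * g (IZR m) * e (eta * IZR m + B * sqrt (IZR m)))%C))
    <= K * (Rpower Delta (5 / 6) * (G + Delta * G')
            * Rpower M (vartheta - 1 / 3) * Rpower F (1 / 3 + eps)).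
Proof.
  intros psi kappa t vt [Hinv _] _ Hexp Hvt Hco eps c0 c1 c2 Heps Hc0 Hc1 Hc2.
  (* The number of blocks. [N > 4] makes a block no longer than [M / 4], and [N > 23 c0] ensures
     [23 D <= F], since [De <= M <= c0 F]. *)
  destruct (INR_unbounded (4 + 23 * c0)) as [n0 Hn0]. set (N := INR n0) in *.
  assert (HN : 4 < N) by lra.
  assert (HsN : 0 < sqrt N) by pos.
  destruct (complex_key_bound psi kappa t (4 * c0 * N) Hinv Hexp) as [K1 [ct [HK1 [Hct KB]]]]; [pos|].
  destruct (Hco eps Heps) as [A HA].
  (* The first bound gives every block the smallness condition with [ct]; the 2 allows for the
     growth of [F] along the blocks, [sqrt N] for the shorter blocks. The second bound excludes
     [De < N]. *)
  set (ctt := Rmin (ct / (2 * sqrt N)) (/ (c0 * N * sqrt N))).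
  assert (Hctt : 0 < ctt) by (unfold ctt; apply Rmin_glb_lt; pos).
  assert (Hctt1 : ctt <= ct / (2 * sqrt N)) by apply Rmin_l.
  assert (Hctt2 : ctt <= / (c0 * N * sqrt N)) by apply Rmin_r.
  set (kap := Rmin 1 ctt). assert (Hkap : 0 < kap) by (apply Rmin_glb_lt; lra).
  assert (Hkap3 : kap ^ 3 <= ctt).
  { assert (kap <= 1) by apply Rmin_l. assert (kap <= ctt) by apply Rmin_r. nra. }
  set (Ce := Rpower c0 eps). assert (HCe : 0 < Ce) by apply exp_pos.
  set (T2 := Rpower 2 (vt + eps)). assert (HT2 : 0 < T2) by apply exp_pos.
  set (Kt := 4 * Rabs A * T2 * c1 * Ce / kap).
  assert (HKt : 0 <= Kt).
  { pos. }
  set (Cl := (5 + 3 / eps) ^ 3). assert (HCl : 0 < Cl) by (unfold Cl; assert (0 < 3 / eps) by pos; apply pow_lt; lra).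
  set (Km := 4 * ((N + 1) * (2 * K1 * Cl * Ce)) * (c1 + c2)).
  assert (HKm : 0 < Km) by pos.
  exists (Kt + Km). split; [lra|].
  intros M eta B De F HM HDe HF HMF g dg G G' HC1 HG HG' Hg Hdg.
  assert (HF0 : 0 < F).
  { apply Rnot_le_lt. intros D. assert (De * F <= 0) by nra. assert (c0 * (De * F) <= 0) by nra. nra. }
  assert (HsM : 0 < sqrt M) by pos. assert (EsM : sqrt M * sqrt M = M) by (apply sqrt_sqrt; lra).
  assert (HsD : 0 < sqrt De) by pos. assert (EsD : sqrt De * sqrt De = De) by (apply sqrt_sqrt; lra).
  assert (EsN : sqrt N * sqrt N = N) by (apply sqrt_sqrt; lra).
  assert (HaB : 0 < Rabs B).
  { destruct (Req_dec B 0) as [-> |Ne]; [rewrite Rabs_R0 in HF; lra|apply Rabs_pos_lt; auto]. }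
  assert (HB0 : B <> 0) by (intros ->; rewrite Rabs_R0 in HaB; lra).
  (* [De <= M] in the hypothesis. Powers [M^eps] from coefficients and logarithms thereby become
     powers of [F]. *)
  assert (HMc : M <= c0 * F).
  { apply (Rmult_le_reg_l M); [lra|]. replace (M * M) with (M ^ 2) by ring. via HMF.
    replace (M * (c0 * F)) with (c0 * (M * F)) by ring. mull. apply Rmult_le_compat_r; lra. }
  set (Fe := Rpower F eps). assert (HFe : 0 < Fe) by apply exp_pos.
  assert (HMe : Rpower M eps <= Ce * Fe).
  { unfold Ce, Fe. rewrite Rpower_mult_distr by lra. apply Rle_Rpower_l; lra. }
  set (Mv := Rpower M vt).
  assert (HMv : 1 <= Mv) by (unfold Mv; rewrite <- (Rpower_O M) by lra; apply Rle_Rpower; lra).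
  destruct (main_identity De F M ltac:(lra) HF0 ltac:(lra)) as [HP HP3].
  set (P := Rpower De (5 / 6) * Rpower F (1 / 3) * Rpower M (- (1 / 3))) in *.
  assert (ER : Rpower De (5 / 6) * (G + De * G') * Rpower M (vt - 1 / 3) * Rpower F (1 / 3 + eps) = P * Fe * Mv * (G + De * G')).
  { unfold Rminus. rewrite !Rpower_plus. unfold P, Fe, Mv. ring. }
  rewrite ER.
  assert (HGG : 0 < G + De * G') by (assert (0 < De * G') by pos; lra).
  assert (HGl : G <= G + De * G') by (assert (0 < De * G') by pos; lra).
  assert (HPF : 0 < P * Fe) by pos.
  assert (Split : Cmod (sum_between M (M + De) (fun m : Z => (t m * g (IZR m) * e (eta * IZR m + B * sqrt (IZR m)))%C)) <= Kt * (P * Fe * Mv * (G + De * G'))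
     \/ Cmod (sum_between M (M + De) (fun m : Z => (t m * g (IZR m) * e (eta * IZR m + B * sqrt (IZR m)))%C)) <= Km * (P * Fe * Mv * (G + De * G'))).
  2:{ assert (0 < P * Fe * Mv * (G + De * G')) by pos.
      destruct Split as [S1|S1]; eapply Rle_trans; [apply S1| |apply S1|]; apply Rmult_le_compat_r; lra. }
  destruct (Rle_lt_dec (ctt * (sqrt De * M)) F) as [Big|Small]; [left|right].
  (* For large [F] the number of terms is already at most [P] up to a constant, and the coefficient
     bound suffices. *)
  - assert (HkP : kap * De <= P).
    { apply cube_le; [lra|]. apply (Rmult_le_reg_r M); [lra|]. rewrite HP3.
      apply Rle_trans with (De ^ 2 * sqrt De * (ctt * (sqrt De * M))).
      - replace (De ^ 2 * sqrt De * (ctt * (sqrt De * M))) with (ctt * (De ^ 3 * M))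
          by (rewrite <- EsD at 1; replace (De ^ 2 * sqrt De * (ctt * (sqrt De * M))) with (ctt * (De ^ 2 * (sqrt De * sqrt De) * M)) by ring; rewrite EsD; ring).
        rewrite Rpow_mult_distr, Rmult_assoc. apply Rmult_le_compat_r; auto. pos.
      - apply Rmult_le_compat_l; auto. pos. }
    via (trivial_sum_bound t g M De B eta HM HDe (Rabs A * (T2 * (Mv * (Ce * Fe)))) (c1 * G)).
    + pos.
    + intros m Hm. assert (Hm1 : (1 <= Z.of_nat m)%Z) by (apply le_IZR; rewrite <- INR_IZR_INZ; lra).
      via (HA _ Hm1). rewrite <- INR_IZR_INZ.
      apply Rle_trans with (Rabs A * Rpower (INR m) (vt + eps)); [apply Rmult_le_compat_r; [left; apply exp_pos|apply Rle_abs]|].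
      mull.
      apply Rle_trans with (Rpower (2 * M) (vt + eps)); [apply Rle_Rpower_l; lra|].
      rewrite <- Rpower_mult_distr by lra. mull.
      rewrite Rpower_plus. apply Rmult_le_compat_l; auto. left; apply exp_pos.
    + auto.
    + apply Rle_trans with (Kt * (kap * De * Fe * Mv * G)).
      * right. unfold Kt. field. lra.
      * apply Rmult_le_compat_l; auto. assert (0 < Mv) by lra. assert (0 < De) by lra.
        apply Rmult_le_compat; auto; [left; pos|lra|]. mulr. apply Rmult_le_compat_r; lra.
  (* For [De < N] smallness of [F] would give [c0 N F < M], whereas [M^2 <= c0 N F] and [M >= 1]. *)
  - assert (HDN : N <= De).
    { apply Rnot_lt_le. intros D. assert (sqrt De <= sqrt N) by (apply sqrt_le_1_alt; lra).
      assert (HM2 : M * M <= c0 * N * F).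
      { replace (M * M) with (M ^ 2) by ring. via HMF. rewrite Rmult_assoc. mull. apply Rmult_le_compat_r; lra. }
      assert (HcN : 0 < c0 * N) by pos.
      assert (F * (c0 * N) < M).
      { apply Rlt_le_trans with (ctt * (sqrt De * M) * (c0 * N)); [apply Rmult_lt_compat_r; auto|].
        apply Rle_trans with (/ (c0 * N * sqrt N) * (sqrt N * M) * (c0 * N)); [|right; field; lra].
        mulr. apply Rmult_le_compat; try lra; [apply Rmult_le_pos; lra|]. apply Rmult_le_compat_r; lra. }
      assert (M * 1 <= M * M) by (apply Rmult_le_compat_l; lra). lra. }
    set (D := De / N).
    assert (ED : N * D = De) by (unfold D; field; lra).
    assert (HD1 : 1 <= D) by (apply (Rmult_le_reg_l N); lra).
    assert (HDM : D <= M / 4). { apply (Rmult_le_reg_l N); [lra|]. assert (4 * M <= N * M) by (apply Rmult_le_compat_r; lra). lra. }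
    assert (HDDe : D <= De) by (rewrite <- ED, <- (Rmult_1_l D) at 1; apply Rmult_le_compat_r; lra).
    set (L3 := (1 + ln (2 + 14 * M)) ^ 3).
    assert (HL3 : L3 <= Cl * (Ce * Fe)).
    { via (log_le_power eps M Heps HM). apply Rmult_le_compat_l; [left; exact HCl|auto]. }
    set (E := 2 * K1 * Cl * Ce * (P * Fe)).
    assert (HE : 0 < E) by pos.
    destruct (range_props M De HM HDe) as [R1 [R2 _]].
    set (p0 := Z.to_nat (Zceil M)) in *. set (nn := (Z.to_nat (Zfloor (M + De)) - p0)%nat) in *.
    assert (Block : forall j k0 k, (j < S n0)%nat -> (1 <= k)%nat -> M + INR j * D <= INR k0 -> INR (k0 + k - 1) <= M + INR j * D + D ->
      Rabs (lsum (seq k0 k) (fun m => fst (osc_summand t eta B m))) <= E /\ Rabs (lsum (seq k0 k) (fun m => snd (osc_summand t eta B m))) <= E).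
    { intros j k0 k Hj Hk Hk0 Hk1. set (Mj := M + INR j * D) in *.
      assert (HjD : 0 <= INR j * D <= De).
      { rewrite <- ED. split; [apply Rmult_le_pos; [apply pos_INR|lra]|]. mulr. apply le_INR. lia. }
      assert (HMj : M <= Mj <= 2 * M) by (unfold Mj; lra).
      assert (HsMj : 0 < sqrt Mj) by pos.
      assert (HsMj1 : sqrt M <= sqrt Mj) by (apply sqrt_le_1_alt; lra).
      assert (HsMj2 : sqrt Mj <= 2 * sqrt M).
      { rewrite <- (sqrt_pow2 2) by lra. rewrite <- sqrt_mult_alt by lra. apply sqrt_le_1_alt. lra. }
      assert (HsDD : 0 < sqrt D <= sqrt De) by (split; [pos|apply sqrt_le_1_alt; auto]).
      assert (EsDD : sqrt De = sqrt N * sqrt D) by (rewrite <- sqrt_mult_alt by lra; f_equal; lra).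
      assert (HFj : F <= Rabs B * sqrt Mj) by (rewrite HF; apply Rmult_le_compat_l; lra).
      assert (HFj2 : Rabs B * sqrt Mj <= 2 * F).
      { rewrite HF. replace (2 * (Rabs B * sqrt M)) with (Rabs B * (2 * sqrt M)) by ring. apply Rmult_le_compat_l; lra. }
      assert (HFjD : 0 < Rabs B * sqrt Mj * D) by pos.
      destruct (cube_root_exists (Mj ^ 2 * sqrt Mj / (Rabs B * sqrt Mj * D))) as [X [HX HX3]].
      { pos. }
      assert (KB' := KB Mj D B eta X k0 k ltac:(lra) ltac:(lra) HB0).
      assert (Q : K1 * (1 + ln (2 + 7 * Mj)) ^ 3 * (sqrt Mj * sqrt D / X) <= E).
      { assert (HL : 0 <= (1 + ln (2 + 7 * Mj)) ^ 3 <= L3).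
        { assert (0 <= ln (2 + 7 * Mj)) by (rewrite <- ln_1; apply ln_le; lra). split; [apply pow_le; lra|].
          unfold L3. apply pow_incr. split; [lra|]. apply Rplus_le_compat_l. apply ln_le; lra. }
        (* Equality of cubes would hold for a block with [Mj = M] and [D = De]; a later start and a
           shorter block only increase [X]. *)
        assert (HXP : sqrt M * sqrt De <= P * X).
        { apply cube_le; [left; pos|].
          rewrite !Rpow_mult_distr, HX3.
          replace (sqrt M ^ 3 * sqrt De ^ 3) with (M * sqrt M * (De * sqrt De)) by (rewrite <- EsM at 1; rewrite <- EsD at 1; ring).
          apply (Rmult_le_reg_r M); [lra|].
          replace (P ^ 3 * (Mj ^ 2 * sqrt Mj / (Rabs B * sqrt Mj * D)) * M) with (P ^ 3 * M * (Mj ^ 2 * / (Rabs B * D))) by (field; lra).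
          rewrite HP3, HF.
          apply Rle_trans with (De ^ 2 * sqrt De * (Rabs B * sqrt M) * (M ^ 2 * / (Rabs B * De))).
          - right. field. lra.
          - apply Rmult_le_compat_l.
            + pos.
            + apply Rmult_le_compat; [apply pow2_ge_0|left; pos|apply pow_incr; lra|].
              apply Rinv_le_contravar; [pos|]. mull. auto. }
        assert (HY : 0 <= sqrt Mj * sqrt D / X <= 2 * P).
        { split; [left; pos|]. apply (Rmult_le_reg_r X); auto. rewrite Rdiv_mult_l by lra.
          apply Rle_trans with (2 * sqrt M * sqrt De); [apply Rmult_le_compat; lra|]. lra. }
        apply Rle_trans with (K1 * (Cl * (Ce * Fe)) * (2 * P)).
        - apply Rmult_le_compat; [apply Rmult_le_pos; lra|lra| |lra]. apply Rmult_le_compat_l; lra.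
        - right. unfold E. ring. }
      destruct KB' as [B1 B2]; auto.
      - apply Rle_trans with ((2 * M) ^ 2); [apply pow_incr; lra|]. apply Rle_trans with (4 * (c0 * (De * F))); [lra|].
        rewrite <- ED. replace (4 * (c0 * (N * D * F))) with (4 * c0 * N * (D * F)) by ring.
        mull. apply Rmult_le_compat_l; lra.
      - apply Rle_trans with F; auto. apply (Rmult_le_reg_l c0); auto.
        apply Rle_trans with M; auto. apply Rle_trans with (N * D); [|lra].
        replace (c0 * (23 * D)) with (23 * c0 * D) by ring. apply Rmult_le_compat_r; lra.
      - apply Rle_trans with (2 * F); auto. apply Rle_trans with (2 * (ctt * (sqrt De * M))); [lra|].
        apply Rle_trans with (2 * (ct / (2 * sqrt N) * (sqrt De * M))).
        + mull. apply Rmult_le_compat_r; auto. apply Rmult_le_pos; lra.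
        + rewrite EsDD. replace (2 * (ct / (2 * sqrt N) * (sqrt N * sqrt D * M))) with (ct * sqrt D * M) by (field; lra).
          mull. lra.
      - rewrite HX3. apply Rdiv_mult_l. lra.
      - lra. }
    assert (Hpre : forall k, (k <= S nn)%nat ->
      Rabs (lsum (seq p0 k) (fun m => fst (osc_summand t eta B m))) <= (N + 1) * E /\ Rabs (lsum (seq p0 k) (fun m => snd (osc_summand t eta B m))) <= (N + 1) * E).
    (* One block beyond the [N] that fill the range: [block_prefix] asks for a strict upper bound,
       and m may equal [M + De]. *)
    { intros k Hk. replace (N + 1) with (INR (S n0)) by (rewrite S_INR; reflexivity).
      assert (Hlt : forall m, (p0 <= m < p0 + k)%nat -> INR m < M + INR (S n0) * D).
      { intros m Hm. rewrite S_INR. fold N. replace ((N + 1) * D) with (De + D) by lra.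
        assert (INR m <= INR (p0 + nn)) by (apply le_INR; lia). lra. }
      split; apply (block_prefix _ M D E p0 (S n0)); auto; try lra; intros j k0 k1 Hj Hk1 Hk2 Hk3; apply (Block j k0 k1); auto. }
    eapply Rle_trans; [apply (weighted_sum_bound t g dg M De B eta HM HDe ((N + 1) * E) (c1 * G) (c2 * G')); auto|].
    + pos.
    + pos.
    + apply Rle_trans with (4 * ((N + 1) * E * ((c1 + c2) * (G + De * G')))).
      * mull. mull.
        assert (0 < De) by lra. assert (0 < c1 * (De * G')) by pos. assert (0 < c2 * G) by pos. lra.
      * apply Rle_trans with (Km * (P * Fe * 1 * (G + De * G'))).
        -- right. unfold Km, E. ring.
        -- mull. mulr. apply Rmult_le_compat_l; lra.
Qed.
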